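(* Let $n\ge 1$, let $m\ge2$ be a prime number, let $P\in\Omega_m(2n)$ and $\Sigma\in\mathcal{H}_P(2n)$. Let $(\tau,x)\in\mathcal{J}(\Sigma)$ be a prime closed characteristic and let $\gamma_x$ be its associated symplectic path. Assume that $x(t)=Px(t+\frac{\tau}{m})$ for all $t\in[0,\tau]$. Then, for $\omega\in\sigma(P)\cap\mathbf{U}^+$, $$\mu(Gr(I_{2n}),Gr(\gamma_x))+2S^+_{\gamma_x(\tau)}(1)-\nu_1(\gamma_x)\ \ge\ 2n-S^-_P(\omega).$$ In particular, if $P\in\tilde\Omega^0_m(2n)$, then $$\mu(Gr(I_{2n}),Gr(\gamma_x))+2S^+_{\gamma_x(\tau)}(1)-\nu_1(\gamma_x)\ \ge\ \tfrac{3n}{2};$$ if $P\in\tilde\Omega^{1}_m(2n)$ (respectively $P\in\tilde\Omega^{-1}_m(2n)$), then $$\mu(Gr(I_{2n}),Gr(\gamma_x))+2S^+_{\gamma_x(\tau)}(1)-\nu_1(\gamma_x)\ \ge\ [\tfrac{3n}{2}]+1\quad(\text{respectively }[\tfrac{3n}{2}]).$$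
   Context: $[a]$ denotes the largest integer $\le a$. $J=\begin{pmatrix}0&-I_n\\ I_n&0\end{pmatrix}$, $\mathrm{Sp}(2n)=\{M\in GL(2n,\mathbb{R}): M^TJM=J\}$, $\mathbf{U}=\{z\in\mathbb{C}:|z|=1\}$, $\mathbf{U}^+=\{e^{\sqrt{-1}\theta}:\theta\in(0,\pi]\}$, $\sigma(M)$ is the set of complex eigenvalues of $M$. With $\omega_k=e^{2k\pi\sqrt{-1}/m}$, $$\Omega_m(2n)=\{P\in\mathrm{Sp}(2n): P^m=I_{2n}\text{ and }\sigma(P)=\{\omega_k,\bar\omega_k\}\text{ for some }k\in\{1,\dots,[\tfrac m2]\}\},$$ and for $a\in\{-1,0,1\}$, $\tilde\Omega^a_m(2n)=\{P\in\Omega_m(2n): S^+_P(\omega)=S^-_P(\omega)+a\ \text{ for }\omega\in\sigma(P)\cap\mathbf{U}^+\}$. Hypersurfaces and characteristics: $\mathcal{H}(2n)$ is the set of $C^2$ compact convex hypersurfaces $\Sigma\subset\mathbb{R}^{2n}$ surrounding $0$ (boundary of a compact convex set $C$ with $0$ in its interior). Let $j_\Sigma(0)=0$, $j_\Sigma(x)=\inf\{\lambda>0:x/\lambda\in C\}$ for $x\ne 0$; fix $\alpha\in(1,2)$ and set $H_\alpha=j_\Sigma^\alpha$, so $\Sigma=H_\alpha^{-1}(1)$. Convexity is understood in the sense that $H_\alpha''(x)$ is positive definite for $x\ne0$. $\mathcal{H}_P(2n)=\{\Sigma\in\mathcal{H}(2n): Px\in\Sigma\ \forall x\in\Sigma\}$.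 $\mathcal{J}(\Sigma)$ is the set of closed characteristics of $\Sigma$, identified with pairs $(\tau,x)$, $\tau>0$, where $x$ solves $H_\alpha(x)=1$, $\dot x=JH_\alpha'(x)$, $x(0)=x(\tau)$; $(\tau,x)$ is prime if $\tau$ is the minimal period. The associated symplectic path $\gamma_x:[0,\tau]\to\mathrm{Sp}(2n)$ is the fundamental solution ($\gamma_x(0)=I_{2n}$) of $\dot y(t)=JH_\alpha''(x(t))y(t)$. Maslov-type index (Long's $\omega$-index): let $\mathcal{P}_\tau(2n)$ be the set of continuous paths $\gamma:[0,\tau]\to\mathrm{Sp}(2n)$ with $\gamma(0)=I_{2n}$. For $\gamma\in\mathcal{P}_\tau(2n)$ and $\omega\in\mathbf{U}$, $\nu_\omega(\gamma)=\dim_{\mathbb{C}}\ker_{\mathbb{C}}(\gamma(\tau)-\omega I_{2n})$. For a continuous path $\gamma$ in $\mathrm{Sp}(2n)$ write the polar decomposition $\gamma(t)=A(t)U(t)$ with $A(t)$ symmetric positive definite symplectic and $U(t)=\begin{pmatrix}u_1&-u_2\\ u_2&u_1\end{pmatrix}$ orthogonal symplectic, $\det(u_1+\sqrt{-1}u_2)(t)=e^{\sqrt{-1}\Delta(t)}$ with $\Delta$ continuous, and let $\Delta(\gamma)$ be the total change of $\Delta(t)$ along the path. Let $\mathrm{Sp}(2n)^*_\omega=\{M\in\mathrm{Sp}(2n):\det(M-\omega I_{2n})\neq0\}$, which has two path components, one containing $M_n^+=\mathrm{diag}(2,\frac12)^{\diamond n}$ and the other $M_n^-=\mathrm{diag}(-2,-\frac12)\diamond\mathrm{diag}(2,\frac12)^{\diamond(n-1)}$,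 where $\diamond$ is the symplectic direct sum $\begin{pmatrix}A_1&A_2\\ A_3&A_4\end{pmatrix}\diamond\begin{pmatrix}B_1&B_2\\ B_3&B_4\end{pmatrix}=\begin{pmatrix}A_1&0&A_2&0\\ 0&B_1&0&B_2\\ A_3&0&A_4&0\\ 0&B_3&0&B_4\end{pmatrix}$. If $\gamma\in\mathcal{P}_\tau(2n)$ and $\gamma(\tau)\in\mathrm{Sp}(2n)^*_\omega$, choose a path $\beta$ in $\mathrm{Sp}(2n)^*_\omega$ from $\gamma(\tau)$ to $M_n^+$ or $M_n^-$ and set $i_\omega(\gamma)=(\Delta(\gamma)+\Delta(\beta))/\pi\in\mathbb{Z}$. If $\gamma(\tau)\notin\mathrm{Sp}(2n)^*_\omega$, set $i_\omega(\gamma)=\sup_{\mathcal{U}}\inf\{i_\omega(\beta):\beta\in\mathcal{U},\ \beta(\tau)\in\mathrm{Sp}(2n)^*_\omega\}$, with $\mathcal{U}$ ranging over the open neighborhoods of $\gamma$ in $\mathcal{P}_\tau(2n)$ ($C^0$ topology). Splitting numbers: for $M\in\mathrm{Sp}(2n)$ and $\omega\in\mathbf{U}$, $S^\pm_M(\omega)=\lim_{\epsilon\to0^+}\big(i_{e^{\pm\sqrt{-1}\epsilon}\omega}(\gamma)-i_\omega(\gamma)\big)$ for any $\gamma\in\mathcal{P}_\tau(2n)$ with $\gamma(\tau)=M$; this does not depend on $\gamma$. Maslov index: $Gr(M)$ denotes the graph of $M$, and $\mu(\cdot,\cdot)$ is the Cappell–Lee–Miller Maslov index of a pair of Lagrangian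 paths; for $\gamma\in\mathcal{P}_\tau(2n)$ it is normalized so that $\mu(Gr(I_{2n}),Gr(\gamma))=i_1(\gamma)+n$, which may be taken as its definition here. *)

(* Defs.v *)
From mathcomp Require Import all_boot all_order all_algebra.
From mathcomp Require Import complex.
From mathcomp Require Import all_classical all_reals all_analysis.

Set Implicit Arguments.
Unset Strict Implicit.
Unset Printing Implicit Defensive.

Import Order.TTheory GRing.Theory Num.Theory.
Import numFieldNormedType.Exports.

Local Open Scope classical_set_scope.
Local Open Scope ring_scope.

(** Vectors of R^{2n} are columns of height [n + n], so that 2n x 2n matrices
    are 2 x 2 block matrices with n x n blocks. *)

Definition Jmx (R : realType) (n : nat) : 'M[R]_(n + n) :=
  block_mx 0 (- 1%:M) 1%:M 0.

Definition symplectic (R : realType) (n : nat) (M : 'M[R]_(n + n)) : Prop :=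
  M \in unitmx /\ M^T *m Jmx R n *m M = Jmx R n.

Definition posdef (R : realType) (k : nat) (A : 'M[R]_k) : Prop :=
  A^T = A /\ forall v : 'cV[R]_k, v != 0 -> 0 < (v^T *m A *m v) 0 0.

Definition cmx (R : realType) (k l : nat) (M : 'M[R]_(k, l)) : 'M[R[i]]_(k, l) :=
  map_mx (real_complex R) M.

Definition expi (R : realType) (t : R) : R[i] := Complex (cos t) (sin t).

Definition Uplus (R : realType) : set R[i] :=
  [set expi t | t in [set t : R | 0 < t <= pi]].

Definition spectrum (R : realType) (k : nat) (M : 'M[R]_k) : set R[i] :=
  [set z | eigenvalue (cmx M) z].

Definition is_path (R : realType) (n : nat) (a b : R) (g : R -> 'M[R]_(n + n)) :
    Prop :=
  {within `[a, b], continuous g} /\ forall t, t \in `[a, b] -> symplectic (g t).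

(** Paths are total functions of which only the values on
    [0, tau] matter. *)
Definition Ppath (R : realType) (n : nat) (tau : R) :
    set (R -> 'M[R]_(n + n)) :=
  [set g | is_path 0 tau g /\ g 0 = 1%:M].

Definition nullity (R : realType) (n : nat) (tau : R) (w : R[i])
    (g : R -> 'M[R]_(n + n)) : nat :=
  (* [kermx] is a left kernel, hence the transpose *)
  \rank (kermx (cmx (g tau) - w%:M)^T).

(** [d] is an angle of [det (u1 + i u2)], for the polar decomposition
    [M = A U] of the symplectic matrix [M]. *)
Definition polar_angle (R : realType) (n : nat) (M : 'M[R]_(n + n)) (d : R) :
    Prop :=
  exists A : 'M[R]_(n + n), exists u1 u2 : 'M[R]_n,
    let U := block_mx u1 (- u2) u2 u1 in
    [/\ posdef A, symplectic A,
        U^T *m U = 1%:M /\ symplectic U,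
        M = A *m U &
        \det (cmx u1 + 'i%C *: cmx u2) = expi d].

Definition total_angle (R : realType) (n : nat) (a b : R)
    (g : R -> 'M[R]_(n + n)) (r : R) : Prop :=
  exists D : R -> R,
    [/\ {within `[a, b], continuous D},
        forall t, t \in `[a, b] -> polar_angle (g t) (D t) &
        r = D b - D a].

Definition nondegenerate (R : realType) (n : nat) (w : R[i])
    (M : 'M[R]_(n + n)) : bool :=
  \det (cmx M - w%:M) != 0.

Definition diamond (R : realType) (k l : nat) (A : 'M[R]_(k + k))
    (B : 'M[R]_(l + l)) : 'M[R]_((k + l) + (k + l)) :=
  block_mx (block_mx (ulsubmx A) 0 0 (ulsubmx B))
           (block_mx (ursubmx A) 0 0 (ursubmx B))
           (block_mx (dlsubmx A) 0 0 (dlsubmx B))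
           (block_mx (drsubmx A) 0 0 (drsubmx B)).

Definition diag2 (R : realType) (a b : R) : 'M[R]_(1 + 1) :=
  block_mx a%:M 0 0 b%:M.

Fixpoint Mplus (R : realType) (n : nat) : 'M[R]_(n + n) :=
  match n with
  | 0 => 0
  | n'.+1 => diamond (diag2 2 2^-1) (Mplus R n')
  end.

Definition Mminus (R : realType) (n : nat) : 'M[R]_(n + n) :=
  match n with
  | 0 => 0
  | n'.+1 => diamond (diag2 (- 2) (- 2^-1)) (Mplus R n')
  end.

(** Indices are integers, represented here as elements of [R].  [xget 0] selects the value, which depends on no choice. *)
Definition index_nd (R : realType) (n : nat) (tau : R) (w : R[i])
    (g : R -> 'M[R]_(n + n)) : R :=
  xget 0 [set r : R | exists (b : R -> 'M[R]_(n + n)) (dg db : R),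
    [/\ is_path 0 1 b /\ (forall t, t \in `[0, 1] -> nondegenerate w (b t)),
        b 0 = g tau, b 1 = Mplus R n \/ b 1 = Mminus R n,
        total_angle 0 tau g dg /\ total_angle 0 1 b db &
        r = (dg + db) / pi]].

(** The C^0 topology on P_tau(2n) is induced by the topology of uniform
    convergence on [0, tau]. *)
Definition maslov_index (R : realType) (n : nat) (tau : R) (w : R[i])
    (g : R -> 'M[R]_(n + n)) : R :=
  if nondegenerate w (g tau) then index_nd tau w g
  else fine (ereal_sup
    [set ereal_inf
       [set (index_nd tau w b)%:E | b in
          [set b | [/\ Ppath tau b, U b & nondegenerate w (b tau)]]]
    | U in [set U : set {uniform` `[0, tau] -> 'M[R]_(n + n)} |
              open U /\ U g]]).

(** [splitting e M w], for [e = 1] or [e = -1], is the limit of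
    i_{exp(i e eps) w} - i_w as eps tends to 0 from the right; it does not
    depend on the path ending at [M] which is selected by [xget]. *)
Definition splitting (R : realType) (n : nat) (e : R) (M : 'M[R]_(n + n))
    (w : R[i]) : R :=
  xget 0 [set r : R | exists (tau : R) (g : R -> 'M[R]_(n + n)),
    [/\ 0 < tau, Ppath tau g, g tau = M &
        (maslov_index tau (expi (e * eps) * w) g - maslov_index tau w g)
          @[eps --> 0^'+] --> r]].

Definition Splus (R : realType) (n : nat) (M : 'M[R]_(n + n)) (w : R[i]) : R :=
  splitting 1 M w.

Definition Sminus (R : realType) (n : nat) (M : 'M[R]_(n + n)) (w : R[i]) : R :=
  splitting (-1) M w.

(** The Cappell-Lee-Miller index of the pair (Gr(I), Gr(g)), by its
    normalization. *)
Definition mu_graph (R : realType) (n : nat) (tau : R)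
    (g : R -> 'M[R]_(n + n)) : R :=
  maslov_index tau 1 g + n%:R.

Definition omega (R : realType) (m k : nat) : R[i] :=
  expi ((2 * k)%:R * pi / m%:R).

Definition Omega (R : realType) (m n : nat) : set 'M[R]_(n + n) :=
  [set P | [/\ symplectic P, P ^+ m = 1 &
    exists2 k : nat, (1 <= k <= m./2)%N &
      spectrum P = [set omega R m k; ((omega R m k)^*)%C]]].

Definition Omega_tilde (R : realType) (m n : nat) (a : int) :
    set 'M[R]_(n + n) :=
  [set P | Omega m P /\
    forall w, (spectrum P `&` @Uplus R) w -> Splus P w = Sminus P w + a%:~R].

Definition partial (R : realType) (k : nat) (i : 'I_k) (f : 'cV[R]_k -> R) :
    'cV[R]_k -> R :=
  fun x => 'D_(delta_mx i 0) f x.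

Definition grad (R : realType) (k : nat) (f : 'cV[R]_k -> R) (x : 'cV[R]_k) :
    'cV[R]_k :=
  \col_i partial i f x.

Definition hess (R : realType) (k : nat) (f : 'cV[R]_k -> R) (x : 'cV[R]_k) :
    'M[R]_k :=
  \matrix_(i, j) partial i (partial j f) x.

Definition C2_on (R : realType) (k : nat) (V : set 'cV[R]_k)
    (f : 'cV[R]_k -> R) : Prop :=
  forall x, V x ->
    [/\ differentiable f x,
        forall i, differentiable (partial i f) x &
        forall i j, {for x, continuous (partial i (partial j f))}].

Definition C2_hypersurface (R : realType) (k : nat) (S : set 'cV[R]_k) : Prop :=
  forall p, S p -> exists (V : set 'cV[R]_k) (f : 'cV[R]_k -> R),
    [/\ open V, V p, C2_on V f, forall x, V x -> grad f x != 0 &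
        S `&` V = [set x | V x /\ f x = 0]].

Definition gauge (R : realType) (k : nat) (C : set 'cV[R]_k) (x : 'cV[R]_k) : R :=
  if x == 0 then 0 else inf [set l : R | 0 < l /\ C (l^-1 *: x)].

Definition Halpha (R : realType) (k : nat) (C : set 'cV[R]_k) (alpha : R)
    (x : 'cV[R]_k) : R :=
  gauge C x `^ alpha.

(** [C] is determined by [S]; it is kept as a parameter because the gauge is
    defined from it.  The last condition does not depend on [alpha > 1]. *)
Definition convex_hypersurface (R : realType) (n : nat) (alpha : R)
    (C S : set 'cV[R]_(n + n)) : Prop :=
  [/\ compact C /\ convex_set C,
      (interior C) 0,
      S = closure C `\` interior C,
      C2_hypersurface S &
      forall x, x != 0 -> posdef (hess (Halpha C alpha) x)].

Definition sym_convex_hypersurface (R : realType) (n : nat) (alpha : R)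
    (P : 'M[R]_(n + n)) (C S : set 'cV[R]_(n + n)) : Prop :=
  convex_hypersurface alpha C S /\ forall x, S x -> S (P *m x).

(** [x] is extended periodically to the whole line. *)
Definition closed_characteristic (R : realType) (n : nat) (alpha : R)
    (C : set 'cV[R]_(n + n)) (tau : R) (x : R -> 'cV[R]_(n + n)) : Prop :=
  [/\ 0 < tau,
      forall t, Halpha C alpha (x t) = 1,
      forall t : R,
        is_derive t (1 : R) x (Jmx R n *m grad (Halpha C alpha) (x t)) &
      x 0 = x tau].

Definition prime_period (R : realType) (n : nat) (tau : R)
    (x : R -> 'cV[R]_(n + n)) : Prop :=
  forall s : R, 0 < s -> (forall t, x (t + s) = x t) -> tau <= s.

Definition associated_path (R : realType) (n : nat) (alpha : R)
    (C : set 'cV[R]_(n + n)) (tau : R) (x : R -> 'cV[R]_(n + n))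
    (g : R -> 'M[R]_(n + n)) : Prop :=
  [/\ g 0 = 1%:M,
      {within `[0, tau], continuous g} &
      forall t : R, t \in `]0, tau[ ->
        is_derive t (1 : R) g
          (Jmx R n *m hess (Halpha C alpha) (x t) *m g t)].

(* Main.v *)
Require Import Defs.
From HB Require Import structures.
From mathcomp Require Import all_boot all_order all_algebra.
From mathcomp Require Import complex.
From mathcomp Require Import ring lra zify.
From mathcomp Require Import all_classical all_reals all_analysis.

Set Implicit Arguments.
Unset Strict Implicit.
Unset Printing Implicit Defensive.

Import Order.TTheory GRing.Theory Num.Theory.
Import numFieldNormedType.Exports.

Local Open Scope classical_set_scope.
Local Open Scope ring_scope.

Notation reC := (@complex.Re _).
Notation imC := (@complex.Im _).

(** In the complex coordinates [q + i p], [q - i p] the graph of a symplectic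
    matrix [M] becomes the graph of a unitary matrix [W_z], depending on a
    unit [z], with [dim ker (M - z) = dim ker (W_z - 1)].  If [theta_z] is the
    sum of the arguments in [(0, 2 pi]] of the eigenvalues of [W_z], then
    [i_z (g) = n + (2 Delta (g) - theta_z (g (tau))) / (2 pi)] for every [z],
    degenerate or not: [theta_z] differs from [2 Delta] by a locally constant
    multiple of [2 pi] on nondegenerate matrices, these are connected to the two
    normal forms, and the eigenvalues of [W_z] rotate in one direction when [M]
    is multiplied by small rotations, so the infimum in the definition is attained.

    The gauge inherits the symmetry of [Sigma], so [gamma (tau) = X (s) ^ m] for
    [s = tau / m] and [X = P gamma], a path whose quotient derivative is positive
    because the Hessian is.  The increase [E (zeta)] of
    [(2 Delta - theta_zeta) / (2 pi)] along [X] is then at least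
    [dim ker (P - zeta)], and by a Bott formula the left-hand side of the
    inequality is a signed sum of the values of [E] at the [m]-th roots of unity
    and just after them.  Going through the roots of the upper
    half circle, the variation of [E] between two of them is controlled by
    the eigenvalues of [X (s)] in between; as [P] has no eigenvalue other than
    [omega] there, what is lost at [omega] is at most [S^-_P (omega)]. *)

(** * Complex numbers of modulus one *)

Section Exponential.
Variable R : realType.
Implicit Types (z w : R[i]) (s t : R).

(** All objects defined by a choice, a supremum or a limit are reduced to [theta], so index theory
    becomes a count of eigenvalues of unitary matrices crossing [1]. The value [1] sits at the top
    end of [(0, 2 pi]] because an eigenvalue leaving it counterclockwise then lowers the sum by
    [2 pi], while one leaving clockwise changes nothing: this is the one-sided behaviour that the
    sup-inf selects. Eigenvalues are never followed one by one; two spectra are compared through the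
    doubly stochastic matrix of overlaps of their eigenbases.

    In the final count, [E (zeta) + dim ker (X (s) - zeta) - theta_zeta (P) / (2 pi)] varies on the
    upper half circle by at most the number of eigenvalues, of a slight rotation of [X (s)], that
    are met there. Symplectic spectra being closed under conjugation, this number is at most [n].
    For odd [m] the root [1] enters once and the other roots in conjugate pairs, so the upper half
    circle suffices. For [m = 2] the root [-1] is its own conjugate and carries all [2n] dimensions,
    so that case is treated apart. *)

Definition nsq z : R := reC z ^+ 2 + imC z ^+ 2.

Lemma nsqE z : (nsq z)%:C%C = z * z^*%C.
Proof. by case: z => a b; rewrite /nsq /=; simpc; congr Complex; ring. Qed.

Lemma nsqM z w : nsq (z * w) = nsq z * nsq w.
Proof. by case: z w => a b [c d]; rewrite /nsq /=; ring. Qed.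

Lemma nsq_ge0 z : 0 <= nsq z. Proof. by rewrite addr_ge0 ?sqr_ge0. Qed.

Lemma nsq_eq0 z : (nsq z == 0) = (z == 0).
Proof.
by case: z => a b; rewrite /nsq /= paddr_eq0 ?sqr_ge0// !sqrf_eq0 eq_complex.
Qed.

Lemma nsqJ z : nsq z^*%C = nsq z.
Proof. by case: z => a b; rewrite /nsq /= sqrrN. Qed.

Lemma conj_unitE z : nsq z = 1 -> z^-1 = z^*%C.
Proof.
move=> z1; have zz : z * z^*%C = 1 by rewrite -nsqE z1.
have z0 : z != 0 by rewrite -nsq_eq0 z1 oner_eq0.
by apply: (mulfI z0); rewrite zz divff.
Qed.

Lemma nsq_expi t : nsq (expi t) = 1.
Proof. by rewrite /nsq /= cos2Dsin2. Qed.

Lemma expiD s t : expi (s + t) = expi s * expi t.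
Proof. by rewrite /expi cosD sinD; simpc; congr Complex; ring. Qed.

Lemma expi0 : expi (0 : R) = 1.
Proof. by rewrite /expi cos0 sin0. Qed.

Lemma expiJ t : (expi t)^*%C = expi (- t).
Proof. by rewrite /expi cosN sinN. Qed.

Lemma expi_neq0 t : expi t != 0.
Proof. by rewrite -nsq_eq0 nsq_expi oner_eq0. Qed.

Lemma expiN t : expi (- t) = (expi t)^-1.
Proof. by rewrite conj_unitE ?nsq_expi// expiJ. Qed.

Lemma expi_natM m t : expi (m%:R * t) = expi t ^+ m.
Proof.
elim: m => [|m IH]; first by rewrite mul0r expi0.
by rewrite exprS -IH -expiD -natr1 mulrDl mul1r addrC.
Qed.

Lemma expi2pi : expi (2 * pi : R) = 1.
Proof. by rewrite /expi mulr_natl cos2pi sin2pi. Qed.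

Lemma expiDint t (k : int) : expi (t + k%:~R * (2 * pi)) = expi t.
Proof.
have nat_case (m : nat) s : expi (s + m%:R * (2 * pi)) = expi s.
  by rewrite expiD expi_natM expi2pi expr1n mulr1.
case: k => m; first exact: nat_case.
by rewrite NegzE -(nat_case m.+1 (_ + _)) mulrNz mulNr addrNK.
Qed.

Lemma expi_eq1_small t : 0 <= t < 2 * pi -> expi t = 1 -> t = 0.
Proof.
move=> /andP[t0 t2] [] ct st.
have [tpi|tpi] := leP t pi.
  by apply: cos_inj; rewrite ?in_itv/= ?t0 ?tpi ?lexx ?pi_ge0// ct cos0.
have : 2 * pi - t = 0.
  apply: cos_inj; rewrite ?in_itv/= ?lexx ?pi_ge0//.
    by apply/andP; split; lra.
  rewrite cos0; suff -> : cos (2 * pi - t) = reC (expi (2 * pi - t)) by rewrite expiD expi2pi mul1r -expiJ /= ct.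
  by [].
by move/eqP; rewrite subr_eq0 => /eqP E; rewrite E ltxx in t2.
Qed.

Lemma expi_eq1 t : expi t = 1 -> exists k : int, t = k%:~R * (2 * pi).
Proof.
move=> t1; have p0 : (0 : R) < 2 * pi by rewrite mulr_gt0 ?pi_gt0.
exists (Num.floor (t / (2 * pi))); apply/eqP; rewrite -subr_eq0; apply/eqP.
apply: expi_eq1_small; last by rewrite -mulNr -mulrNz expiDint.
have /andP[h1 h2] := mem_rg1_floor (t / (2 * pi)).
move: h1 h2; rewrite ler_pdivlMr// ltr_pdivrMr// => h1 h2.
by rewrite subr_ge0 h1/= ltrBlDl; move: h2; rewrite mulrDl mul1r.
Qed.

Lemma expi_eq s t : expi s = expi t -> exists k : int, s = t + k%:~R * (2 * pi).
Proof.
move=> st; have /expi_eq1[k kE] : expi (s - t) = 1.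
  by rewrite expiD st expiN divff// expi_neq0.
by exists k; rewrite -kE addrC subrK.
Qed.

Lemma expi_surj z : nsq z = 1 -> exists2 t, 0 < t <= 2 * pi & z = expi t.
Proof.
case: z => a b; rewrite /nsq/= => ab.
have a1 : -1 <= a <= 1.
  by rewrite -ler_norml -(@ler_pXn2r _ 2)// ?nnegrE// expr1n real_normK ?num_real// -ab lerDl sqr_ge0.
have b2 : b ^+ 2 = 1 - a ^+ 2 by rewrite -ab addrC addKr.
have cosa : cos (acos a) = a by apply: acosK; rewrite in_itv.
have sina : sin (acos a) = `|b|.
  by rewrite sin_acos// -b2 sqrtr_sqr.
have aa : 0 <= acos a <= pi by rewrite acos_ge0// acos_lepi.
case/andP: aa => aa0 aapi.
have [b0|b0] := ltP 0 b.
  exists (acos a); last by rewrite /expi cosa sina gtr0_norm.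
  rewrite (le_trans aapi) ?andbT ?ler_peMl ?pi_ge0// ?ler1n//.
  rewrite lt_neqAle aa0 andbT; apply: contraTneq b0 => h.
  by move: sina; rewrite -h sin0 => /esym/eqP; rewrite normr_eq0 => /eqP->; rewrite ltxx.
exists (2 * pi - acos a); last first.
  by rewrite expiD expi2pi mul1r -expiJ /expi cosa sina ler0_norm //= opprK.
rewrite gerBl aa0 andbT subr_gt0 (le_lt_trans aapi)// ltr_pMl ?pi_gt0// ltr1n.
by [].
Qed.

(** On the unit circle the set is a singleton. Elsewhere it is empty and the value is the default
    [0], outside [(0, 2 pi]]. *)
Definition ang z : R := xget 0 [set t | 0 < t <= 2 * pi /\ z = expi t].

Lemma angP z : nsq z = 1 -> 0 < ang z <= 2 * pi /\ z = expi (ang z).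
Proof.
move=> /expi_surj[t ht zt]; rewrite /ang.
by case: xgetP => [s -> //|/(_ t)]; case.
Qed.

Lemma ang_expi t : 0 < t <= 2 * pi -> ang (expi t) = t.
Proof.
move=> /andP[t0 t2]; have [/andP[s0 s2] /expi_eq [k E]] := angP (nsq_expi t).
have p0 : (0 : R) < 2 * pi by rewrite mulr_gt0 ?pi_gt0.
set s := ang _ in s0 s2 E *.
suff k0 : k = 0 by move: E; rewrite k0 mul0r addr0 => ->.
have : `|k%:~R * (2 * pi)| < 2 * pi :> R.
  have -> : k%:~R * (2 * pi) = t - s by rewrite E addrAC subrr add0r.
  by rewrite ltr_norml; apply/andP; split; lra.
rewrite normrM (gtr0_norm p0) gtr_pMl// -intr_norm ltrz1.
by case: (k) => [[|m]|m] //.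
Qed.

Lemma ang1 : ang 1 = 2 * pi.
Proof. by rewrite -expi2pi ang_expi// lexx mulr_gt0// pi_gt0. Qed.

Lemma ang_eq2pi z : nsq z = 1 -> ang z = 2 * pi -> z = 1.
Proof. by move=> /angP[_ zE] a2; rewrite zE a2 expi2pi. Qed.

Lemma angJ z : nsq z = 1 -> z != 1 -> ang z^*%C = 2 * pi - ang z.
Proof.
move=> z1 zn1; have [/andP[a0 a2] zE] := angP z1.
have ->: z^*%C = expi (2 * pi - ang z) by rewrite expiD expi2pi mul1r {1}zE expiJ.
apply: ang_expi; rewrite gerBl ltW// andbT subr_gt0 lt_neqAle a2 andbT.
by apply: contra zn1 => /eqP /(ang_eq2pi z1) ->.
Qed.

(** The branch with values in [(- pi / 2, pi / 2)]. Unlike [ang] it is continuous at [1], so small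
    increments of an argument are measured with it, on the right half-plane. *)
Definition argp z : R := atan (imC z / reC z).

Lemma argp_itv z : - (pi / 2) < argp z < pi / 2.
Proof. by rewrite /argp atan_gtNpi2 atan_ltpi2. Qed.

Lemma argpP z : 0 < reC z -> z = (Num.sqrt (nsq z))%:C%C * expi (argp z).
Proof.
case: z => a b /= a0; rewrite /argp /expi/= /nsq /=.
have cosE : cos (atan (b / a)) = (Num.sqrt (1 + (b / a) ^+ 2))^-1 by rewrite cos_atan.
have sinE : sin (atan (b / a)) = (b / a) * (Num.sqrt (1 + (b / a) ^+ 2))^-1.
  by rewrite -cosE -{2}(atanK (b / a)) /tan divfK// cosE invr_eq0 gt_eqF// sqrtr_gt0 ltr_pwDl ?sqr_ge0.
rewrite cosE sinE.
have E : Num.sqrt (1 + (b / a) ^+ 2) = Num.sqrt (a ^+ 2 + b ^+ 2) / a.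
  have -> : a ^+ 2 + b ^+ 2 = (1 + (b / a) ^+ 2) * a ^+ 2 by field; rewrite gt_eqF.
  by rewrite sqrtrM ?addr_ge0 ?sqr_ge0// sqrtr_sqr gtr0_norm// mulfK// gt_eqF.
have s0 : Num.sqrt (a ^+ 2 + b ^+ 2) != 0.
  by rewrite gt_eqF// sqrtr_gt0 ltr_pwDl ?sqr_ge0// exprn_gt0.
have a0' : a != 0 by rewrite gt_eqF.
by rewrite E; simpc; congr Complex; field; rewrite s0 a0'.
Qed.

Lemma argp_unit z : nsq z = 1 -> 0 < reC z -> z = expi (argp z).
Proof. by move=> z1 /argpP {1}->; rewrite z1 sqrtr1 mul1r. Qed.

End Exponential.

(** * Entrywise convergence of complex matrices *)

Section ComplexConvergence.
Variables (R : realType) (T : Type) (F : set_system T).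
Context {FF : Filter F}.
Implicit Types (f g : T -> R[i]) (z w : R[i]).

(* [R[i]] carries no topology usable with real filters, so convergence is stated componentwise. *)
Definition ccvg f z := (reC (f t) @[t --> F] --> reC z) /\ (imC (f t) @[t --> F] --> imC z).

Lemma ccvg_eq f g z : (forall t, f t = g t) -> ccvg f z -> ccvg g z.
Proof. by move=> /funext ->. Qed.

Lemma ccvg_cst z : ccvg (fun=> z) z.
Proof. by split; exact: cvg_cst. Qed.

Lemma ccvgD f g z w : ccvg f z -> ccvg g w -> ccvg (fun t => f t + g t) (z + w).
Proof.
move=> [f1 f2] [g1 g2].
have reD (x y : R[i]) : reC (x + y) = reC x + reC y by case: x y => ? ? [? ?].
have imD (x y : R[i]) : imC (x + y) = imC x + imC y by case: x y => ? ? [? ?].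
split.
  by rewrite reD (_ : (fun _ => _) = (fun t => reC (f t) + reC (g t))); [exact: cvgD|apply/funext => t; rewrite reD].
by rewrite imD (_ : (fun _ => _) = (fun t => imC (f t) + imC (g t))); [exact: cvgD|apply/funext => t; rewrite imD].
Qed.

Lemma ccvgM f g z w : ccvg f z -> ccvg g w -> ccvg (fun t => f t * g t) (z * w).
Proof.
move=> [f1 f2] [g1 g2].
have reM (x y : R[i]) : reC (x * y) = reC x * reC y - imC x * imC y by case: x y => ? ? [? ?].
have imM (x y : R[i]) : imC (x * y) = reC x * imC y + imC x * reC y by case: x y => ? ? [? ?].
split.
  rewrite reM (_ : (fun _ => _) = (fun t => reC (f t) * reC (g t) - imC (f t) * imC (g t))).
    by apply: cvgB; apply: cvgM.
  by apply/funext => t; rewrite reM.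
rewrite imM (_ : (fun _ => _) = (fun t => reC (f t) * imC (g t) + imC (f t) * reC (g t))).
  by apply: cvgD; apply: cvgM.
by apply/funext => t; rewrite imM.
Qed.

Lemma ccvgN f z : ccvg f z -> ccvg (fun t => - f t) (- z).
Proof.
move=> fz; rewrite -mulN1r; apply: ccvg_eq (ccvgM (ccvg_cst (- 1)) fz) => t.
by rewrite mulN1r.
Qed.

Lemma ccvgJ f z : ccvg f z -> ccvg (fun t => (f t)^*%C) z^*%C.
Proof.
have reJ (x : R[i]) : reC x^*%C = reC x by case: x.
have imJ (x : R[i]) : imC x^*%C = - imC x by case: x.
move=> [f1 f2]; split.
  by rewrite reJ (_ : (fun _ => _) = (fun t => reC (f t)))//; apply/funext => t; rewrite reJ.
by rewrite imJ (_ : (fun _ => _) = (fun t => - imC (f t))); [exact: cvgN|apply/funext => t; rewrite imJ].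
Qed.

Lemma ccvg_real (f : T -> R) (x : R) : f t @[t --> F] --> x ->
  ccvg (fun t => (f t)%:C%C) x%:C%C.
Proof. by move=> fx; split => //=; exact: cvg_cst. Qed.

Lemma ccvg_nsq f z : ccvg f z -> nsq (f t) @[t --> F] --> nsq z.
Proof. by move=> [f1 f2]; apply: cvgD; rewrite expr2; under eq_fun do rewrite expr2; apply: cvgM. Qed.

Lemma ccvgV f z : z != 0 -> ccvg f z -> ccvg (fun t => (f t)^-1) z^-1.
Proof.
move=> z0 fz.
have VE (x : R[i]) : x^-1 = x^*%C * ((nsq x)^-1)%:C%C.
  have [->|x0] := eqVneq x 0; first by rewrite invr0 conjc0 mul0r.
  apply: (mulfI x0); rewrite divff// mulrA -nsqE -rmorphM/= divff ?nsq_eq0//.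
rewrite VE; apply: (@ccvg_eq (fun t => (f t)^*%C * ((nsq (f t))^-1)%:C%C)) => [t|].
  by rewrite -VE.
apply: ccvgM; first exact: ccvgJ.
by apply: ccvg_real; apply: cvgV; [rewrite nsq_eq0|exact: ccvg_nsq].
Qed.

Lemma ccvg_bigsum (I : Type) (r : seq I) (f : I -> T -> R[i]) (l : I -> R[i]) :
  (forall i, ccvg (f i) (l i)) -> ccvg (fun t => \sum_(i <- r) f i t) (\sum_(i <- r) l i).
Proof.
move=> fl; elim: r => [|i r IH].
  by rewrite big_nil; apply: ccvg_eq (ccvg_cst 0) => t; rewrite big_nil.
by rewrite big_cons; apply: ccvg_eq (ccvgD (fl i) IH) => t; rewrite big_cons.
Qed.

Lemma ccvg_bigprod (I : Type) (r : seq I) (f : I -> T -> R[i]) (l : I -> R[i]) :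
  (forall i, ccvg (f i) (l i)) -> ccvg (fun t => \prod_(i <- r) f i t) (\prod_(i <- r) l i).
Proof.
move=> fl; elim: r => [|i r IH].
  by rewrite big_nil; apply: ccvg_eq (ccvg_cst 1) => t; rewrite big_nil.
by rewrite big_cons; apply: ccvg_eq (ccvgM (fl i) IH) => t; rewrite big_cons.
Qed.

Definition mcvg m n (A : T -> 'M[R[i]]_(m, n)) (B : 'M[R[i]]_(m, n)) :=
  forall i j, ccvg (fun t => A t i j) (B i j).

Lemma mcvg_cst m n (B : 'M[R[i]]_(m, n)) : mcvg (fun=> B) B.
Proof. by move=> i j; exact: ccvg_cst. Qed.

Lemma mcvg_eq m n (A A' : T -> 'M[R[i]]_(m, n)) B : (forall t, A t = A' t) ->
  mcvg A B -> mcvg A' B.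
Proof. by move=> /funext ->. Qed.

Lemma mcvgD m n (A A' : T -> 'M[R[i]]_(m, n)) B B' :
  mcvg A B -> mcvg A' B' -> mcvg (fun t => A t + A' t) (B + B').
Proof.
by move=> AB AB' i j; rewrite mxE; apply: ccvg_eq (ccvgD (AB i j) (AB' i j)) => t; rewrite mxE.
Qed.

Lemma mcvgN m n (A : T -> 'M[R[i]]_(m, n)) B : mcvg A B -> mcvg (fun t => - A t) (- B).
Proof. by move=> AB i j; rewrite mxE; apply: ccvg_eq (ccvgN (AB i j)) => t; rewrite mxE. Qed.

Lemma mcvgB m n (A A' : T -> 'M[R[i]]_(m, n)) B B' :
  mcvg A B -> mcvg A' B' -> mcvg (fun t => A t - A' t) (B - B').
Proof. by move=> AB AB'; apply: mcvgD => //; exact: mcvgN. Qed.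

Lemma mcvgM m n p (A : T -> 'M[R[i]]_(m, n)) (A' : T -> 'M[R[i]]_(n, p)) B B' :
  mcvg A B -> mcvg A' B' -> mcvg (fun t => A t *m A' t) (B *m B').
Proof.
move=> AB AB' i j; rewrite mxE.
by apply: ccvg_eq (ccvg_bigsum _ (fun k => ccvgM (AB i k) (AB' k j))) => t; rewrite mxE.
Qed.

Lemma mcvgZ m n (f : T -> R[i]) z (A : T -> 'M[R[i]]_(m, n)) B :
  ccvg f z -> mcvg A B -> mcvg (fun t => f t *: A t) (z *: B).
Proof.
by move=> fz AB i j; rewrite mxE; apply: ccvg_eq (ccvgM fz (AB i j)) => t; rewrite mxE.
Qed.

Lemma mcvg_trmxC m n (A : T -> 'M[R[i]]_(m, n)) B :
  mcvg A B -> mcvg (fun t => (A t ^t*)%sesqui) (B ^t*)%sesqui.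
Proof. by move=> AB i j; rewrite !mxE; apply: ccvg_eq (ccvgJ (AB j i)) => t; rewrite !mxE. Qed.

Lemma ccvg_det n (A : T -> 'M[R[i]]_n) B : mcvg A B -> ccvg (fun t => \det (A t)) (\det B).
Proof.
move=> AB; apply: ccvg_bigsum => s; apply: ccvgM; first exact: ccvg_cst.
by apply: ccvg_bigprod => i.
Qed.

Lemma ccvg_tr n (A : T -> 'M[R[i]]_n) B : mcvg A B -> ccvg (fun t => \tr (A t)) (\tr B).
Proof. by move=> AB; apply: ccvg_bigsum => i. Qed.

Lemma mcvg_col m1 m2 n (A : T -> 'M[R[i]]_(m1, n)) (B : T -> 'M[R[i]]_(m2, n)) A0 B0 :
  mcvg A A0 -> mcvg B B0 -> mcvg (fun t => col_mx (A t) (B t)) (col_mx A0 B0).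
Proof.
move=> hA hB i j; rewrite mxE; case E: (fintype.split i) => [k|k].
  by apply: ccvg_eq (hA k j) => t; rewrite mxE E.
by apply: ccvg_eq (hB k j) => t; rewrite mxE E.
Qed.

Lemma mcvg_row m n1 n2 (A : T -> 'M[R[i]]_(m, n1)) (B : T -> 'M[R[i]]_(m, n2)) A0 B0 :
  mcvg A A0 -> mcvg B B0 -> mcvg (fun t => row_mx (A t) (B t)) (row_mx A0 B0).
Proof.
move=> hA hB i j; rewrite mxE; case E: (fintype.split j) => [k|k].
  by apply: ccvg_eq (hA i k) => t; rewrite mxE E.
by apply: ccvg_eq (hB i k) => t; rewrite mxE E.
Qed.

Lemma mcvg_block m1 m2 n1 n2 (A : T -> 'M[R[i]]_(m1, n1)) (B : T -> 'M[R[i]]_(m1, n2))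
    (C : T -> 'M[R[i]]_(m2, n1)) (D : T -> 'M[R[i]]_(m2, n2)) A0 B0 C0 D0 :
  mcvg A A0 -> mcvg B B0 -> mcvg C C0 -> mcvg D D0 ->
  mcvg (fun t => block_mx (A t) (B t) (C t) (D t)) (block_mx A0 B0 C0 D0).
Proof. by move=> hA hB hC hD; apply: mcvg_col; apply: mcvg_row. Qed.

(** By the adjugate formula the entries of the inverse are minors divided by the determinant, so
    continuity of [\det] and of the inverse in [R[i]] is enough. *)
Lemma mcvg_inv n (A : T -> 'M[R[i]]_n) B : B \in unitmx -> (forall t, A t \in unitmx) ->
  mcvg A B -> mcvg (fun t => invmx (A t)) (invmx B).
Proof.
move=> uB uA AB i j.
have AE t : invmx (A t) = (\det (A t))^-1 *: \adj (A t) by rewrite /invmx uA.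
have -> : invmx B i j = (\det B)^-1 * \adj B i j by rewrite /invmx uB mxE.
apply: (@ccvg_eq (fun t => (\det (A t))^-1 * \adj (A t) i j) (fun t => invmx (A t) i j)) => [t|].
  by rewrite AE [RHS]mxE.
apply: ccvgM; first by apply: ccvgV; [rewrite -unitfE -unitmxE|exact: ccvg_det].
have BE : (-1) ^+ (j + i) * \det (row' j (col' i B)) = \adj B i j by rewrite mxE.
apply: (eq_ind _ (fun z => ccvg _ z) _ _ BE).
apply: (@ccvg_eq (fun t => (-1) ^+ (j + i) * \det (row' j (col' i (A t)))) (fun t => \adj (A t) i j)).
  by move=> t; rewrite mxE.
apply: ccvgM; first exact: ccvg_cst.
by apply: ccvg_det => k l; rewrite !mxE; apply: ccvg_eq (AB _ _) => t; rewrite !mxE.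
Qed.

End ComplexConvergence.

(** * Eigenvalue arguments of unitary matrices *)

Section UnitaryDiagonalization.
Variable R : realType.
Local Notation C := R[i].
Local Open Scope sesquilinear_scope.

(** The square of the Frobenius norm. *)
Definition fro m n (A : 'M[C]_(m, n)) : R := \sum_i \sum_j nsq (A i j).

Lemma froE m n (A : 'M[C]_(m, n)) : (fro A)%:C%C = \tr (A *m A^t* ).
Proof.
rewrite /fro rmorph_sum /mxtrace /=; apply: eq_bigr => i _.
rewrite rmorph_sum mxE; apply: eq_bigr => j _.
by rewrite [LHS]nsqE !mxE.
Qed.

Lemma unitaryM n (A B : 'M[C]_n) : A \is unitarymx -> B \is unitarymx -> A *m B \is unitarymx.
Proof. exact: mul_unitarymx. Qed.

Lemma unitaryC n (A : 'M[C]_n) : A \is unitarymx -> A^t* \is unitarymx.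
Proof. by move=> uA; rewrite (trmxC_unitary A). Qed.

Lemma trmxC_mul m n p (A : 'M[C]_(m, n)) (B : 'M[C]_(n, p)) :
  (A *m B)^t* = B^t* *m A^t*.
Proof. by rewrite trmx_mul map_mxM. Qed.

Lemma fro_mulUmx m n (U : 'M[C]_m) (A : 'M[C]_(m, n)) : U \is unitarymx -> fro (U *m A) = fro A.
Proof.
move=> uU; apply: (@complexI R); rewrite !froE trmxC_mul mulmxA mxtrace_mulC.
rewrite !mulmxA; congr (\tr (_ *m _)).
by rewrite -(invmx_unitary uU) mulVmx ?mul1mx// unitarymx_unit.
Qed.

Lemma fro_mulmxU m n (U : 'M[C]_n) (A : 'M[C]_(m, n)) : U \is unitarymx -> fro (A *m U) = fro A.
Proof.
move=> uU; apply: (@complexI R); rewrite !froE trmxC_mul -mulmxA.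
by rewrite (mulmxA U) (unitarymxP uU) mul1mx.
Qed.

Lemma fro_ge0 m n (A : 'M[C]_(m, n)) : 0 <= fro A.
Proof. by apply: sumr_ge0 => i _; apply: sumr_ge0 => j _; exact: nsq_ge0. Qed.

(** The rows of [U] are an orthonormal basis of left eigenvectors; rows rather than columns, to
    agree with [kermx]. *)
Definition unidiag N (W U : 'M[C]_N) (d : 'rV[C]_N) :=
  U \is unitarymx /\ W = U^t* *m diag_mx d *m U.

Lemma unitary_unidiag N (W : 'M[C]_N) : W \is unitarymx ->
  unidiag W (spectralmx W) (spectral_diag W).
Proof.
move=> uW; split; first exact: spectral_unitarymx.
have nW : W \is normalmx.
  apply/normalmxP; rewrite (unitarymxP uW) -(invmx_unitary uW) mulVmx//.
  exact: unitarymx_unit.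
have /orthomx_spectralP {1}-> := nW.
by rewrite (invmx_unitary (spectral_unitarymx _)).
Qed.

Lemma unidiag_mulmx N (W U : 'M[C]_N) d : unidiag W U d -> U *m W = diag_mx d *m U.
Proof. by move=> [uU ->]; rewrite !mulmxA (unitarymxP uU) mul1mx. Qed.

Lemma unidiag_unit N (W U : 'M[C]_N) d : W \is unitarymx -> unidiag W U d ->
  forall j, nsq (d 0 j) = 1.
Proof.
move=> uW Wd j; have [uU _] := Wd; apply: (@complexI R).
have /matrixP/(_ j j) : (U *m W) *m (U *m W)^t* = 1%:M.
  exact/unitarymxP/unitaryM.
rewrite (unidiag_mulmx Wd) trmxC_mul mulmxA -(mulmxA _ U) (unitarymxP uU) mulmx1.
rewrite tr_diag_mx mul_diag_mx [in RHS]mxE eqxx => E; apply: etrans E.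
by rewrite [LHS]nsqE !mxE eqxx !mulr1n.
Qed.

Section Compare.
Variables (N : nat) (W W' U U' : 'M[C]_N) (d d' : 'rV[C]_N).
Hypotheses (Wd : unidiag W U d) (Wd' : unidiag W' U' d').

Let V := U *m U'^t*.

Let uV : V \is unitarymx.
Proof. by rewrite mul_unitarymx ?trmxC_unitary//; [case: Wd|case: Wd']. Qed.

(** The squared moduli of the inner products of the two eigenbases. They form a doubly stochastic
    matrix, which compares two spectra without matching their elements, as in the Hoffman-Wielandt
    inequality. *)
Definition overlap i j : R := nsq (V i j).

Lemma overlap_ge0 i j : 0 <= overlap i j. Proof. exact: nsq_ge0. Qed.

Lemma overlap_row i : \sum_j overlap i j = 1.
Proof.
apply: (@complexI R); have /matrixP/(_ i i) := unitarymxP uV.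
rewrite mxE [in RHS]mxE eqxx rmorph_sum/= => E; apply: etrans E; apply: eq_bigr => j _.
by rewrite [LHS]nsqE !mxE.
Qed.

Lemma overlap_col j : \sum_i overlap i j = 1.
Proof.
apply: (@complexI R); have uV' : V^t* \is unitarymx by rewrite trmxC_unitary.
have /matrixP/(_ j j) := unitarymxP uV'.
rewrite mxE [in RHS]mxE eqxx rmorph_sum/= => E; apply: etrans E; apply: eq_bigr => i _.
by rewrite [LHS]nsqE !mxE mulrC; congr (_ * _); rewrite [RHS]conjcK.
Qed.

(** The entries of [U (W - W') U'^*] are [V i j * (d i - d' j)], and the Frobenius norm is invariant
    under unitary factors on either side. *)
Lemma overlap_dist : \sum_i \sum_j overlap i j * nsq (d 0 i - d' 0 j) = fro (W - W').
Proof.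
have [[uU _] [uU' _]] := (Wd, Wd').
rewrite -(fro_mulUmx _ uU) -(@fro_mulmxU _ _ (U'^t* )) ?trmxC_unitary//.
have -> : U *m (W - W') *m U'^t* = diag_mx d *m V - V *m diag_mx d'.
  rewrite mulmxBr mulmxBl (unidiag_mulmx Wd) -!mulmxA; congr (_ - _).
  by have [_ ->] := Wd'; rewrite -!mulmxA (unitarymxP uU') mulmx1.
apply: eq_bigr => i _; apply: eq_bigr => j _.
rewrite !mxE /overlap -nsqM; congr nsq.
rewrite (bigD1 i)//= big1 ?addr0 => [|k ki]; last by rewrite !mxE eq_sym (negbTE ki) mulr0n mul0r.
have -> : \sum_k V i k * diag_mx d' k j = V i j * d' 0 j.
  rewrite (bigD1 j)//= big1 ?addr0 => [|k kj]; last by rewrite !mxE (negbTE kj) mulr0n mulr0.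
  by rewrite [diag_mx _ _ _]mxE eqxx mulr1n.
by rewrite [diag_mx _ _ _]mxE eqxx mulr1n mulrBr [d 0 i * _]mulrC.
Qed.

(** The rows and the columns of [overlap] sum to [1], so each of the two sums can be spread over all
    pairs. *)
Lemma spectral_sum_diff (f : C -> R) :
  \sum_i f (d 0 i) - \sum_j f (d' 0 j) =
  \sum_i \sum_j overlap i j * (f (d 0 i) - f (d' 0 j)).
Proof.
have E i : \sum_j overlap i j * (f (d 0 i) - f (d' 0 j)) =
    f (d 0 i) - \sum_j overlap i j * f (d' 0 j).
  under eq_bigr do rewrite mulrBr.
  by rewrite sumrB -mulr_suml overlap_row mul1r.
under [RHS]eq_bigr do rewrite E.
rewrite sumrB; congr (_ - _); rewrite exchange_big /=; apply: eq_bigr => j _.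
by rewrite -mulr_suml overlap_col mul1r.
Qed.
End Compare.
End UnitaryDiagonalization.

Section UnitaryDiagonalization2.
Variable R : realType.
Local Notation C := R[i].
Local Open Scope sesquilinear_scope.

Lemma fro_eq0 m n (A : 'M[C]_(m, n)) : fro A = 0 -> A = 0.
Proof.
move=> /eqP; rewrite psumr_eq0 => [/allP A0|i _]; last by apply: sumr_ge0 => j _; exact: nsq_ge0.
apply/matrixP => i j; have := A0 i (mem_index_enum _).
rewrite psumr_eq0 => [/allP/(_ j (mem_index_enum _))|k _]; last exact: nsq_ge0.
by rewrite nsq_eq0 mxE => /eqP.
Qed.

(** With [W = W'] the distance identity forces the overlap of [i] and [j] to vanish unless the
    eigenvalues agree; hence spectral sums do not depend on the diagonalization. *)
Lemma spectral_sum_eq N (W U U' : 'M[C]_N) d d' (f : C -> R) :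
  unidiag W U d -> unidiag W U' d' -> \sum_j f (d 0 j) = \sum_j f (d' 0 j).
Proof.
move=> Wd Wd'; apply/eqP; rewrite -subr_eq0 (spectral_sum_diff Wd Wd').
have /eqP := overlap_dist Wd Wd'; rewrite subrr.
have -> : fro (0 : 'M[C]_N) = 0.
  by rewrite /fro !big1// => i _; rewrite big1// => j _; rewrite mxE /nsq/= expr0n/= addr0.
have ge0 i j : 0 <= overlap U U' i j * nsq (d 0 i - d' 0 j).
  by rewrite mulr_ge0 ?overlap_ge0 ?nsq_ge0.
rewrite psumr_eq0 => [/allP H|i _]; last exact: sumr_ge0.
rewrite big1// => i _; rewrite big1// => j _.
have := H i (mem_index_enum _); rewrite psumr_eq0 => [/allP/(_ j (mem_index_enum _))|k _ //].
rewrite mulf_eq0 => /orP[/eqP->|]; first by rewrite mul0r.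
by rewrite nsq_eq0 subr_eq0 => /eqP->; rewrite subrr mulr0.
Qed.

Lemma mulmx_unitaryE N (V : 'M[C]_N) : V \is unitarymx -> V^t* *m V = 1%:M.
Proof. by move=> uV; rewrite -(invmx_unitary uV) mulVmx// unitarymx_unit. Qed.

Lemma unidiag_conj N (W U V : 'M[C]_N) d : V \is unitarymx ->
  unidiag W U d -> unidiag (V *m W *m V^t* ) (U *m V^t* ) d.
Proof.
move=> uV [uU ->]; split; first exact: unitaryM (unitaryC uV).
by rewrite (trmxC_mul U) (trmxCK V) !mulmxA.
Qed.

Lemma unidiag_trmx N (W U : 'M[C]_N) d : unidiag W U d -> unidiag W^T (map_mx Num.conj U) d.
Proof.
move=> [uU ->]; split; first by rewrite conjC_unitary.
rewrite (trmx_mul (U^t* *m diag_mx d)) (trmx_mul _ (diag_mx d)) tr_diag_mx mulmxA.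
have -> : (U^t* )^T = map_mx Num.conj U by apply/matrixP => i j; rewrite !mxE.
suff -> : ((map_mx Num.conj U)^t* )%sesqui = U^T by [].
by apply/matrixP => i j; rewrite !mxE [LHS]conjcK.
Qed.

Lemma unidiag_trmxC N (W U : 'M[C]_N) d : unidiag W U d ->
  unidiag (W^t* ) U (map_mx Num.conj d).
Proof.
move=> [uU ->]; split=> //.
rewrite (trmxC_mul (U^t* *m diag_mx d)) (trmxC_mul _ (diag_mx d)) (trmxCK U) mulmxA.
suff -> : ((diag_mx d)^t* )%sesqui = diag_mx (map_mx Num.conj d) by [].
by rewrite tr_diag_mx map_diag_mx.
Qed.

Lemma unidiag_diag N (d : 'rV[C]_N) : unidiag (diag_mx d) 1%:M d.
Proof.
have u1 : (1%:M : 'M[C]_N) \is unitarymx by rewrite qualifE /= trmx1 map_mx1 mulmx1.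
by split=> //; rewrite trmx1 map_mx1 mul1mx mulmx1.
Qed.

(** Eigenvectors for [z] lie in the kernel of [W - z] and the others in its image; the two lower
    bounds on ranks add up to [N], so both are equalities. *)
Lemma unidiag_rank N (W U : 'M[C]_N) d z : unidiag W U d ->
  \rank (kermx (W - z%:M)) = #|[set j | d 0 j == z]%SET|.
Proof.
move=> [uU WE]; have uUU := unitarymx_unit uU.
set A := [set j | _]%SET.
have rowsE (B : {set 'I_N}) (f : 'I_#|B| -> 'I_N) : injective f ->
    \rank (rowsub f U) = #|B|.
  move=> fI; apply: mxrank_unitary; apply/unitarymxP.
  have -> : rowsub f U *m (rowsub f U)^t* = mxsub f f (U *m U^t* ).
    by apply/matrixP => i j; rewrite !mxE; apply: eq_bigr => k _; rewrite !mxE.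
  rewrite (unitarymxP uU); apply/matrixP => i j; rewrite !mxE.
  by rewrite (inj_eq fI).
have UWz : U *m (W - z%:M) = diag_mx (d - const_mx z) *m U.
  rewrite mulmxBr (unidiag_mulmx (conj uU WE)) raddfB /= mulmxBl; congr (_ - _).
  by rewrite diag_const_mx mul_mx_scalar mul_scalar_mx.
have le1 : (#|A| <= \rank (kermx (W - z%:M)))%N.
  rewrite -(rowsE A enum_val enum_val_inj); apply: mxrankS; apply/sub_kermxP.
  rewrite -[rowsub _ _ *m _]mul_rowsub_mx || idtac.
  apply/matrixP => i j; rewrite !mxE.
  have := congr1 (fun M : 'M[C]_N => M (enum_val i) j) UWz; rewrite mul_diag_mx !mxE.
  have := enum_valP i; rewrite inE => /eqP ->; rewrite subrr mul0r => UW0; rewrite -[RHS]UW0.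
  by apply: eq_bigr => k _; rewrite !mxE.
have le2 : (#|~: A| <= \rank (W - z%:M)%R)%N.
  rewrite -(rowsE (~: A)%SET enum_val enum_val_inj); apply: mxrankS; apply/row_subP => i.
  have di : d 0 (enum_val i) - z != 0 by rewrite subr_eq0; have := enum_valP i; rewrite !inE.
  have -> : row i (rowsub enum_val U) =
      (d 0 (enum_val i) - z)^-1 *: row (enum_val i) U *m (W - z%:M).
    rewrite -scalemxAl -row_mul UWz; apply/rowP => j.
    by rewrite mul_diag_mx !mxE mulrA mulVf ?mul1r.
  exact: submxMl.
apply/eqP; rewrite eqn_leq le1 andbT mxrank_ker leq_subLR addnC -leq_subLR.
by rewrite (leq_trans _ le2)// leq_subLR cardsC card_ord.
Qed.

Section Counting.
Variables (N : nat) (W U : 'M[C]_N) (d : 'rV[C]_N).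
Hypothesis Wd : unidiag W U d.

(* A row space on which [v W v^*] lies over the half-plane [q > 0] meets the span of the other eigenvectors trivially. *)
Lemma count_ge_rank (q : C -> R) (a : C) (b : R) m (E : 'M[C]_(m, N)) :
  (forall z, q z = reC (a * z) - b) ->
  (forall v : 'rV[C]_N, (v <= E)%MS -> v != 0 ->
     0 < reC (a * (v *m W *m v^t* ) 0 0) - b * fro v) ->
  (\rank E <= #|[set j | (0 < q (d 0 j))%R]%SET|)%N.
Proof.
have [uU WE] := Wd; move=> qE pos; set A := [set j | _]%SET.
rewrite leqNgt; apply/negP => lt.
(* [pr] extracts the coordinates on eigenvectors with [q > 0]. There are fewer of them than the rank
   of [E], so some nonzero [v] of [E] has none. *)
pose pr : 'M[C]_(N, #|A|) := \matrix_(i, k) (i == enum_val k)%:R.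
have [v vE [v0 vpr]] : exists2 v : 'rV[C]_N, (v <= E)%MS & v != 0 /\ v *m U^t* *m pr = 0.
  have : kermx (row_base E *m U^t* *m pr) != 0.
    by rewrite -mxrank_eq0 mxrank_ker -lt0n subn_gt0 (leq_ltn_trans (rank_leq_col _))//.
  case/rowV0Pn => w /sub_kermxP w0 wn0.
  exists (w *m row_base E); first by rewrite mulmx_sub// eq_row_base.
  split; first by rewrite mulmx_free_eq0 ?row_base_free.
  by rewrite -w0 !mulmxA.
have := pos v vE v0; apply/negP; rewrite -leNgt.
set u := v *m U^t*.
have uA j : j \in A -> u 0 j = 0.
  move=> jA; have /rowP/(_ (enum_rank_in jA j)) := vpr.
  rewrite mxE [RHS]mxE (bigD1 j)//= [X in _ * X]mxE enum_rankK_in// eqxx mulr1 big1 ?addr0 // => k kj.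
  by rewrite [X in _ * X]mxE enum_rankK_in// (negbTE kj) mulr0.
have -> : fro v = fro u by rewrite (fro_mulmxU v (unitaryC uU)).
have -> : v *m W *m v^t* = u *m diag_mx d *m u^t*.
  by rewrite WE /u (trmxC_mul v) (trmxCK U) !mulmxA.
have -> : reC (a * (u *m diag_mx d *m u^t* ) 0 0) - b * fro u =
   \sum_j nsq (u 0 j) * q (d 0 j).
  rewrite mxE mulr_sumr raddf_sum /= /fro big_ord1 mulr_sumr -sumrB.
  apply: eq_bigr => j _; move: (u) => w; rewrite mul_mx_diag !mxE qE.
  have -> : a * (w 0 j * d 0 j * Num.conj (w 0 j)) = (nsq (w 0 j))%:C%C * (a * d 0 j).
    by rewrite nsqE -[(w 0 j)^*%C]/(Num.conj (w 0 j)); move: (Num.conj _) => c; ring.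
  by case: (a * d 0 j) => x y /=; ring.
apply: sumr_le0 => j _; have [jA|jA] := boolP (j \in A).
  by rewrite uA// /nsq/= expr0n/= addr0 mul0r.
by rewrite mulr_ge0_le0 ?nsq_ge0// leNgt; move: jA; rewrite inE.
Qed.
End Counting.

End UnitaryDiagonalization2.

(** * Continuity and jumps of the sum of arguments *)

Section AngleContinuity.
Variable R : realType.
Implicit Types (z w : R[i]) (e r x : R).

Lemma cos_le_arc c x : 0 <= c <= pi -> c <= x <= 2 * pi - c -> cos x <= cos c.
Proof.
move=> /andP[c0 cp] /andP[cx xc].
have ler_cos (y : R) : c <= y <= pi -> cos y <= cos c.
  move=> /andP[cy yp]; rewrite leNgt; apply/negP => lt.
  have : cos c < cos y := lt; rewrite ltr_cos ?in_itv/= ?c0 ?cp ?yp ?(le_trans c0)//.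
  by rewrite ltNge cy.
have [xp|xp] := leP x pi; first by apply: ler_cos; rewrite cx.
have -> : cos x = cos (2 * pi - x).
  have -> : cos (2 * pi - x) = reC (expi (2 * pi - x)) by [].
  by rewrite expiD expi2pi mul1r /= cosN.
by apply: ler_cos; apply/andP; split; lra.
Qed.

Lemma near_argp e : 0 < e ->
  exists2 r, 0 < r & forall w, nsq w = 1 -> nsq (w - 1) < r -> exists2 x, `|x| < e & w = expi x.
Proof.
move=> e0; have /cvgrPdist_lt/(_ e e0) := @continuous_atan R 0.
rewrite atan0 => /nbhs_ballP[d /= d0 dP].
(* The bound [1 / 4] keeps the real part above [1 / 2]; then an imaginary part below [d / 2] makes
   the quotient under [atan] smaller than [d]. *)
exists (Num.min 4^-1 (d ^+ 2 / 4)); first by rewrite lt_min invr_gt0 ltr0n/= divr_gt0// exprn_gt0.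
case=> a b w1; rewrite lt_min => /andP[h1 h2].
have [r1 i1] : (1 - a) ^+ 2 < 4^-1 /\ b ^+ 2 < d ^+ 2 / 4.
  move: h1 h2; rewrite /nsq /= oppr0 addr0 => h1 h2.
  have := sqr_ge0 (a - 1); have := sqr_ge0 b => b0 a0; split; last by lra.
  by rewrite -sqrrN opprB; lra.
have a2 : 2^-1 < a.
  rewrite ltNge; apply/negP => a2; suff : 4^-1 <= (1 - a) ^+ 2 by rewrite leNgt r1.
  have -> : 4^-1 = 2^-1 ^+ 2 :> R by field.
  by rewrite lerXn2r// ?nnegrE; lra.
exists (argp (a +i* b)%C); last by apply: argp_unit => //=; lra.
rewrite /argp/= -normrN -sub0r; apply: dP; rewrite /ball/= sub0r normrN normrM normfV.
rewrite (@gtr0_norm _ a); last lra.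
rewrite ltr_pdivrMr; last lra.
have bd : `|b| < d / 2.
  rewrite -(@ltr_pXn2r _ 2)// ?nnegrE ?normr_ge0// ?divr_ge0// ?ltW// real_normK ?num_real// expr_div_n.
  by have -> : 2 ^+ 2 = 4 :> R by ring.
by rewrite (lt_le_trans bd)// ler_wpM2l// ltW.
Qed.

Lemma nsqBM z w : nsq w = 1 -> nsq (z * w^*%C - 1) = nsq (z - w).
Proof.
move=> w1; have -> : z * w^*%C - 1 = (z - w) * w^*%C.
  by rewrite mulrBl -nsqE w1.
by rewrite nsqM nsqJ w1 mulr1.
Qed.

Lemma near_ang e z : 0 < e -> nsq z = 1 -> exists2 r, 0 < r &
  forall w, nsq w = 1 -> nsq (w - z) < r -> exists2 x, `|x| < e & w = expi (ang z + x).
Proof.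
move=> e0 z1; have [r r0 rP] := near_argp e0; exists r => // w w1.
rewrite -nsqBM// => /rP[|x xe wE]; first by rewrite nsqM nsqJ w1 z1 mulr1.
exists x => //; have [_ zE] := angP z1; rewrite expiD -zE -wE mulrCA.
by rewrite -nsqE z1 mulr1.
Qed.

Lemma ang_continuous e z : 0 < e -> nsq z = 1 -> z != 1 -> exists2 r, 0 < r &
  forall w, nsq w = 1 -> nsq (w - z) < r -> `|ang w - ang z| < e.
Proof.
move=> e0 z1 zn1; have [/andP[a0 a2] _] := angP z1.
have {}a2 : ang z < 2 * pi.
  by rewrite lt_neqAle a2 andbT; apply: contra zn1 => /eqP/(ang_eq2pi z1)->.
(* Cutting the tolerance at both ends of [(0, 2 pi)] keeps the perturbed argument on the branch of
   [ang]. *)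
have e'0 : 0 < Num.min e (Num.min (ang z) (2 * pi - ang z)) by rewrite !lt_min e0 a0 subr_gt0.
have [r r0 rP] := near_ang e'0 z1; exists r => // w w1 /(rP _ w1)[x].
rewrite !lt_min => /and3P[xe xa xb] ->; rewrite ang_expi; first by rewrite addrAC subrr add0r.
by move: xa xb; rewrite !ltr_norml => /andP[? ?] /andP[? ?]; apply/andP; split; lra.
Qed.

Lemma ang_near1 e : 0 < e < pi -> exists2 r, 0 < r &
  forall w : R[i], nsq w = 1 -> nsq (w - 1) < r -> ang w < e \/ 2 * pi - e < ang w.
Proof.
move=> /andP[e0 ep]; have [r r0 rP] := near_argp e0; exists r => // w w1 /(rP _ w1)[x].
rewrite ltr_norml => /andP[x1 x2] ->; have p0 := pi_gt0 R.
have [x0|x0] := ltP 0 x; first by left; rewrite ang_expi//; apply/andP; split; lra.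
right; have -> : expi x = expi (2 * pi + x) by rewrite expiD expi2pi mul1r.
by rewrite ang_expi; [lra|apply/andP; split; lra].
Qed.

(** The half-plane cuts from the unit circle the open arc of arguments between [0] and [r].
    Membership in an arc becomes a linear condition, the form in which [count_ge_rank] can test
    it. *)
Lemma posarcP r (z : R[i]) : 0 < r < pi -> nsq z = 1 ->
  0 < reC (expi (- (r / 2)) * z) - cos (r / 2) -> ang z < r.
Proof.
move=> /andP[r0 rp] z1; have [/andP[a0 a2] zE] := angP z1.
rewrite {1}zE -expiD /= subr_gt0 => h; rewrite ltNge; apply/negP => le.
move: h; rewrite ltNge => /negP; apply; apply: cos_le_arc; apply/andP; split; lra.
Qed.

Lemma negarcP r (z : R[i]) : 0 < r < pi -> nsq z = 1 ->
  0 < reC (expi (r / 2) * z) - cos (r / 2) -> 2 * pi - r < ang z < 2 * pi.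
Proof.
move=> /andP[r0 rp] z1; have [/andP[a0 a2] zE] := angP z1.
rewrite {1}zE -expiD => h; apply/andP; split.
  rewrite ltNge; apply/negP => le; move: h; rewrite /= subr_gt0 ltNge => /negP; apply.
  by apply: cos_le_arc; apply/andP; split; lra.
rewrite lt_neqAle a2 andbT; apply/negP => /eqP E; move: h; rewrite E expiD expi2pi mulr1 /=.
by rewrite subrr ltxx.
Qed.

End AngleContinuity.

Section Theta.
Variable R : realType.
Local Notation C := R[i].
Local Open Scope sesquilinear_scope.

Lemma int_small (k : int) : `|k%:~R : R| < 1 -> k = 0.
Proof. by rewrite -intr_norm ltrz1; lia. Qed.

Lemma nat_close (a b : nat) : `|a%:R - b%:R : R| < 1 -> a = b.
Proof. by rewrite !pmulrn -intrB => /int_small; lia. Qed.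

Lemma natr_card N (b : 'I_N -> bool) : (#|[set j | b j]%SET|)%:R = \sum_j (b j)%:R :> R.
Proof.
rewrite -sum1_card natr_sum big_mkcond /=.
by apply: eq_bigr => j _; rewrite inE; case: (b j).
Qed.

(* The eigenvalue [1] contributes [2 pi], not [0]. *)
Definition Theta N (W : 'M[C]_N) : R := \sum_j ang (spectral_diag W 0 j).

Lemma ThetaE N (W U : 'M[C]_N) d : W \is unitarymx -> unidiag W U d ->
  Theta W = \sum_j ang (d 0 j).
Proof. by move=> uW Wd; apply: (spectral_sum_eq _ (unitary_unidiag uW) Wd). Qed.

Lemma expi_Theta N (W : 'M[C]_N) : W \is unitarymx -> expi (Theta W) = \det W.
Proof.
move=> uW; have Wd := unitary_unidiag uW; have [uU WE] := Wd.
have -> : \det W = \prod_j spectral_diag W 0 j.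
  rewrite {1}WE (det_mulmx (_ *m _)) (det_mulmx _ (diag_mx _)) mulrAC -det_mulmx (mulmx_unitaryE uU).
  by rewrite det1 mul1r det_diag.
rewrite /Theta; elim/big_rec2: _ => [|j z t _ <-]; first exact: expi0.
have [_ E] := angP (unidiag_unit uW Wd j).
by rewrite expiD; congr (_ * _); rewrite -E.
Qed.

Section SpectralSumCvg.
Variables (T : Type) (F : set_system T).
Context {FF : Filter F}.
Variables (N : nat) (W : T -> 'M[C]_N) (W0 : 'M[C]_N).
Hypotheses (uW : forall t, W t \is unitarymx) (uW0 : W0 \is unitarymx).
Hypothesis WW0 : mcvg F W W0.

Let d t := spectral_diag (W t).
Let d0 := spectral_diag W0.

Let d_unit t j : nsq (d t 0 j) = 1.
Proof. by have := unidiag_unit (uW t) (unitary_unidiag (uW t)) j. Qed.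

Let d0_unit j : nsq (d0 0 j) = 1.
Proof. by have := unidiag_unit uW0 (unitary_unidiag uW0) j. Qed.

Lemma fro_cvg0 : fro (W t - W0) @[t --> F] --> 0.
Proof.
have h : mcvg F (fun t => W t - W0) 0 by rewrite -(subrr W0); apply: mcvgB => //; exact: mcvg_cst.
have [+ _] := ccvg_tr (mcvgM h (mcvg_trmxC h)).
rewrite mul0mx mxtrace0 /=; under eq_fun do rewrite -froE /=.
exact.
Qed.

(** Only continuity of [f] at the limit eigenvalues is used. In [spectral_sum_diff], pairs of close
    eigenvalues differ by less than [e']; distant ones are bounded by [2 * B / r j] times their term
    in the distance identity, whose total [fro (W t - W0)] tends to [0]. *)
Lemma spectral_sum_cvg (f : C -> R) (B : R) :
  (forall z, nsq z = 1 -> `|f z| <= B) ->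
  (forall j e, 0 < e -> exists2 r, 0 < r &
     forall z, nsq z = 1 -> nsq (z - d0 0 j) < r -> `|f z - f (d0 0 j)| < e) ->
  \sum_j f (d t 0 j) @[t --> F] --> \sum_j f (d0 0 j).
Proof.
move=> fB fc; apply/cvgrPdist_lt => e e0.
have B0 : 0 <= B by rewrite (le_trans _ (fB 1 _))// /nsq/= expr1n expr0n/= addr0.
(* [N.+1] instead of [N] also covers size [0]; the close pairs then contribute at most
   [N * e' <= e / 2]. *)
pose e' := e / (2 * N.+1%:R); have e'0 : 0 < e' by rewrite divr_gt0// mulr_gt0.
have /choice[r rP] : forall j, exists r, 0 < r /\ forall z, nsq z = 1 ->
    nsq (z - d0 0 j) < r -> `|f z - f (d0 0 j)| < e'.
  by move=> j; have [r r0 rP] := fc j _ e'0; exists r.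
pose K := \sum_j (2 * B / r j).
have Kj j : 2 * B / r j <= K.
  rewrite /K (bigD1 j)//= lerDl sumr_ge0// => i _.
  by rewrite divr_ge0 ?mulr_ge0// ltW//; case: (rP i).
have K0 : 0 <= K by apply: sumr_ge0 => i _; rewrite divr_ge0 ?mulr_ge0// ltW//; case: (rP i).
have bound t : `|\sum_j f (d0 0 j) - \sum_j f (d t 0 j)| <= N%:R * e' + K * fro (W t - W0).
  rewrite distrC (spectral_sum_diff (unitary_unidiag (uW t)) (unitary_unidiag uW0)).
  rewrite -(overlap_dist (unitary_unidiag (uW t)) (unitary_unidiag uW0)).
  have -> : N%:R * e' = \sum_i \sum_j
     overlap (spectralmx (W t)) (spectralmx W0) i j * e'.
    under eq_bigr do rewrite -mulr_suml (overlap_row (unitary_unidiag (uW t)) (unitary_unidiag uW0)) mul1r.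
    by rewrite big_const_ord iter_addr_0 mulr_natl.
  rewrite mulr_sumr -big_split/= (le_trans (ler_norm_sum _ _ _))// ler_sum// => i _.
  rewrite mulr_sumr -big_split/= (le_trans (ler_norm_sum _ _ _))// ler_sum// => j _.
  set P := overlap _ _ i j; have P0 : 0 <= P := overlap_ge0 _ _ _ _.
  rewrite normrM (ger0_norm P0) (mulrCA K) -mulrDr ler_wpM2l//.
  have [r0 /(_ _ (d_unit t i))] := rP j.
  case: (ltP (nsq _) (r j)) => [_ /(_ isT) lt|ge _].
    by rewrite (le_trans (ltW lt))// lerDl mulr_ge0 ?nsq_ge0.
  have h1 : `|f (d t 0 i) - f (d0 0 j)| <= 2 * B.
    by rewrite (le_trans (ler_normB _ _))// mulrDl mul1r lerD// fB.
  apply: (le_trans h1); rewrite -[leLHS]add0r lerD// ?(ltW e'0)//.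
  apply: (@le_trans _ _ (2 * B / r j * r j)); first by rewrite divfK// gt_eqF.
  by rewrite ler_pM// ?divr_ge0 ?mulr_ge0// ltW.
have e2 : 0 < e / 2 / (K + 1) by rewrite divr_gt0 ?divr_gt0// ltr_wpDl.
have /cvgrPdist_lt/(_ _ e2) := fro_cvg0; apply: filterS => t.
rewrite sub0r normrN ger0_norm ?fro_ge0// ltr_pdivlMr ?ltr_wpDl// => h.
apply: (le_lt_trans (bound t)).
have h1 : N%:R * e' <= e / 2.
  have -> : N%:R * e' = e / 2 * (N%:R / N.+1%:R).
    by rewrite /e'; field; rewrite addrC natr1 pnatr_eq0.
  rewrite ler_piMr ?divr_ge0 ?ltW// ltr_pdivrMr// mul1r ltr_nat.
  by [].
have h2 : K * fro (W t - W0) <= fro (W t - W0) * (K + 1).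
  by rewrite mulrC ler_wpM2l ?fro_ge0// lerDl.
by lra.
Qed.

(** Eigenvalues shortly after [1] and shortly before it; the eigenvalue [1] itself, of argument
    [2 pi], belongs to [neg]. *)
Let pos r t := [set j | ang (d t 0 j) < r]%SET.
Let neg r t := [set j | 2 * pi - r < ang (d t 0 j)]%SET.

(** The limit spectrum meets the closed arc of radius [r] around [1] at most in [1], so the
    eigenvalues found there later on all come from [1]. *)
Definition clear_arc r := forall j, d0 0 j != 1 -> r < ang (d0 0 j) < 2 * pi - r.

Lemma near_clear_arc : \forall r \near 0^'+, clear_arc r.
Proof.
apply: filter_forall => j; have [->|z1] := eqVneq (d0 0 j) 1.
  by near=> r => /eqP.
have [/andP[a0 a2] _] := angP (d0_unit j).
have {}a2 : ang (d0 0 j) < 2 * pi.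
  by rewrite lt_neqAle a2 andbT; apply: contra z1 => /eqP/(ang_eq2pi (d0_unit j))->.
near=> r => _; apply/andP; split; first by near: r; exact: nbhs_right_lt.
by rewrite ltrBrDl -ltrBrDr; near: r; apply: nbhs_right_lt; rewrite subr_gt0.
Unshelve. all: by end_near. Qed.

(** The indicator of the arc around [1] is continuous at every limit eigenvalue, so its spectral sum
    converges; being an integer, it is eventually equal to its limit. *)
Lemma count_near1 r : 0 < r < pi -> clear_arc r ->
  \forall t \near F, (#|pos r t| + #|neg r t| = \rank (kermx (W0 - 1%:M)))%N.
Proof.
move=> rp rc; have [r0 rpi] := andP rp; have p0 := pi_gt0 R.
pose f (z : C) : R := (ang z < r)%R%:R + (2 * pi - r < ang z)%R%:R.
have fE t : \sum_j f (d t 0 j) = (#|pos r t| + #|neg r t|)%:R.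
  by rewrite big_split natrD /pos /neg (natr_card (fun j => ang (d t 0 j) < r))
    (natr_card (fun j => 2 * pi - r < ang (d t 0 j))).
have fpos z : ang z < r -> f z = 1.
  by move=> h; rewrite /f h ltNge (_ : ang z <= 2 * pi - r) ?addr0//; lra.
have fneg z : 2 * pi - r < ang z -> f z = 1.
  by move=> h; rewrite /f h (ltNge (ang z) r) (_ : r <= ang z) ?add0r//; lra.
have fout z : r < ang z < 2 * pi - r -> f z = 0.
  by case/andP=> h1 h2; rewrite /f !ltNge (ltW h1) (ltW h2) addr0.
have f1 : f 1 = 1 by apply: fneg; rewrite ang1; lra.
have f0 j : d0 0 j != 1 -> f (d0 0 j) = 0 by move=> /rc /fout.
have fE0 : \sum_j f (d0 0 j) = (\rank (kermx (W0 - 1%:M)))%:R.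
  rewrite (unidiag_rank 1 (unitary_unidiag uW0)) (natr_card (fun j => d0 0 j == 1)).
  by apply: eq_bigr => j _; have [->|/f0] := eqVneq (d0 0 j) 1.
have fc : \sum_j f (d t 0 j) @[t --> F] --> \sum_j f (d0 0 j).
  apply: (@spectral_sum_cvg f 2) => [z _|j e e0].
    by rewrite /f ger0_norm ?addr_ge0//; case: (ang z < r); case: (_ < ang z) => /=; lra.
  have [->|z1] := eqVneq (d0 0 j) 1.
    have [r' r'0 r'P] := @ang_near1 R r rp; exists r' => // w w1 /(r'P _ w1) h.
    by rewrite f1; case: h => [/fpos|/fneg] ->; rewrite subrr normr0.
  have /andP[a1 a2] := rc j z1; rewrite f0//.
  have e'0 : 0 < Num.min (ang (d0 0 j) - r) (2 * pi - r - ang (d0 0 j)).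
    by rewrite lt_min !subr_gt0 a1.
  have [r' r'0 r'P] := ang_continuous e'0 (d0_unit j) z1; exists r' => // w w1 /(r'P _ w1).
  rewrite lt_min !ltr_norml => /andP[/andP[h1 h2] /andP[h3 h4]].
  by rewrite fout ?subrr ?normr0//; apply/andP; split; lra.
have /cvgrPdist_lt/(_ _ (@ltr01 R)) := fc; apply: filterS => t.
by rewrite fE fE0 => /nat_close ->.
Qed.

(** Adding [2 pi] to the arguments below [r] removes the jump of [ang] at [1] and makes the summand
    continuous at the limit eigenvalues. *)
Lemma Theta_near r e : 0 < r < pi -> clear_arc r -> 0 < e ->
  \forall t \near F, `|Theta (W t) + 2 * pi * #|pos r t|%:R - Theta W0| < e.
Proof.
move=> rp rc e0; have [r0 rpi] := andP rp; have p0 := pi_gt0 R.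
pose f (z : C) : R := ang z + 2 * pi * (ang z < r)%R%:R.
have fE t : \sum_j f (d t 0 j) = Theta (W t) + 2 * pi * #|pos r t|%:R.
  by rewrite big_split -mulr_sumr /pos (natr_card (fun j => ang (d t 0 j) < r)).
have fpos z : ang z < r -> f z = ang z + 2 * pi by move=> h; rewrite /f h mulr1.
have fout z : r <= ang z -> f z = ang z by move=> h; rewrite /f ltNge h mulr0 addr0.
have f0 j : f (d0 0 j) = ang (d0 0 j).
  apply: fout; have [->|/rc /andP[h _]] := eqVneq (d0 0 j) 1; last exact: ltW.
  by rewrite ang1; lra.
have fE0 : \sum_j f (d0 0 j) = Theta W0 by apply: eq_bigr => j _.
have fc : \sum_j f (d t 0 j) @[t --> F] --> \sum_j f (d0 0 j).
  apply: (@spectral_sum_cvg f (4 * pi)) => [z z1|j e' e'0].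
    have [/andP[a0 a2] _] := angP z1.
    by rewrite /f ger0_norm; case: (_ < _) => /=; lra.
  rewrite f0; have [->|z1] := eqVneq (d0 0 j) 1.
    have e1 : 0 < Num.min r e' < pi by rewrite lt_min r0 e'0 gt_min rpi.
    have [r' r'0 r'P] := @ang_near1 R _ e1; exists r' => // w w1 /(r'P _ w1).
    have [/andP[a0 a2] _] := angP w1.
    rewrite lt_min ang1 => -[/andP[h1 h2]|h].
      by rewrite fpos// ltr_norml; apply/andP; split; lra.
    have h1 : 2 * pi - r < ang w by apply: le_lt_trans h; rewrite lerD2l lerN2 ge_min lexx.
    have h2 : 2 * pi - e' < ang w by apply: le_lt_trans h; rewrite lerD2l lerN2 ge_min lexx orbT.
    rewrite fout; last lra.
    by rewrite ltr_norml; apply/andP; split; lra.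
  have /andP[a1 a2] := rc j z1.
  have e1 : 0 < Num.min e' (ang (d0 0 j) - r) by rewrite lt_min e'0 subr_gt0.
  have [r' r'0 r'P] := ang_continuous e1 (d0_unit j) z1; exists r' => // w w1 /(r'P _ w1).
  rewrite lt_min => /andP[h1 h2]; rewrite fout//.
  by move: h2; rewrite ltr_norml => /andP[h3 h4]; lra.
have /cvgrPdist_lt/(_ _ e0) := fc; apply: filterS => t.
by rewrite fE fE0 distrC.
Qed.

Let nu := \rank (kermx (W0 - 1%:M)).

Lemma arc_radius : exists r, [/\ 0 < r < pi & clear_arc r].
Proof.
have : \forall r \near (0 : R)^'+, 0 < r < pi /\ clear_arc r.
  near=> r; split; last by near: r; exact: near_clear_arc.
  apply/andP; split; near: r; [exact: nbhs_right_gt|apply: nbhs_right_lt; exact: pi_gt0].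
by move=> /filter_ex[r [? ?]]; exists r.
Unshelve. all: by end_near. Qed.

(** [k] is the number of eigenvalues that have left [1] counterclockwise; each of them lowers the
    sum by [2 pi]. *)
Lemma Theta_local e : 0 < e -> \forall t \near F, exists2 k : nat, (k <= nu)%N &
  `|Theta (W t) + 2 * pi * k%:R - Theta W0| < e.
Proof.
move=> e0; have [r [rp rc]] := arc_radius.
move: (count_near1 rp rc) (Theta_near rp rc e0).
by apply: filterS2 => t h1 h2; exists #|pos r t|; rewrite // /nu -h1 leq_addr.
Qed.

Lemma rank_unit0 t : (forall j, ang (d t 0 j) < 2 * pi) -> \rank (kermx (W t - 1%:M)) = 0%N.
Proof.
move=> h; rewrite (unidiag_rank 1 (unitary_unidiag (uW t))); apply: eq_card0 => j.
by rewrite !inE; apply/negbTE/eqP => dj; have := h j; rewrite /d dj ang1 ltxx.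
Qed.

(** The hypothesis puts all [nu] eigenvalues near [1] into the arc of small positive arguments. None
    is left at [1], and the sum loses the full [2 pi * nu]. *)
Lemma Theta_right e : 0 < e ->
  (forall r, 0 < r < pi -> \forall t \near F,
     (nu <= #|[set j | (0 < reC (expi (- (r / 2)) * d t 0 j) - cos (r / 2))%R]%SET|)%N) ->
  \forall t \near F, \rank (kermx (W t - 1%:M)) = 0%N /\
    `|Theta (W t) + 2 * pi * nu%:R - Theta W0| < e.
Proof.
move=> e0 H; have [r [rp rc]] := arc_radius.
move: (H r rp) (count_near1 rp rc) (Theta_near rp rc e0).
apply: filterS3 => t h1 h2 h3.
have le : (nu <= #|pos r t|)%N.
  apply: leq_trans h1 _; apply: subset_leq_card; apply/fintype.subsetP => j; rewrite !inE.
  exact: posarcP.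
have n0 : #|neg r t| = 0%N by move: h2 le; rewrite -/nu; lia.
have p1 : #|pos r t| = nu by move: h2; rewrite n0 addn0.
split; last by rewrite -p1.
apply: rank_unit0 => j; have := card0_eq n0 j; rewrite !inE => /negbT; rewrite -leNgt => h.
by apply: le_lt_trans h _; case/andP: rp; lra.
Qed.

(** Here all [nu] eigenvalues move to arguments just below [2 pi], where [ang] is continuous from
    below, and nothing is lost. *)
Lemma Theta_left e : 0 < e ->
  (forall r, 0 < r < pi -> \forall t \near F,
     (nu <= #|[set j | (0 < reC (expi (r / 2) * d t 0 j) - cos (r / 2))%R]%SET|)%N) ->
  \forall t \near F, \rank (kermx (W t - 1%:M)) = 0%N /\
    `|Theta (W t) - Theta W0| < e.
Proof.
move=> e0 H; have [r [rp rc]] := arc_radius.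
move: (H r rp) (count_near1 rp rc) (Theta_near rp rc e0).
apply: filterS3 => t h1 h2 h3.
(* The strict bound [< 2 * pi] excludes the eigenvalue [1], which [neg] admits; equality of the two
   sets is what yields nondegeneracy. *)
pose sneg := [set j | 2 * pi - r < ang (d t 0 j) < 2 * pi]%SET.
have le : (nu <= #|sneg|)%N.
  apply: leq_trans h1 _; apply: subset_leq_card; apply/fintype.subsetP => j; rewrite !inE.
  exact: negarcP.
have sub : sneg \subset neg r t by apply/fintype.subsetP => j; rewrite !inE => /andP[].
have le2 := subset_leq_card sub.
have p0 : #|pos r t| = 0%N by move: h2 le le2; rewrite -/nu; lia.
have E : neg r t = sneg.
  have le3 : (#|neg r t| <= #|sneg|)%N by move: h2; rewrite p0 add0n => ->; exact: le.
  by apply/esym/eqP; rewrite eqEcard sub le3.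
split; last by move: h3; rewrite p0 mulr0 addr0.
apply: rank_unit0 => j; rewrite lt_neqAle; have [/andP[_ ->] _] := angP (d_unit t j).
rewrite andbT; apply/negP => /eqP jE.
have : j \in neg r t by rewrite inE jE; case/andP: rp; lra.
by rewrite E inE jE ltxx andbF.
Qed.

End SpectralSumCvg.

Definition hposdef N (G : 'M[C]_N) :=
  G^t* = G /\ forall v : 'rV[C]_N, v != 0 -> 0 < reC ((v *m G *m v^t* ) 0 0).

Lemma hposdef_bound N (G : 'M[C]_N) : hposdef G ->
  exists2 c, 0 < c & forall v : 'rV[C]_N, c * fro v <= reC ((v *m G *m v^t* ) 0 0).
Proof.
move=> [hG pG].
have nG : G \is normalmx by apply/normalmxP; rewrite hG.
have [uU GE] : unidiag G (spectralmx G) (spectral_diag G).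
  split; first exact: spectral_unitarymx.
  have /orthomx_spectralP {1}-> := nG.
  by rewrite (invmx_unitary (spectral_unitarymx _)).
set U := spectralmx G in uU GE; set d := spectral_diag G in GE.
have quad (v : 'rV[C]_N) :
    reC ((v *m G *m v^t* ) 0 0) = \sum_j nsq ((v *m U^t* ) 0 j) * reC (d 0 j).
  have -> : v *m G *m v^t* = (v *m U^t* ) *m diag_mx d *m (v *m U^t* )^t*.
    by rewrite GE (trmxC_mul v) (trmxCK U) !mulmxA.
  move: (v *m U^t* ) => u; rewrite mxE raddf_sum /=; apply: eq_bigr => j _.
  rewrite mul_mx_diag !mxE.
  have -> : u 0 j * d 0 j * Num.conj (u 0 j) = (nsq (u 0 j))%:C%C * d 0 j.
    by rewrite nsqE -[(u 0 j)^*%C]/(Num.conj (u 0 j)); move: (Num.conj _) => c; ring.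
  by case: (d 0 j) => x y /=; ring.
have dpos j : 0 < reC (d 0 j).
  have v0 : row j U != 0.
    apply/eqP => v0; have /matrixP/(_ j j) := unitarymxP uU.
    by rewrite -[(U *m _) j j](mxE tt (fun _ _ => (U *m U^t* ) j j)) || rewrite mxE [RHS]mxE eqxx;
       rewrite big1 => [/eqP|k _]; [rewrite eq_sym oner_eq0|have /rowP/(_ k) := v0; rewrite !mxE => ->; rewrite mul0r].
  have := pG _ v0; rewrite quad (bigD1 j)//= big1 ?addr0 => [|k kj].
    by rewrite -row_mul (unitarymxP uU) !mxE eqxx /nsq/= expr1n expr0n/= addr0 mul1r.
  by rewrite -row_mul (unitarymxP uU) !mxE eq_sym (negbTE kj) /nsq/= expr0n/= addr0 mul0r.
have [c [c0 cP]] : exists c, 0 < c /\ forall j, c <= reC (d 0 j).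
  have : \forall c \near (0 : R)^'+, 0 < c /\ forall j, c <= reC (d 0 j).
    near=> c; split; first by near: c; exact: nbhs_right_gt.
    near: c; apply: filter_forall => j; near=> c; apply: ltW; near: c; exact: nbhs_right_lt.
  by move=> /filter_ex[c cP]; exists c.
exists c => // v; rewrite quad -(fro_mulmxU v (unitaryC uU)) /fro big_ord1 mulr_sumr.
by apply: ler_sum => j _; rewrite mulrC ler_wpM2l// nsq_ge0.
Unshelve. all: by end_near. Qed.

Lemma quad_small N (D : 'M[C]_N) e (v : 'rV[C]_N) : 0 <= e ->
  (forall i j, `|reC (D i j)| <= e /\ `|imC (D i j)| <= e) ->
  `|reC ((v *m D *m v^t* ) 0 0)| <= e * (2 * N%:R) * fro v.
Proof.
move=> e0 De.
have term (D0 x y : C) : `|reC D0| <= e -> `|imC D0| <= e ->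
    `|reC (x * D0 * y^*%C)| <= e * (nsq x + nsq y).
  case: D0 x y => p q [x1 x2] [y1 y2] /= hp hq; rewrite /nsq /=.
  have -> : (x1 * p - x2 * q) * y1 - (x1 * q + x2 * p) * - y2 =
     p * (x1 * y1 + x2 * y2) + q * (x1 * y2 - x2 * y1) by ring.
  apply: le_trans (ler_normD _ _) _; rewrite !normrM.
  have h1 : `|x1 * y1 + x2 * y2| <= (x1 ^+ 2 + x2 ^+ 2 + (y1 ^+ 2 + y2 ^+ 2)) / 2.
    have := sqr_ge0 (x1 - y1); have := sqr_ge0 (x2 - y2).
    have := sqr_ge0 (x1 + y1); have := sqr_ge0 (x2 + y2).
    by rewrite ler_norml => ? ? ? ?; apply/andP; split; lra.
  have h2 : `|x1 * y2 - x2 * y1| <= (x1 ^+ 2 + x2 ^+ 2 + (y1 ^+ 2 + y2 ^+ 2)) / 2.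
    have := sqr_ge0 (x1 - y2); have := sqr_ge0 (x2 - y1).
    have := sqr_ge0 (x1 + y2); have := sqr_ge0 (x2 + y1).
    by rewrite ler_norml => ? ? ? ?; apply/andP; split; lra.
  apply: le_trans (lerD (ler_pM _ _ hp h1) (ler_pM _ _ hq h2)) _ => //.
  by rewrite -mulrDr -splitr.
rewrite mxE raddf_sum /=.
have -> : e * (2 * N%:R) * fro v = \sum_j \sum_i e * (nsq (v 0 i) + nsq (v 0 j)).
  under eq_bigr do rewrite -mulr_sumr big_split/= big_const_ord iter_addr_0.
  rewrite -mulr_sumr big_split/= sumrMnl big_const_ord iter_addr_0 /fro big_ord1 -mulrnDl.
  by rewrite -mulr_natr; ring.
apply: le_trans (ler_norm_sum _ _ _) _; apply: ler_sum => j _.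
rewrite mxE mulr_suml raddf_sum /= mxE; apply: le_trans (ler_norm_sum _ _ _) _.
by apply: ler_sum => i _; rewrite mxE; have [h1 h2] := De i j; exact: term.
Qed.

Lemma unitary_fix N (W : 'M[C]_N) (v : 'rV[C]_N) : W \is unitarymx ->
  (v <= kermx (W - 1%:M))%MS -> v *m W^t* = v.
Proof.
move=> uW /sub_kermxP; rewrite mulmxBr mulmx1 => /eqP; rewrite subr_eq0 => /eqP vW.
by rewrite -{1}vW -mulmxA (unitarymxP uW) mulmx1.
Qed.

Lemma fro_gt0 N (v : 'rV[C]_N) : v != 0 -> 0 < fro v.
Proof.
by move=> v0; rewrite lt_neqAle fro_ge0 andbT eq_sym; apply: contra v0 => /eqP/fro_eq0 ->.
Qed.

Lemma quadZ N (v : 'rV[C]_N) c (M : 'M[C]_N) :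
  (v *m (c *: M) *m v^t* ) 0 0 = c * (v *m M *m v^t* ) 0 0.
Proof. by rewrite -scalemxAr -scalemxAl mxE. Qed.

Lemma quadD N (v : 'rV[C]_N) (M M' : 'M[C]_N) :
  (v *m (M + M') *m v^t* ) 0 0 = (v *m M *m v^t* ) 0 0 + (v *m M' *m v^t* ) 0 0.
Proof. by rewrite mulmxDr mulmxDl mxE. Qed.

Section MonotoneCrossing.
Variables (T : Type) (F : set_system T).
Context {FF : Filter F}.
Variables (N : nat) (W : T -> 'M[C]_N) (W0 G : 'M[C]_N) (tau : T -> R).
Hypotheses (uW : forall t, W t \is unitarymx) (uW0 : W0 \is unitarymx).
Hypothesis WW0 : mcvg F W W0.
Hypothesis pG : hposdef G.
Hypothesis WG : mcvg F (fun t => ((tau t)^-1)%:C%C *: (W0^t* *m W t - 1%:M)) ('i%C *: G).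

(** On vectors fixed by [W0], [W t] acts to first order as [1 + i tau G]. Rotating by [- s r / 2]
    adds [s * tau * sin (r / 2)] times the positive form of [G] to [cos (r / 2) * fro v]. The sign
    [s] of [tau] treats both directions at once. *)
Lemma crossing_quad s r : (s = 1 \/ s = -1) -> 0 < r < pi ->
  (\forall t \near F, 0 < s * tau t) ->
  \forall t \near F, forall v : 'rV[C]_N, (v <= kermx (W0 - 1%:M))%MS -> v != 0 ->
     0 < reC (expi (- (s * r / 2)) * (v *m W t *m v^t* ) 0 0) - cos (r / 2) * fro v.
Proof.
move=> s1 /andP[r0 rp] tau0; have [c c0 cP] := hposdef_bound pG.
have sr0 : 0 < sin (r / 2) by rewrite sin_gt0_pi// divr_gt0//= ltr_pdivrMr// (lt_trans rp)// ltr_pMr ?pi_gt0 ?ltr1n.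
set a := expi _.
have ss : s * s = 1 by case: s1 => ->; rewrite ?mulr1// mulrN1 opprK.
have cosE : cos (s * r / 2) = cos (r / 2).
  by case: s1 => ->; rewrite ?mul1r// mulN1r mulNr cosN.
have sinE : sin (s * r / 2) = s * sin (r / 2).
  by case: s1 => ->; rewrite ?mul1r// !mulN1r mulNr sinN.
have aE : a = (cos (r / 2) +i* - (s * sin (r / 2)))%C by rewrite /a /expi cosN sinN cosE sinE.
pose K t := ((tau t)^-1)%:C%C *: (W0^t* *m W t - 1%:M).
pose D t := (a * s%:C%C) *: (K t - 'i%C *: G).
have D0 : mcvg F D 0.
  rewrite -(scaler0 _ (a * s%:C%C)) -(subrr ('i%C *: G)); apply: mcvgZ; first exact: ccvg_cst.
  by apply: mcvgB => //; exact: mcvg_cst.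
(* Chosen so that the error [e * (2 * N) * fro v] of [quad_small] stays below the main term
   [sin (r / 2) * c * fro v]; the [+ 1] covers [N = 0]. *)
pose e := sin (r / 2) * c / (2 * N%:R + 1) / 2.
have N0 : (0 : R) < 2 * N%:R + 1 by rewrite ltr_wpDl// mulr_ge0.
have e0 : 0 < e by rewrite !divr_gt0// mulr_gt0.
have De : \forall t \near F, forall i j, `|reC (D t i j)| <= e /\ `|imC (D t i j)| <= e.
  apply: filter_forall => i; apply: filter_forall => j; have [h1 h2] := D0 i j.
  move: h1 h2 => /cvgrPdist_le/(_ _ e0) h1 /cvgrPdist_le/(_ _ e0) h2.
  move: h1 h2; apply: filterS2 => t; rewrite mxE /= !sub0r !normrN; by split.
move: De tau0; apply: filterS2 => t De tau0 v vE v0.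
have vW0 := unitary_fix uW0 vE.
have t0 : tau t != 0 by apply: contraTneq tau0 => ->; rewrite mulr0 ltxx.
have WE : W0^t* *m W t = 1%:M + (tau t)%:C%C *: K t.
  by rewrite /K scalerA -rmorphM/= mulfV// scale1r addrC subrK.
have -> : v *m W t *m v^t* = v *m (W0^t* *m W t) *m v^t*.
  by rewrite (mulmxA v) vW0.
have froV : (v *m v^t* ) 0 0 = (fro v)%:C%C by rewrite froE /mxtrace big_ord1.
rewrite WE (quadD v) mulmx1 froV (quadZ v) mulrDr.
have -> : reC (a * (fro v)%:C%C + a * ((tau t)%:C%C * (v *m K t *m v^t* ) 0 0)) =
   cos (r / 2) * fro v + (s * tau t) * reC ((a * s%:C%C) * (v *m K t *m v^t* ) 0 0).
  case: ((v *m K t *m v^t* ) 0 0) => k1 k2; rewrite aE /=.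
  transitivity (cos (r / 2) * fro v + (s * s) * tau t * (cos (r / 2) * k1 + s * sin (r / 2) * k2)).
    by rewrite ss; ring.
  ring.
rewrite addrAC subrr add0r; apply: mulr_gt0 => //.
have KE : a * s%:C%C *: K t = D t + a * s%:C%C * 'i%C *: G.
  by rewrite /D scalerBr (scalerA _ 'i%C) subrK.
have -> : a * s%:C%C * (v *m K t *m v^t* ) 0 0 =
   (v *m D t *m v^t* ) 0 0 + a * s%:C%C * 'i%C * (v *m G *m v^t* ) 0 0.
  by rewrite -(quadZ v) KE (quadD v) (quadZ v _ G).
have := quad_small v (ltW e0) De; rewrite ler_norml => /andP[low _].
have [hG pos] := pG.
have imG : imC ((v *m G *m v^t* ) 0 0) = 0.
  have : ((v *m G *m v^t* )^t* ) 0 0 = (v *m G *m v^t* ) 0 0.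
    by rewrite (trmxC_mul (v *m G)) (trmxC_mul v) trmxCK hG mulmxA.
  rewrite [LHS]mxE [X in Num.conj X]mxE; case: ((v *m G *m v^t* ) 0 0) => x y [] /= h.
  by lra.
have := cP v; case: ((v *m G *m v^t* ) 0 0) imG => g ? /= -> cg.
have -> : forall z : C, reC (z + a * s%:C%C * 'i%C * (g +i* 0)%C) = reC z + sin (r / 2) * g.
  case=> x y; rewrite aE /=.
  by transitivity (x + (s * s) * (sin (r / 2) * g)); [ring|rewrite ss mul1r].
have f0 := fro_gt0 v0.
have h1 : sin (r / 2) * (c * fro v) <= sin (r / 2) * g by rewrite ler_wpM2l// ltW.
have h2 : e * (2 * N%:R) * fro v < sin (r / 2) * (c * fro v).
  rewrite [ltRHS]mulrA ltr_pM2r//; apply: (@le_lt_trans _ _ (e * (2 * N%:R + 1))).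
    by rewrite ler_wpM2l ?(ltW e0)// lerDl.
  rewrite /e mulrAC divfK ?gt_eqF// gtr_pMr ?mulr_gt0// invf_lt1// ltr1n.
  by [].
lra.
Qed.

Lemma Theta_increase e : 0 < e -> (\forall t \near F, 0 < tau t) ->
  \forall t \near F, \rank (kermx (W t - 1%:M)) = 0%N /\
    `|Theta (W t) + 2 * pi * (\rank (kermx (W0 - 1%:M)))%:R - Theta W0| < e.
Proof.
move=> e0 tau0; apply: Theta_right => // r rp.
have tau1 : \forall t \near F, 0 < 1 * tau t by apply: filterS tau0 => t; rewrite mul1r.
apply: filterS (crossing_quad (or_introl erefl) rp tau1) => t.
rewrite mul1r; exact: (@count_ge_rank _ _ _ _ _ (unitary_unidiag (uW t))
  (fun z => reC (expi (- (r / 2)) * z) - cos (r / 2)) (expi (- (r / 2))) (cos (r / 2))).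
Qed.

Lemma Theta_decrease e : 0 < e -> (\forall t \near F, tau t < 0) ->
  \forall t \near F, \rank (kermx (W t - 1%:M)) = 0%N /\ `|Theta (W t) - Theta W0| < e.
Proof.
move=> e0 tau0; apply: Theta_left => // r rp.
have tau1 : \forall t \near F, 0 < -1 * tau t by apply: filterS tau0 => t; rewrite mulN1r oppr_gt0.
apply: filterS (crossing_quad (or_intror erefl) rp tau1) => t.
rewrite mulN1r mulNr opprK; exact: (@count_ge_rank _ _ _ _ _ (unitary_unidiag (uW t))
  (fun z => reC (expi (r / 2) * z) - cos (r / 2)) (expi (r / 2)) (cos (r / 2))).
Qed.

End MonotoneCrossing.
End Theta.

(** * The unitary matrix of a symplectic graph *)

Section Scattering.
Variables (R : realType) (n : nat).
Local Notation C := R[i].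
Local Open Scope sesquilinear_scope.
Implicit Types (M : 'M[R]_(n + n)) (G : 'M[C]_(n + n)).

(** The Hermitian form of signature [(n, n)] that [- i J] becomes in the coordinates [q + i p],
    [q - i p]. *)
Definition Hd : 'M[C]_(n + n) := block_mx 1%:M 0 0 (- 1%:M).
Definition swapmx : 'M[C]_(n + n) := block_mx 0 1%:M 1%:M 0.
Definition Tm : 'M[C]_(n + n) := block_mx 1%:M ('i%C)%:M 1%:M (- 'i%C)%:M.

(* [Gm M] is [M] in the coordinates [q + i p], [q - i p]. *)
Definition Gm M : 'M[C]_(n + n) := 2^-1 *: (Tm *m cmx M *m Tm^t* ).

Lemma trmxC_block m1 m2 n1 n2 (A : 'M[C]_(m1, n1)) (B : 'M[C]_(m1, n2))
    (A' : 'M[C]_(m2, n1)) (B' : 'M[C]_(m2, n2)) :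
  (block_mx A B A' B')^t* = block_mx (A^t* ) (A'^t* ) (B^t* ) (B'^t* ).
Proof. by rewrite tr_block_mx map_block_mx. Qed.

Lemma trmxC_scalar k (z : C) : (z%:M : 'M[C]_k)^t* = (z^*%C)%:M.
Proof. by rewrite tr_scalar_mx map_scalar_mx. Qed.

Lemma trmxC0 k l : (0 : 'M[C]_(k, l))^t* = 0.
Proof. by rewrite trmx0 map_mx0. Qed.

Lemma trmxC1 k : (1%:M : 'M[C]_k)^t* = 1%:M.
Proof. by rewrite trmx1 map_mx1. Qed.

Lemma trmxCN k l (A : 'M[C]_(k, l)) : (- A)^t* = - A^t*.
Proof. by rewrite linearN /= map_mxN. Qed.

Lemma trmxCZ k l (z : C) (A : 'M[C]_(k, l)) : (z *: A)^t* = z^*%C *: A^t*.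
Proof. by apply/matrixP => i j; rewrite !mxE rmorphM. Qed.

Lemma trmxC_cmx k l (A : 'M[R]_(k, l)) : (cmx A)^t* = cmx A^T.
Proof. by apply/matrixP => i j; rewrite !mxE; apply: conjc_real. Qed.

Lemma half2 : 2^-1 * 2 = 1 :> C. Proof. by rewrite mulVf// pnatr_eq0. Qed.

Lemma conj_half : (2^-1 : C)^*%C = 2^-1. Proof. by rewrite conjc_inv conjc_nat. Qed.

Lemma ii1 : 'i%C * 'i%C = -1 :> C. Proof. by rewrite -expr2 sqr_i. Qed.

Lemma conji : ('i%C)^*%C = - 'i%C :> C. Proof. by rewrite /= ; simpc. Qed.

Lemma conjNi : (- 'i%C)^*%C = 'i%C :> C.
Proof. by apply/eqP; rewrite eq_complex /= !opprK oppr0 !eqxx. Qed.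

Lemma TmCE : Tm^t* = block_mx 1%:M 1%:M (- 'i%C)%:M ('i%C)%:M.
Proof. by rewrite trmxC_block trmxC1 !trmxC_scalar conji conjNi. Qed.

Ltac entrywise := apply/matrixP => ? ?; rewrite !mxE; case: (_ == _);
  rewrite ?mulr1n ?mulr0n ?(mulNr, mulrN) ?ii1; (ring || field).

Lemma TmK : Tm^t* *m Tm = (2 : C)%:M.
Proof.
rewrite TmCE mulmx_block !mul1mx !mulmx1 -!scalar_mxM [RHS]scalar_mx_block.
by congr block_mx; entrywise.
Qed.

Lemma TmKC : Tm *m Tm^t* = (2 : C)%:M.
Proof.
rewrite TmCE mulmx_block !mul1mx -!scalar_mxM [RHS]scalar_mx_block.
by congr block_mx; entrywise.
Qed.

Lemma cmxM k l p (A : 'M[R]_(k, l)) (B : 'M[R]_(l, p)) : cmx (A *m B) = cmx A *m cmx B.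
Proof. exact: map_mxM. Qed.

Lemma cmx_scalar k (a : R) : cmx (a%:M : 'M[R]_k) = (a%:C%C)%:M.
Proof. exact: map_scalar_mx. Qed.

Lemma GmM A B : Gm (A *m B) = Gm A *m Gm B.
Proof.
rewrite /Gm -scalemxAl -scalemxAr -!mulmxA (mulmxA (Tm^t* )) TmK mul_scalar_mx.
by rewrite -!scalemxAr scalerA half2 scale1r cmxM !mulmxA.
Qed.

Lemma Gm_scalar (a : R) : Gm a%:M = (a%:C%C)%:M.
Proof.
rewrite /Gm cmx_scalar mul_mx_scalar -scalemxAl TmKC scalerA scale_scalar_mx.
by rewrite mulrAC half2 mul1r.
Qed.

Lemma GmB A B : Gm (A - B) = Gm A - Gm B.
Proof. by rewrite /Gm /cmx map_mxB mulmxBr mulmxBl scalerBr. Qed.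

Lemma GmZ (a : R) A : Gm (a *: A) = a%:C%C *: Gm A.
Proof. by rewrite /Gm /cmx map_mxZ -scalemxAr -scalemxAl !scalerA mulrC. Qed.

Lemma Gm_trmxC M : (Gm M)^t* = Gm M^T.
Proof.
rewrite /Gm trmxCZ (trmxC_mul (Tm *m _)) (trmxC_mul Tm) trmxCK trmxC_cmx mulmxA.
by congr (_ *: _); exact: conj_half.
Qed.

Lemma mulmx_Jblocks (S : pzRingType) (X Y : 'M[S]_n) :
  block_mx 1%:M X 1%:M Y *m block_mx 0 (- 1%:M) 1%:M 0 *m block_mx 1%:M 1%:M Y X =
  block_mx (X - Y) (X - X) (Y - Y) (Y - X).
Proof.
by rewrite !mulmx_block !(mul1mx, mulmx1, mulmx0, mul0mx, mulmxN, mulNmx, add0r, addr0).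
Qed.

Lemma Gm_J : Gm (Jmx R n) = 'i%C *: Hd.
Proof.
have cJ : cmx (Jmx R n) = block_mx 0 (- 1%:M) 1%:M 0.
  by rewrite /Jmx /cmx map_block_mx !map_mx0 map_mxN map_mx1.
rewrite /Gm cJ TmCE mulmx_Jblocks.
rewrite /Hd (scale_block_mx (2^-1)) (scale_block_mx 'i%C) scaler0 !scalerN.
rewrite !scalemx1 !scalerBr !scale_scalar_mx.
by congr block_mx; entrywise.
Qed.

Lemma Hd2 : Hd *m Hd = 1%:M.
Proof.
rewrite /Hd mulmx_block !(mul1mx, mulmx0, mul0mx, mulNmx, mulmxN, opprK, addr0, add0r, oppr0).
by rewrite -scalar_mx_block.
Qed.

Lemma HdE : Hd = (- 'i%C) *: Gm (Jmx R n).
Proof. by rewrite Gm_J scalerA mulNr ii1 opprK scale1r. Qed.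

Lemma scalemx_mid k l p q z (A : 'M[C]_(k, l)) (B : 'M[C]_(l, p)) (D : 'M[C]_(p, q)) :
  A *m (z *: B) *m D = z *: (A *m B *m D).
Proof. by rewrite -scalemxAr -scalemxAl. Qed.

Lemma Gm_symplectic M : symplectic M -> (Gm M)^t* *m Hd *m Gm M = Hd.
Proof.
move=> [_ sM]; rewrite Gm_trmxC HdE (scalemx_mid _ (Gm M^T) (Gm (Jmx R n)) (Gm M)).
by rewrite -(GmM M^T) -(GmM _ M) sM.
Qed.

(** The determinant of the complex linear part of [M]. Its argument is the angle of the polar
    decomposition, see [polar_angleP], and it is available without extracting a square root. *)
Definition adet M : C := \det (ulsubmx (Gm M)).

(** For [y = G x], [Am G] sends [x] to [(y+, x-)] and [Lm G] sends it to [(x+, y-)]. *)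
Definition Am G : 'M[C]_(n + n) := block_mx (ulsubmx G) (ursubmx G) 0 1%:M.
Definition Lm G : 'M[C]_(n + n) := block_mx 1%:M 0 (dlsubmx G) (drsubmx G).

(* [Sm] sends [(x+, y-)] to [(y+, x-)] whenever [y = G x]: the unitary (scattering) form of the graph. *)
Definition Sm G : 'M[C]_(n + n) := Am G *m invmx (Lm G).

(** The polarization of [|y+|^2 + |x-|^2 - |x+|^2 - |y-|^2 = (|y+|^2 - |y-|^2) - (|x+|^2 - |x-|^2)].
    With [G0 = G] it gives unitarity of [Sm]; with two different matrices it computes the motion of
    [Wz]. *)
Lemma polarized_identity G G0 :
  (Am G0)^t* *m Am G - (Lm G0)^t* *m Lm G = G0^t* *m Hd *m G - Hd.
Proof.
rewrite /Am /Lm /Hd -[G in RHS]submxK -[G0 in RHS]submxK.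
move: (ulsubmx G) (ursubmx G) (dlsubmx G) (drsubmx G) => a b c d.
move: (ulsubmx G0) (ursubmx G0) (dlsubmx G0) (drsubmx G0) => a0 b0 c0 d0.
rewrite (trmxC_block a0 b0 0 1%:M) (trmxC_block 1%:M 0 c0 d0) (trmxC_block a0 b0 c0 d0).
rewrite !trmxC0 !trmxC1; move: (a0^t* ) (b0^t* ) (c0^t* ) (d0^t* ) => a' b' c' d'.
rewrite !mulmx_block !(mul1mx, mulmx1, mulmx0, mul0mx, mulNmx, mulmxN, addr0, add0r, oppr0).
rewrite !(opp_block_mx, add_block_mx) !(addr0, add0r, oppr0, opprK).
by congr block_mx; rewrite ?opprD ?addrA ?subr0 // addrAC.
Qed.

Section Symplectic.
Variable M : 'M[R]_(n + n).
Hypothesis sM : symplectic M.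
Let G := Gm M.

Lemma Am_Lm : (Am G)^t* *m Am G = (Lm G)^t* *m Lm G.
Proof. by apply/eqP; rewrite -subr_eq0 polarized_identity Gm_symplectic// subrr. Qed.

Lemma drsubmx_id : (drsubmx G)^t* *m drsubmx G = 1%:M + (ursubmx G)^t* *m ursubmx G.
Proof.
have := Am_Lm; rewrite /Am /Lm (trmxC_block _ _ 0 1%:M) (trmxC_block 1%:M 0) !trmxC0 !trmxC1.
move: ((ulsubmx G)^t* ) ((ursubmx G)^t* ) ((dlsubmx G)^t* ) ((drsubmx G)^t* ) => a' b' c' d'.
move: (ulsubmx G) (ursubmx G) (dlsubmx G) (drsubmx G) => a b c d.
rewrite !mulmx_block !(mul1mx, mulmx1, mulmx0, mul0mx, addr0, add0r).
by move=> /eq_block_mx[_ _ _ <-]; rewrite addrC.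
Qed.

(** [d^* d = 1 + b^* b] is positive definite, so the scattering form exists for every symplectic
    matrix. *)
Lemma drsubmx_unit : drsubmx G \in unitmx.
Proof.
rewrite -unitmx_tr -row_free_unit -kermx_eq0; apply: contraT => /rowV0Pn[v /sub_kermxP vd v0].
pose x := v^T; have dx : drsubmx G *m x = 0.
  by rewrite -[LHS]trmxK trmx_mul trmxK vd trmx0.
have x0 : x != 0 by rewrite /x trmx_eq0.
have : x^t* *m ((drsubmx G)^t* *m drsubmx G) *m x = 0.
  by rewrite !mulmxA -!mulmxA dx !mulmx0.
rewrite drsubmx_id mulmxDr mulmxDl mulmx1 => /(congr1 (fun A : 'M[C]_1 => \tr A)).
have -> : x^t* *m ((ursubmx G)^t* *m ursubmx G) *m x = (ursubmx G *m x)^t* *m (ursubmx G *m x).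
  by rewrite (trmxC_mul (ursubmx G)) !mulmxA.
rewrite mxtraceD mxtrace0 !(mxtrace_mulC (_ ^t*)%sesqui) -!froE -rmorphD /=.
move=> /(congr1 (@complex.Re R))/= /eqP; rewrite paddr_eq0 ?fro_ge0// => /andP[/eqP/fro_eq0 E _].
by rewrite E eqxx in x0.
Qed.

Lemma Lm_unit : Lm G \in unitmx.
Proof. by rewrite unitmxE /Lm det_lblock det1 mul1r -unitmxE drsubmx_unit. Qed.

Lemma Sm_unitary : Sm G \is unitarymx.
Proof.
have h : (Sm G)^t* *m Sm G = 1%:M.
  rewrite /Sm (trmxC_mul (Am G)) !mulmxA -(mulmxA _ _ (Am G)) Am_Lm.
  rewrite mulmxA -(trmxC_mul (Lm G)) mulmxV ?Lm_unit// trmxC1 mul1mx mulmxV ?Lm_unit//.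
by apply/unitarymxP; apply: mulmx1C.
Qed.

End Symplectic.

Lemma swapmxK : swapmx *m swapmx = 1%:M.
Proof.
by rewrite /swapmx mulmx_block !(mul1mx, mulmx0, mul0mx, addr0, add0r) -scalar_mx_block.
Qed.

Lemma swapmx_trmxC : swapmx^t* = swapmx.
Proof. by rewrite /swapmx trmxC_block !trmxC0 trmxC1. Qed.

Lemma swapmx_unitary : swapmx \is unitarymx.
Proof. by apply/unitarymxP; rewrite swapmx_trmxC swapmxK. Qed.

Lemma swapmx_block (a b c d : 'M[C]_n) :
  swapmx *m block_mx a b c d *m swapmx = block_mx d c b a.
Proof.
by rewrite /swapmx mulmx_block !mul0mx !mul1mx !add0r !addr0 mulmx_block !mulmx0 !mulmx1 !add0r !addr0.
Qed.

Lemma map_conj_cmx k l (A : 'M[R]_(k, l)) : map_mx Num.conj (cmx A) = cmx A.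
Proof. by apply/matrixP => i j; rewrite !mxE; apply: conjc_real. Qed.

(** [cmx M] is real, and conjugation exchanges the coordinates [q + i p] and [q - i p]. *)
Lemma conj_Gm M : map_mx Num.conj (Gm M) = swapmx *m Gm M *m swapmx.
Proof.
have cT : map_mx Num.conj Tm = swapmx *m Tm.
  have cj : map_mx Num.conj (('i%C)%:M : 'M[C]_n) = (- 'i%C)%:M.
    by rewrite map_scalar_mx; congr (_%:M); exact: conji.
  have cNj : map_mx Num.conj ((- 'i%C)%:M : 'M[C]_n) = ('i%C)%:M.
    by rewrite map_scalar_mx; congr (_%:M); exact: conjNi.
  rewrite /Tm map_block_mx !map_mx1 cj cNj.
  by rewrite /swapmx mulmx_block !(mul0mx, mul1mx) !add0r !addr0.
have cT' : map_mx Num.conj (Tm^t* ) = Tm^t* *m swapmx.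
  by rewrite -[swapmx in RHS]swapmx_trmxC -(trmxC_mul swapmx) -cT map_trmx.
rewrite /Gm map_mxZ !map_mxM /= cT cT' map_conj_cmx.
rewrite (scalemx_mid _ swapmx _ swapmx) !mulmxA; congr (_ *: _).
exact: conj_half.
Qed.

Section Conjugation.
Variable M : 'M[R]_(n + n).
Let G := Gm M.

Lemma conj_Gm_blocks : [/\ map_mx Num.conj (ulsubmx G) = drsubmx G,
  map_mx Num.conj (ursubmx G) = dlsubmx G, map_mx Num.conj (dlsubmx G) = ursubmx G &
  map_mx Num.conj (drsubmx G) = ulsubmx G].
Proof.
have := conj_Gm M; rewrite -/G -[G]submxK map_block_mx swapmx_block => /eq_block_mx[].
by rewrite !block_mxKul !block_mxKur !block_mxKdl !block_mxKdr.
Qed.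

Lemma conj_Am : map_mx Num.conj (Am G) = swapmx *m Lm G *m swapmx.
Proof.
have [E1 E2 _ _] := conj_Gm_blocks.
by rewrite /Am /Lm swapmx_block map_block_mx map_mx0 map_mx1 E1 E2.
Qed.

Lemma conj_Lm : map_mx Num.conj (Lm G) = swapmx *m Am G *m swapmx.
Proof.
have [_ _ E1 E2] := conj_Gm_blocks.
by rewrite /Am /Lm swapmx_block map_block_mx map_mx0 map_mx1 E1 E2.
Qed.

Lemma det_drsubmx : \det (drsubmx G) = (adet M)^*%C.
Proof. by have [<- _ _ _] := conj_Gm_blocks; rewrite det_map_mx. Qed.

Hypothesis sM : symplectic M.

Lemma adet_neq0 : adet M != 0.
Proof. by rewrite -conjc_eq0 -det_drsubmx -unitfE -unitmxE drsubmx_unit. Qed.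

Lemma det_Sm : \det (Sm G) = adet M / (adet M)^*%C.
Proof.
by rewrite /Sm det_mulmx det_inv /Am /Lm det_ublock det_lblock !det1 mulr1 mul1r det_drsubmx.
Qed.

Lemma conj_Sm : map_mx Num.conj (Sm G) *m (swapmx *m Sm G *m swapmx) = 1%:M.
Proof.
have E : map_mx Num.conj (Sm G) *m (swapmx *m Am G *m swapmx) = swapmx *m Lm G *m swapmx.
  by rewrite -conj_Lm -conj_Am -map_mxM /Sm -mulmxA mulVmx ?mulmx1// Lm_unit.
move: E; move: (map_mx Num.conj (Sm G)) => X; rewrite /Sm.
move: (Lm_unit sM) swapmxK; rewrite -/G; move: (Am G) (Lm G) => A L.
move: swapmx => s uL ss E.
have cancel (B D : 'M[C]_(n + n)) : (s *m B *m s) *m (s *m D *m s) = s *m (B *m D) *m s.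
  by rewrite !mulmxA -(mulmxA _ s s) ss mulmx1.
by rewrite -cancel (mulmxA X) E cancel mulmxV// mulmx1 ss.
Qed.

(** Unitarity turns the reality condition [conj_Sm] into a symmetry under transposition, which
    relates [Wz] at conjugate parameters. *)
Lemma trmx_Sm : (Sm G)^T = swapmx *m Sm G *m swapmx.
Proof.
have uJ : map_mx Num.conj (Sm G) \is unitarymx by rewrite conjC_unitary; exact: Sm_unitary.
rewrite -[RHS]mul1mx -(mulmx_unitaryE uJ) -(mulmxA _ (map_mx Num.conj (Sm G))) conj_Sm mulmx1.
by apply/matrixP => i j; rewrite !mxE [RHS]conjcK.
Qed.

End Conjugation.

(** The scattering matrix of multiplication by a unit [z]: from [y = z x] follow [y+ = z x+] and
    [x- = z^-1 y-]. Hence [Wz] compares the graph of [M] with that of [z], and its eigenvalue [1]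
    records their intersection. *)
Definition Dz (z : C) : 'M[C]_(n + n) := block_mx z%:M 0 0 (z^*%C)%:M.
Definition Wz z M : 'M[C]_(n + n) := (Dz z)^t* *m Sm (Gm M).
Definition nuz z M : nat := \rank (kermx (cmx M - z%:M)).

Lemma conjM_unit (z : C) : nsq z = 1 -> z * z^*%C = 1.
Proof. by move=> z1; rewrite -nsqE z1. Qed.

Lemma Dz_trmxC z : (Dz z)^t* = Dz z^*%C.
Proof. by rewrite /Dz trmxC_block !trmxC0 !trmxC_scalar. Qed.

Lemma Dz_unitary z : nsq z = 1 -> Dz z \is unitarymx.
Proof.
move=> z1; apply/unitarymxP; rewrite Dz_trmxC /Dz mulmx_block !(mulmx0, mul0mx, addr0, add0r).
by rewrite -!scalar_mxM conjcK conjM_unit// mulrC conjM_unit// -scalar_mx_block.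
Qed.

Lemma Wz_unitary z M : nsq z = 1 -> symplectic M -> Wz z M \is unitarymx.
Proof. by move=> z1 sM; apply: unitaryM (Sm_unitary sM); exact: unitaryC (Dz_unitary z1). Qed.

Lemma mxrank_unitl k l (U : 'M[C]_k) (A : 'M[C]_(k, l)) : U \in unitmx -> \rank (U *m A) = \rank A.
Proof. by rewrite -row_full_unit => uU; rewrite (eqmxMfull A uU). Qed.

Lemma mxrank_unitr k l (U : 'M[C]_l) (A : 'M[C]_(k, l)) : U \in unitmx -> \rank (A *m U) = \rank A.
Proof. by move=> uU; rewrite mxrankMfree// row_free_unit. Qed.

Lemma Tm_unit : Tm \in unitmx.
Proof.
have : Tm *m Tm^t* \in unitmx by rewrite TmKC unitmxE det_scalar unitfE expf_neq0// pnatr_eq0.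
by rewrite unitmx_mul => /andP[].
Qed.

Lemma TmC_unit : Tm^t* \in unitmx.
Proof.
have : Tm *m Tm^t* \in unitmx by rewrite TmKC unitmxE det_scalar unitfE expf_neq0// pnatr_eq0.
by rewrite unitmx_mul => /andP[].
Qed.

Lemma Gm_sub_scalar z M : Gm M - z%:M = 2^-1 *: (Tm *m (cmx M - z%:M) *m Tm^t* ).
Proof.
rewrite mulmxBr mulmxBl scalerBr; congr (_ - _).
by rewrite mul_mx_scalar -scalemxAl TmKC scalerA scale_scalar_mx mulrAC half2 mul1r.
Qed.

(** [(Sm - Dz) Lm] equals [Q (Gm M - z)] with [Q] invertible; all other factors are invertible, so
    the kernels have the same dimension. *)
Lemma nuz_Wz z M : nsq z = 1 -> symplectic M -> \rank (kermx (Wz z M - 1%:M)) = nuz z M.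
Proof.
move=> z1 sM; apply: etrans (mxrank_ker _) (etrans _ (esym (mxrank_ker _))); congr (_ - _)%N.
have uD := Dz_unitary z1; have uL := Lm_unit sM.
have -> : Wz z M - 1%:M = (Dz z)^t* *m (Sm (Gm M) - Dz z).
  by rewrite mulmxBr (mulmx_unitaryE uD).
rewrite (mxrank_unitl _ (unitarymx_unit (unitaryC uD))) -(mxrank_unitr _ uL).
pose Q : 'M[C]_(n + n) := block_mx 1%:M 0 0 (- z^*%C)%:M.
have -> : (Sm (Gm M) - Dz z) *m Lm (Gm M) = Q *m (Gm M - z%:M).
  rewrite mulmxBl /Sm -mulmxA mulVmx// mulmx1 /Am /Lm /Dz /Q -[X in _ = _ *m (X - _)]submxK.
  rewrite (scalar_mx_block _ _ z); move: (ulsubmx _) (ursubmx _) (dlsubmx _) (drsubmx _) => a b c d.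
  rewrite (opp_block_mx z%:M) !add_block_mx !mulmx_block.
  rewrite !(mul1mx, mulmx1, mulmx0, mul0mx, addr0, add0r, oppr0, subr0).
  rewrite (opp_block_mx z%:M) add_block_mx subr0 sub0r.
  rewrite mulmxBr -scalar_mxM mulNr mulrC conjM_unit//.
  congr block_mx; first by rewrite !mul_scalar_mx scaleNr.
  by rewrite !mul_scalar_mx scaleNr raddfN /= opprK addrC.
have uQ : Q \in unitmx.
  rewrite unitmxE /Q det_ublock det1 mul1r det_scalar unitfE expf_neq0// oppr_eq0 conjc_eq0.
  by rewrite -nsq_eq0 z1 oner_eq0.
rewrite (mxrank_unitl _ uQ) Gm_sub_scalar mxrank_scale_nz ?invr_eq0 ?pnatr_eq0//.
by rewrite (mxrank_unitr _ TmC_unit) (mxrank_unitl _ Tm_unit).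
Qed.

Definition theta z M : R := Theta (Wz z M).

(** Transposition keeps the spectrum, and [trmx_Sm] makes the transpose of [Wz z M] unitarily
    conjugate to [Wz] at the conjugate parameter. *)
Lemma theta_conj z M : nsq z = 1 -> symplectic M -> theta z^*%C M = theta z M.
Proof.
move=> z1 sM; have z1' : nsq z^*%C = 1 by rewrite nsqJ.
have uW := Wz_unitary z1 sM; have uS := Sm_unitary sM.
have Wd := unidiag_trmx (unitary_unidiag uW).
pose V := (swapmx *m Sm (Gm M))^t*.
have uV : V \is unitarymx := unitaryC (unitaryM swapmx_unitary uS).
have := unidiag_conj uV Wd.
have -> : V *m (Wz z M)^T *m V^t* = Wz z^*%C M.
  have -> : (Wz z M)^T = swapmx *m Sm (Gm M) *m swapmx *m Dz z^*%C.
    by rewrite /Wz trmx_mul trmx_Sm// Dz_trmxC /Dz tr_block_mx !trmx0 !tr_scalar_mx.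
  have VX : V *m (swapmx *m Sm (Gm M)) = 1%:M := mulmx_unitaryE (unitaryM swapmx_unitary uS).
  rewrite -(mulmxA _ swapmx) (mulmxA V) VX mul1mx /V trmxCK.
  rewrite /Wz Dz_trmxC conjcK !mulmxA; congr (_ *m _).
  by rewrite /Dz swapmx_block conjcK.
by move=> /(ThetaE (Wz_unitary z1' sM)).
Qed.

(** In [\det (Dz z)] the factors [z] and its conjugate cancel, so the determinant of [Wz] does not
    depend on [z]. This ties every [theta z] to the same angle [2 D] modulo [2 pi]. *)
Lemma expi_theta z M : nsq z = 1 -> symplectic M ->
  expi (theta z M) = adet M / (adet M)^*%C.
Proof.
move=> z1 sM; rewrite expi_Theta ?Wz_unitary// /Wz det_mulmx Dz_trmxC /Dz det_ublock.
by rewrite !det_scalar -exprMn conjM_unit ?nsqJ// expr1n mul1r det_Sm.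
Qed.

Definition is_arg M (D : R) := adet M = (Num.sqrt (nsq (adet M)))%:C%C * expi D.

Lemma theta_arg z M D : nsq z = 1 -> symplectic M -> is_arg M D ->
  exists k : int, theta z M = 2 * D + k%:~R * (2 * pi).
Proof.
move=> z1 sM DM; apply: expi_eq; rewrite expi_theta// mulr2n || rewrite expi_theta//.
have a0 := adet_neq0 sM; rewrite DM.
set r := Num.sqrt _; have r0 : r != 0.
  by apply: contra a0 => /eqP r0; rewrite DM -/r r0 mul0r.
have conjM (x y : C) : (x * y)^*%C = x^*%C * y^*%C by exact: rmorphM.
rewrite conjM conjc_real expiJ expiN mulrDl mul1r expiD invfM invrK.
rewrite mulrACA divff ?mul1r//.
by apply: contra r0 => /eqP [->].
Qed.

End Scattering.

(** * Variation of [theta] along families of symplectic matrices *)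

Section RealConvergence.
Variables (R : realType) (T : Type) (F : set_system T).
Context {FF : Filter F}.

Definition rcvg k l (A : T -> 'M[R]_(k, l)) (B : 'M[R]_(k, l)) :=
  forall i j, A t i j @[t --> F] --> B i j.

Lemma mcvg_cmx k l (A : T -> 'M[R]_(k, l)) B : rcvg A B -> mcvg F (fun t => cmx (A t)) (cmx B).
Proof.
move=> AB i j; rewrite mxE; apply: ccvg_eq (ccvg_real (AB i j)) => t.
by rewrite mxE.
Qed.

Lemma rcvg_cst k l (B : 'M[R]_(k, l)) : rcvg (fun=> B) B.
Proof. by move=> i j; exact: cvg_cst. Qed.

Lemma rcvg_sum (I : Type) (r : seq I) (f : I -> T -> R) (l : I -> R) :
  (forall i, f i t @[t --> F] --> l i) ->
  (\sum_(i <- r) f i t) @[t --> F] --> \sum_(i <- r) l i.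
Proof.
move=> fl; elim: r => [|i r IH].
  by rewrite big_nil; under eq_fun do rewrite big_nil; exact: cvg_cst.
by rewrite big_cons; under eq_fun do rewrite big_cons; exact: cvgD.
Qed.

Lemma rcvgD k l (A A' : T -> 'M[R]_(k, l)) B B' :
  rcvg A B -> rcvg A' B' -> rcvg (fun t => A t + A' t) (B + B').
Proof. by move=> h h' i j; rewrite mxE; under eq_fun do rewrite mxE; exact: cvgD. Qed.

Lemma rcvgN k l (A : T -> 'M[R]_(k, l)) B : rcvg A B -> rcvg (fun t => - A t) (- B).
Proof. by move=> h i j; rewrite mxE; under eq_fun do rewrite mxE; exact: cvgN. Qed.

Lemma rcvgZ k l (f : T -> R) (c : R) (A : T -> 'M[R]_(k, l)) B :
  f t @[t --> F] --> c -> rcvg A B -> rcvg (fun t => f t *: A t) (c *: B).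
Proof. by move=> h h' i j; rewrite mxE; under eq_fun do rewrite mxE; exact: cvgM. Qed.

Lemma rcvgM k l p (A : T -> 'M[R]_(k, l)) (A' : T -> 'M[R]_(l, p)) B B' :
  rcvg A B -> rcvg A' B' -> rcvg (fun t => A t *m A' t) (B *m B').
Proof.
move=> h h' i j; rewrite mxE; under eq_fun do rewrite mxE.
by apply: rcvg_sum => q; exact: cvgM.
Qed.

Lemma rcvgX k (A : T -> 'M[R]_k) B m : rcvg A B -> rcvg (fun t => A t ^+ m) (B ^+ m).
Proof.
move=> AB; elim: m => [|m IH]; first exact: rcvg_cst.
by rewrite exprS; have := rcvgM AB IH; congr rcvg; apply/funext => t; rewrite exprS.
Qed.

End RealConvergence.

Section JumpArithmetic.
Variable R : realType.

Lemma two_pi_small (k : int) (x y : R) : `|x| < pi -> `|y| < pi -> x - y = k%:~R * (2 * pi) -> x = y.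
Proof.
move=> xp yp E; suff k0 : k = 0 by move/eqP: E; rewrite k0 mul0r subr_eq0 => /eqP.
apply: (@int_small R); have p0 := pi_gt0 R; rewrite -(@ltr_pM2r _ (2 * pi)) ?mulr_gt0// mul1r.
rewrite -[X in _ * X](@gtr0_norm _ (2 * pi)) ?mulr_gt0// -normrM -E.
by apply: le_lt_trans (ler_normB _ _) _; rewrite mulrDl mul1r ltrD.
Qed.

(** [th - 2 D] takes values in a discrete set, so a jump known up to less than [pi] is known
    exactly: convergence statements become equalities. *)
Lemma jump_arith (th th0 D D0 : R) (k1 k2 : int) (k : nat) :
  th = 2 * D + k1%:~R * (2 * pi) -> th0 = 2 * D0 + k2%:~R * (2 * pi) ->
  `|D0 - D| < pi / 2 -> `|th + 2 * pi * k%:R - th0| < pi / 2 ->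
  th - 2 * D = th0 - 2 * D0 - 2 * pi * k%:R.
Proof.
move=> E1 E2 h1 h2; have p0 := pi_gt0 R.
have E : (th + 2 * pi * k%:R - th0) - 2 * (D - D0) = (k1 - k2 + k%:Z)%:~R * (2 * pi).
  by rewrite E1 E2 rmorphD rmorphB /= -pmulrn; ring.
have H : th + 2 * pi * k%:R - th0 = 2 * (D - D0).
  apply: (two_pi_small _ _ E); first by apply: lt_trans h2 _; lra.
  by rewrite normrM ger0_norm// distrC; lra.
by lra.
Qed.

Lemma jump_arith0 (th th0 D D0 : R) (k1 k2 : int) :
  th = 2 * D + k1%:~R * (2 * pi) -> th0 = 2 * D0 + k2%:~R * (2 * pi) ->
  `|D0 - D| < pi / 2 -> `|th - th0| < pi / 2 -> th - 2 * D = th0 - 2 * D0.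
Proof.
move=> E1 E2 h1 h2; rewrite (jump_arith (k := 0) E1 E2 h1) ?mulr0 ?subr0//.
by rewrite addr0.
Qed.

End JumpArithmetic.

Section SubmatrixConvergence.
Variables (R : realType) (T : Type) (F : set_system T).
Context {FF : Filter F}.

Lemma mcvg_lsubmx k l p (A : T -> 'M[R[i]]_(k, l + p)) B :
  mcvg F A B -> mcvg F (fun t => lsubmx (A t)) (lsubmx B).
Proof. by move=> h i j; rewrite mxE; apply: ccvg_eq (h i _) => t; rewrite mxE. Qed.

Lemma mcvg_rsubmx k l p (A : T -> 'M[R[i]]_(k, l + p)) B :
  mcvg F A B -> mcvg F (fun t => rsubmx (A t)) (rsubmx B).
Proof. by move=> h i j; rewrite mxE; apply: ccvg_eq (h i _) => t; rewrite mxE. Qed.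

Lemma mcvg_usubmx k l p (A : T -> 'M[R[i]]_(k + l, p)) B :
  mcvg F A B -> mcvg F (fun t => usubmx (A t)) (usubmx B).
Proof. by move=> h i j; rewrite mxE; apply: ccvg_eq (h _ j) => t; rewrite mxE. Qed.

Lemma mcvg_dsubmx k l p (A : T -> 'M[R[i]]_(k + l, p)) B :
  mcvg F A B -> mcvg F (fun t => dsubmx (A t)) (dsubmx B).
Proof. by move=> h i j; rewrite mxE; apply: ccvg_eq (h _ j) => t; rewrite mxE. Qed.

Lemma mulmx_fixB (S : pzRingType) N (A g h x g0 : 'M[S]_N) : g *m h *m g0 = h ->
  A *m g *m h *m (x - g0) = A *m (g *m h *m x - h).
Proof. by move=> E; rewrite mulmxBr [RHS]mulmxBr -[X in _ = _ - A *m X]E !mulmxA. Qed.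

Lemma mulmx_adj_inv N (L0 L : 'M[R[i]]_N) : L0 \in unitmx -> L \in unitmx ->
  ((invmx L0)^t* *m (L0^t* *m L) *m invmx L)%sesqui = 1%:M.
Proof.
move=> u0 uL; have E : ((invmx L0)^t* *m L0^t*)%sesqui = 1%:M.
  by rewrite -(trmxC_mul L0) mulmxV// trmxC1.
by rewrite mulmxA E mul1mx mulmxV.
Qed.

Lemma mulmx_invol (S : comPzRingType) N (X H Q G V : 'M[S]_N) c : H *m H = 1%:M ->
  (X *m H) *m (c *: H *m Q *m G) *m V = c *: (X *m Q *m (G *m V)).
Proof.
move=> HH; rewrite -!scalemxAl -scalemxAr -scalemxAl; congr (_ *: _).
by rewrite !mulmxA -(mulmxA X H H) HH mulmx1.
Qed.

End SubmatrixConvergence.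

Section SymplecticConvergence.
Variables (R : realType) (n : nat) (T : Type) (F : set_system T).
Context {FF : Filter F}.
Local Notation C := R[i].
Local Open Scope sesquilinear_scope.
Variables (M : T -> 'M[R]_(n + n)) (M0 : 'M[R]_(n + n)).
Hypotheses (sM : forall t, symplectic (M t)) (sM0 : symplectic M0).
Hypothesis MM0 : rcvg F M M0.

Lemma mcvg_Gm : mcvg F (fun t => Gm (M t)) (Gm M0).
Proof.
apply: mcvgZ; first exact: ccvg_cst.
by apply: mcvgM; [apply: mcvgM; [exact: mcvg_cst|exact: mcvg_cmx]|exact: mcvg_cst].
Qed.

Lemma mcvg_submx : [/\ mcvg F (fun t => ulsubmx (Gm (M t))) (ulsubmx (Gm M0)),
  mcvg F (fun t => ursubmx (Gm (M t))) (ursubmx (Gm M0)),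
  mcvg F (fun t => dlsubmx (Gm (M t))) (dlsubmx (Gm M0)) &
  mcvg F (fun t => drsubmx (Gm (M t))) (drsubmx (Gm M0))].
Proof.
have h := mcvg_Gm; split.
- exact: mcvg_lsubmx (mcvg_usubmx h).
- exact: mcvg_rsubmx (mcvg_usubmx h).
- exact: mcvg_lsubmx (mcvg_dsubmx h).
- exact: mcvg_rsubmx (mcvg_dsubmx h).
Qed.

Lemma ccvg_adet : ccvg F (fun t => adet (M t)) (adet M0).
Proof. by have [h _ _ _] := mcvg_submx; exact: ccvg_det. Qed.

Lemma mcvg_invLm : mcvg F (fun t => invmx (Lm (Gm (M t)))) (invmx (Lm (Gm M0))).
Proof.
have [_ _ h1 h2] := mcvg_submx; apply: mcvg_inv.
- exact: Lm_unit.
- by move=> t; exact: Lm_unit.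
- by apply: mcvg_block => //; exact: mcvg_cst.
Qed.

Lemma mcvg_Sm : mcvg F (fun t => Sm (Gm (M t))) (Sm (Gm M0)).
Proof.
have [h1 h2 _ _] := mcvg_submx; apply: mcvgM; last exact: mcvg_invLm.
by apply: mcvg_block => //; exact: mcvg_cst.
Qed.

Section Rotating.
Variables (z : T -> C) (z0 : C).
Hypotheses (z1 : forall t, nsq (z t) = 1) (z01 : nsq z0 = 1) (zz0 : ccvg F z z0).

Lemma mcvg_scalar k (y : T -> C) (y0 : C) : ccvg F y y0 ->
  mcvg F (fun t => (y t)%:M : 'M[C]_k) y0%:M.
Proof.
move=> yy i j; rewrite mxE; case: (eqVneq i j) => [->|ij].
  by rewrite mulr1n; apply: ccvg_eq yy => t; rewrite mxE eqxx mulr1n.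
by rewrite mulr0n; apply: ccvg_eq (@ccvg_cst _ _ F _ 0) => t; rewrite mxE (negbTE ij) mulr0n.
Qed.

Lemma mcvg_Wz : mcvg F (fun t => Wz (z t) (M t)) (Wz z0 M0).
Proof.
apply: mcvgM; last exact: mcvg_Sm.
apply: mcvg_trmxC; apply: mcvg_block; try exact: mcvg_cst.
  exact: mcvg_scalar.
by apply: mcvg_scalar; exact: ccvgJ.
Qed.

Variables (D : T -> R) (D0 : R).
Hypotheses (DM : forall t, is_arg (M t) (D t)) (DM0 : is_arg M0 D0) (DD0 : D t @[t --> F] --> D0).

(** [z] may move along with the matrix, so the lemma serves paths of matrices at fixed [z] as well
    as the variation of [z] for a fixed matrix. *)
Lemma theta_path_local : \forall t \near F, exists2 k : nat, (k <= nuz z0 M0)%N &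
  theta (z t) (M t) - 2 * D t = theta z0 M0 - 2 * D0 - 2 * pi * k%:R.
Proof.
have p0 := pi_gt0 R.
have uW t := Wz_unitary (z1 t) (sM t); have uW0 := Wz_unitary z01 sM0.
have e0 : (0 : R) < pi / 2 by rewrite divr_gt0.
have /cvgrPdist_lt/(_ _ e0) := DD0.
have := @Theta_local _ _ F FF _ _ _ uW uW0 mcvg_Wz _ e0; rewrite nuz_Wz// => /[swap].
apply: filterS2 => t h1 [k kn h2]; exists k => //.
have [k1 E1] := theta_arg (z1 t) (sM t) (DM t); have [k2 E2] := theta_arg z01 sM0 DM0.
exact: jump_arith E1 E2 h1 h2.
Qed.

End Rotating.

Section Monotone.
Variables (z : C) (B : 'M[R]_(n + n)) (tau : T -> R) (D : T -> R) (D0 : R).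
Hypotheses (z1 : nsq z = 1) (pB : posdef B).
Hypothesis dM : rcvg F (fun t => (tau t)^-1 *: (M t - M0)) (Jmx R n *m B *m M0).
Hypotheses (DM : forall t, is_arg (M t) (D t)) (DM0 : is_arg M0 D0) (DD0 : D t @[t --> F] --> D0).

Lemma hposdef_cmx : hposdef (cmx B).
Proof.
have [sB pB'] := pB; split; first by rewrite trmxC_cmx sB.
move=> v v0; pose x := map_mx (@complex.Re R) v; pose y := map_mx (@complex.Im R) v.
have q (a b : 'rV[R]_(n + n)) : (a *m B *m b^T) 0 0 = \sum_j \sum_i a 0 i * B i j * b 0 j.
  rewrite mxE; apply: eq_bigr => j _; rewrite mxE mulr_suml; apply: eq_bigr => i _.
  by rewrite mxE.
have -> : reC ((v *m cmx B *m v^t* ) 0 0) = (x *m B *m x^T) 0 0 + (y *m B *m y^T) 0 0.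
  rewrite !q -big_split /= mxE raddf_sum /=; apply: eq_bigr => j _.
  rewrite mxE mulr_suml raddf_sum /= -big_split /=; apply: eq_bigr => i _.
  rewrite !mxE; case: (v 0 i) (v 0 j) => a b [a' b'] /=.
  by ring.
have pos (a : 'rV[R]_(n + n)) : 0 <= (a *m B *m a^T) 0 0.
  have [->|a0] := eqVneq a 0; first by rewrite !mul0mx mxE.
  by apply: ltW; rewrite -{1}[a]trmxK; apply: pB'; rewrite trmx_eq0.
have pos' (a : 'rV[R]_(n + n)) : a != 0 -> 0 < (a *m B *m a^T) 0 0.
  by move=> a0; rewrite -{1}[a]trmxK; apply: pB'; rewrite trmx_eq0.
have [x0|x0] := eqVneq x 0; last by rewrite ltr_pwDl// pos'.
have y0 : y != 0.
  apply: contra v0 => /eqP y0; apply/eqP/rowP => j.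
  have /rowP/(_ j) := x0; have /rowP/(_ j) := y0; rewrite !mxE.
  by case: (v 0 j) => a b /= -> ->.
by rewrite ltr_wpDl ?pos// pos'.
Qed.

Lemma hposdef_congr N (G Y : 'M[C]_N) : Y \in unitmx -> hposdef G -> hposdef (Y *m G *m Y^t* ).
Proof.
move=> uY [hG pG]; split; first by rewrite (trmxC_mul (Y *m G)) (trmxC_mul Y) trmxCK hG mulmxA.
move=> v v0; have -> : v *m (Y *m G *m Y^t* ) *m v^t* = (v *m Y) *m G *m (v *m Y)^t*.
  by rewrite (trmxC_mul v) !mulmxA.
by apply: pG; rewrite mulmx_free_eq0// row_free_unit.
Qed.

Lemma hposdef_Gm : hposdef (Gm B).
Proof.
have [h p] := hposdef_congr (Tm_unit R n) hposdef_cmx.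
split; first by rewrite /Gm trmxCZ h conj_half.
move=> v v0; rewrite /Gm (quadZ v); move: (p v v0).
have -> : (2^-1 : C) = (2^-1 : R)%:C%C by rewrite fmorphV /= rmorph_nat.
by case: (_ 0 0) => a b /= a0; rewrite mul0r subr0 mulr_gt0// invr_gt0.
Qed.

(** [Y0] sends [(x+, y-)] to the point [y] of the graph of [M0], so [K0] is the Hamiltonian [B]
    evaluated at [y]; it governs the first-order motion of [Wz] and inherits positivity from [B]. *)
Let Y0 := Gm M0 *m invmx (Lm (Gm M0)).
Let K0 := Y0^t* *m Gm B *m Y0.

Let uY0 : Y0^t* \in unitmx.
Proof.
have uG : Gm M0 \in unitmx.
  have sG := Gm_symplectic sM0; have : (Gm M0)^t* *m Hd R n *m Gm M0 \in unitmx.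
    rewrite sG; have : Hd R n *m Hd R n \in unitmx by rewrite Hd2 unitmx1.
    by rewrite unitmx_mul => /andP[].
  by rewrite unitmx_mul => /andP[].
have uY : Y0 \in unitmx by rewrite unitmx_mul uG unitmx_inv Lm_unit.
rewrite unitmxE det_map_mx det_tr unitfE; apply: contraTneq uY => /eqP.
by rewrite conjc_eq0 unitmxE unitfE => ->.
Qed.

(** By [polarized_identity] and the symplecticity of [M0], [Wz(M0)^* Wz(M t) - 1] is exactly a
    product linear in [M t - M0], up to a factor converging with [M t]; no remainder has to be
    estimated. *)
Lemma Wz_derivative : mcvg F (fun t => ((tau t)^-1)%:C%C *: ((Wz z M0)^t* *m Wz z (M t) - 1%:M))
   ('i%C *: K0).
Proof.
pose P := ((invmx (Lm (Gm M0)))^t*) *m (Gm M0)^t* *m Hd R n.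
have E t : ((tau t)^-1)%:C%C *: ((Wz z M0)^t* *m Wz z (M t) - 1%:M) =
    P *m Gm ((tau t)^-1 *: (M t - M0)) *m invmx (Lm (Gm (M t))).
  rewrite GmZ (scalemx_mid _ P); congr (_ *: _).
  have uD := Dz_unitary n z1.
  have -> : (Wz z M0)^t* *m Wz z (M t) = (Sm (Gm M0))^t* *m Sm (Gm (M t)).
    rewrite /Wz (trmxC_mul ((Dz n z)^t* )) trmxCK -!mulmxA (mulmxA (Dz n z)).
    by rewrite (unitarymxP uD) mul1mx.
  have uL := Lm_unit (sM t); have uL0 := Lm_unit sM0.
  have -> : P *m Gm (M t - M0) = (invmx (Lm (Gm M0)))^t* *m
      ((Gm M0)^t* *m Hd R n *m Gm (M t) - Hd R n).
    by rewrite GmB; exact: mulmx_fixB (Gm_symplectic sM0).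
  rewrite -polarized_identity mulmxBr mulmxBl; congr (_ - _).
    by rewrite /Sm (trmxC_mul (Am _)) !mulmxA.
  by rewrite (mulmx_adj_inv uL0 uL).
apply: mcvg_eq (fun t => esym (E t)) _.
have -> : 'i%C *: K0 = P *m Gm (Jmx R n *m B *m M0) *m invmx (Lm (Gm M0)).
  rewrite (GmM _ M0) (GmM _ B) Gm_J /P (mulmx_invol _ _ _ _ _ (Hd2 R n)).
  by rewrite /K0 /Y0 (trmxC_mul (Gm M0)).
apply: mcvgM; last exact: mcvg_invLm.
apply: mcvgM; first exact: mcvg_cst.
apply: mcvgZ; first exact: ccvg_cst.
by apply: mcvgM; [apply: mcvgM; [exact: mcvg_cst|exact: mcvg_cmx]|exact: mcvg_cst].
Qed.

Let pK0 : hposdef K0.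
Proof. by have := hposdef_congr uY0 hposdef_Gm; rewrite trmxCK. Qed.

(** A positive path turns all eigenvalues of [Wz] at [1] counterclockwise: after the crossing time
    they have small positive arguments, before it arguments just below [2 pi]. Hence the jump here
    and its absence in [theta_path_left]. *)
Lemma theta_path_right : (\forall t \near F, 0 < tau t) ->
  \forall t \near F, nuz z (M t) = 0%N /\
    theta z (M t) - 2 * D t = theta z M0 - 2 * D0 - 2 * pi * (nuz z M0)%:R.
Proof.
move=> tau0; have p0 := pi_gt0 R.
have uW t := Wz_unitary z1 (sM t); have uW0 := Wz_unitary z1 sM0.
have e0 : (0 : R) < pi / 2 by rewrite divr_gt0.
have Hw : mcvg F (fun t => Wz z (M t)) (Wz z M0) by apply: mcvg_Wz; exact: ccvg_cst.
have := @Theta_increase _ _ F FF _ _ _ _ _ uW uW0 Hw pK0 Wz_derivative _ e0 tau0.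
have /cvgrPdist_lt/(_ _ e0) := DD0.
apply: filterS2 => t h1 [h3 h2]; rewrite nuz_Wz// in h3; split=> //; rewrite nuz_Wz// in h2.
have [k1 E1] := theta_arg z1 (sM t) (DM t); have [k2 E2] := theta_arg z1 sM0 DM0.
exact: jump_arith E1 E2 h1 h2.
Qed.

Lemma theta_path_left : (\forall t \near F, tau t < 0) ->
  \forall t \near F, nuz z (M t) = 0%N /\
    theta z (M t) - 2 * D t = theta z M0 - 2 * D0.
Proof.
move=> tau0; have p0 := pi_gt0 R.
have uW t := Wz_unitary z1 (sM t); have uW0 := Wz_unitary z1 sM0.
have e0 : (0 : R) < pi / 2 by rewrite divr_gt0.
have Hw : mcvg F (fun t => Wz z (M t)) (Wz z M0) by apply: mcvg_Wz; exact: ccvg_cst.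
have := @Theta_decrease _ _ F FF _ _ _ _ _ uW uW0 Hw pK0 Wz_derivative _ e0 tau0.
have /cvgrPdist_lt/(_ _ e0) := DD0.
apply: filterS2 => t h1 [h3 h2]; rewrite nuz_Wz// in h3; split=> //.
have [k1 E1] := theta_arg z1 (sM t) (DM t); have [k2 E2] := theta_arg z1 sM0 DM0.
exact: jump_arith0 E1 E2 h1 h2.
Qed.

End Monotone.
End SymplecticConvergence.

(** * Continuous arguments along paths *)

Section Lifts.
Variable R : realType.
Implicit Types (a b t : R) (c : R -> R[i]) (D f : R -> R).

(** Composition with [clamp] extends a path from a segment to the whole line by constants, so
    continuity can be handled on [R] instead of within an interval. *)
Definition clamp a b t : R := Num.max a (Num.min t b).

Lemma clamp_itv a b t : a <= b -> clamp a b t \in `[a, b].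
Proof. by move=> ab; rewrite in_itv /= /clamp le_max lexx/= ge_max ab /= ge_min lexx orbT. Qed.

Lemma clamp_id a b t : t \in `[a, b] -> clamp a b t = t.
Proof. by rewrite in_itv /= => /andP[at_ tb]; rewrite /clamp (min_idPl tb); apply/max_idPr. Qed.

Lemma max_lipschitz (x y z : R) : `|Num.max x y - Num.max x z| <= `|y - z|.
Proof.
have h1 := ler_norm (y - z); have h2 : - (y - z) <= `|y - z| by rewrite -normrN ler_norm.
by rewrite ler_norml; case: (leP x y) => ?; case: (leP x z) => ?; apply/andP; split; lra.
Qed.

Lemma min_lipschitz (x y z : R) : `|Num.min x z - Num.min y z| <= `|x - y|.
Proof.
have h1 := ler_norm (x - y); have h2 : - (x - y) <= `|x - y| by rewrite -normrN ler_norm.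
by rewrite ler_norml; case: (leP x z) => ?; case: (leP y z) => ?; apply/andP; split; lra.
Qed.

Lemma lipschitz_continuous f : (forall x y, `|f x - f y| <= `|x - y|) -> continuous f.
Proof.
move=> fl x; apply/cvgrPdist_lt => e e0.
have /cvgrPdist_lt/(_ _ e0) : y @[y --> x] --> x by exact: cvg_id.
by apply: filterS => y; exact: le_lt_trans (fl _ _).
Qed.

Lemma clamp_continuous a b : continuous (clamp a b).
Proof.
apply: lipschitz_continuous => x y.
exact: le_trans (max_lipschitz _ _ _) (min_lipschitz _ _ _).
Qed.

Lemma within_clamp (T : topologicalType) a b (g : R -> T) : a <= b ->
  {within `[a, b], continuous g} -> continuous (g \o clamp a b).
Proof.
move=> ab /subspace_continuousP gc t.
have := gc _ (clamp_itv t ab) => gt U /gt; rewrite /= nbhs_simpl /= => h.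
have := @clamp_continuous a b t _ h; rewrite /= nbhs_simpl /=.
by apply: filterS => y /=; apply; exact: clamp_itv.
Qed.

Lemma continuous_within (T : topologicalType) a b (g : R -> T) :
  continuous g -> {within `[a, b], continuous g}.
Proof. by move=> gc; apply: continuous_subspaceT. Qed.

Definition ccontinuous c := forall t, ccvg (nbhs t) c (c t).

(** To leave the interval [|f|] would have to take the value [pi / 2], where the cosine vanishes. *)
Lemma close_lifts a b f : continuous f ->
  (forall t, t \in `[a, b] -> 0 < cos (f t)) -> `|f a| < pi / 2 ->
  forall t, t \in `[a, b] -> `|f t| < pi / 2.
Proof.
move=> fc fpos fa t tab; rewrite ltNge; apply/negP => ge.
move: (tab); rewrite in_itv /= => /andP[at_ tb].
have nfc : continuous (fun x => `|f x|).
  by move=> x; apply: cvg_norm; exact: fc.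
have [|s st fs] := IVT (v := pi / 2) at_ (continuous_within nfc).
  by rewrite ge_min (ltW fa) le_max ge orbT.
have := fpos s; move: st; rewrite !in_itv /= => /andP[as_ st].
rewrite as_ (le_trans st tb) => /(_ isT).
by rewrite -cos_norm fs cos_pihalf ltxx.
Qed.

(** The difference of the two lifts, shifted to start at [0], has exponential [1] throughout; it
    cannot reach [pi / 2], so its final value, a multiple of [2 pi], is [0]. *)
Lemma lift_unique a b D1 D2 : a <= b -> continuous D1 -> continuous D2 ->
  (forall t, t \in `[a, b] -> expi (D1 t) = expi (D2 t)) ->
  D1 b - D1 a = D2 b - D2 a.
Proof.
move=> ab c1 c2 E; have aab : a \in `[a, b] by rewrite in_itv /= lexx.
have bab : b \in `[a, b] by rewrite in_itv /= lexx andbT.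
have [k Ek] := expi_eq (E a aab).
have p0 := pi_gt0 R.
pose f t := D1 t - D2 t - k%:~R * (2 * pi).
have fc : continuous f.
  by move=> t; apply: cvgB; [apply: cvgB; [exact: c1|exact: c2]|exact: cvg_cst].
have fE t : t \in `[a, b] -> expi (f t) = 1.
  by move=> /E h; rewrite /f -mulNr -mulrNz expiDint expiD expiN h divff// expi_neq0.
have fpos t : t \in `[a, b] -> 0 < cos (f t).
  by move=> /fE [-> _].
have fa : `|f a| < pi / 2 by rewrite /f Ek addrAC addrAC subrr add0r subrr || rewrite /f Ek [D2 a + _]addrC addrK subrr normr0 divr_gt0.
have := close_lifts fc fpos fa bab => fb.
have [k' Ek'] := expi_eq1 (fE b bab).
have k0 : k' = 0.
  apply: (@int_small R); move: fb; rewrite Ek' normrM (@gtr0_norm _ (2 * pi)) ?mulr_gt0// => h.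
  by rewrite -(@ltr_pM2r _ (2 * pi)) ?mulr_gt0// mul1r; apply: lt_trans h _; lra.
have fb0 : f b = 0 by rewrite Ek' k0 mul0r.
by move: fb0; rewrite /f Ek; lra.
Qed.

Lemma ccvg_comp (T U : Type) (F : set_system T) (G : set_system U) (c : U -> R[i]) (g : T -> U) z :
  ccvg G c z -> g y @[y --> F] --> G -> ccvg F (fun y => c (g y)) z.
Proof. by move=> [h1 h2] gt; split; [exact: cvg_comp gt h1|exact: cvg_comp gt h2]. Qed.

Lemma cvg_realfun (T : Type) (F : set_system T) (f : T -> R) (g : R -> R) x :
  g y @[y --> x] --> g x -> f t @[t --> F] --> x -> g (f t) @[t --> F] --> g x.
Proof. by move=> gc fx; exact: cvg_comp fx gc. Qed.

Lemma argp_cvg (T : Type) (F : set_system T) (FF : Filter F) (f : T -> R[i]) z :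
  0 < reC z -> ccvg F f z -> argp (f t) @[t --> F] --> argp z.
Proof.
move=> z0 [h1 h2].
have h : imC (f t) / reC (f t) @[t --> F] --> imC z / reC z.
  by apply: cvgM => //; apply: cvgV => //; rewrite gt_eqF.
by rewrite /argp; apply: (cvg_realfun (g := @atan R)) h; exact: continuous_atan.
Qed.

Lemma re_conj1 (z : R[i]) : nsq z = 1 -> reC (z * z^*%C) = 1.
Proof. by move=> z1; rewrite -nsqE z1. Qed.

(** The tube lemma: by compactness of the segment, positivity near each of its points holds
    uniformly for parameters close to the limit. *)
Lemma near_segment_pos (I : Type) (F : set_system I) (FF : Filter F) a b
    (f : I -> R -> R) (l : R -> R) :
  (forall x, x \in `[a, b] -> 0 < l x /\ f p.2 p.1 @[p --> (nbhs x, F)] --> l x) ->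
  \forall i \near F, forall t, t \in `[a, b] -> 0 < f i t.
Proof.
move=> H; have /compact_near_coveringP K := @segment_compact R a b.
have := K I F (fun i t => 0 < f i t) FF; apply=> x /H[lx fx].
exact: (cvgr_gt (l x) fx).
Qed.

(** Uniform continuity in multiplicative form: quotients of values at close times stay in the right
    half-plane, the domain of [argp]. *)
Lemma unit_step a b c : ccontinuous c -> (forall t, nsq (c t) = 1) ->
  exists2 e, 0 < e & forall t t', t \in `[a, b] -> `|t' - t| < e -> 0 < reC (c t' * (c t)^*%C).
Proof.
move=> cc c1.
have : \forall h \near (0 : R), forall t, t \in `[a, b] -> 0 < reC (c (t + h) * (c t)^*%C).
  apply: (@near_segment_pos _ (nbhs (0 : R)) _ a b (fun h t => reC (c (t + h) * (c t)^*%C)) (fun=> 1)).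
  move=> x xab; split=> //; rewrite -(re_conj1 (c1 x)).
  have [h _] // : ccvg (filter_prod (nbhs x) (nbhs (0 : R)))
     (fun p => c (p.1 + p.2) * (c p.1)^*%C) (c x * (c x)^*%C).
  apply: ccvgM; last by apply: ccvgJ; apply: ccvg_comp (cc x) _; exact: cvg_fst.
  apply: (ccvg_comp (G := nbhs x)) (cc x) _; 
  have : p.1 + p.2 @[p --> filter_prod (nbhs x) (nbhs (0 : R))] --> x + 0.
    by apply: cvgD; [exact: cvg_fst|exact: cvg_snd].
  by rewrite addr0.
move=> /nbhs_ballP[e /= e0 eP]; exists e => // t t' tab tt'.
have := eP (t' - t); rewrite /ball /= sub0r normrN => /(_ tt' t tab).
by rewrite addrC subrK.
Qed.

Section UnitLift.
Variables (a b : R) (c : R -> R[i]).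
Hypotheses (ab : a <= b) (cc : ccontinuous c) (c1 : forall t, nsq (c t) = 1).

(* [D] sums the small arguments of [c] along a fine subdivision, cut off at [t]. *)
Lemma unit_lift : exists2 D, continuous D & forall t, t \in `[a, b] -> c t = expi (D t).
Proof.
have [e e0 eP] := unit_step a b cc c1.
have [N Ne] : exists N : nat, (b - a) / N.+1%:R < e.
  exists (Num.truncn ((b - a) / e)); rewrite ltr_pdivrMr// mulrC -ltr_pdivrMr//.
  have := truncnS_gt ((b - a) / e); exact.
pose h := (b - a) / N.+1%:R; have h0 : 0 <= h by rewrite divr_ge0// subr_ge0.
pose k i t : R := Num.min t (a + i%:R * h).
have kc i : continuous (k i).
  by apply: lipschitz_continuous => x y; exact: min_lipschitz.
pose q i t := c (k i.+1 t) * (c (k i t))^*%C.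
have q1 i t : nsq (q i t) = 1 by rewrite nsqM nsqJ !c1 mulr1.
have qpos i t : (i < N.+1)%N -> 0 < reC (q i t).
  move=> iN; have hi : i.+1%:R * h = i%:R * h + h by rewrite -natr1 mulrDl mul1r.
  have i0 : 0 <= i%:R * h by rewrite mulr_ge0.
  have iE : i%:R * h <= b - a.
    have -> : b - a = N.+1%:R * h by rewrite /h mulrC divfK// pnatr_eq0.
    by rewrite ler_wpM2r// ler_nat ltnW.
  have [ta|ta] := leP t a.
    have E l : k l t = t.
      by apply/min_idPl; apply: (le_trans ta); rewrite lerDl mulr_ge0.
    by rewrite /q !E re_conj1.
  apply: eP; rewrite /k.
    rewrite in_itv /= le_min ge_min (ltW ta) lerDl i0 /=.
    by apply/orP; right; lra.
  apply: le_lt_trans Ne; rewrite -/h hi addrA.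
  case: (leP t (a + i%:R * h + h)) => ?; case: (leP t (a + i%:R * h)) => ?; rewrite ler_norml; apply/andP; split; lra.
have [/andP[_ _] ca] := angP (c1 a).
pose D t := ang (c a) + \sum_(i < N.+1) argp (q i t).
exists D.
  move=> t; apply: cvgD; first exact: cvg_cst.
  rewrite /= ; apply: (@rcvg_sum R R (nbhs t) _ 'I_N.+1 (index_enum _) (fun i t => argp (q i t))) => i.
  apply: argp_cvg; first by apply: qpos.
  apply: ccvgM; first by apply: ccvg_comp (cc _) _; exact: kc.
  by apply: ccvgJ; apply: ccvg_comp (cc _) _; exact: kc.
move=> t; rewrite in_itv /= => /andP[at_ tb].
have part m : (m <= N.+1)%N -> c (k m t) = expi (ang (c a) + \sum_(i < m) argp (q i t)).
  elim: m => [_|m IH mN].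
    by rewrite big_ord0 addr0 -ca /k mul0r addr0 (min_idPr at_).
  rewrite big_ord_recr /= addrA expiD -IH ?(ltnW mN)//.
  rewrite -(argp_unit (q1 m t) (qpos m t mN)) /q mulrCA.
  by rewrite -nsqE c1 mulr1.
rewrite /D -(part N.+1)// /k (min_idPl _)//.
by rewrite /h mulrC divfK ?pnatr_eq0//; lra.
Qed.

End UnitLift.

Lemma sqrt_nsq_gt0 (z : R[i]) : z != 0 -> 0 < Num.sqrt (nsq z).
Proof. by move=> z0; rewrite sqrtr_gt0 lt_neqAle nsq_ge0 andbT eq_sym nsq_eq0. Qed.

Lemma lift_exists a b c : a <= b -> ccontinuous c -> (forall t, c t != 0) ->
  exists2 D, continuous D &
    forall t, t \in `[a, b] -> c t = (Num.sqrt (nsq (c t)))%:C%C * expi (D t).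
Proof.
move=> ab cc c0; pose u t := ((Num.sqrt (nsq (c t)))^-1)%:C%C * c t.
have s0 t : Num.sqrt (nsq (c t)) != 0 by rewrite gt_eqF// sqrt_nsq_gt0.
have u1 t : nsq (u t) = 1.
  rewrite /u nsqM /nsq /= expr0n /= addr0 -[X in _ * X]/(nsq (c t)).
  by rewrite exprVn sqr_sqrtr ?nsq_ge0// mulVf// nsq_eq0.
have uc : ccontinuous u.
  move=> t; apply: ccvgM; last exact: cc.
  apply: ccvg_real; apply: cvgV; first exact: s0.
  by apply: (cvg_realfun (g := @Num.sqrt R)); [exact: sqrt_continuous|exact: ccvg_nsq].
have [D Dc DE] := unit_lift ab uc u1; exists D => // t tab.
by rewrite -DE// /u mulrA -rmorphM /= divff// mul1r.
Qed.

Lemma polar_unique (r s D D' : R) : 0 < r -> 0 < s -> r%:C%C * expi D = s%:C%C * expi D' :> R[i] ->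
  expi D = expi D'.
Proof.
move=> r0 s0 E; have := congr1 (@nsq R) E; rewrite !nsqM !nsq_expi !mulr1 /nsq /= !expr0n /= !addr0.
move=> /eqP; rewrite eqrXn2 ?(ltW r0) ?(ltW s0)// => /eqP rs; move: E; rewrite rs.
by apply: mulfI; apply/eqP => -[] /eqP; rewrite gt_eqF.
Qed.

(* Lifts along the vertical edge and then along the horizontals assemble into a lift that is
   continuous along the diagonal: the argument increments along two homotopic paths agree. *)
Lemma square_lift (s : R) (c : R -> R -> R[i]) : 0 <= s ->
  (forall p : R * R, ccvg (nbhs p) (fun q => c q.1 q.2) (c p.1 p.2)) ->
  (forall u v, nsq (c u v) = 1) ->
  forall D D0 D1, continuous D -> continuous D0 -> continuous D1 ->
  (forall u, u \in `[0, s] -> c u u = expi (D u)) ->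
  (forall v, v \in `[0, s] -> c 0 v = expi (D0 v)) ->
  (forall u, u \in `[0, s] -> c u s = expi (D1 u)) ->
  D s - D 0 = (D0 s - D0 0) + (D1 s - D1 0).
Proof.
move=> s0 cc c1 D D0 D1 Dc D0c D1c DE D0E D1E.
have p0 := pi_gt0 R.
have s_in : s \in `[0, s] by rewrite in_itv /= s0 lexx.
have z_in : 0 \in `[0, s] by rewrite in_itv /= s0 lexx.
have slice v : ccontinuous (fun u => c u v).
  move=> u; apply: (@ccvg_comp R (R * R)%type (nbhs u) (nbhs (u, v)) (fun q => c q.1 q.2)
    (fun x => (x, v)) _ (cc (u, v))).
  have i1 : (fun y : R => y) y @[y --> u] --> nbhs u by exact: cvg_id.
  have i2 : (fun _ : R => v) y @[y --> u] --> nbhs v by exact: cvg_cst.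
  exact: (cvg_pair i1 i2).
(* [H v] is the lift along the horizontal at height [v], normalized to start at [D0 v]; for [v]
   outside the segment any function will do. *)
have /choice[H HP] : forall v, exists Dv : R -> R, [/\ continuous Dv, Dv 0 = D0 v &
    v \in `[0, s] -> forall u, u \in `[0, s] -> c u v = expi (Dv u)].
  move=> v; have [Dv Dvc DvE] := unit_lift s0 (slice v) (fun u => c1 u v).
  have [vs|vs] := boolP (v \in `[0, s]); last first.
    by exists (fun=> D0 v); split=> //; move=> ?; exact: cvg_cst.
  have [k kE] := expi_eq (etrans (esym (DvE 0 z_in)) (D0E v vs)).
  exists (fun u => Dv u - k%:~R * (2 * pi)); split=> [u||_ u us].
  - by apply: cvgB; [exact: Dvc|exact: cvg_cst].
  - by rewrite kE addrK.
  - by rewrite -mulNr -mulrNz expiDint DvE.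
(* Lifts along neighbouring horizontals start close to each other, and they cannot drift apart since
   the cosine of their difference stays above [cos e]. *)
have close v e : v \in `[0, s] -> 0 < e -> e < pi / 2 -> \forall v' \near v,
    v' \in `[0, s] -> forall u, u \in `[0, s] -> `|H v' u - H v u| < e.
  move=> vs e0 ep.
  have h1 : \forall v' \near v, forall u, u \in `[0, s] -> 0 < reC (c u v' * (c u v)^*%C) - cos e.
    apply: (@near_segment_pos _ (nbhs v) _ 0 s (fun v' u => reC (c u v' * (c u v)^*%C) - cos e) (fun=> 1 - cos e)).
    move=> u us; split.
      rewrite subr_gt0 -cos0 ltr_cos ?in_itv /= ?lexx ?pi_ge0 ?(ltW e0)//; lra.
    apply: cvgB; last exact: cvg_cst.
    rewrite -(re_conj1 (c1 u v)).
    have [h _] // : ccvg (filter_prod (nbhs u) (nbhs v))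
       (fun p => c p.1 p.2 * (c p.1 v)^*%C) (c u v * (c u v)^*%C).
    apply: ccvgM; first exact: (cc (u, v)).
    by apply: ccvgJ; apply: ccvg_comp (slice v u) _; exact: cvg_fst.
  have h2 : \forall v' \near v, `|D0 v - D0 v'| < e.
    by have /cvgrPdist_lt/(_ _ e0) := D0c v.
  move: h1 h2; apply: filterS2 => v' h1 h2 vs' u us.
  have [c1' z1' E1] := HP v; have [c2' z2' E2] := HP v'.
  pose f x := H v' x - H v x.
  have fc : continuous f by move=> x; apply: cvgB; [exact: c2'|exact: c1'].
  have fcos x : x \in `[0, s] -> cos e < cos (f x).
    move=> xs; have := h1 x xs; rewrite subr_gt0 (E1 vs x xs) (E2 vs' x xs) expiJ -expiD.
    by [].
  have fpos x : x \in `[0, s] -> 0 < cos (f x).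
    move=> /fcos; apply: lt_trans; apply: cos_gt0_pihalf; apply/andP; split; lra.
  have f0 : `|f 0| < pi / 2 by rewrite /f z1' z2' distrC; lra.
  have := close_lifts fc fpos f0 us => fu.
  rewrite ltNge; apply/negP => ge; have := fcos u us; rewrite -(cos_norm (f u)).
  rewrite ltNge => /negP; apply; rewrite leNgt; apply/negP.
  rewrite ltr_cos ?in_itv /= ?normr_ge0 ?(ltW e0) /=; [lra|lra|lra].
(* The horizontal lifts read off on the diagonal: a continuous lift there, hence comparable with
   [D]. *)
pose K v := H (clamp 0 s v) (clamp 0 s v).
have Kc : continuous K.
  move=> v; pose w := clamp 0 s v; have ws : w \in `[0, s] := clamp_itv v s0.
  apply/cvgrPdist_lt => e e0.
  pose e' := Num.min (e / 2) (pi / 4).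
  have e'0 : 0 < e' by rewrite lt_min !divr_gt0.
  have e'p : e' < pi / 2 by rewrite gt_min; apply/orP; right; lra.
  have e'e : e' <= e / 2 by rewrite ge_min lexx.
  have h1 := @clamp_continuous 0 s v _ (close w e' ws e'0 e'p).
  have [wc _ _] := HP w.
  have /cvgrPdist_lt/(_ _ e'0) h2 : H w (clamp 0 s v') @[v' --> v] --> H w w.
    by apply: (cvg_realfun (g := H w)) (@clamp_continuous 0 s v); exact: wc.
  move: h1 h2; rewrite !near_simpl; apply: filterS2 => v' h1 h2.
  have := h1 (clamp_itv v' s0) _ (clamp_itv v' s0).
  rewrite /K -/w in h2 *; move: h2; rewrite !ltr_norml => /andP[? ?] /andP[? ?].
  by apply/andP; split; lra.
have KE u : u \in `[0, s] -> expi (D u) = expi (K u).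
  move=> us; have [_ _ E] := HP u; rewrite -DE// /K clamp_id//; exact: E.
rewrite (lift_unique s0 Dc Kc KE).
have [hc hz hE] := HP s.
have E1 : forall u, u \in `[0, s] -> expi (D1 u) = expi (H s u).
  by move=> u us; rewrite -D1E// hE.
rewrite (lift_unique s0 D1c hc E1) /K !clamp_id// hz.
have [_ -> _] := HP 0; lra.
Qed.

End Lifts.

(** * Polar decomposition *)

Section SymplecticGroup.
Variables (R : realType) (n : nat).
Implicit Types M A : 'M[R]_(n + n).
Local Notation J := (Jmx R n).

Lemma Jmx_tr : J^T = - J.
Proof.
by rewrite /Jmx tr_block_mx !trmx0 linearN /= trmx1 opp_block_mx oppr0 opprK.
Qed.

Lemma Jmx2 : J *m J = - 1%:M.
Proof.
rewrite /Jmx mulmx_block !(mul0mx, mulmx0, mulmx1, mul1mx, add0r, addr0, mulNmx, mulmxN).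
by rewrite (scalar_mx_block n n (1 : R)) opp_block_mx oppr0.
Qed.

Lemma Jmx_unit : J \in unitmx.
Proof.
have : J *m J \in unitmx.
  by rewrite Jmx2 unitmxE -scaleN1r detZ det1 mulr1 unitfE expf_neq0// oppr_eq0 oner_eq0.
by rewrite unitmx_mul => /andP[].
Qed.

Lemma symplectic_of M : M^T *m J *m M = J -> symplectic M.
Proof.
move=> E; split=> //; have : M^T *m J *m M \in unitmx by rewrite E Jmx_unit.
by rewrite unitmx_mul => /andP[].
Qed.

Lemma symplectic1 : @symplectic R n 1%:M.
Proof. by apply: symplectic_of; rewrite trmx1 mul1mx mulmx1. Qed.

Lemma symplecticM M A : symplectic M -> symplectic A -> symplectic (M *m A).
Proof.
move=> [_ sM] [_ sA]; apply: symplectic_of.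
rewrite trmx_mul; have -> : A^T *m M^T *m J *m (M *m A) = A^T *m (M^T *m J *m M) *m A.
  by rewrite !mulmxA.
by rewrite sM.
Qed.

Lemma symplecticX M m : symplectic M -> symplectic (M ^+ m).
Proof.
by move=> sM; elim: m => [|m IH]; [exact: symplectic1|rewrite exprS; exact: symplecticM].
Qed.

Lemma symplectic_inv_mul M : symplectic M -> (- (J *m M^T *m J)) *m M = 1%:M.
Proof.
by move=> [_ sM]; rewrite mulNmx -!mulmxA (mulmxA M^T) sM Jmx2 opprK.
Qed.

Lemma symplectic_invE M : symplectic M -> invmx M = - (J *m M^T *m J).
Proof.
move=> sM; have [uM _] := sM.
by rewrite -[RHS]mulmx1 -(mulmxV uM) mulmxA symplectic_inv_mul// mul1mx.
Qed.

Lemma symplectic_tr_mul M : symplectic M -> M *m J *m M^T = J.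
Proof.
move=> sM; have E := mulmx1C (symplectic_inv_mul sM).
have E2 : M *m J *m M^T *m J = - 1%:M.
  by rewrite -E mulmxN opprK !mulmxA.
have JJ : J *m (- J) = 1%:M by rewrite mulmxN Jmx2 opprK.
by rewrite -[LHS]mulmx1 -JJ mulmxA E2 mulNmx mul1mx opprK.
Qed.

Lemma symplectic_tr M : symplectic M -> symplectic M^T.
Proof. by move=> sM; apply: symplectic_of; rewrite trmxK symplectic_tr_mul. Qed.

Lemma symplecticJ : symplectic J.
Proof. by apply: symplectic_of; rewrite Jmx_tr mulNmx Jmx2 opprK mul1mx. Qed.

Lemma symplecticN M : symplectic M -> symplectic (- M).
Proof.
move=> [_ sM]; apply: symplectic_of.
have -> : (- M)^T = - M^T by exact: linearN.
by rewrite !(mulNmx, mulmxN) opprK sM.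
Qed.

Lemma symplecticV M : symplectic M -> symplectic (invmx M).
Proof.
move=> sM; rewrite symplectic_invE//; apply: symplecticN.
by apply: symplecticM symplecticJ; apply: symplecticM (symplectic_tr sM); exact: symplecticJ.
Qed.

Definition rotmx (u1 u2 : 'M[R]_n) : 'M[R]_(n + n) := block_mx u1 (- u2) u2 u1.

(** An orthogonal symplectic matrix commutes with [J], that is, it is complex linear. *)
Lemma orthosymplectic_block (U : 'M[R]_(n + n)) : U^T *m U = 1%:M -> symplectic U ->
  U = rotmx (ulsubmx U) (dlsubmx U).
Proof.
move=> oU [_ sU]; have oU' := mulmx1C oU.
have JU : J *m U = U *m J by rewrite -[LHS]mul1mx -oU' -!mulmxA (mulmxA U^T) sU.
move: JU; rewrite -[U]submxK /rotmx.
move: (ulsubmx U) (ursubmx U) (dlsubmx U) (drsubmx U) => p q r t.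
rewrite /Jmx block_mxKul block_mxKdl !mulmx_block.
rewrite !(mul0mx, mulmx0, mulmx1, mul1mx, add0r, addr0, mulNmx, mulmxN).
by move=> /eq_block_mx[E1 E2 _ _]; rewrite -E1 -[t]opprK E2 opprK.
Qed.

End SymplecticGroup.

Section Polar.
Variables (R : realType) (n : nat).
Local Notation C := R[i].
Local Notation J := (Jmx R n).
Local Open Scope sesquilinear_scope.

Lemma hposdef_unidiag N (G : 'M[C]_N) : hposdef G ->
  unidiag G (spectralmx G) (spectral_diag G) /\
  forall j, exists2 x : R, 0 < x & spectral_diag G 0 j = x%:C%C.
Proof.
move=> [hG pG].
have nG : G \is normalmx by apply/normalmxP; rewrite hG.
have Gd : unidiag G (spectralmx G) (spectral_diag G).
  split; first exact: spectral_unitarymx.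
  have /orthomx_spectralP {1}-> := nG.
  by rewrite (invmx_unitary (spectral_unitarymx _)).
split=> // j; have [uU GE] := Gd.
set U := spectralmx G in Gd uU GE *; set d := spectral_diag G in Gd GE *.
have v0 : row j U != 0.
  apply/eqP => v0; have /matrixP/(_ j j) := unitarymxP uU.
  rewrite mxE [RHS]mxE eqxx big1 => [/eqP|k _]; first by rewrite eq_sym oner_eq0.
  by have /rowP/(_ k) := v0; rewrite !mxE => ->; rewrite mul0r.
have dE : (row j U *m G *m (row j U)^t* ) 0 0 = d 0 j.
  have -> : row j U *m G = d 0 j *: row j U.
    by rewrite -row_mul (unidiag_mulmx Gd); apply/rowP => k; rewrite mul_diag_mx !mxE.
  rewrite -scalemxAl mxE.
  suff -> : (row j U *m (row j U)^t* ) 0 0 = 1 by rewrite mulr1.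
  have /matrixP/(_ j j) := unitarymxP uU; rewrite [in RHS]mxE eqxx => E; apply: etrans E.
  by rewrite !mxE; apply: eq_bigr => k _; rewrite !mxE.
have := pG _ v0; rewrite dE => d0.
have dreal : (d 0 j)^*%C = d 0 j.
  rewrite -dE; have E : ((row j U *m G *m (row j U)^t* )^t* ) = row j U *m G *m (row j U)^t*.
    by rewrite (trmxC_mul (row j U *m G)) (trmxC_mul (row j U)) trmxCK hG mulmxA.
  by rewrite -[in RHS]E [in RHS]mxE [in RHS]mxE.
exists (reC (d 0 j)) => //; move: dreal d0; case: (d 0 j) => x y [] /= h _.
by congr Complex; lra.
Qed.

Lemma hposdef_det N (G : 'M[C]_N) : hposdef G -> exists2 r : R, 0 < r & \det G = r%:C%C.
Proof.
move=> /hposdef_unidiag[[uU GE] dP].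
have -> : \det G = \prod_j spectral_diag G 0 j.
  rewrite {1}GE (det_mulmx (_ *m _)) (det_mulmx _ (diag_mx _)) mulrAC -det_mulmx (mulmx_unitaryE uU).
  by rewrite det1 mul1r det_diag.
apply: (big_ind (fun z : C => exists2 r : R, 0 < r & z = r%:C%C)).
- by exists 1.
- by move=> x y [r r0 ->] [r' r'0 ->]; exists (r * r'); [exact: mulr_gt0|rewrite rmorphM].
- by move=> j _; exact: dP.
Qed.

Lemma unidiag_sqr N (A U : 'M[C]_N) d : unidiag A U d ->
  unidiag (A *m A) U (\row_j (d 0 j ^+ 2)).
Proof.
move=> [uU ->]; split=> //; move: (U^t* ) (unitarymxP uU) => U' UU'.
have -> : U' *m diag_mx d *m U *m (U' *m diag_mx d *m U) =
   U' *m (diag_mx d *m (U *m U') *m diag_mx d) *m U by rewrite !mulmxA.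
rewrite UU' mulmx1 mulmx_diag.
suff -> : \row_j (d 0 j * d 0 j) = \row_j (d 0 j ^+ 2) by [].
by apply/rowP => j; rewrite !mxE.
Qed.

Lemma unidiag_hposdef N (W U : 'M[C]_N) d : unidiag W U d ->
  (forall j, exists2 x : R, 0 < x & d 0 j = x%:C%C) -> hposdef W.
Proof.
move=> Wd dP; have [uU WE] := Wd; split.
  have dJ : map_mx Num.conj d = d.
    by apply/rowP => j; rewrite mxE; have [x _ ->] := dP j; exact: conjc_real.
  by have [_ ->] := unidiag_trmxC Wd; rewrite dJ WE.
move=> v v0.
have -> : v *m W *m v^t* = (v *m U^t* ) *m diag_mx d *m (v *m U^t* )^t*.
  by rewrite WE (trmxC_mul v) (trmxCK U) !mulmxA.
have w0 : v *m U^t* != 0.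
  have uUC := unitarymx_unit (unitaryC uU).
  by rewrite mulmx_free_eq0 ?v0// row_free_unit uUC.
move: (v *m U^t* ) w0 => w w0.
have -> : reC ((w *m diag_mx d *m w^t* ) 0 0) = \sum_j nsq (w 0 j) * reC (d 0 j).
  rewrite mxE raddf_sum /=; apply: eq_bigr => j _; rewrite mul_mx_diag mxE [(w^t* ) _ _]mxE [_^T _ _]mxE.
  have -> : w 0 j * d 0 j * Num.conj (w 0 j) = (nsq (w 0 j))%:C%C * d 0 j.
    by rewrite nsqE -[(w 0 j)^*%C]/(Num.conj (w 0 j)); move: (Num.conj _) => c; ring.
  by case: (d 0 j) => x y /=; ring.
have ge0 j : 0 <= nsq (w 0 j) * reC (d 0 j).
  by rewrite mulr_ge0 ?nsq_ge0//; have [x /ltW x0 ->] := dP j.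
rewrite lt_neqAle sumr_ge0 ?andbT// eq_sym psumr_eq0//; apply: contra w0 => /allP H.
apply/eqP/rowP => j; have := H j (mem_index_enum _); rewrite mulf_eq0 => /orP[|].
  by rewrite nsq_eq0 mxE => /eqP.
by have [x x0 ->] := dP j; rewrite /= gt_eqF.
Qed.

(** Where the overlap of the eigenbases is nonzero the squared eigenvalues agree, hence so do the
    positive eigenvalues; the distance identity for [G] and [G'] then gives [0]. *)
Lemma hposdef_sqrt_unique N (G G' : 'M[C]_N) : hposdef G -> hposdef G' ->
  G *m G = G' *m G' -> G = G'.
Proof.
move=> /hposdef_unidiag[Gd dP] /hposdef_unidiag[Gd' dP'] E.
have := overlap_dist (unidiag_sqr Gd) (unidiag_sqr Gd').
rewrite E subrr.
have -> : fro (0 : 'M[C]_N) = 0.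
  by rewrite /fro !big1// => i _; rewrite big1// => j _; rewrite mxE /nsq/= expr0n/= addr0.
have ge0 (i j : 'I_N) : 0 <= overlap (spectralmx G) (spectralmx G') i j *
    nsq ((\row_j (spectral_diag G 0 j ^+ 2)) 0 i - (\row_j (spectral_diag G' 0 j ^+ 2)) 0 j :> C).
  by rewrite mulr_ge0 ?overlap_ge0 ?nsq_ge0.
move=> /eqP; rewrite psumr_eq0 => [/allP H|i _]; last by apply: sumr_ge0 => j _; exact: ge0.
apply/eqP; rewrite -subr_eq0; apply/eqP/fro_eq0.
rewrite -(overlap_dist Gd Gd') big1// => i _; rewrite big1// => j _.
have := H i (mem_index_enum _); rewrite psumr_eq0 => [/allP/(_ j (mem_index_enum _))|k _]; last exact: ge0.
rewrite mulf_eq0 => /orP[/eqP->|]; first by rewrite mul0r.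
rewrite nsq_eq0 !mxE; have [x x0 ->] := dP i; have [y y0 ->] := dP' j.
rewrite subr_sqr mulf_eq0 => /orP[/eqP->|]; first by rewrite /nsq /= expr0n /= addr0 mulr0.
rewrite -rmorphD /= => /eqP [] xy; have := addr_gt0 x0 y0; rewrite xy ltxx.
by [].
Qed.

Lemma hposdef_sqrt N (G : 'M[C]_N) : hposdef G -> exists2 B, hposdef B & B *m B = G.
Proof.
move=> pG; have [[uU GE] dP] := hposdef_unidiag pG.
set U := spectralmx G in uU GE; set d := spectral_diag G in GE dP.
pose e : 'rV[C]_N := \row_j (Num.sqrt (reC (d 0 j)))%:C%C.
have eP j : exists2 x : R, 0 < x & e 0 j = x%:C%C.
  by have [x x0 E] := dP j; exists (Num.sqrt x); rewrite ?sqrtr_gt0// mxE E.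
have Bd : unidiag (U^t* *m diag_mx e *m U) U e by [].
exists (U^t* *m diag_mx e *m U); first exact: unidiag_hposdef Bd eP.
have [_ ->] := unidiag_sqr Bd; rewrite [RHS]GE.
suff -> : \row_j (e 0 j ^+ 2) = d by [].
apply/rowP => j; rewrite !mxE; have [x x0 ->] := dP j.
by rewrite -rmorphXn /= sqr_sqrtr// ltW.
Qed.

Lemma hposdefV N (G : 'M[C]_N) : hposdef G -> G \in unitmx /\ hposdef (invmx G).
Proof.
move=> pG; have [r r0 E] := hposdef_det pG; have [hG _] := pG.
have uG : G \in unitmx by rewrite unitmxE E unitfE; apply/eqP => -[] /eqP; rewrite gt_eqF.
split=> //; have hV : (invmx G)^t* = invmx G.
  have E1 : (invmx G)^t* *m G = 1%:M by rewrite -{2}hG -(trmxC_mul G) mulmxV// trmxC1.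
  by rewrite -[LHS]mulmx1 -(mulmxV uG) mulmxA E1 mul1mx.
have uV : invmx G \in unitmx by rewrite unitmx_inv.
by have := hposdef_congr uV pG; rewrite hV (mulVmx uG) mul1mx.
Qed.

Lemma hposdef_real k (A : 'M[R]_k) : hposdef (cmx A) -> posdef A.
Proof.
move=> [hA pA]; split.
  apply/matrixP => i j; have /matrixP/(_ i j) := hA.
  by rewrite trmxC_cmx !mxE => -[].
move=> v v0; have w0 : (cmx v)^t* != 0 :> 'rV[C]_k.
  rewrite trmxC_cmx; apply: contra v0 => /eqP/rowP h; apply/eqP/colP => j.
  by have := h j; rewrite !mxE => -[].
have := pA _ w0; rewrite trmxCK trmxC_cmx -[cmx v^T *m _]map_mxM -[_ *m cmx v]map_mxM.
by rewrite mxE.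
Qed.

Lemma symplectic_tr_id (H : 'M[R]_(n + n)) : symplectic H -> H^T = H ->
  invmx H = J *m H *m invmx J.
Proof.
move=> sH hH; rewrite symplectic_invE// hH (symplectic_invE (symplecticJ R n)) Jmx_tr.
rewrite !mulmxN mulNmx !mulmxN; congr (- _).
by rewrite Jmx2 mulNmx mul1mx mulmxN opprK.
Qed.

(* The positive square root is unique, hence real and symplectic when its square is. *)
Lemma symplectic_sqrt (H : 'M[R]_(n + n)) : symplectic H -> posdef H ->
  exists A, [/\ posdef A, symplectic A & A *m A = H].
Proof.
move=> sH pH; have pcH := hposdef_cmx pH; have [hH _] := pH.
have [B pB BB] := hposdef_sqrt pcH.
have [uB pVB] := hposdefV pB.
have Breal : map_mx Num.conj B = B.
  apply: (hposdef_sqrt_unique _ pB); last by rewrite -map_mxM BB map_conj_cmx.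
  have [hB pos] := pB; split.
    apply/matrixP => i j; have /matrixP/(_ i j) := hB; rewrite !mxE => E.
    by rewrite -[in RHS]E.
  move=> v v0; have w0 : map_mx Num.conj v != 0.
    by rewrite map_mx_eq0.
  have -> : (v *m map_mx Num.conj B *m v^t* ) 0 0 =
      Num.conj ((map_mx Num.conj v *m B *m (map_mx Num.conj v)^t* ) 0 0).
    have -> : v *m map_mx Num.conj B *m v^t* =
      map_mx Num.conj (map_mx Num.conj v *m B *m (map_mx Num.conj v)^t* ).
      rewrite !map_mxM /=; congr (_ *m _ *m _).
        by apply/matrixP => i j; rewrite !mxE [RHS]conjcK.
      by apply/matrixP => i j; rewrite !mxE [RHS]conjcK.
    by rewrite mxE.
  by have := pos _ w0; case: (_ 0 0).
have [A BA] : exists A : 'M[R]_(n + n), B = cmx A.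
  exists (map_mx (@complex.Re R) B); apply/matrixP => i j; rewrite !mxE.
  have /matrixP/(_ i j) := Breal; rewrite mxE; case: (B i j) => x y [] /= h.
  by congr Complex; lra.
have cI k (X Y : 'M[R]_k) : cmx X = cmx Y -> X = Y.
  by move=> /matrixP E; apply/matrixP => i j; have := E i j; rewrite !mxE => -[].
have AA : A *m A = H by apply: cI; rewrite cmxM -BA.
have pA : posdef A by apply: hposdef_real; rewrite -BA.
have uA : A \in unitmx.
  have [uH _] := sH; by move: uH; rewrite -AA unitmx_mul => /andP[].
have [hA _] := pA.
have uJ := Jmx_unit R n.
(* [A'] is positive and squares to [J H^-1 J^-1 = H], so it is the same root; the equality [A = A']
   says that [A] is symplectic. *)
pose A' := J *m invmx A *m invmx J.
have VJ : invmx J = J^T by rewrite (symplectic_invE (symplecticJ R n)) Jmx_tr mulmxN mulNmx opprK Jmx2 mulNmx mul1mx.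
have AA' : A = A'.
  apply: cI; apply: hposdef_sqrt_unique.
  - by rewrite -BA.
  - rewrite /A' cmxM cmxM VJ -trmxC_cmx; apply: hposdef_congr.
      by rewrite /cmx map_unitmx.
    by rewrite /cmx map_invmx -/(cmx A) -BA.
  rewrite -!cmxM; congr cmx; rewrite AA /A'.
  have -> : J *m invmx A *m invmx J *m (J *m invmx A *m invmx J) =
    J *m (invmx A *m (invmx J *m J) *m invmx A) *m invmx J by rewrite !mulmxA.
  have VV : invmx A *m invmx A = invmx H.
    apply: (can_inj (mulmxK uA)); apply: (can_inj (mulmxK uA)).
    rewrite -(mulmxA _ (invmx A) A) mulVmx// mulmx1 mulVmx// -mulmxA AA mulVmx//.
    by have [] := sH.
  rewrite (mulVmx uJ) mulmx1 VV (symplectic_tr_id sH hH).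
  have JJ : J *m J = - 1%:M := Jmx2 R n.
  have VJVJ : invmx J *m invmx J = - 1%:M by rewrite VJ Jmx_tr mulmxN mulNmx opprK JJ.
  rewrite !mulmxA JJ -(mulmxA _ (invmx J) (invmx J)) VJVJ mulNmx mul1mx mulmxN mulmx1 opprK.
  by [].
exists A; split=> //; apply: symplectic_of; rewrite hA {1}AA' /A' -!mulmxA.
by rewrite (mulmxA (invmx J)) (mulVmx uJ) mul1mx (mulVmx uA) mulmx1.
Qed.

End Polar.

Section PolarAngle.
Variables (R : realType) (n : nat).
Local Notation C := R[i].
Local Open Scope sesquilinear_scope.

Lemma mulmx_rotblocks (S : comNzRingType) (w : S) (a b c d : 'M[S]_n) :
  block_mx 1%:M w%:M 1%:M (- w%:M) *m block_mx a b c d *m block_mx 1%:M 1%:M (- w%:M) w%:M =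
  block_mx (a + w *: c - w *: (b + w *: d)) (a + w *: c + w *: (b + w *: d))
           (a - w *: c - w *: (b - w *: d)) (a - w *: c + w *: (b - w *: d)).
Proof.
by rewrite !mulmx_block !mul1mx !mulmx1 !mulNmx !mulmxN !mul_scalar_mx !mul_mx_scalar.
Qed.

Lemma Gm_blocks (a b c d : 'M[R]_n) :
  ulsubmx (Gm (block_mx a b c d)) = 2^-1 *: (cmx (a + d) + 'i%C *: cmx (c - b)) /\
  dlsubmx (Gm (block_mx a b c d)) = 2^-1 *: (cmx (a - d) - 'i%C *: cmx (c + b)).
Proof.
have -> : Gm (block_mx a b c d) = 2^-1 *:
   (block_mx 1%:M ('i%C)%:M 1%:M (- ('i%C)%:M) *m block_mx (cmx a) (cmx b) (cmx c) (cmx d) *m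
    block_mx 1%:M 1%:M (- ('i%C)%:M) ('i%C)%:M).
  have NE : (- 'i%C)%:M = - ('i%C)%:M :> 'M[C]_n by rewrite raddfN.
  by rewrite /Gm TmCE /Tm NE /cmx map_block_mx.
rewrite mulmx_rotblocks scale_block_mx block_mxKul block_mxKdl.
have ii : 'i%C * 'i%C = -1 :> R[i] := sqr_i R.
have cD (u v : 'M[R]_n) : cmx (u + v) = cmx u + cmx v by exact: map_mxD.
have cB (u v : 'M[R]_n) : cmx (u - v) = cmx u - cmx v by exact: map_mxB.
rewrite !cB !cD.
move: (cmx a) (cmx b) (cmx c) (cmx d) 'i%C ii => {a b c d}a b c d I ii.
split; apply: (congr1 (GRing.scale 2^-1)); rewrite !scalerBr !scalerDr !scalerA ii scaleN1r.
  by rewrite opprD opprK [- _ + d]addrC addrACA.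
by rewrite !opprD !opprK [- _ - d]addrC addrACA.
Qed.

Lemma Gm_rotmx (u1 u2 : 'M[R]_n) : ulsubmx (Gm (rotmx u1 u2)) = cmx u1 + 'i%C *: cmx u2 /\
  dlsubmx (Gm (rotmx u1 u2)) = 0.
Proof.
have [-> ->] := Gm_blocks u1 (- u2) u2 u1; split; apply/matrixP => i j; rewrite !mxE.
  move: (u1 i j) (u2 i j) => x y.
  by apply/eqP; rewrite eq_complex /=; apply/andP; split; apply/eqP; field.
move: (u1 i j) (u2 i j) => x y.
by apply/eqP; rewrite eq_complex /=; apply/andP; split; apply/eqP; ring.
Qed.

Lemma mulmx_block_ul (S : pzRingType) (A B : 'M[S]_(n + n)) : dlsubmx B = 0 ->
  ulsubmx (A *m B) = ulsubmx A *m ulsubmx B.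
Proof.
move=> B0; rewrite -{1}[A]submxK -{1}[B]submxK mulmx_block B0 block_mxKul.
by rewrite mulmx0 addr0.
Qed.

Lemma adet_mul_rotmx (A : 'M[R]_(n + n)) (u1 u2 : 'M[R]_n) :
  adet (A *m rotmx u1 u2) = adet A * \det (cmx u1 + 'i%C *: cmx u2).
Proof.
have [E1 E2] := Gm_rotmx u1 u2.
rewrite /adet (GmM A) (mulmx_block_ul (Gm A) E2) det_mulmx.
exact: (congr1 (fun B => _ * \det B) E1).
Qed.

Lemma hposdef_ulsubmx (G : 'M[C]_(n + n)) : hposdef G -> hposdef (ulsubmx G).
Proof.
move=> [hG pG]; have [hul _ _ _] : [/\ (ulsubmx G)^t* = ulsubmx G, (dlsubmx G)^t* = ursubmx G,
    (ursubmx G)^t* = dlsubmx G & (drsubmx G)^t* = drsubmx G].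
  by move: hG; rewrite -[G]submxK trmxC_block => /eq_block_mx[]; rewrite !block_mxKul !block_mxKur
    !block_mxKdl !block_mxKdr.
split=> // v v0; have w0 : row_mx v 0 != 0 :> 'rV[C]_(n + n).
  by apply: contra v0 => /eqP E; rewrite -[v](row_mxKl v (0 : 'rV[C]_n)) E linear0.
have := pG _ w0; rewrite -{1}[G]submxK mul_row_block !mul0mx !addr0.
rewrite tr_row_mx map_col_mx trmx0 map_mx0 mul_row_col mulmx0 addr0.
exact.
Qed.

Lemma adet_posdef (A : 'M[R]_(n + n)) : posdef A -> exists2 r : R, 0 < r & adet A = r%:C%C.
Proof. by move=> /hposdef_Gm /hposdef_ulsubmx /hposdef_det. Qed.

Lemma is_arg_polar (r D : R) (M : 'M[R]_(n + n)) : 0 < r -> adet M = r%:C%C * expi D -> is_arg M D.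
Proof.
move=> r0 E; rewrite /is_arg {1}E; congr (_%:C%C * _).
by rewrite E nsqM nsq_expi mulr1 /nsq /= expr0n /= addr0 sqrtr_sqr gtr0_norm.
Qed.

(** The positive factor multiplies [adet] by a positive number, its upper left block in complex
    coordinates being positive definite, and the rotation by [\det (u1 + i u2)]. Conversely the
    decomposition is built from the positive root of [M M^T]. *)
Lemma polar_angleP (M : 'M[R]_(n + n)) D : symplectic M -> polar_angle M D <-> is_arg M D.
Proof.
move=> sM; split.
  move=> [A [u1 [u2 [pA sA [oU sU] -> dU]]]].
  have [r r0 rE] := adet_posdef pA.
  by apply: (is_arg_polar r0); rewrite -/(rotmx u1 u2) adet_mul_rotmx rE dU.
move=> DM; have sMt := symplectic_tr sM; have sH := symplecticM sM sMt.
have [uM _] := sM.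
have pH : posdef (M *m M^T).
  split; first by rewrite trmx_mul trmxK.
  move=> v v0; have -> : v^T *m (M *m M^T) *m v = (M^T *m v)^T *m (M^T *m v).
    by rewrite trmx_mul trmxK !mulmxA.
  have w0 : M^T *m v != 0.
    apply: contra v0 => /eqP E; apply/eqP.
    have uMt : M^T \in unitmx by rewrite unitmx_tr.
    by rewrite -(mulKmx uMt v) E mulmx0.
  move: (M^T *m v) w0 => w w0; rewrite mxE.
  have ge0 i : 0 <= w^T 0 i * w i 0 by rewrite mxE -expr2 sqr_ge0.
  rewrite lt_neqAle sumr_ge0 ?andbT// eq_sym psumr_eq0//; apply: contra w0 => /allP H.
  apply/eqP/colP => j; have := H j (mem_index_enum _).
  by rewrite [w^T _ _]mxE -expr2 sqrf_eq0 mxE => /eqP.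
have [A [pA sA AA]] := symplectic_sqrt sH pH.
have [uA _] := sA; have [hA _] := pA.
pose U := invmx A *m M.
have sU : symplectic U := symplecticM (symplecticV sA) sM.
have oU : U^T *m U = 1%:M.
  have E : invmx A *m invmx A = (invmx M)^T *m invmx M.
    apply: (can_inj (mulmxK uA)); apply: (can_inj (mulmxK uA)).
    rewrite -(mulmxA _ (invmx A) A) mulVmx// mulmx1 mulVmx// -!mulmxA AA (mulmxA (invmx M)) mulVmx//.
    by rewrite mul1mx -trmx_mul mulmxV// trmx1.
  have -> : U^T *m U = M^T *m (invmx A *m invmx A) *m M.
    by rewrite /U trmx_mul trmx_inv hA !mulmxA.
  by rewrite E !mulmxA -trmx_mul mulVmx// trmx1 mul1mx mulVmx.
have UE := orthosymplectic_block oU sU.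
have ME : M = A *m U by rewrite /U mulmxA mulmxV// mul1mx.
exists A, (ulsubmx U), (dlsubmx U); split=> //; rewrite -?/(rotmx _ _) -?UE//.
have [r r0 rE] := adet_posdef pA.
set u := \det _; have E : adet M = r%:C%C * u by rewrite {1}ME {1}UE adet_mul_rotmx rE.
(* [Gm U] is unitary with vanishing lower left block, so its upper left block is unitary and has a
   determinant of modulus one. *)
have nu : nsq u = 1.
  have sP := Sm_unitary sU; have -> : u = adet U.
    by rewrite UE /adet; have [-> _] := Gm_rotmx (ulsubmx U) (dlsubmx U).
  have E1 : (ulsubmx (Gm U))^t* *m ulsubmx (Gm U) = 1%:M.
    have := Gm_trmxC U; have : Gm U^T *m Gm U = 1%:M by rewrite -GmM oU Gm_scalar.
    move=> h1 h2; move: h1; rewrite -h2.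
    have dl0 : dlsubmx (Gm U) = 0 by rewrite UE; have [_ ->] := Gm_rotmx (ulsubmx U) (dlsubmx U).
    rewrite -[Gm U]submxK dl0 trmxC_block mulmx_block trmxC0 (scalar_mx_block n n 1).
    by move=> /eq_block_mx[+ _ _ _]; rewrite mul0mx addr0 !block_mxKul.
  have := congr1 (fun X : 'M[C]_n => \det X) E1; rewrite /= det_mulmx det1 det_map_mx det_tr.
  rewrite mulrC -/(adet U) => E2; have := nsqE (adet U); rewrite -[_ * _]/(adet U * Num.conj (adet U)) E2.
  by move=> [].
have [/andP[_ _] uE] := angP nu; rewrite uE.
suff -> : expi D = expi (ang u) by [].
have s0 := sqrt_nsq_gt0 (adet_neq0 sM).
by apply: (polar_unique s0 r0); rewrite -uE -E -DM.
Qed.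

End PolarAngle.

Section PathArguments.
Variables (R : realType) (n : nat).

Lemma rcvgP (T : Type) (F : set_system T) (FF : Filter F) k l (A : T -> 'M[R]_(k, l)) B :
  A t @[t --> F] --> B <-> rcvg F A B.
Proof.
split=> [AB i j|AB].
  apply/cvgrPdist_lt => e e0; have /cvg_ballP/(_ e e0) := AB.
  by apply: filterS => t [_ /(_ i j)].
apply/cvg_ballP => e e0; have : \forall t \near F, forall i j, ball (B i j) e (A t i j).
  apply: filter_forall => i; apply: filter_forall => j.
  by have /cvgrPdist_lt/(_ _ e0) := AB i j.
by apply: filterS => t h; split.
Qed.

Lemma ccontinuous_adet (g : R -> 'M[R]_(n + n)) : (forall t, symplectic (g t)) -> continuous g ->
  ccontinuous (fun t => adet (g t)).
Proof. by move=> sg gc t; apply: ccvg_adet; apply/rcvgP; exact: gc. Qed.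

Lemma path_clamp a b (g : R -> 'M[R]_(n + n)) : a <= b -> is_path a b g ->
  continuous (g \o clamp a b) /\ forall t, symplectic ((g \o clamp a b) t).
Proof.
move=> ab [gc sg]; split; first exact: within_clamp.
by move=> t; apply: sg; exact: clamp_itv.
Qed.

Lemma path_arg a b (g : R -> 'M[R]_(n + n)) : a <= b -> is_path a b g ->
  exists2 D : R -> R, continuous D & forall t, t \in `[a, b] -> is_arg (g t) (D t).
Proof.
move=> ab gp; have [gc sg] := path_clamp ab gp.
have an0 t : adet ((g \o clamp a b) t) != 0 by apply: adet_neq0; exact: sg.
have ac : ccontinuous (fun t => adet ((g \o clamp a b) t)) by exact: ccontinuous_adet.
have [D Dc DE] := lift_exists ab ac an0.
exists D; first exact: Dc.
move=> t tab; have := DE t tab; rewrite /is_arg /comp (clamp_id tab); exact.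
Qed.

(** Two lifts of the same angle have the same increment, so the total angle can be computed with any
    continuous argument of [adet]. *)
Lemma total_angle_path a b (g : R -> 'M[R]_(n + n)) D : a <= b -> is_path a b g ->
  continuous D -> (forall t, t \in `[a, b] -> is_arg (g t) (D t)) ->
  forall r, total_angle a b g r <-> r = D b - D a.
Proof.
move=> ab [gc sg] Dc DE r; split; last first.
  move=> ->; exists D; split=> //; first exact: continuous_within.
  by move=> t tab; apply/(polar_angleP _ (sg t tab)); exact: DE.
move=> [D' [D'c D'E ->]].
have aab : a \in `[a, b] by rewrite in_itv /= lexx.
have bab : b \in `[a, b] by rewrite in_itv /= lexx andbT.
have := lift_unique ab (within_clamp ab D'c) Dc; rewrite /= !clamp_id//; apply=> t tab.
rewrite clamp_id//; have /(polar_angleP _ (sg t tab)) h1 := D'E t tab; have h2 := DE t tab.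
have s0 := sqrt_nsq_gt0 (adet_neq0 (sg t tab)).
by apply: (polar_unique s0 s0); rewrite -h1 -h2.
Qed.

End PathArguments.

Notation nondeg := Defs.nondegenerate.

(** * Components of the nondegenerate symplectic matrices *)

Section BilinearForm.
Variables (S : comNzRingType) (N : nat).
Implicit Types (x y : 'cV[S]_N) (A B : 'M[S]_N).

Definition bform x y A : S := (x^T *m A *m y) 0 0.

Lemma bformDl x x' y A : bform (x + x') y A = bform x y A + bform x' y A.
Proof. by rewrite /bform linearD !mulmxDl mxE. Qed.

Lemma bformDr x y y' A : bform x (y + y') A = bform x y A + bform x y' A.
Proof. by rewrite /bform mulmxDr mxE. Qed.

Lemma bformZl c x y A : bform (c *: x) y A = c * bform x y A.
Proof. by rewrite /bform linearZ -!scalemxAl mxE. Qed.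

Lemma bformZr c x y A : bform x (c *: y) A = c * bform x y A.
Proof. by rewrite /bform -scalemxAr mxE. Qed.

Lemma bformNl x y A : bform (- x) y A = - bform x y A.
Proof. by rewrite -scaleN1r bformZl mulN1r. Qed.

Lemma bformNr x y A : bform x (- y) A = - bform x y A.
Proof. by rewrite -scaleN1r bformZr mulN1r. Qed.

Lemma bformNm x y A : bform x y (- A) = - bform x y A.
Proof. by rewrite /bform mulmxN mulNmx mxE. Qed.

Lemma bform_tr x y A : bform x y A = bform y x A^T.
Proof.
have E (B : 'M[S]_1) : B 0 0 = B^T 0 0 by rewrite mxE.
by rewrite /bform E !trmx_mul !trmxK mulmxA.
Qed.

Lemma bform_mulr x y A B : bform x y (A *m B) = bform x (B *m y) A.
Proof. by rewrite /bform !mulmxA. Qed.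

Lemma bform_mull x y A B : bform (A *m x) y B = bform x y (A^T *m B).
Proof. by rewrite /bform trmx_mul !mulmxA. Qed.

Lemma rank1_mulmx (u x : 'cV[S]_N) A : u *m u^T *m A *m x = bform u x A *: u.
Proof.
rewrite -!mulmxA (mulmxA u^T) [u^T *m A *m x]mx11_scalar mul_mx_scalar.
by rewrite /bform.
Qed.

Lemma bform_delta i j A : bform (delta_mx i 0) (delta_mx j 0) A = A i j.
Proof. by rewrite /bform trmx_delta -rowE -colE !mxE. Qed.

End BilinearForm.

Section TwoForms.
Variable R : realType.
Variable N : nat.

Lemma alt_bform (F : numFieldType) (x : 'cV[F]_N) A : A^T = - A -> bform x x A = 0.
Proof.
move=> AT; have := bform_tr x x A; rewrite AT bformNm => /eqP.
by rewrite -subr_eq0 opprK -mulr2n mulrn_eq0 /= => /eqP.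
Qed.

Lemma fun_neq0 (a : 'cV[R]_N) : a != 0 -> (a^T *m a) 0 0 != 0.
Proof.
apply: contra => /eqP; rewrite mxE => E; apply/eqP/colP => i; rewrite mxE.
have /eqP := E; rewrite psumr_eq0; last by move=> j _; rewrite mxE -expr2 sqr_ge0.
by move=> /allP/(_ i (mem_index_enum _)); rewrite mxE -expr2 sqrf_eq0 => /eqP.
Qed.

Lemma two_functionals (a b : 'cV[R]_N) : a != 0 -> b != 0 ->
  exists y : 'cV[R]_N, (a^T *m y) 0 0 != 0 /\ (b^T *m y) 0 0 != 0.
Proof.
move=> /fun_neq0 a0 /fun_neq0 b0.
have [E1|E1] := eqVneq ((b^T *m a) 0 0) 0; last by exists a.
have [E2|E2] := eqVneq ((a^T *m b) 0 0) 0; last by exists b.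
by exists (a + b); split; rewrite mulmxDr mxE ?E1 ?E2 ?addr0 ?add0r.
Qed.

Lemma alt_of_bform (A : 'M[R[i]]_N) :
  (forall u : 'cV[R]_N, bform (cmx u) (cmx u) A = 0) -> A^T = - A.
Proof.
move=> H.
have D i : A i i = 0.
  by have := H (delta_mx i 0); rewrite /cmx map_delta_mx bform_delta.
apply/matrixP => i j; rewrite !mxE; have := H (delta_mx i 0 + delta_mx j 0).
rewrite /cmx map_mxD !map_delta_mx !bformDl !bformDr !bform_delta !D addr0 add0r => /eqP.
by rewrite addr_eq0 => /eqP ->; rewrite opprK.
Qed.

(** [a + s b] and [c + s d] vanish for at most one [s] each, so one of the nonzero values [1], [2],
    [-1] avoids both zeros. *)
Lemma three_values (a b c d : R) : a != 0 -> d != 0 ->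
  exists s : R, a + s * b != 0 /\ s * c + s ^+ 2 * d != 0.
Proof.
move=> a0 d0.
suff [s [s0 h1 h2]] : exists s : R, [/\ s != 0, a + s * b != 0 & c + s * d != 0].
  exists s; split=> //; rewrite expr2 -mulrA -mulrDr mulf_neq0//.
have [E1|E1] := eqVneq (a + b) 0; have [E2|E2] := eqVneq (c + d) 0.
- exists 2; split; first by rewrite pnatr_eq0.
    by apply: contra a0 => /eqP H; apply/eqP; move: H E1; lra.
  by apply: contra d0 => /eqP H; apply/eqP; move: H E2; lra.
- have [E3|E3] := eqVneq (c + 2 * d) 0.
    exists (-1); split; first by rewrite oppr_eq0 oner_eq0.
      by apply: contra a0 => /eqP H; apply/eqP; move: H E1; lra.
    by apply: contra d0 => /eqP H; apply/eqP; move: H E3; lra.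
  exists 2; split; rewrite ?pnatr_eq0//.
  by apply: contra a0 => /eqP H; apply/eqP; move: H E1; lra.
- have [E3|E3] := eqVneq (a + 2 * b) 0.
    exists (-1); split; first by rewrite oppr_eq0 oner_eq0.
      by apply: contra a0 => /eqP H; apply/eqP; move: H E3; lra.
    by apply: contra d0 => /eqP H; apply/eqP; move: H E2; lra.
  exists 2; split; rewrite ?pnatr_eq0//.
  by apply: contra d0 => /eqP H; apply/eqP; move: H E2; lra.
- by exists 1; rewrite !mul1r oner_eq0; split.
Qed.

(** If neither [v] nor [w] serves both forms, then along [v + s w] the first form is affine in [s]
    and the second is [s] times an affine function; [three_values] applies. *)
Lemma common_nonzero (A : 'M[R]_N) (q : 'cV[R]_N -> R) (B : 'M[R[i]]_N) (v w : 'cV[R]_N) :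
  (forall u, (q u)%:C%C = bform (cmx u) (cmx u) B) ->
  bform v v A != 0 -> q w != 0 -> exists x, bform x x A != 0 /\ q x != 0.
Proof.
move=> qE v0 w0.
have [E1|E1] := eqVneq (bform w w A) 0; last by exists w.
have [E2|E2] := eqVneq (q v) 0; last by exists v.
pose c := reC (bform (cmx v) (cmx w) B + bform (cmx w) (cmx v) B).
have [s [h1 h2]] := three_values (bform v w A + bform w v A) c v0 w0.
exists (v + s *: w); split.
  suff -> : bform (v + s *: w) (v + s *: w) A = bform v v A + s * (bform v w A + bform w v A) by [].
  by rewrite !bformDl !bformDr !bformZl !bformZr E1; ring.
suff -> : q (v + s *: w) = s * c + s ^+ 2 * q w by [].
have re (x : R) : x = reC (x%:C%C) by [].
rewrite (re (q (v + _))) (re (q w)) !qE /cmx map_mxD map_mxZ !bformDl !bformDr !bformZl !bformZr -!qE E2.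
rewrite /c /cmx; move: (bform _ _ B) (bform _ (map_mx _ v) B) => [x1 y1] [x2 y2] /=.
by ring.
Qed.

End TwoForms.

Section Connection.
Variables (R : realType) (z : R[i]).
Hypothesis z1 : nsq z = 1.
Local Notation C := R[i].

Lemma nondegP n (M : 'M[R]_(n + n)) :
  nondeg z M <-> forall x : 'cV[C]_(n + n), cmx M *m x = z *: x -> x = 0.
Proof.
rewrite /Defs.nondegenerate; split=> [d0 x Mx|H].
  have u : cmx M - z%:M \in unitmx by rewrite unitmxE unitfE.
  by rewrite -(mulKmx u x) mulmxBl Mx mul_scalar_mx subrr mulmx0.
apply/negP => /eqP; rewrite -det_tr => /eqP/det0P[v v0 vE]; move/negP: v0; apply; apply/eqP.
rewrite -[v]trmxK [v^T]H ?trmx0//; apply/eqP; rewrite -subr_eq0 -mul_scalar_mx -mulmxBl.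
by rewrite -[_ - _]trmxK -trmx_mul vE trmx0.
Qed.

Definition rcontinuous k l (b : R -> 'M[R]_(k, l)) := forall t, rcvg (nbhs t) b (b t).

Definition conn n (M M' : 'M[R]_(n + n)) := exists b : R -> 'M[R]_(n + n),
  [/\ rcontinuous b, forall t, symplectic (b t) /\ nondeg z (b t), b 0 = M & b 1 = M'].

Lemma rcontinuous_comp k l (b : R -> 'M[R]_(k, l)) (f : R -> R) :
  rcontinuous b -> continuous f -> rcontinuous (b \o f).
Proof.
move=> bc fc t i j; rewrite /comp; exact: (cvg_comp _ _ (fc t) (bc (f t) i j)).
Qed.

Lemma conn_itv n (b : R -> 'M[R]_(n + n)) : rcontinuous b ->
  (forall t, t \in `[0, 1] -> symplectic (b t) /\ nondeg z (b t)) -> conn (b 0) (b 1).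
Proof.
move=> bc H; exists (b \o clamp 0 1); split.
- by apply: rcontinuous_comp => //; exact: clamp_continuous.
- by move=> t; apply: H; exact: clamp_itv.
- by rewrite /= clamp_id// in_itv /= lexx ler01.
- by rewrite /= clamp_id// in_itv /= lexx ler01.
Qed.

Lemma conn_refl n (M : 'M[R]_(n + n)) : symplectic M -> nondeg z M -> conn M M.
Proof. by move=> sM nM; exists (fun=> M); split=> // t; exact: rcvg_cst. Qed.

Lemma conn_sym n (M M' : 'M[R]_(n + n)) : conn M M' -> conn M' M.
Proof.
move=> [b [bc sb <- <-]]; exists (fun t => b (1 - t)); split.
- apply: (rcontinuous_comp bc) => t; apply: cvgB; [exact: cvg_cst|exact: cvg_id].
- by move=> t; exact: sb.
- by rewrite subr0.
- by rewrite subrr.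
Qed.

(** The paths are glued as [b M2^-1 c] with clamped times: at every moment one of [b], [c] equals
    [M2], and continuity at the junction requires no case distinction. *)
Lemma conn_trans n (M1 M2 M3 : 'M[R]_(n + n)) : conn M1 M2 -> conn M2 M3 -> conn M1 M3.
Proof.
move=> [b [bc sb b0 b1]] [c [cc sc c0 c1]].
have cl (x : R) : continuous (fun t : R => clamp 0 1 (2 * t - x)).
  move=> t; apply: (cvg_comp (fun t : R => 2 * t - x) (clamp 0 1) _ (@clamp_continuous R 0 1 _)).
  by apply: cvgB; [apply: cvgM; [exact: cvg_cst|exact: cvg_id]|exact: cvg_cst].
pose d (t : R) := b (clamp 0 1 (2 * t - 0)) *m invmx M2 *m c (clamp 0 1 (2 * t - 1)).
have s2 : symplectic M2 by rewrite -b1; have [] := sb 1.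
have [u2 _] := s2.
have dc : rcontinuous d.
  have h1 : rcontinuous (fun t : R => c (clamp 0 1 (2 * t - 1))).
    exact: (@rcontinuous_comp _ _ c _ cc (cl 1)).
  have h0 : rcontinuous (fun t : R => b (clamp 0 1 (2 * t - 0))).
    exact: (@rcontinuous_comp _ _ b _ bc (cl 0)).
  move=> t; rewrite /d; apply: rcvgM; last exact: h1.
  by apply: rcvgM; [exact: h0|exact: rcvg_cst].
have clL (x : R) : x <= 0 -> clamp 0 1 x = 0.
  by move=> x0; rewrite /clamp (min_idPl _) ?(max_idPl _)//; apply: le_trans x0 ler01.
have clR (x : R) : 1 <= x -> clamp 0 1 x = 1.
  by move=> x0; rewrite /clamp (min_idPr _)// (max_idPr _).
have dL t : t <= 2^-1 -> d t = b (clamp 0 1 (2 * t - 0)).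
  by move=> tl; rewrite /d (clL (2 * t - 1)) ?c0 ?mulmxKV//; move: tl; lra.
have dR t : 2^-1 <= t -> d t = c (clamp 0 1 (2 * t - 1)).
  by move=> tl; rewrite /d (clR (2 * t - 0)) ?b1 ?mulmxV ?mul1mx//; move: tl; lra.
exists d; split=> //.
- by move=> t; have [tl|tl] := lerP t 2^-1; [rewrite dL|rewrite dR//; exact: ltW].
- by rewrite dL ?mulr0 ?subr0 ?clL ?invr_ge0.
- rewrite dR ?clR//; first by lra.
  by rewrite invf_le1// ler1n.
Qed.

End Connection.

Lemma cmx_tr (R : realType) k l (A : 'M[R]_(k, l)) : cmx A^T = (cmx A)^T.
Proof. by apply/matrixP => i j; rewrite !mxE. Qed.

Section Transvections.
Variables (R : realType) (n : nat).
Local Notation J := (Jmx R n).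
Implicit Types (u v w : 'cV[R]_(n + n)) (M X : 'M[R]_(n + n)).

Definition transvection (t : R) u : 'M[R]_(n + n) := 1%:M + t *: (u *m u^T *m J).

Lemma transvectionE t u w : transvection t u *m w = w + (t * bform u w J) *: u.
Proof. by rewrite /transvection mulmxDl mul1mx -scalemxAl rank1_mulmx scalerA. Qed.

Lemma bform_JE u w : bform u w J = - bform w u J.
Proof. by rewrite bform_tr Jmx_tr bformNm. Qed.

Lemma bform_J0 u : bform u u J = 0.
Proof. by apply: alt_bform; exact: Jmx_tr. Qed.

Lemma bform_sympl M u w : symplectic M -> bform (M *m u) (M *m w) J = bform u w J.
Proof. by move=> [_ E]; rewrite bform_mull -bform_mulr E. Qed.

Lemma bform_ext N (A B : 'M[R]_N) : (forall u w : 'cV[R]_N, bform u w A = bform u w B) -> A = B.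
Proof. by move=> H; apply/matrixP => i j; rewrite -!bform_delta H. Qed.

Lemma symplectic_transvection t u : symplectic (transvection t u).
Proof.
apply: symplectic_of; apply: bform_ext => v w.
rewrite bform_mulr -bform_mull !transvectionE bformDl !bformDr !bformZl !bformZr bform_J0.
by rewrite (bform_JE v u); ring.
Qed.

Lemma transvection0 u : transvection 0 u = 1%:M.
Proof. by rewrite /transvection scale0r addr0. Qed.

Lemma transvection_cont u : rcontinuous (fun t => transvection t u).
Proof.
move=> t; apply: rcvgD; first exact: rcvg_cst.
by apply: rcvgZ; [exact: cvg_id|exact: rcvg_cst].
Qed.

Lemma two_pairings v w : v != 0 -> w != 0 -> exists y, bform v y J != 0 /\ bform w y J != 0.
Proof.
have J0 x : x != 0 -> J^T *m x != 0.
  apply: contra => /eqP E; have uJ : J^T \in unitmx by rewrite unitmx_tr Jmx_unit.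
  by rewrite -(mulKmx uJ x) E mulmx0.
move=> /J0 v0 /J0 w0; have [y [h1 h2]] := two_functionals v0 w0; exists y.
by move: h1 h2; rewrite /bform !trmx_mul !trmxK.
Qed.

Lemma transvection_move v w : bform v w J != 0 -> exists t, exists u, transvection t u *m v = w.
Proof.
move=> h; exists ((bform w v J)^-1), (w - v); rewrite transvectionE bformDl bformNl bform_J0 subr0.
have h' : bform w v J != 0 by rewrite bform_JE oppr_eq0.
by rewrite mulVf// scale1r addrC subrK.
Qed.

End Transvections.

Section Connecting.
Variables (R : realType) (z : R[i]).
Hypothesis z1 : nsq z = 1.
Local Notation C := R[i].

Lemma nondeg_conj n (M X : 'M[R]_(n + n)) : X \in unitmx -> nondeg z M ->
  nondeg z (X *m M *m invmx X).
Proof.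
move=> uX /(@nondegP _ z n M) nM; apply/nondegP => x E.
have cX : cmx (invmx X) *m cmx X = 1%:M by rewrite -cmxM mulVmx// cmx_scalar.
have cX' : cmx X *m cmx (invmx X) = 1%:M by rewrite -cmxM mulmxV// cmx_scalar.
have y0 : cmx (invmx X) *m x = 0.
  apply: nM; rewrite scalemxAr -E !cmxM -!mulmxA.
  by rewrite (mulmxA (cmx (invmx X)) (cmx X)) cX mul1mx.
by rewrite -[x]mul1mx -cX' -mulmxA y0 mulmx0.
Qed.

Lemma rcvg_inv_sympl (T : Type) (F : set_system T) (FF : Filter F) n (X : T -> 'M[R]_(n + n)) X0 :
  (forall t, symplectic (X t)) -> symplectic X0 -> rcvg F X X0 ->
  rcvg F (fun t => invmx (X t)) (invmx X0).
Proof.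
move=> sX sX0 XX0; have E t : invmx (X t) = - (Jmx R n *m (X t)^T *m Jmx R n).
  by rewrite symplectic_invE.
rewrite (funext E) symplectic_invE//; apply: rcvgN; apply: rcvgM; last exact: rcvg_cst.
by apply: rcvgM; [exact: rcvg_cst|move=> i j; under eq_fun do rewrite mxE; rewrite mxE; exact: XX0].
Qed.

Lemma conn_conj_path n (M : 'M[R]_(n + n)) (X : R -> 'M[R]_(n + n)) :
  symplectic M -> nondeg z M -> rcontinuous X -> (forall t, symplectic (X t)) ->
  conn z (X 0 *m M *m invmx (X 0)) (X 1 *m M *m invmx (X 1)).
Proof.
move=> sM nM Xc sX; apply: (@conn_itv _ z _ (fun t => X t *m M *m invmx (X t))) => t.
  apply: rcvgM; last by apply: rcvg_inv_sympl; [exact: sX|exact: sX|exact: Xc].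
  by apply: rcvgM; [exact: Xc|exact: rcvg_cst].
move=> _; have [uX _] := sX t; split; last exact: nondeg_conj.
by apply: symplecticM; [exact: symplecticM|exact: symplecticV].
Qed.

Lemma conn_transvection n (M : 'M[R]_(n + n)) s u : symplectic M -> nondeg z M ->
  conn z M (transvection s u *m M *m invmx (transvection s u)).
Proof.
move=> sM nM; have := @conn_conj_path n M (fun t => transvection (t * s) u) sM nM.
rewrite mul0r mul1r transvection0 mul1mx invmx1 mulmx1; apply.
  apply: (@rcontinuous_comp R _ _ (fun t => transvection t u) (fun t => t * s)).
    exact: transvection_cont.
  by move=> t; apply: cvgM; [exact: cvg_id|exact: cvg_cst].
by move=> t; exact: symplectic_transvection.
Qed.

Lemma conn_conj_move1 n (M : 'M[R]_(n + n)) v w l : symplectic M -> nondeg z M ->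
  M *m v = l *: v -> bform v w (Jmx R n) != 0 ->
  exists M', [/\ conn z M M', symplectic M', nondeg z M' & M' *m w = l *: w].
Proof.
move=> sM nM Mv /transvection_move[t [u E]]; have sT := symplectic_transvection t u.
have [uT _] := sT; exists (transvection t u *m M *m invmx (transvection t u)); split.
- exact: conn_transvection.
- by apply: symplecticM; [exact: symplecticM|exact: symplecticV].
- exact: nondeg_conj.
- by rewrite -E -!mulmxA mulKmx// Mv scalemxAr.
Qed.

(** A transvection moves [v] to [w] provided that [J] pairs them nontrivially. In general one passes
    through a vector paired nontrivially with both, conjugating by one transvection at a time. *)
Lemma conn_conj_move n (M : 'M[R]_(n + n)) (v w : 'cV[R]_(n + n)) l : symplectic M -> nondeg z M ->
  M *m v = l *: v -> v != 0 -> w != 0 ->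
  exists M', [/\ conn z M M', symplectic M', nondeg z M' & M' *m w = l *: w].
Proof.
move=> sM nM Mv v0 w0; have [y [h1 h2]] := two_pairings v0 w0.
have [M1 [c1 s1 n1 E1]] := conn_conj_move1 sM nM Mv h1.
have h3 : bform y w (Jmx R n) != 0 by rewrite bform_JE oppr_eq0.
have [M2 [c2 s2 n2 E2]] := conn_conj_move1 s1 n1 E1 h3.
by exists M2; split=> //; exact: conn_trans c1 c2.
Qed.

Section RealEigenvalue.
Variable n : nat.
Variable M : 'M[R]_(n + n).
Hypotheses (sM : symplectic M) (nM : nondeg z M).
Local Notation J := (Jmx R n).
Local Notation Res := (invmx (cmx M - z%:M)).

Lemma resolventP u : cmx M *m (Res *m u) = u + z *: (Res *m u) :> 'cV[C]_(n + n).
Proof.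
have uR : cmx M - z%:M \in unitmx by rewrite unitmxE unitfE.
by rewrite -mul_scalar_mx -{2}(mulKVmx uR u) -mulmxDl subrK.
Qed.

Lemma resolvent_uniq (u y : 'cV[C]_(n + n)) : cmx M *m y = u + z *: y -> y = Res *m u.
Proof.
have uR : cmx M - z%:M \in unitmx by rewrite unitmxE unitfE.
move=> E; rewrite -(mulKmx uR y); congr (_ *m _).
by rewrite mulmxBl E mul_scalar_mx addrK.
Qed.

(** The coefficient of the rank-one perturbation formula: formally [\det (T M - z) = \det (M - z) *
    (1 + t * qres u)] for the transvection [T] of parameter [t] along [u]. *)
Definition qres (u : 'cV[C]_(n + n)) : C := bform u (Res *m u) (cmx J *m cmx M).

Lemma bform_sympl_cmx (x y : 'cV[C]_(n + n)) :
  bform (cmx M *m x) (cmx M *m y) (cmx J) = bform x y (cmx J).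
Proof.
have [_ E] := sM; rewrite bform_mull -bform_mulr; congr (bform _ _ _).
by rewrite -[in RHS]E !cmxM cmx_tr.
Qed.

Lemma bform_cmxJ0 (x : 'cV[C]_(n + n)) : bform x x (cmx J) = 0.
Proof. by apply: alt_bform; rewrite -cmx_tr Jmx_tr /cmx map_mxN. Qed.

Lemma bform_conj (x y : 'cV[C]_(n + n)) (A : 'M[R]_(n + n)) :
  (bform x y (cmx A))^*%C = bform (map_mx conjc x) (map_mx conjc y) (cmx A).
Proof.
have E (B : 'M[C]_1) : (B 0 0)^*%C = (map_mx conjc B) 0 0 by rewrite mxE.
have cA : map_mx conjc (cmx A) = cmx A by apply/matrixP => i j; rewrite !mxE; exact: conjc_real.
have cx : map_mx conjc x^T = (map_mx conjc x)^T by apply/matrixP => i j; rewrite !mxE.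
by rewrite /bform E !map_mxM cA cx.
Qed.

Lemma conjz : z * z^*%C = 1. Proof. exact: conjM_unit. Qed.

(** With [u] written once through the resolvent vector [y] and once through its conjugate,
    [bform u u J = 0] expands, for a unit [z], into the difference of [qres] and its conjugate. *)
Lemma qres_real (u : 'cV[R]_(n + n)) : imC (qres (cmx u)) = 0.
Proof.
pose y := Res *m cmx u; have My := resolventP (cmx u); rewrite -/y in My.
pose yc := map_mx conjc y.
have Myc : cmx M *m yc = cmx u + z^*%C *: yc.
  have := congr1 (map_mx conjc) My; rewrite map_mxM map_mxD map_mxZ /=.
  have cr (k l : nat) (A : 'M[R]_(k, l)) : map_mx conjc (cmx A) = cmx A.
    by apply/matrixP => i j; rewrite !mxE; exact: conjc_real.
  by rewrite !cr.
have uE : cmx u = cmx M *m y - z *: y by rewrite My addrK.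
have uE' : cmx u = cmx M *m yc - z^*%C *: yc by rewrite Myc addrK.
pose a := bform yc y (cmx J); pose b := bform yc (cmx M *m y) (cmx J).
pose c := bform (cmx M *m yc) y (cmx J).
have q1 : qres (cmx u) = a - z^*%C * b.
  rewrite /qres bform_mulr -/y {1}uE' bformDl bformNl bformZl bform_sympl_cmx.
  by [].
have q2 : (qres (cmx u))^*%C = - a + z * c.
  rewrite /qres bform_mulr -/y bform_conj map_mxM -/yc.
  have cr (k l : nat) (A : 'M[R]_(k, l)) : map_mx conjc (cmx A) = cmx A.
    by apply/matrixP => i j; rewrite !mxE; exact: conjc_real.
  rewrite !cr {1}uE bformDl bformNl bformZl bform_sympl_cmx.
  have cJ (p q : 'cV[C]_(n + n)) : bform p q (cmx J) = - bform q p (cmx J).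
    by rewrite bform_tr -cmx_tr Jmx_tr /cmx map_mxN bformNm.
  by rewrite (cJ y) (cJ y (_ *m _)) mulrN opprK.
have q3 : a - z * c - z^*%C * b + a = 0.
  have := bform_cmxJ0 (cmx u); rewrite {1}uE' {1}uE bformDl !bformDr !bformNl !bformNr.
  rewrite !bformZl !bformZr bform_sympl_cmx -/a -/b -/c => <-.
  rewrite (mulrA z^*%C z a) (mulrC z^*%C z) conjz mul1r; ring.
have : qres (cmx u) = (qres (cmx u))^*%C.
  by apply/eqP; rewrite -subr_eq0 q2 q1 -q3; apply/eqP; ring.
by case: (qres (cmx u)) => x y' [] /eqP; rewrite -subr_eq0 opprK -mulr2n mulrn_eq0 => /eqP.
Qed.

(** A vector [x] with [T M x = z x] is a multiple of [Res u], and substituting this back shows that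
    the scalar [s] satisfies [s * (1 + t * qres u) = 0]. *)
Lemma nondeg_transvection t (u : 'cV[R]_(n + n)) : 1 + t%:C%C * qres (cmx u) != 0 ->
  nondeg z (transvection t u *m M).
Proof.
move=> h; apply/nondegP => x; rewrite cmxM /transvection /cmx map_mxD map_mx1 map_mxZ !map_mxM.
rewrite -!/(cmx _) cmx_tr mulmxDl mulmxDl mul1mx -!scalemxAl -mulmxA rank1_mulmx scalerA => E.
pose s := bform (cmx u) (cmx M *m x) (cmx J).
have xE : x = - (t%:C%C * s) *: (Res *m cmx u).
  rewrite scalemxAr; apply: resolvent_uniq; rewrite -E scaleNr /s addrCA addNr addr0.
  by [].
have sE : s * (1 + t%:C%C * qres (cmx u)) = 0.
  rewrite mulrDr mulr1 {1}/s {1}xE -scalemxAr bformZr -bform_mulr.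
  by rewrite -/(qres _); apply/eqP; rewrite -[X in _ == X](subrr (t%:C%C * s * qres (cmx u))); apply/eqP; ring.
move/eqP: sE; rewrite mulf_eq0 (negPf h) orbF => /eqP s0.
by rewrite xE s0 mulr0 oppr0 scale0r.
Qed.

(** [l v - M v] is the direction of the transvection that turns [v] into an eigenvector for [l]. The
    identity reduces its effect on nondegeneracy to [qres v] and to the pairing of [v] with
    [M v]. *)
Lemma qres_shift (v : 'cV[C]_(n + n)) (l : C) :
  qres (l *: v - cmx M *m v) =
  qres v * ((l - z) * (l - z^*%C)) - l * bform v (cmx M *m v) (cmx J).
Proof.
pose y := Res *m v; have My := resolventP v; rewrite -/y in My.
have yE : Res *m (l *: v - cmx M *m v) = l *: y - cmx M *m y.
  symmetry; apply: resolvent_uniq; rewrite mulmxBr -scalemxAr My mulmxDr -scalemxAr My.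
  rewrite scalerBr !scalerDr !scalerA (mulrC z l) !opprD !addrA; congr (_ - _).
  by rewrite -!addrA; congr (_ + _); rewrite addrCA; congr (_ + _); rewrite addrC -scalerA -scalerDr.
have q0 : qres v = bform v (cmx M *m y) (cmx J) by rewrite /qres bform_mulr.
have vy : bform v y (cmx J) = z^*%C * qres v.
  have : z * bform v y (cmx J) = qres v.
    by rewrite q0 My bformDr bform_cmxJ0 add0r bformZr.
  by move=> <-; rewrite mulrA (mulrC _ z) conjz mul1r.
have vMMy : bform v (cmx M *m (cmx M *m y)) (cmx J) =
   bform v (cmx M *m v) (cmx J) + z * qres v.
  by rewrite {1}My mulmxDr bformDr -scalemxAr bformZr -q0.
rewrite {1}/qres yE bform_mulr mulmxBr -scalemxAr bformDl !bformDr !bformNl !bformNr !bformZl !bformZr.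
rewrite bform_sympl_cmx bform_sympl_cmx -q0 vy vMMy; have := conjz; move: (z^*%C) (qres v) => zc q zz.
by rewrite mulrBl !mulrBr (mulrC z l) zz; ring.
Qed.

End RealEigenvalue.

End Connecting.

Section Eigenvalue.
Variables (R : realType) (z : R[i]).
Hypothesis z1 : nsq z = 1.
Local Notation C := R[i].

Lemma symplectic_antiJ n (M : 'M[R]_(n + n)) :
  (forall u : 'cV[R]_(n + n), bform u u (Jmx R n *m M) = 0) -> M^T *m Jmx R n = Jmx R n *m M.
Proof.
move=> H; have N0 : (cmx (Jmx R n *m M))^T = - cmx (Jmx R n *m M).
  apply: alt_of_bform => u; have := H u; rewrite /bform -cmx_tr -!cmxM [cmx _ _ _]mxE => ->.
  by [].
have E : (Jmx R n *m M)^T = - (Jmx R n *m M).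
  apply/matrixP => i j; have := congr1 (fun A : 'M[C]_(n + n) => reC (A i j)) N0.
  by rewrite !mxE.
by move: E; rewrite trmx_mul Jmx_tr mulmxN => /oppr_inj.
Qed.

Lemma nondeg_transvection_itv n (M : 'M[R]_(n + n)) (u : 'cV[R]_(n + n)) q s :
  nondeg z M -> qres z M (cmx u) = q%:C%C -> 0 < 1 + s * q ->
  forall t : R, t \in `[0, 1] -> nondeg z (transvection (t * s) u *m M).
Proof.
move=> nM qE h t; rewrite in_itv /= => /andP[t0 t1]; apply: nondeg_transvection => //.
rewrite qE; suff h' : 0 < 1 + t * s * q.
  apply/eqP => /(congr1 (@complex.Re R)) /=; rewrite !mul0r subr0 => E.
  by move: h'; rewrite E ltxx.
rewrite -mulrA; move: (s * q) h => p h; have [p0|p0] := lerP 0 p.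
  by have := mulr_ge0 t0 p0; lra.
have t1' : 0 <= 1 - t by rewrite subr_ge0.
have : 0 <= (1 - t) * - p.
  by apply: mulr_ge0 => //; rewrite oppr_ge0 ltW.
by lra.
Qed.

Lemma conn_transvection_mul n (M : 'M[R]_(n + n)) (u : 'cV[R]_(n + n)) q s :
  symplectic M -> nondeg z M -> qres z M (cmx u) = q%:C%C -> 0 < 1 + s * q ->
  conn z M (transvection s u *m M).
Proof.
move=> sM nM qE h.
have := @conn_itv R z n (fun t => transvection (t * s) u *m M).
rewrite mul0r mul1r transvection0 mul1mx; apply.
  move=> t; apply: rcvgM; last exact: rcvg_cst.
  apply: (@rcontinuous_comp R _ _ (fun t => transvection t u) (fun t => t * s)).
    exact: transvection_cont.
  by move=> t'; apply: cvgM; [exact: cvg_id|exact: cvg_cst].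
move=> t tI; split; last exact: (nondeg_transvection_itv nM qE h).
by apply: symplecticM => //; exact: symplectic_transvection.
Qed.

Lemma qres_antiJ n (M : 'M[R]_(n + n)) (u : 'cV[R]_(n + n)) : symplectic M -> nondeg z M ->
  M^T *m Jmx R n = Jmx R n *m M -> qres z M (cmx u) = 0.
Proof.
move=> sM nM anti; rewrite /qres; set y := _ *m cmx u.
have My : cmx M *m y = cmx u + z *: y by exact: resolventP.
have A0 : bform y y (cmx (Jmx R n) *m cmx M) = 0.
  apply: alt_bform; rewrite -cmxM -cmx_tr trmx_mul Jmx_tr mulmxN anti.
  by rewrite /cmx map_mxN.
have -> : cmx u = cmx M *m y - z *: y by rewrite My addrK.
rewrite bformDl bformNl bformZl A0 mulr0 subr0 bform_mulr bform_sympl_cmx//.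
by rewrite bform_cmxJ0.
Qed.

(** The factor [l^2 - 2 l r + 1] equals [|l - z|^2] when [r] is the real part of the unit [z];
    [|l| = 2] keeps it positive for every such [z]. *)
Lemma shift_sign (p c l r : R) : c != 0 -> l = 2 \/ l = -2 -> 0 < p * c * l -> r ^+ 2 <= 1 ->
  0 < 1 + (l * c)^-1 * (p * (l ^+ 2 - 2 * l * r + 1) - l * c).
Proof.
move=> c0 lE plc r1; have l0 : l != 0 by case: lE => ->; rewrite ?oppr_eq0 pnatr_eq0.
have -> : 1 + (l * c)^-1 * (p * (l ^+ 2 - 2 * l * r + 1) - l * c) =
    (p * c * l) * (l ^+ 2 - 2 * l * r + 1) * (l * c)^-1 ^+ 2 by field; rewrite l0 c0.
apply: mulr_gt0; last by rewrite exprn_even_gt0// invr_neq0// mulf_neq0.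
apply: mulr_gt0 => //; rewrite expr2 in r1 *.
by case: lE => ->; nra.
Qed.

Lemma shift_real (p d l : R) :
  p%:C%C * ((l%:C%C - z) * (l%:C%C - z^*%C)) - l%:C%C * d%:C%C =
  (p * (l ^+ 2 - 2 * l * reC z + 1) - l * d)%:C%C.
Proof.
have := z1; rewrite /nsq; case: (z) => a b /= ab.
have bE : b ^+ 2 = 1 - a ^+ 2 by rewrite -ab addrAC subrr add0r.
apply/eqP; rewrite eq_complex /=; apply/andP; split; apply/eqP; last by ring.
rewrite [LHS](_ : _ = p * (l ^+ 2 - 2 * l * a + (a ^+ 2 + b ^+ 2)) - l * d); last by ring.
by rewrite bE; ring.
Qed.

(** For a vector at which both [u J M u] and [qres] are nonzero, one transvection creates an
    eigenvalue [2] or [-2], and the sign can be chosen so that nondegeneracy persists along its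
    whole path. *)
Lemma conn_eigen n (M : 'M[R]_(n + n)) (v : 'cV[R]_(n + n)) : symplectic M -> nondeg z M ->
  bform v v (Jmx R n *m M) != 0 ->
  exists M' (l : R) (v' : 'cV[R]_(n + n)), [/\ conn z M M', symplectic M', nondeg z M', l = 2 \/ l = -2 &
    v' != 0 /\ M' *m v' = l *: v'].
Proof.
move=> sM nM v0.
pose q (u : 'cV[R]_(n + n)) := reC (qres z M (cmx u)).
have qE u : qres z M (cmx u) = (q u)%:C%C.
  have := qres_real z1 sM nM u; rewrite /q; case: (qres _ _ _) => a b /= ->.
  by [].
pose B := cmx (Jmx R n) *m cmx M *m invmx (cmx M - z%:M).
have qB u : (q u)%:C%C = bform (cmx u) (cmx u) B by rewrite -qE /qres -bform_mulr.
(* If [qres] vanished at all real vectors, [J M (M - z)^-1] would be antisymmetric; this forces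
   [M^T J = J M], and the form [u J M u] would vanish, contrary to [v0]. *)
have [w w0] : exists w, q w != 0.
  apply: contrapT => H; have qz u : q u = 0.
    by apply/eqP; apply: contrapT => h; apply: H; exists u; apply/negP.
  have BT : B^T = - B by apply: alt_of_bform => u; rewrite -qB qz.
  have uR : cmx M - z%:M \in unitmx by rewrite unitmxE unitfE.
  have E1 : B *m (cmx M - z%:M) = cmx (Jmx R n *m M).
    by rewrite /B -mulmxA mulVmx// mulmx1 cmxM.
  have E2 : (cmx M - z%:M)^T *m B *m (cmx M - z%:M) = (cmx M - z%:M)^T *m cmx (Jmx R n *m M).
    by rewrite -mulmxA E1.
  have E3 : (cmx M - z%:M)^T *m B *m (cmx M - z%:M) = - cmx (Jmx R n *m M)^T *m (cmx M - z%:M).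
    by rewrite -(opprK B) -BT mulmxN -trmx_mul E1 cmx_tr mulNmx.
  have tE : (cmx M - z%:M)^T = cmx M^T - z%:M by rewrite linearB /= tr_scalar_mx cmx_tr.
  have [_ sE] := sM.
  have E4 : z *: cmx (M^T *m Jmx R n) = z *: cmx (Jmx R n *m M).
    move: E3; rewrite E2 tE trmx_mul Jmx_tr mulmxN /cmx map_mxN opprK -!/(cmx _).
    rewrite mulmxBl mulmxBr mul_scalar_mx mul_mx_scalar -!cmxM mulmxA sE => /eqP.
    by move=> /eqP /addrI /oppr_inj ->.
  have z0 : z != 0 by apply/eqP => E; move: z1; rewrite E /nsq /= expr0n /= addr0 => /eqP; rewrite eq_sym oner_eq0.
  have E5 : cmx (M^T *m Jmx R n) = cmx (Jmx R n *m M).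
    by have := congr1 (fun X => z^-1 *: X) E4; rewrite !scalerA mulVf// !scale1r.
  have anti : M^T *m Jmx R n = Jmx R n *m M.
    by apply/matrixP => i j; have := congr1 (fun A : 'M[C]_(n + n) => reC (A i j)) E5; rewrite !mxE.
  move/eqP: v0; apply; apply: alt_bform.
  by rewrite trmx_mul Jmx_tr mulmxN anti.
have [x [c0 q0]] := common_nonzero qB v0 w0.
(* The sign of [l] makes [q x * c * l] positive, which is the condition of [shift_sign]. *)
pose c := bform x x (Jmx R n *m M); pose l : R := if 0 < q x * c then 2 else -2.
have lE : l = 2 \/ l = -2 by rewrite /l; case: ifP; [left|right].
have l2 : l ^+ 2 = 4 by case: lE => ->; rewrite expr2; ring.
have lc : 0 < q x * c * l.
  have qc0 : q x * c != 0 by rewrite mulf_neq0.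
  rewrite /l; case: ifP => [h|/negbT]; first by rewrite mulr_gt0.
  by rewrite -leNgt le_eqVlt (negPf qc0) /= => h; rewrite nmulr_rgt0// oppr_lt0.
have c00 : c != 0 by [].
have l0 : l != 0 by case: lE => ->; rewrite ?oppr_eq0 pnatr_eq0.
pose u := l *: x - M *m x.
pose Q := q x * (l ^+ 2 - 2 * l * reC z + 1) - l * c.
have QE : qres z M (cmx u) = Q%:C%C.
  have -> : cmx u = (l%:C%C) *: cmx x - cmx M *m cmx x by rewrite /u /cmx map_mxB map_mxZ map_mxM.
  rewrite qres_shift// qE -cmxM.
  have -> : bform (cmx x) (cmx (M *m x)) (cmx (Jmx R n)) = c%:C%C.
    by rewrite /c bform_mulr /bform -cmx_tr -!cmxM mxE.
  exact: shift_real.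
pose s := (l * c)^-1.
have lc0 : l * c != 0 by rewrite mulf_neq0.
have h1 : 0 < 1 + s * Q.
  by apply: shift_sign => //; rewrite -z1 /nsq lerDl sqr_ge0.
exists (transvection s u *m M), l, x; split=> //.
- exact: conn_transvection_mul QE h1.
- by apply: symplecticM => //; exact: symplectic_transvection.
- have := nondeg_transvection_itv nM QE h1 (t := 1); rewrite mul1r; apply.
  by rewrite in_itv /= ler01 lexx.
split.
  by apply: contraNneq c00 => x0; rewrite /c x0 -(scale0r (0 : 'cV[R]_(n + n))) bformZl mul0r.
rewrite -mulmxA transvectionE.
have -> : bform u (M *m x) (Jmx R n) = l * c.
  by rewrite /u bformDl bformNl bformZl bform_J0 subr0 /c bform_mulr.
by rewrite /s mulVf// scale1r /u addrC subrK.
Qed.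

(** When the form [u J M u] vanishes identically, so does [qres]. Every transvection then preserves
    nondegeneracy, and one of them makes the form nonzero. *)
Lemma conn_real_eigen n (M : 'M[R]_(n + n)) : (0 < n)%N -> symplectic M -> nondeg z M ->
  exists M' (l : R) (v' : 'cV[R]_(n + n)), [/\ conn z M M', symplectic M', nondeg z M', l = 2 \/ l = -2 &
    v' != 0 /\ M' *m v' = l *: v'].
Proof.
move=> n0 sM nM.
have [[v v0]|H] := pselect (exists v : 'cV[R]_(n + n), bform v v (Jmx R n *m M) != 0); first exact: conn_eigen v0.
have anti : M^T *m Jmx R n = Jmx R n *m M.
  apply: symplectic_antiJ => u; apply/eqP; apply: contrapT => h; apply: H; exists u.
  exact/negP.
pose u : 'cV[R]_(n + n) := const_mx 1.
have u0 : u != 0.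
  have i : 'I_(n + n) by exists 0%N; rewrite addn_gt0 n0.
  by apply/eqP => /matrixP/(_ i 0); rewrite !mxE => /eqP; rewrite oner_eq0.
have qE : qres z M (cmx u) = 0%:C%C by rewrite (qres_antiJ _ sM nM anti).
have h : (0 : R) < 1 + 1 * 0 by rewrite mulr0 addr0.
have c1 := conn_transvection_mul sM nM qE h.
pose M1 := transvection 1 u *m M.
have s1 : symplectic M1 by apply: symplecticM => //; exact: symplectic_transvection.
have n1 : nondeg z M1.
  have := nondeg_transvection_itv nM qE h (t := 1); rewrite mul1r; apply.
  by rewrite in_itv /= ler01 lexx.
have [uM _] := sM.
have w0 : invmx M *m u != 0.
  by apply: contra u0 => /eqP E; rewrite -(mulKVmx uM u) E mulmx0.
have [y [y1 y2]] := two_pairings u0 w0.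
have yq : bform y y (Jmx R n *m M1) != 0.
  have y0 : bform y y (Jmx R n *m M) = 0.
    by apply/eqP; apply: contrapT => h'; apply: H; exists y; apply/negP.
  have E2 : bform u (M *m y) (Jmx R n) = bform (invmx M *m u) y (Jmx R n).
    by rewrite -{1}(mulKVmx uM u) bform_sympl.
  rewrite bform_mulr /M1 -mulmxA transvectionE bformDr -bform_mulr y0 add0r bformZr mul1r E2.
  by rewrite mulf_neq0// bform_JE oppr_eq0.
have [M2 [l [v [c2 s2 n2 lE vE]]]] := conn_eigen s1 n1 yq.
by exists M2, l, v; split=> //; exact: conn_trans c1 c2.
Qed.

End Eigenvalue.

(** * Symplectic direct sums and the splitting off of a real eigenvalue *)

Section DiamondAlgebra.
Variable S : comNzRingType.

(** [diamond] over an arbitrary commutative ring, so that it also applies to complexified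
    matrices. *)
Definition dia k l (A : 'M[S]_(k + k)) (B : 'M[S]_(l + l)) : 'M[S]_((k + l) + (k + l)) :=
  block_mx (block_mx (ulsubmx A) 0 0 (ulsubmx B)) (block_mx (ursubmx A) 0 0 (ursubmx B))
           (block_mx (dlsubmx A) 0 0 (dlsubmx B)) (block_mx (drsubmx A) 0 0 (drsubmx B)).

Definition corner k l (X : 'M[S]_((k + l) + (k + l))) : 'M[S]_(l + l) :=
  block_mx (drsubmx (ulsubmx X)) (drsubmx (ursubmx X))
           (drsubmx (dlsubmx X)) (drsubmx (drsubmx X)).

Lemma corner_dia k l (A : 'M[S]_(k + k)) (B : 'M[S]_(l + l)) : corner (dia A B) = B.
Proof. by rewrite /corner /dia !block_mxKul !block_mxKur !block_mxKdl !block_mxKdr submxK. Qed.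

Lemma mulmx_submx p q r s t u (A : 'M[S]_(p + q, r + s)) (B : 'M[S]_(r + s, t + u)) :
  [/\ ulsubmx (A *m B) = ulsubmx A *m ulsubmx B + ursubmx A *m dlsubmx B,
      ursubmx (A *m B) = ulsubmx A *m ursubmx B + ursubmx A *m drsubmx B,
      dlsubmx (A *m B) = dlsubmx A *m ulsubmx B + drsubmx A *m dlsubmx B &
      drsubmx (A *m B) = dlsubmx A *m ursubmx B + drsubmx A *m drsubmx B].
Proof.
by rewrite -{1 4 7 10}[A]submxK -{1 4 7 10}[B]submxK mulmx_block block_mxKul block_mxKur
  block_mxKdl block_mxKdr.
Qed.

Lemma mulmx_dblock k l (a a' : 'M[S]_k) (d d' : 'M[S]_l) :
  block_mx a 0 0 d *m block_mx a' 0 0 d' = block_mx (a *m a') 0 0 (d *m d').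
Proof. by rewrite mulmx_block !mulmx0 !mul0mx !addr0 !add0r. Qed.

Lemma diaM k l (A A' : 'M[S]_(k + k)) (B B' : 'M[S]_(l + l)) :
  dia A B *m dia A' B' = dia (A *m A') (B *m B').
Proof.
have [e1 e2 e3 e4] := mulmx_submx A A'; have [f1 f2 f3 f4] := mulmx_submx B B'.
by rewrite /dia mulmx_block e1 e2 e3 e4 f1 f2 f3 f4 !mulmx_dblock !add_block_mx !addr0.
Qed.

Lemma dia_scalar k l (a : S) : dia (a%:M : 'M[S]_(k + k)) (a%:M : 'M[S]_(l + l)) = a%:M.
Proof.
rewrite /dia !(scalar_mx_block, block_mxKul, block_mxKur, block_mxKdl, block_mxKdr).
by rewrite block_mx0.
Qed.

Lemma diaB k l (A A' : 'M[S]_(k + k)) (B B' : 'M[S]_(l + l)) :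
  dia A B - dia A' B' = dia (A - A') (B - B').
Proof.
rewrite /dia !opp_block_mx !add_block_mx !oppr0 !addr0.
by congr block_mx; congr block_mx; apply/matrixP => i j; rewrite !mxE.
Qed.

Lemma dia_tr k l (A : 'M[S]_(k + k)) (B : 'M[S]_(l + l)) : (dia A B)^T = dia A^T B^T.
Proof.
rewrite /dia !tr_block_mx !trmx0; congr block_mx; congr block_mx; apply/matrixP => i j;
by rewrite !mxE.
Qed.

Lemma corner_mul k l (X : 'M[S]_((k + l) + (k + l))) (A : 'M[S]_(k + k)) (B : 'M[S]_(l + l)) :
  corner (X *m dia A B) = corner X *m B.
Proof.
rewrite -{2}[B]submxK /corner mulmx_block.
have [-> -> -> ->] := mulmx_submx X (dia A B).
rewrite /dia !block_mxKul !block_mxKur !block_mxKdl !block_mxKdr.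
have addd (p q : nat) (Y Z : 'M[S]_(p + q)) : drsubmx (Y + Z) = drsubmx Y + drsubmx Z.
  by apply/matrixP => i j; rewrite !mxE.
have dr (p q : nat) (Y : 'M[S]_(p + q)) (a : 'M[S]_p) (b : 'M[S]_q) :
    drsubmx (Y *m block_mx a 0 0 b) = drsubmx Y *m b.
  by have [_ _ _ ->] := mulmx_submx Y (block_mx a 0 0 b); rewrite block_mxKur block_mxKdr mulmx0 add0r.
by rewrite !addd !dr.
Qed.

End DiamondAlgebra.

Section DiamondUnit.
Variables (S : comUnitRingType) (k l : nat) (A : 'M[S]_(k + k)) (B : 'M[S]_(l + l)).

Lemma dia_unitl : A \in unitmx -> B \in unitmx -> dia A B \in unitmx.
Proof.
move=> uA uB; have E : dia (invmx A) (invmx B) *m dia A B = 1%:M.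
  by rewrite diaM !mulVmx// dia_scalar.
by have /mulmx1_unit[] := E.
Qed.

Lemma dia_unitr : dia A B \in unitmx -> B \in unitmx.
Proof.
move=> uD; have E : corner (invmx (dia A B)) *m B = 1%:M.
  by rewrite -(corner_mul _ A) mulVmx// -(dia_scalar k l (1 : S)) corner_dia.
by have /mulmx1_unit[] := E.
Qed.

End DiamondUnit.

Section DiamondNondegenerate.
Variables (R : realType) (z : R[i]).
Local Notation C := R[i].

Lemma cmx_diamond k l (A : 'M[R]_(k + k)) (B : 'M[R]_(l + l)) :
  cmx (diamond A B) = dia (cmx A) (cmx B).
Proof.
rewrite /cmx /diamond /dia !map_block_mx !map_mx0.
by congr block_mx; congr block_mx; apply/matrixP => i j; rewrite !mxE.
Qed.

Lemma Jmx_dia k l : Jmx R (k + l) = dia (Jmx R k) (Jmx R l).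
Proof.
rewrite /dia /Jmx !block_mxKul !block_mxKur !block_mxKdl !block_mxKdr.
by rewrite !scalar_mx_block opp_block_mx !oppr0 !block_mx0.
Qed.

Lemma symplectic_diamond k l (A : 'M[R]_(k + k)) (B : 'M[R]_(l + l)) :
  symplectic A -> symplectic B -> symplectic (diamond A B).
Proof.
move=> [_ sA] [_ sB]; apply: symplectic_of.
by rewrite -/(dia A B) dia_tr Jmx_dia !diaM sA sB.
Qed.

Lemma symplectic_corner k l (A : 'M[R]_(k + k)) (B : 'M[R]_(l + l)) :
  symplectic (diamond A B) -> symplectic B.
Proof.
move=> [_ E]; apply: symplectic_of; move: E; rewrite -/(dia A B) dia_tr Jmx_dia !diaM.
by move=> /(congr1 (@corner _ _ _)); rewrite !corner_dia.
Qed.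

Lemma nondeg_unit n (M : 'M[R]_(n + n)) : nondeg z M = (cmx M - z%:M \in unitmx).
Proof. by rewrite /Defs.nondegenerate unitmxE unitfE. Qed.

Lemma cmx_diamondB k l (A : 'M[R]_(k + k)) (B : 'M[R]_(l + l)) :
  cmx (diamond A B) - z%:M = dia (cmx A - z%:M) (cmx B - z%:M).
Proof. by rewrite cmx_diamond -(dia_scalar k l z) diaB. Qed.

Lemma nondeg_diamond k l (A : 'M[R]_(k + k)) (B : 'M[R]_(l + l)) :
  nondeg z A -> nondeg z B -> nondeg z (diamond A B).
Proof. by rewrite !nondeg_unit cmx_diamondB; exact: dia_unitl. Qed.

Lemma nondeg_corner k l (A : 'M[R]_(k + k)) (B : 'M[R]_(l + l)) :
  nondeg z (diamond A B) -> nondeg z B.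
Proof. by rewrite !nondeg_unit cmx_diamondB; exact: dia_unitr. Qed.

Lemma rcvg_block (T : Type) (F : set_system T) (FF : Filter F) m1 m2 n1 n2
    (A : T -> 'M[R]_(m1, n1)) (B : T -> 'M[R]_(m1, n2)) (D : T -> 'M[R]_(m2, n1))
    (E : T -> 'M[R]_(m2, n2)) A0 B0 D0 E0 :
  rcvg F A A0 -> rcvg F B B0 -> rcvg F D D0 -> rcvg F E E0 ->
  rcvg F (fun t => block_mx (A t) (B t) (D t) (E t)) (block_mx A0 B0 D0 E0).
Proof.
move=> hA hB hD hE i j; case: (split_ordP i) => k ->; case: (split_ordP j) => l ->.
- by rewrite block_mxEul; under eq_fun do rewrite block_mxEul; exact: hA.
- by rewrite block_mxEur; under eq_fun do rewrite block_mxEur; exact: hB.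
- by rewrite block_mxEdl; under eq_fun do rewrite block_mxEdl; exact: hD.
- by rewrite block_mxEdr; under eq_fun do rewrite block_mxEdr; exact: hE.
Qed.

Lemma rcvg_diamond (T : Type) (F : set_system T) (FF : Filter F) k l
    (A : T -> 'M[R]_(k + k)) (B : T -> 'M[R]_(l + l)) A0 B0 :
  rcvg F A A0 -> rcvg F B B0 -> rcvg F (fun t => diamond (A t) (B t)) (diamond A0 B0).
Proof.
move=> hA hB; rewrite /diamond.
by apply: rcvg_block; apply: rcvg_block; (try exact: rcvg_cst) => i j; rewrite !mxE;
  under eq_fun do rewrite !mxE; (exact: hA || exact: hB).
Qed.

Lemma conn_diamond k l (A A' : 'M[R]_(k + k)) (B B' : 'M[R]_(l + l)) :
  conn z A A' -> conn z B B' -> conn z (diamond A B) (diamond A' B').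
Proof.
move=> [a [ac sa <- <-]] [b [bc sb <- <-]]; exists (fun t => diamond (a t) (b t)); split=> //.
  by move=> t; apply: rcvg_diamond; [exact: ac|exact: bc].
move=> t; have [s1 n1] := sa t; have [s2 n2] := sb t.
by split; [exact: symplectic_diamond|exact: nondeg_diamond].
Qed.

End DiamondNondegenerate.

Section EigenSplitting.
Variables (R : realType) (z : R[i]).
Hypothesis z1 : nsq z = 1.
Local Notation C := R[i].

Lemma punctured_const (f : R -> R) c : f s @[s --> 0] --> f 0 ->
  (forall s, s != 0 -> f s = c) -> f 0 = c.
Proof.
move=> fc H; have h : f s @[s --> 0^'] --> f 0 by exact: cvg_within_filter fc.
suff h' : f s @[s --> 0^'] --> c by exact: (cvg_unique _ h h').
apply/cvgrPdist_lt => e' e0; near=> s; rewrite H ?subrr ?normr0//.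
by near: s; exact: nbhs_dnbhs_neq.
Unshelve. all: by end_near. Qed.

Variable n : nat.
Local Notation N := ((1 + n) + (1 + n))%N.
Local Notation J := (Jmx R (1 + n)).
Implicit Types i j : 'I_N.

(** Weights [2], [1], [0] for the eigenvector [e], its intermediate coordinates and the dual vector
    [f]: the grading of the flag formed by [e] and its symplectic complement, which [M]
    preserves. *)
Definition wt i : nat := if (i == 0%N :> nat) then 2%N else if (i == n.+1 :> nat) then 0%N else 1%N.

Lemma JmxE i j : J i j = (i == j + n.+1 :> nat)%N%:R - (j == i + n.+1 :> nat)%N%:R.
Proof.
have F (p q : 'I_(1 + n)) : (p == (q + n.+1)%N :> nat) = false.
  by rewrite (ltn_eqF (leq_trans (ltn_ord p) (leq_addl _ _))).
have F' (p q : 'I_(1 + n)) : (p == (n.+1 + q + n.+1)%N :> nat) = false.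
  by rewrite (ltn_eqF (leq_trans (ltn_ord p) (leq_addl _ _))).
have vL (p : 'I_(1 + n)) : lshift (1 + n) p = p :> nat by [].
have vR (p : 'I_(1 + n)) : rshift (1 + n) p = (n.+1 + p)%N :> nat by [].
case: (split_ordP i) => k ->; case: (split_ordP j) => l ->; rewrite /Jmx ?vL ?vR.
- by rewrite block_mxEul mxE !F subrr.
- by rewrite block_mxEur !mxE F' sub0r [(n.+1 + l)%N]addnC eqn_add2r eq_sym.
- by rewrite block_mxEdl !mxE F' subr0 [(n.+1 + k)%N]addnC eqn_add2r.
- by rewrite block_mxEdr mxE -!addnA !eqn_add2l !F subrr.
Qed.

Lemma Jmx_wt i j : J i j != 0 -> (wt i + wt j = 2)%N.
Proof.
rewrite JmxE /wt; have := ltn_ord i; have := ltn_ord j.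
case E1: (i == _ :> nat); case E2: (j == _ :> nat); rewrite ?subrr ?eqxx//.
all: move: E1 E2; do !case: eqP; move=> *; lia.
Qed.

Variables (M : 'M[R]_N) (l : R).
Hypotheses (sM : symplectic M) (nM : nondeg z M).
Let e : 'I_N := lshift _ (lshift _ 0).
Let f : 'I_N := rshift _ (lshift _ 0).
Hypothesis Me : M *m delta_mx e 0 = l *: delta_mx e 0 :> 'cV[R]_N.
Hypothesis l0 : l != 0.

Lemma eigen_col i : M i e = (i == e)%:R * l.
Proof.
have := congr1 (fun A : 'cV[R]_N => A i 0) Me; rewrite -colE !mxE eqxx andbT => ->.
by rewrite mulrC.
Qed.

Lemma eigen_row j : M f j = (j == f)%:R * l^-1.
Proof.
have Je : J *m delta_mx e 0 = delta_mx f 0 :> 'cV[R]_N.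
  apply/colP => i; rewrite -colE [LHS]mxE JmxE [RHS]mxE /= eqxx andbT add0n.
  rewrite (_ : (0 == _)%N = false) ?subr0; last by lia.
  by rewrite -(inj_eq val_inj) /= addn0.
have [_ sE] := sM.
have E : l *: (M^T *m delta_mx f 0) = delta_mx f 0 :> 'cV[R]_N.
  by rewrite -Je -{2}sE -!mulmxA Me -!scalemxAr.
have := congr1 (fun A : 'cV[R]_N => A j 0) E; rewrite -colE !mxE eqxx andbT => h.
by rewrite -h mulrC mulKf.
Qed.

Lemma wt_lt i j : (wt i < wt j)%N -> M i j = 0.
Proof.
rewrite /wt => h; have [jE|jE] := eqVneq j e.
  rewrite jE eigen_col; case: eqP => [iE|]; last by rewrite mul0r.
  by move: h; rewrite jE iE ltnn.
have [iE|iE] := eqVneq i f.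
  rewrite iE eigen_row; case: eqP => [jE'|]; last by rewrite mul0r.
  by move: h; rewrite iE jE' ltnn.
have j0 : (j == 0%N :> nat) = false.
  by apply/eqP => E; move/eqP: jE; apply; apply: val_inj.
have i0 : (i == n.+1 :> nat) = false.
  by apply/eqP => E; move/eqP: iE; apply; apply: val_inj; rewrite /= E; lia.
by move: h; rewrite j0 i0; case: ifP; case: ifP.
Qed.

(** For [s != 0] the conjugate of [M] by the diagonal matrix of the [s ^+ wt i]. Since [M] preserves
    the flag only nonnegative powers of [s] occur, so the family extends to [s = 0], where the block
    diagonal part is left. *)
Definition rescale s : 'M[R]_N :=
  \matrix_(i, j) (if (wt j <= wt i)%N then s ^+ (wt i - wt j) * M i j else 0).

Let D (s : R) : 'M[R]_N := diag_mx (\row_i s ^+ wt i).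

Lemma rescale_mul s : rescale s *m D s = D s *m M.
Proof.
apply/matrixP => i j; rewrite mul_mx_diag mul_diag_mx !mxE.
case: leqP => h; last by rewrite mul0r wt_lt// mulr0.
by rewrite mulrAC -exprD subnK.
Qed.

Lemma D_unit s : s != 0 -> D s \in unitmx.
Proof.
move=> s0; rewrite unitmxE unitfE /D det_diag; apply/prodf_neq0 => i _.
by rewrite mxE expf_neq0.
Qed.

(** [J] pairs only coordinates whose weights add up to [2]; hence [D s] scales the symplectic form
    and conjugation by it stays symplectic. *)
Lemma D_J s : D s *m J *m D s = s ^+ 2 *: J.
Proof.
apply/matrixP => i j; move: J (@Jmx_wt i j) => K KW; rewrite mul_mx_diag mul_diag_mx !mxE.
have [->|h] := eqVneq (K i j) 0; first by rewrite !mulr0 mul0r.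
by rewrite mulrAC -exprD (KW h).
Qed.

Lemma rescale_sympl0 s : s != 0 -> (rescale s)^T *m J *m rescale s = J.
Proof.
move=> s0; have uD := D_unit s0; have [_ sE] := sM.
apply: (can_inj (mulmxK uD)); apply: (can_inj (mulKmx uD)).
have DT : (D s)^T = D s by rewrite /D tr_diag_mx.
have -> : D s *m ((rescale s)^T *m J *m rescale s *m D s) =
    (rescale s *m D s)^T *m J *m (rescale s *m D s).
  by rewrite trmx_mul DT !mulmxA.
rewrite rescale_mul trmx_mul DT.
have -> : M^T *m D s *m J *m (D s *m M) = M^T *m (D s *m J *m D s) *m M by rewrite !mulmxA.
by rewrite D_J -scalemxAr -scalemxAl sE mulmxA D_J.
Qed.

Lemma rescale_cont : rcontinuous rescale.
Proof.
move=> s i j; rewrite mxE; under eq_fun do rewrite mxE; case: ifP => _; last exact: cvg_cst.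
by apply: cvgM; [exact: exprn_continuous|exact: cvg_cst].
Qed.

Lemma rescale_sympl s : symplectic (rescale s).
Proof.
apply: symplectic_of; have [->|/rescale_sympl0//] := eqVneq s 0.
apply/matrixP => i j; apply: (@punctured_const (fun s => ((rescale s)^T *m J *m rescale s) i j)).
  have h : rcvg (nbhs (0 : R)) (fun s => (rescale s)^T *m J *m rescale s)
      ((rescale 0)^T *m J *m rescale 0).
    apply: rcvgM; last exact: rescale_cont.
    apply: rcvgM; last exact: rcvg_cst.
    by move=> i' j'; under eq_fun do rewrite mxE; rewrite mxE; exact: rescale_cont.
  exact: h.
by move=> t t0; rewrite rescale_sympl0.
Qed.

(** Conjugation invariance for [s != 0] passes to [s = 0] by continuity, so the degeneration to
    block form never meets a degenerate matrix. *)
Lemma rescale_det s : \det (cmx (rescale s) - z%:M) = \det (cmx M - z%:M).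
Proof.
have H t : t != 0 -> \det (cmx (rescale t) - z%:M) = \det (cmx M - z%:M).
  move=> t0; have d0 : \det (cmx (D t)) != 0.
    by rewrite det_map_mx fmorph_eq0 -unitfE -unitmxE D_unit.
  apply: (mulIf d0); rewrite -det_mulmx [RHS]mulrC -det_mulmx; congr (\det _).
  by rewrite mulmxBl mulmxBr -!cmxM rescale_mul mul_scalar_mx mul_mx_scalar.
have [->|/H//] := eqVneq s 0.
have h : ccvg (nbhs (0 : R)) (fun s => \det (cmx (rescale s) - z%:M)) (\det (cmx (rescale 0) - z%:M)).
  apply: ccvg_det; apply: mcvgB; last exact: mcvg_cst.
  by apply: mcvg_cmx; exact: rescale_cont.
have [h1 h2] := h.
have E1 := @punctured_const (fun s => reC (\det (cmx (rescale s) - z%:M))) (reC (\det (cmx M - z%:M))) h1.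
have E2 := @punctured_const (fun s => imC (\det (cmx (rescale s) - z%:M))) (imC (\det (cmx M - z%:M))) h2.
apply/eqP; rewrite eq_complex E1 ?E2 ?eqxx// => t t0; by rewrite H.
Qed.

Lemma rescale1 : rescale 1 = M.
Proof.
apply/matrixP => i j; rewrite mxE expr1n mul1r; case: leqP => // h.
by rewrite wt_lt.
Qed.

Lemma rescale0 i j : rescale 0 i j = if wt i == wt j then M i j else 0.
Proof.
rewrite mxE; case: ltngtP => h; rewrite ?h ?subnn ?expr0 ?mul1r//.
by rewrite expr0n subn_eq0 leqNgt h mul0r.
Qed.

Lemma rescale0_diamond : rescale 0 = diamond (diag2 l l^-1) (corner (rescale 0)).
Proof.
have Z i j : wt i != wt j -> rescale 0 i j = 0 by move=> /negPf h; rewrite rescale0 h.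
have Ee : rescale 0 e e = l by rewrite rescale0 eqxx eigen_col eqxx mul1r.
have Ef : rescale 0 f f = l^-1 by rewrite rescale0 eqxx eigen_row eqxx mul1r.
rewrite /diamond /diag2 /corner !block_mxKul !block_mxKur !block_mxKdl !block_mxKdr.
move: (rescale 0) Z Ee Ef => X Z Ee Ef.
rewrite -{1}[X]submxK -{1}[ulsubmx X]submxK -{1}[ursubmx X]submxK
  -{1}[dlsubmx X]submxK -{1}[drsubmx X]submxK.
congr block_mx; congr block_mx; apply/matrixP => i j; rewrite !mxE.
all: try (rewrite !ord1 ?eqxx; by [exact: Ee | exact: Ef]).
all: apply: Z; rewrite /wt /=; try (have := ltn_ord i); try (have := ltn_ord j).
all: repeat case: eqP; move=> *; lia.
Qed.

Lemma conn_split : exists B : 'M[R]_(n + n),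
  [/\ conn z M (diamond (diag2 l l^-1) B), symplectic B & nondeg z B].
Proof.
have nd s : nondeg z (rescale s) by rewrite /Defs.nondegenerate rescale_det.
exists (corner (rescale 0)); rewrite -rescale0_diamond; split.
- apply: conn_sym; rewrite -[X in conn z _ X]rescale1; apply: conn_itv; first exact: rescale_cont.
  by move=> t _; split; [exact: rescale_sympl|exact: nd].
- by apply: (@symplectic_corner R 1 n (diag2 l l^-1)); rewrite -rescale0_diamond; exact: rescale_sympl.
- by apply: (@nondeg_corner R z 1 n (diag2 l l^-1)); rewrite -rescale0_diamond; exact: nd.
Qed.

End EigenSplitting.

Section NormalForm.
Variables (R : realType) (z : R[i]).
Hypothesis z1 : nsq z = 1.
Local Notation C := R[i].

(** [Mplus] and [Mminus] have this form with [O] diagonal with entries of modulus one. For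
    orthogonal [O] the eigenvalues have modulus [2] or [1 / 2], so moving [O] never meets a unit
    [z]. *)
Definition stretch n (O : 'M[R]_n) : 'M[R]_(n + n) := block_mx (2 *: O) 0 0 (2^-1 *: O).

Lemma symplectic_stretch n (O : 'M[R]_n) : O^T *m O = 1%:M -> symplectic (stretch O).
Proof.
move=> oO; apply: symplectic_of; rewrite /stretch tr_block_mx !trmx0 !mulmx_block.
rewrite !mulmx0 !mul0mx !addr0 !add0r !mul0mx mulmx1 mulmxN mulmx1 mulNmx !linearZ /=.
by rewrite -!scalemxAl scalerN !scalerA oO mulVf ?mulfV ?pnatr_eq0// !scale1r.
Qed.

Lemma fro_mulmx_orth n (O : 'M[R]_n) (v : 'rV[C]_n) : O^T *m O = 1%:M -> fro (v *m cmx O) = fro v.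
Proof.
move=> oO; apply: fro_mulmxU; apply/unitarymxP.
by rewrite trmxC_cmx -cmxM (mulmx1C oO) cmx_scalar.
Qed.

Lemma froZ n (a : C) (v : 'rV[C]_n) : fro (a *: v) = nsq a * fro v.
Proof.
rewrite /fro mulr_sumr; apply: eq_bigr => i _; rewrite mulr_sumr; apply: eq_bigr => j _.
by rewrite mxE nsqM.
Qed.

Lemma fro_gt0' n (v : 'rV[C]_n) : (fro v == 0) = (v == 0).
Proof.
apply/eqP/eqP => [/fro_eq0//|->]; rewrite /fro big1// => i _; rewrite big1// => j _.
by rewrite mxE /nsq /= expr0n /= addr0.
Qed.

Lemma scaled_orth_unit n (O : 'M[R]_n) (a : R) : O^T *m O = 1%:M -> a ^+ 2 != 1 ->
  cmx (a *: O) - z%:M \in unitmx.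
Proof.
move=> oO a1; rewrite unitmxE unitfE; apply/det0P => -[v v0 /eqP].
rewrite mulmxBr subr_eq0 mul_mx_scalar /cmx map_mxZ -scalemxAr => /eqP E.
have := congr1 (@fro R _ _) E; rewrite !froZ fro_mulmx_orth// z1 mul1r /nsq /= expr0n /= addr0.
move=> /eqP; rewrite -subr_eq0 -{2}[fro v]mul1r -mulrBl mulf_eq0 subr_eq0 (negPf a1) /=.
by rewrite fro_gt0' (negPf v0).
Qed.

Lemma nondeg_stretch n (O : 'M[R]_n) : O^T *m O = 1%:M -> nondeg z (stretch O).
Proof.
move=> oO; rewrite nondeg_unit.
have -> : cmx (stretch O) - z%:M = block_mx (cmx (2 *: O) - z%:M) 0 0 (cmx (2^-1 *: O) - z%:M).
  by rewrite /cmx /stretch map_block_mx !map_mx0 (scalar_mx_block n n) opp_block_mx add_block_mx !oppr0 !addr0.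
have four : (2 : R) ^+ 2 != 1.
  by apply/eqP; rewrite expr2; lra.
rewrite unitmxE det_ublock unitrM -!unitmxE !scaled_orth_unit//.
by rewrite exprVn invr_eq1.
Qed.

Lemma rcontinuous_stretch n (O : R -> 'M[R]_n) : rcontinuous O -> rcontinuous (fun t => stretch (O t)).
Proof.
move=> Oc t; apply: rcvg_block; (try exact: rcvg_cst).
  by apply: rcvgZ; [exact: cvg_cst|exact: Oc].
by apply: rcvgZ; [exact: cvg_cst|exact: Oc].
Qed.

Lemma conn_stretch n (O : R -> 'M[R]_n) : rcontinuous O -> (forall t, (O t)^T *m O t = 1%:M) ->
  conn z (stretch (O 0)) (stretch (O 1)).
Proof.
move=> Oc oO; exists (fun t => stretch (O t)); split=> //; first exact: rcontinuous_stretch.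
by move=> t; split; [exact: symplectic_stretch|exact: nondeg_stretch].
Qed.

Lemma diamond_stretch n (a : R) (O : 'M[R]_n) :
  diamond (diag2 (2 * a) (2^-1 * a)) (stretch O) = stretch (block_mx a%:M 0 0 O).
Proof.
rewrite /diamond /diag2 /stretch !block_mxKul !block_mxKur !block_mxKdl !block_mxKdr.
by rewrite !scale_block_mx !scaler0 !scale_scalar_mx !block_mx0.
Qed.

Lemma Mplus_stretch n : Mplus R n = stretch 1%:M.
Proof.
elim: n => [|n IH]; first by rewrite [LHS]flatmx0 [RHS]flatmx0.
have := diamond_stretch 1 (1%:M : 'M[R]_n).
by rewrite !mulr1 -(scalar_mx_block 1 n 1) -IH.
Qed.

Lemma Mminus_stretch n : Mminus R n.+1 = stretch (block_mx (-1)%:M 0 0 1%:M : 'M[R]_(1 + n)).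
Proof. by rewrite -diamond_stretch -Mplus_stretch !mulrN1. Qed.

Definition plane n (a b c d : R) : 'M[R]_(1 + (1 + n)) :=
  block_mx a%:M (row_mx b%:M 0) (col_mx c%:M 0) (block_mx d%:M 0 0 1%:M).

Lemma plane_cont n (a b c d : R -> R) : continuous a -> continuous b -> continuous c -> continuous d ->
  rcontinuous (fun t => plane n (a t) (b t) (c t) (d t)).
Proof.
have S k (f : R -> R) t : continuous f -> rcvg (nbhs t) (fun t => (f t)%:M : 'M[R]_k) (f t)%:M.
  move=> fc i j; rewrite mxE; under eq_fun do rewrite mxE.
  by case: (i == j); [exact: fc|rewrite mulr0n; under eq_fun do rewrite mulr0n; exact: cvg_cst].
move=> ac bc cc dc t; apply: rcvg_block.
- exact: S.
- move=> i j; case: (split_ordP j) => k ->.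
    by rewrite row_mxEl; under eq_fun do rewrite row_mxEl; exact: S.
  by rewrite row_mxEr; under eq_fun do rewrite row_mxEr; exact: cvg_cst.
- move=> i j; case: (split_ordP i) => k ->.
    by rewrite col_mxEu; under eq_fun do rewrite col_mxEu; exact: S.
  by rewrite col_mxEd; under eq_fun do rewrite col_mxEd; exact: cvg_cst.
- by apply: rcvg_block; try exact: rcvg_cst; exact: S.
Qed.

Lemma plane_orth n a b c d : a ^+ 2 + c ^+ 2 = 1 -> b ^+ 2 + d ^+ 2 = 1 -> a * b + c * d = 0 ->
  (plane n a b c d)^T *m plane n a b c d = 1%:M.
Proof.
move=> h1 h2 h3; apply/matrixP => i j; rewrite mxE.
have E k : (plane n a b c d)^T i k * plane n a b c d k j = plane n a b c d k i * plane n a b c d k j.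
  by rewrite mxE.
under eq_bigr do rewrite E; clear E.
rewrite big_split_ord big_ord1 big_split_ord big_ord1 /=.
have p00 (x y : 'I_1) : plane n a b c d (lshift _ x) (lshift _ y) = a.
  by rewrite block_mxEul mxE !ord1 eqxx.
have p01 (x y : 'I_1) : plane n a b c d (lshift _ x) (rshift _ (lshift _ y)) = b.
  by rewrite block_mxEur row_mxEl mxE !ord1 eqxx.
have p02 (x : 'I_1) y : plane n a b c d (lshift _ x) (rshift _ (rshift _ y)) = 0.
  by rewrite block_mxEur row_mxEr mxE.
have p10 (x y : 'I_1) : plane n a b c d (rshift _ (lshift _ x)) (lshift _ y) = c.
  by rewrite block_mxEdl col_mxEu mxE !ord1 eqxx.
have p20 x (y : 'I_1) : plane n a b c d (rshift _ (rshift _ x)) (lshift _ y) = 0.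
  by rewrite block_mxEdl col_mxEd mxE.
have p11 (x y : 'I_1) : plane n a b c d (rshift _ (lshift _ x)) (rshift _ (lshift _ y)) = d.
  by rewrite block_mxEdr block_mxEul mxE !ord1 eqxx.
have p12 (x : 'I_1) y : plane n a b c d (rshift _ (lshift _ x)) (rshift _ (rshift _ y)) = 0.
  by rewrite block_mxEdr block_mxEur mxE.
have p21 x (y : 'I_1) : plane n a b c d (rshift _ (rshift _ x)) (rshift _ (lshift _ y)) = 0.
  by rewrite block_mxEdr block_mxEdl mxE.
have p22 x y : plane n a b c d (rshift _ (rshift _ x)) (rshift _ (rshift _ y)) = (x == y)%:R.
  by rewrite block_mxEdr block_mxEdr mxE.
have pE := (p00, p01, p02, p10, p11, p12, p20, p21, p22).
clear p00 p01 p02 p10 p11 p12 p20 p21 p22.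
move: (plane n a b c d) pE => p pE.
have cs (i' : 'I_(1 + (1 + n))) : [\/ i' = lshift _ 0, i' = rshift _ (lshift _ 0) | exists y, i' = rshift _ (rshift _ y)].
  case: (split_ordP i') => x ->; first by apply: Or31; rewrite ord1.
  case: (split_ordP x) => y ->; first by apply: Or32; rewrite ord1.
  by apply: Or33; exists y.
have s0 (F : 'I_n -> R) : (forall y, F y = 0) -> \sum_y F y = 0 by move=> F0; rewrite big1.
case: (cs i) => [->|->|[x ->]]; case: (cs j) => [->|->|[y ->]]; rewrite !pE mxE -val_eqE /=.
- by rewrite ?eqxx s0 ?addr0 -?expr2// => k; rewrite !pE mulr0.
- by rewrite s0 ?addr0// => k; rewrite !pE mulr0.
- by rewrite !mulr0 s0 ?addr0// => k; rewrite !pE mul0r.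
- by rewrite s0 ?addr0 1?mulrC 1?[d * c]mulrC// => k; rewrite !pE mulr0.
- by rewrite ?eqxx s0 ?addr0 -?expr2// => k; rewrite !pE mulr0.
- by rewrite !mulr0 s0 ?addr0// => k; rewrite !pE mul0r.
- by rewrite !mul0r s0 ?addr0// => k; rewrite !pE mulr0.
- by rewrite !mul0r s0 ?addr0// => k; rewrite !pE mulr0.
- rewrite !mul0r !add0r (bigD1 x)//= !pE eqxx mul1r big1 ?addr0; first by rewrite !eqn_add2l val_eqE.
  by move=> k kx; rewrite !pE (negPf kx) mul0r.
Qed.

Lemma plane_diag n a d : plane n a 0 0 d = block_mx a%:M 0 0 (block_mx d%:M 0 0 1%:M).
Proof.
have E k : (0%:M : 'M[R]_k) = 0 by rewrite raddf0.
by rewrite /plane !E row_mx0 col_mx0.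
Qed.

(** A rotation by [pi] in the first two coordinates cancels two negative signs. *)
Lemma conn_merge n :
  conn z (stretch (block_mx (-1)%:M 0 0 (block_mx (-1)%:M 0 0 1%:M) : 'M[R]_(1 + (1 + n))))
         (stretch (1%:M : 'M[R]_(1 + (1 + n)))).
Proof.
apply: conn_sym; have := @conn_stretch (1 + (1 + n))
  (fun t => plane n (cos (pi * t)) (- sin (pi * t)) (sin (pi * t)) (cos (pi * t))).
have pc : continuous (fun t : R => pi * t) by move=> t; apply: cvgM; [exact: cvg_cst|exact: cvg_id].
have cc : continuous (fun t : R => cos (pi * t)).
  by move=> t; apply: (cvg_comp (fun t : R => pi * t) cos _ _); [exact: pc|exact: continuous_cos].
have sc : continuous (fun t : R => sin (pi * t)).
  by move=> t; apply: (cvg_comp (fun t : R => pi * t) sin _ _); [exact: pc|exact: continuous_sin].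
rewrite mulr0 mulr1 cos0 sin0 cospi sinpi oppr0 !plane_diag -!scalar_mx_block; apply.
  by apply: plane_cont => // t; apply: cvgN; exact: sc.
move=> t; apply: plane_orth; rewrite ?sqrrN; last by ring.
- exact: cos2Dsin2.
- by rewrite addrC cos2Dsin2.
Qed.

(** A rotating reflection of the first two coordinates moves the negative sign from the second to
    the first. *)
Lemma conn_swap n :
  conn z (stretch (block_mx 1%:M 0 0 (block_mx (-1)%:M 0 0 1%:M) : 'M[R]_(1 + (1 + n))))
         (stretch (block_mx (-1)%:M 0 0 1%:M : 'M[R]_(1 + (1 + n)))).
Proof.
have := @conn_stretch (1 + (1 + n))
  (fun t => plane n (cos (pi * t)) (sin (pi * t)) (sin (pi * t)) (- cos (pi * t))).
have pc : continuous (fun t : R => pi * t) by move=> t; apply: cvgM; [exact: cvg_cst|exact: cvg_id].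
have cc : continuous (fun t : R => cos (pi * t)).
  by move=> t; apply: (cvg_comp (fun t : R => pi * t) cos _ _); [exact: pc|exact: continuous_cos].
have sc : continuous (fun t : R => sin (pi * t)).
  by move=> t; apply: (cvg_comp (fun t : R => pi * t) sin _ _); [exact: pc|exact: continuous_sin].
rewrite mulr0 mulr1 cos0 sin0 cospi sinpi opprK !plane_diag -(scalar_mx_block 1 n 1); apply.
  by apply: plane_cont => // t; apply: cvgN; exact: cc.
move=> t; apply: plane_orth; rewrite ?sqrrN; last by ring.
- exact: cos2Dsin2.
- by rewrite addrC cos2Dsin2.
Qed.

(** Induction on [n]: a plane with eigenvalues [l], [l^-1], where [l = 2] or [l = -2], is split off,
    the complement is treated by induction, and at most one negative sign survives since pairs of
    them cancel. *)
Lemma conn_Mpm n (M : 'M[R]_(n + n)) : symplectic M -> nondeg z M ->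
  conn z M (Mplus R n) \/ conn z M (Mminus R n).
Proof.
elim: n M => [|n IH] M sM nM.
  by left; rewrite (_ : Mplus R 0 = M); [exact: conn_refl|rewrite [LHS]flatmx0 [RHS]flatmx0].
have [M1 [l [v [c1 s1 n1 lE [v0 vE]]]]] := conn_real_eigen z1 (ltn0Sn n) sM nM.
pose e := delta_mx (lshift (1 + n) (lshift n (0 : 'I_1))) 0 : 'cV[R]_((1 + n) + (1 + n)).
have e0 : e != 0.
  apply/eqP => /matrixP/(_ (lshift (1 + n) (lshift n (0 : 'I_1))) 0); rewrite !mxE !eqxx => /eqP.
  by rewrite oner_eq0.
have [M2 [c2 s2 n2 eE]] := @conn_conj_move R z (1 + n) M1 v e l s1 n1 vE v0 e0.
have l0 : l != 0 by case: lE => ->; rewrite ?oppr_eq0 pnatr_eq0.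
have [B [c3 sB nB]] := conn_split s2 n2 eE l0.
have c4 : conn z M (diamond (diag2 l l^-1) B) := conn_trans c1 (conn_trans c2 c3).
have [a aE la] : exists2 a : R, a = 1 \/ a = -1 & diag2 l l^-1 = diag2 (2 * a) (2^-1 * a).
  case: lE => ->; first by exists 1; [left|rewrite !mulr1].
  by exists (-1); [right|rewrite !mulrN1 invrN].
have sD : symplectic (diag2 (2 * a) (2^-1 * a)) /\ nondeg z (diag2 (2 * a) (2^-1 * a)).
  have -> : diag2 (2 * a) (2^-1 * a) = stretch (a%:M : 'M[R]_1).
    by rewrite /stretch !scale_scalar_mx.
  have oa : (a%:M : 'M[R]_1)^T *m a%:M = 1%:M.
    by rewrite tr_scalar_mx -scalar_mxM; case: aE => ->; rewrite ?mulrNN mulr1.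
  by split; [exact: symplectic_stretch|exact: nondeg_stretch].
have [sD1 nD1] := sD.
have fin X : conn z B (stretch X) ->
    @conn R z (1 + n) M (stretch (block_mx a%:M 0 0 X : 'M[R]_(1 + n))).
  move=> cB; apply: conn_trans c4 _; rewrite la -diamond_stretch.
  exact: (@conn_diamond R z 1 n _ _ _ _ (conn_refl sD1 nD1) cB).
have [cB|cB] := IH B sB nB.
  have := fin 1%:M; rewrite -Mplus_stretch => /(_ cB).
  case: aE => ->; last by rewrite -Mminus_stretch; right.
  by rewrite -(scalar_mx_block 1 n 1) -(Mplus_stretch n.+1); left.
(* For an empty complement [Mminus] and [Mplus] coincide, so only the sign of the plane split off
   remains. *)
case: n IH M sM nM M1 v c1 s1 n1 v0 vE e e0 M2 c2 s2 n2 eE B c3 sB nB c4 fin cB => [|n] _ M sM nM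
  M1 v c1 s1 n1 v0 vE e e0 M2 c2 s2 n2 eE B c3 sB nB c4 fin cB.
  have := fin 1%:M; rewrite -Mplus_stretch => /(_ cB).
  case: aE => ->; last by rewrite -Mminus_stretch; right.
  by rewrite -(scalar_mx_block 1 0 1) -(Mplus_stretch 1); left.
rewrite Mminus_stretch in cB; have := fin _ cB; case: aE => -> c5.
  by right; rewrite Mminus_stretch; exact: conn_trans c5 (conn_swap n).
by left; rewrite Mplus_stretch; exact: conn_trans c5 (conn_merge n).
Qed.

End NormalForm.

(** * Values of [theta] at the normal forms and the index of nondegenerate paths *)

Section SelfAdjointSpectrum.
Variable R : realType.
Local Notation C := R[i].
Local Open Scope sesquilinear_scope.

(** The spectrum is stable under conjugation and avoids [1], so the arguments [a] and [2 pi - a]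
    have the same sum over it, and their mean is [pi]. *)
Lemma Theta_conj_sym N (W V : 'M[C]_N) : W \is unitarymx -> V \is unitarymx ->
  V *m W *m V^t* = W^t* -> \rank (kermx (W - 1%:M)) = 0%N -> Theta W = pi * N%:R.
Proof.
move=> uW uV VWV r0; have Wd := unitary_unidiag uW.
have d1 := unidiag_unit uW Wd.
have Wd' := unidiag_conj uV Wd; rewrite VWV in Wd'.
have Wc := unidiag_trmxC Wd.
have E := spectral_sum_eq (@ang R) Wd' Wc.
have n1 j : spectral_diag W 0 j != 1.
  apply/eqP => dj; have := unidiag_rank 1 Wd; rewrite r0 => /esym/eqP.
  by rewrite cards_eq0 => /eqP/setP/(_ j); rewrite !inE dj eqxx.
have : Theta W = 2 * pi * N%:R - Theta W.
  rewrite {1}/Theta E.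
  under eq_bigr => j _ do rewrite mxE (angJ (d1 j) (n1 j)).
  by rewrite big_split /= sumr_const card_ord sumrN mulr_natr.
by move: (Theta W) => t; lra.
Qed.

Lemma swapmx_Tm n : swapmx R n *m Tm R n = Tm R n *m Hd R n.
Proof.
have NE : (- 'i%C)%:M = - ('i%C)%:M :> 'M[C]_n by rewrite raddfN.
by rewrite /swapmx /Tm /Hd NE !mulmx_block !mul0mx !mul1mx !mulmx0 !add0r !addr0 !mulmxN !mulmx1 opprK.
Qed.

Lemma Hd_trmxC n : (Hd R n)^t* = Hd R n.
Proof. by rewrite /Hd trmxC_block !trmxC0 trmxCN !trmxC1. Qed.

Lemma Tm_swapmx n : (Tm R n)^t* *m swapmx R n = Hd R n *m (Tm R n)^t*.
Proof.
have := congr1 (fun A => A^t*) (swapmx_Tm n).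
by rewrite /= !trmxC_mul swapmx_trmxC Hd_trmxC.
Qed.

Lemma mulmx_involution (S : comPzRingType) N (H T X T' : 'M[S]_N) : H *m H = 1%:M ->
  X *m H = H *m X -> (T *m H) *m X *m (H *m T') = T *m X *m T'.
Proof. by move=> HH XH; rewrite -(mulmxA T) -XH (mulmxA T) -!mulmxA (mulmxA H) HH mul1mx. Qed.

(** Here [Hd] acts on [(q, p)]: matrices commuting with it are block diagonal, and they do not mix
    [q] with [p]. *)
Lemma Gm_real n (M : 'M[R]_(n + n)) : cmx M *m Hd R n = Hd R n *m cmx M ->
  map_mx Num.conj (Gm M) = Gm M.
Proof.
move=> cH; rewrite conj_Gm /Gm; move: (cmx M) cH => X cH.
rewrite scalemx_mid; congr (_ *: _).
have -> : swapmx R n *m (Tm R n *m X *m (Tm R n)^t*) *m swapmx R n =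
    (swapmx R n *m Tm R n) *m X *m ((Tm R n)^t* *m swapmx R n).
  by move: (swapmx R n) (Tm R n) ((Tm R n)^t* ) => s T T'; rewrite !mulmxA.
rewrite swapmx_Tm Tm_swapmx; exact: mulmx_involution (Hd2 R n) cH.
Qed.

Lemma Sm_real n (G : 'M[C]_(n + n)) : map_mx Num.conj G = G -> map_mx Num.conj (Sm G) = Sm G.
Proof.
move=> rG; have E (f : forall p q r s : nat, 'M[C]_(p + q, r + s) -> 'M[C]_(q, s)) : True by [].
have rA : map_mx Num.conj (Am G) = Am G.
  rewrite /Am map_block_mx map_mx0 map_mx1 -{3 4}rG; congr block_mx;
  by apply/matrixP => i j; rewrite !mxE.
have rL : map_mx Num.conj (Lm G) = Lm G.
  rewrite /Lm map_block_mx map_mx0 map_mx1 -{3 4}rG; congr block_mx;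
  by apply/matrixP => i j; rewrite !mxE.
by rewrite /Sm map_mxM map_invmx rA rL.
Qed.

Lemma nuz_nondeg n (z : C) (M : 'M[R]_(n + n)) : nondeg z M = (nuz z M == 0%N).
Proof. by rewrite nondeg_unit /nuz mxrank_ker subn_eq0 row_leq_rank row_free_unit. Qed.

Lemma trmxC_real n (S : 'M[C]_n) : map_mx Num.conj S = S -> S^t* = S^T.
Proof. by move=> rS; rewrite -{2}rS; apply/matrixP => i j; rewrite !mxE. Qed.

Lemma swap_Dz n (z : C) : swapmx R n *m Dz n z *m swapmx R n = (Dz n z)^t*.
Proof. by rewrite {1}/Dz swapmx_block Dz_trmxC /Dz conjcK. Qed.

Lemma conj_sym_identity N (D S s Dc Sc : 'M[C]_N) : s *m s = 1%:M -> s *m Dc *m s = D ->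
  s *m S *m s = Sc -> Dc *m D = 1%:M -> (Dc *m s) *m (Dc *m S) *m (s *m D) = Sc *m D.
Proof.
move=> ss sD sS DD; have -> : Dc *m s *m (Dc *m S) *m (s *m D) =
    Dc *m (s *m Dc *m (s *m s) *m S *m s) *m D by rewrite ss mulmx1 !mulmxA.
have -> : Dc *m (s *m Dc *m (s *m s) *m S *m s) *m D = Dc *m (s *m Dc *m s) *m (s *m S *m s) *m D.
  by rewrite !mulmxA.
by rewrite sD sS DD mul1mx.
Qed.

(** A real scattering matrix makes the spectrum of [Wz] conjugation invariant. The resulting value,
    the same at both normal forms, is what the constant [n] of the index formula compensates. *)
Lemma theta_real n (z : C) (M : 'M[R]_(n + n)) : nsq z = 1 -> symplectic M -> nondeg z M ->
  cmx M *m Hd R n = Hd R n *m cmx M -> theta z M = 2 * pi * n%:R.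
Proof.
move=> z1 sM nM cH; have rS := Sm_real (Gm_real cH).
have uD := Dz_unitary n z1; have uDc := unitaryC uD.
pose V := (Dz n z)^t* *m swapmx R n.
have uV : V \is unitarymx := unitaryM uDc (swapmx_unitary R n).
have ss := swapmxK R n.
have sw : swapmx R n *m (Dz n z)^t* *m swapmx R n = Dz n z.
  by rewrite Dz_trmxC swap_Dz Dz_trmxC conjcK.
have DD : (Dz n z)^t* *m Dz n z = 1%:M by exact: mulmx_unitaryE.
have St : swapmx R n *m Sm (Gm M) *m swapmx R n = (Sm (Gm M))^t*.
  by rewrite (trmxC_real rS) trmx_Sm.
have VW : V *m Wz z M *m V^t* = (Wz z M)^t*.
  rewrite /Wz /V (trmxC_mul _ (swapmx R n)) swapmx_trmxC trmxCK trmxC_mul trmxCK.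
  exact: conj_sym_identity.
rewrite /theta (Theta_conj_sym (Wz_unitary z1 sM) uV VW); first by rewrite natrD; ring.
by rewrite nuz_Wz//; apply/eqP; rewrite -nuz_nondeg.
Qed.

Lemma theta_Mpm n (z : C) (M : 'M[R]_(n + n)) : nsq z = 1 -> M = Mplus R n \/ M = Mminus R n ->
  symplectic M -> nondeg z M -> theta z M = 2 * pi * n%:R.
Proof.
move=> z1 ME sM nM; apply: theta_real => //.
have blk (a d : 'M[C]_n) : block_mx a 0 0 d *m Hd R n = Hd R n *m block_mx a 0 0 d.
  by rewrite /Hd !mulmx_block !mulmx0 !mul0mx !addr0 !add0r !mulmx1 !mul1mx mulmxN mulNmx mulmx1 mul1mx.
have st (O : 'M[R]_n) : cmx (stretch O) *m Hd R n = Hd R n *m cmx (stretch O).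
  by rewrite /cmx /stretch map_block_mx !map_mx0.
case: ME => ->; first by rewrite Mplus_stretch.
clear M sM nM; case: n blk st => [|n] _ st; last by rewrite Mminus_stretch st.
by rewrite [LHS]flatmx0 [RHS]flatmx0.
Qed.

(** At [z = 1] the identity is totally degenerate and each of the [2n] eigenvalues counts [2 pi]; at
    any other unit the mean argument is [pi]. This drop by half enters the final count twice. *)
Lemma theta_1 n (z : C) : nsq z = 1 -> theta z (1%:M : 'M[R]_(n + n)) = 2 * pi * n%:R * (1 + (z == 1)%:R).
Proof.
move=> z1; have [->|zn1] := eqVneq z 1; last first.
  rewrite addr0 mulr1; apply: theta_real => //; first exact: symplectic1.
    rewrite nondeg_unit cmx_scalar -raddfB unitmxE det_scalar unitfE expf_neq0// subr_eq0.
    by rewrite eq_sym.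
  by rewrite cmx_scalar scalar_mxC.
have D1 : Dz n (1 : C) = 1%:M by rewrite /Dz conjc1 -scalar_mx_block.
have S1 : Sm (Gm (1%:M : 'M[R]_(n + n))) = 1%:M.
  have I : (1%:M : 'M[C]_(n + n)) = block_mx 1%:M 0 0 1%:M by exact: scalar_mx_block.
  by rewrite Gm_scalar /Sm /Am /Lm I !block_mxKul !block_mxKur !block_mxKdl !block_mxKdr -I invmx1 mulmx1.
have W1 : Wz 1 (1%:M : 'M[R]_(n + n)) = 1%:M by rewrite /Wz D1 S1 trmxC1 mulmx1.
rewrite /theta W1; have I : (1%:M : 'M[C]_(n + n)) = diag_mx (const_mx 1).
  by rewrite diag_const_mx.
have u1 : (1%:M : 'M[C]_(n + n)) \is unitarymx by apply/unitarymxP; rewrite trmxC1 mulmx1.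
have ud := unidiag_diag (const_mx 1 : 'rV[C]_(n + n)); rewrite -I in ud.
rewrite (ThetaE u1 ud); under eq_bigr => j _ do rewrite mxE ang1.
rewrite sumr_const card_ord -[true%:R]/(1 : R) mulrnDr -mulr_natr; ring.
Qed.

End SelfAdjointSpectrum.

Section PathsWithArgument.
Variables (R : realType) (n : nat).
Local Notation C := R[i].

Definition argpath (g : R -> 'M[R]_(n + n)) (D : R -> R) :=
  [/\ rcontinuous g, continuous D & forall t, symplectic (g t) /\ is_arg (g t) (D t)].

Lemma argpath_exists a b (g : R -> 'M[R]_(n + n)) : a <= b -> is_path a b g ->
  exists2 D, argpath (g \o clamp a b) D & forall r, total_angle a b g r <-> r = D b - D a.
Proof.
move=> ab gp; have [D Dc DE] := path_arg ab gp; have [gc sg] := path_clamp ab gp.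
have aab : a \in `[a, b] by rewrite in_itv /= lexx.
have bab : b \in `[a, b] by rewrite in_itv /= lexx andbT.
exists (D \o clamp a b).
  split; first by move=> t; apply/rcvgP; exact: gc.
    by move=> t; apply: (cvg_comp (clamp a b) D); [exact: clamp_continuous|exact: Dc].
  by move=> t; split; [exact: sg|apply: DE; exact: clamp_itv].
move=> r; rewrite /= !clamp_id//; exact: total_angle_path.
Qed.

Lemma locally_constant (f : R -> R) : (forall t, \forall t' \near t, f t' = f t) ->
  forall x y, f x = f y.
Proof.
move=> H x y; apply: (@is_derive_0_is_cst R f) => t.
have h : \forall t' \near t, (fun=> f t) t' = f t'.
  by have := H t; apply: filterS => t' ->.
exact: near_eq_is_derive h (is_derive_cst _ _ _).
Qed.

Lemma theta_constant (z : C) g D : nsq z = 1 -> argpath g D -> (forall t, nondeg z (g t)) ->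
  forall s t, theta z (g s) - 2 * D s = theta z (g t) - 2 * D t.
Proof.
move=> z1 [gc Dc gD] ng; apply: locally_constant => t.
have cz : ccvg (nbhs t) (fun=> z) z by exact: ccvg_cst.
have := @theta_path_local R n R (nbhs t) (nbhs_filter t) g (g t) (fun t => (gD t).1) (gD t).1 (gc t)
  (fun=> z) z (fun=> z1) z1 cz D (D t) (fun t => (gD t).2) (gD t).2 (Dc t).
have n0 : nuz z (g t) = 0%N by apply/eqP; rewrite -nuz_nondeg; exact: ng.
apply: filterS => t' [k kn E]; apply: (etrans E).
by move: kn; rewrite n0 leqn0 => /eqP ->; rewrite mulr0 subr0.
Qed.

Lemma index_arith (p d th N : R) : p != 0 ->
  (d + (2 * p * N - th) / 2) / p = N + (2 * d - th) / (2 * p).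
Proof. by move=> p0; field. Qed.

(** Along the auxiliary path [theta - 2 D] is constant, and [theta] is [2 pi n] at its end; so its
    angle depends on [g tau] alone, whichever path [xget] selects. Existence of such a path is
    [conn_Mpm]. *)
Lemma index_ndE tau (z : C) (g : R -> 'M[R]_(n + n)) D : 0 < tau -> nsq z = 1 -> Ppath tau g ->
  nondeg z (g tau) -> argpath (g \o clamp 0 tau) D ->
  index_nd tau z g = n%:R + (2 * (D tau - D 0) - theta z (g tau)) / (2 * pi).
Proof.
move=> tau0 z1 [gp g0] ng gD.
have tt : tau \in `[0, tau] by rewrite in_itv /= lexx andbT ltW.
have [D' gD' totE] := argpath_exists (ltW tau0) gp.
have DD : D' tau - D' 0 = D tau - D 0.
  apply: (lift_unique (ltW tau0)); [by case: gD'|by case: gD|] => t _.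
  have [_ _ /(_ t)[st h1]] := gD'; have [_ _ /(_ t)[_ h2]] := gD.
  have s0 := sqrt_nsq_gt0 (adet_neq0 st).
  by apply: (polar_unique s0 s0); rewrite -h1 -h2.
have zo : (0 : R) <= 1 by exact: ler01.
have key (b : R -> 'M[R]_(n + n)) db : is_path 0 1 b -> (forall t, t \in `[0, 1] -> nondeg z (b t)) ->
    b 0 = g tau -> b 1 = Mplus R n \/ b 1 = Mminus R n -> total_angle 0 1 b db ->
    db = (2 * pi * n%:R - theta z (g tau)) / 2.
  move=> bp bn b0 b1 tb; have [Db bD tbE] := argpath_exists zo bp.
  move/tbE: tb => ->; have nb t : nondeg z ((b \o clamp 0 1) t) by apply: bn; exact: clamp_itv.
  have E := theta_constant z1 bD nb 0 1.
  have i0 : (0 : R) \in `[0, 1] by rewrite in_itv /= lexx ler01.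
  have i1 : (1 : R) \in `[0, 1] by rewrite in_itv /= lexx ler01.
  move: E; rewrite /comp !clamp_id// b0 (theta_Mpm z1 b1).
  - by move: (theta z (g tau)) => th; lra.
  - by have [_ /(_ _ i1)] := bp.
  - exact: bn.
have fin (dg db : R) : dg = D tau - D 0 -> db = (2 * pi * n%:R - theta z (g tau)) / 2 ->
    (dg + db) / pi = n%:R + (2 * (D tau - D 0) - theta z (g tau)) / (2 * pi).
  move=> -> ->; have := pi_gt0 R; move: (theta z (g tau)) (D tau - D 0) => th d p0.
  exact/index_arith/lt0r_neq0.
rewrite /index_nd; set A := [set r | _].
have : A (xget 0 A).
  apply: xgetPex; have sg : symplectic (g tau) by have [_ /(_ _ tt)] := gp.
  have [b [bc sb b0 b1]] : exists b : R -> 'M[R]_(n + n), [/\ rcontinuous b,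
      forall t, symplectic (b t) /\ nondeg z (b t), b 0 = g tau & b 1 = Mplus R n \/ b 1 = Mminus R n].
    by have [[b [bc sb b0 b1]]|[b [bc sb b0 b1]]] := conn_Mpm z1 sg ng; exists b; split=> //; [left|right].
  have bp : is_path 0 1 b.
    split; last by move=> t _; have [] := sb t.
    by apply: continuous_within => t; apply/rcvgP; exact: bc.
  have [Db bD tbE] := argpath_exists zo bp.
  exists ((D' tau - D' 0 + (Db 1 - Db 0)) / pi), b, (D' tau - D' 0), (Db 1 - Db 0); split=> //.
    by split=> // t _; have [] := sb t.
  by split; [exact/totE|exact/tbE].
move=> [b [dg [db [[bp bn] b0 b1 [tg tb] ->]]]]; apply: fin.
  by rewrite -DD; exact/totE.
exact: key bp bn b0 b1 tb.
Qed.

End PathsWithArgument.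

(** * Perturbation by small rotations *)

Section Rotation.
Variables (R : realType) (n : nat).
Local Notation C := R[i].
Local Notation J := (Jmx R n).

Definition rotJ (d : R) : 'M[R]_(n + n) := rotmx (cos d)%:M (sin d)%:M.

Lemma rotJE d : rotJ d = (cos d)%:M + sin d *: J.
Proof.
rewrite /rotJ /rotmx /Jmx scale_block_mx (scalar_mx_block n n) add_block_mx !scaler0 !addr0 !add0r.
by rewrite scalerN !scale_scalar_mx mulr1.
Qed.

Lemma rotJ0 : rotJ 0 = 1%:M.
Proof. by rewrite rotJE cos0 sin0 scale0r addr0. Qed.

Lemma symplectic_rotJ d : symplectic (rotJ d).
Proof.
apply: symplectic_of; rewrite rotJE.
have -> : ((cos d)%:M + sin d *: J)^T = (cos d)%:M - sin d *: J.
  by rewrite linearD /= linearZ /= Jmx_tr scalerN tr_scalar_mx.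
rewrite -mulmxA mulmxDr mul_mx_scalar -scalemxAr Jmx2 mulmxBl mul_scalar_mx -scalemxAl.
rewrite mulmxDr -!scalemxAr Jmx2 mulmxN mulmx1.
have := cos2Dsin2 d; move: (cos d) (sin d) J => c s j h.
by rewrite -[RHS]scale1r -h; apply/matrixP => i k; rewrite !mxE; ring.
Qed.

Lemma adet_rotJ (M : 'M[R]_(n + n)) d : adet (M *m rotJ d) = adet M * expi (n%:R * d).
Proof.
rewrite /rotJ adet_mul_rotmx expi_natM; congr (_ * _); rewrite -det_scalar; congr (\det _).
apply/matrixP => i j; rewrite !mxE; case: (i == j); rewrite ?mulr1n ?mulr0n.
  by apply/eqP; rewrite eq_complex /=; apply/andP; split; apply/eqP; ring.
by apply/eqP; rewrite eq_complex /=; apply/andP; split; apply/eqP; ring.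
Qed.

Lemma is_arg_rotJ (M : 'M[R]_(n + n)) D d : symplectic M -> is_arg M D ->
  is_arg (M *m rotJ d) (D + n%:R * d).
Proof.
move=> sM aM; apply: (is_arg_polar (sqrt_nsq_gt0 (adet_neq0 sM))).
by rewrite adet_rotJ {1}aM expiD mulrA.
Qed.

Lemma arg_exists (M : 'M[R]_(n + n)) : symplectic M -> exists D, is_arg M D.
Proof.
move=> sM; have gp : is_path (0 : R) 0 (fun=> M) by split=> //; apply: continuous_within => t; exact: cvg_cst.
have [D _ h] := path_arg (lexx 0) gp.
by exists (D 0); apply: h; rewrite in_itv /= lexx.
Qed.

Lemma rotJ_cont : rcontinuous rotJ.
Proof.
move=> t; rewrite (_ : rotJ = fun d => (cos d)%:M + sin d *: J); last exact/funext/rotJE.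
apply: rcvgD.
  move=> i j; rewrite mxE; under eq_fun do rewrite mxE.
  case: (i == j); rewrite ?mulr1n ?mulr0n; last by under eq_fun do rewrite mulr0n; exact: cvg_cst.
  by under eq_fun do rewrite mulr1n; exact: continuous_cos.
by apply: rcvgZ; [exact: continuous_sin|exact: rcvg_cst].
Qed.

(** Since [M J = J (M M^T)^-1 M], multiplying on the right by small rotations is a positive path
    through [M], with Hamiltonian [(M M^T)^-1]. *)
Lemma rotJ_derive (M : 'M[R]_(n + n)) : symplectic M ->
  rcvg ((0 : R)^') (fun d : R => d^-1 *: (M *m rotJ d - M)) (J *m (invmx M^T *m invmx M) *m M).
Proof.
move=> sM; have [uM _] := sM.
have -> : J *m (invmx M^T *m invmx M) *m M = M *m (0%:M + (1 : R) *: J).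
  rewrite -!mulmxA mulVmx// mulmx1 raddf0 add0r scale1r.
  have uT : M^T \in unitmx by rewrite unitmx_tr.
  by apply: (can_inj (mulmxK uT)); rewrite -mulmxA mulVmx// mulmx1 symplectic_tr_mul.
have E d : d^-1 *: (M *m rotJ d - M) = M *m ((d^-1 * (cos d - 1))%:M + (d^-1 * sin d) *: J).
  rewrite -{2}[M]mulmx1 -mulmxBr scalemxAr; congr (_ *m _).
  by rewrite rotJE addrAC -raddfB scalerDr scale_scalar_mx scalerA.
rewrite (funext E); apply: rcvgM; first exact: rcvg_cst.
have dq (f : R -> R) (l : R) : is_derive (0 : R) (1 : R) f l -> (d : R)^-1 * (f d - f 0) @[d --> 0^'] --> l.
  move=> [df <-]; have := df; rewrite /derivable => /cvg_ex[k kE].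
  have := kE; rewrite {1}/GRing.scale /=; have -> : 'D_1 f 0 = k by apply: cvg_lim.
  by under eq_fun do rewrite addr0 [_ *: 1]mulr1.
apply: rcvgD.
  move=> i j; rewrite mxE; under eq_fun do rewrite mxE.
  case: (i == j); rewrite ?mulr1n ?mulr0n; last by under eq_fun do rewrite mulr0n; exact: cvg_cst.
  under eq_fun do rewrite mulr1n.
  have := dq cos (- sin 0) (is_derive_cos 0); rewrite sin0 cos0 oppr0; exact.
apply: rcvgZ; last exact: rcvg_cst.
have := dq sin (cos 0) (is_derive_sin 0); rewrite sin0 cos0.
by under eq_fun do rewrite subr0.
Qed.

Lemma gram_posdef (M : 'M[R]_(n + n)) : M \in unitmx -> posdef (invmx M^T *m invmx M).
Proof.
move=> uM; have uI : invmx M \in unitmx by rewrite unitmx_inv.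
split; first by rewrite trmx_mul !trmx_inv trmxK.
move=> v v0; have -> : v^T *m (invmx M^T *m invmx M) *m v = (invmx M *m v)^T *m (invmx M *m v).
  by rewrite trmx_mul trmx_inv !mulmxA.
have w0 : invmx M *m v != 0 by apply: contra v0 => /eqP E; rewrite -(mulKmx uI v) E mulmx0.
move: (invmx M *m v) w0 => w w0; rewrite lt_neqAle eq_sym fun_neq0//= mxE sumr_ge0// => i _.
by rewrite mxE -expr2 sqr_ge0.
Qed.

Section Jump.
Variables (z : C) (M : 'M[R]_(n + n)).
Hypotheses (z1 : nsq z = 1) (sM : symplectic M).

Lemma rcvg_rotJ (F : set_system R) (FF : Filter F) : F `=>` nbhs 0 ->
  rcvg F (fun d => M *m rotJ d) M.
Proof.
move=> h; have E : rcvg (nbhs (0 : R)) (fun d => M *m rotJ d) (M *m rotJ 0).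
  by apply: rcvgM; [exact: rcvg_cst|exact: rotJ_cont].
by move: E; rewrite rotJ0 mulmx1 => E i j; apply: cvg_trans (E i j); exact: cvg_app.
Qed.

Lemma arg_rotJ_cvg D (F : set_system R) (FF : Filter F) : F `=>` nbhs 0 ->
  D + n%:R * d @[d --> F] --> D.
Proof.
move=> h; have E : D + n%:R * d @[d --> (0 : R)] --> D + n%:R * 0.
  by apply: cvgD; [exact: cvg_cst|apply: cvgM; [exact: cvg_cst|exact: cvg_id]].
by move: E; rewrite mulr0 addr0 => E; apply: cvg_trans E; exact: cvg_app.
Qed.

(** A small positive rotation removes all degeneracy at [z]. The summand [2 n d] is twice the change
    of the polar angle, and the full multiplicity is lost. *)
Lemma rotJ_right : \forall d \near 0^'+, nuz z (M *m rotJ d) = 0%N /\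
  theta z (M *m rotJ d) = theta z M + 2 * (n%:R * d) - 2 * pi * (nuz z M)%:R.
Proof.
have [D aM] := arg_exists sM; have [uM _] := sM.
have sub : (0 : R)^'+ `=>` nbhs 0 by exact: cvg_within.
have dM : rcvg ((0 : R)^'+) (fun d : R => d^-1 *: (M *m rotJ d - M)) (J *m (invmx M^T *m invmx M) *m M).
  move=> i j; apply: cvg_dnbhs_at_right; exact: rotJ_derive.
have pos : \forall d \near (0 : R)^'+, 0 < d by exact: nbhs_right_gt.
have := @theta_path_right R n R (0^'+) _ (fun d => M *m rotJ d) M
  (fun d => symplecticM sM (symplectic_rotJ d)) sM (@rcvg_rotJ _ _ sub) z _ id
  (fun d => D + n%:R * d) D z1 (gram_posdef uM) dM (fun d => is_arg_rotJ d sM aM) aM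
  (@arg_rotJ_cvg D _ _ sub) pos.
have FF : Filter ((0 : R)^'+) by typeclasses eauto.
move=> /(_ FF FF FF); apply: filterS => d [h E]; split=> //; move: E.
by move: (theta z _) (theta z M) (nuz z M) => a b c; lra.
Qed.

(** Rotating backwards also removes the degeneracy, but without a jump; these perturbations attain
    the infimum in the index. *)
Lemma rotJ_left : \forall d \near 0^'+, nuz z (M *m rotJ (- d)) = 0%N /\
  theta z (M *m rotJ (- d)) = theta z M - 2 * (n%:R * d).
Proof.
have [D aM] := arg_exists sM; have [uM _] := sM.
have opp : (fun d : R => - d) @ 0^'+ `=>` 0^'.
  move=> A [e /= e0 eA]; exists e => //= d de d0; apply: eA.
    by move: de; rewrite /= !sub0r opprK normrN.
  by rewrite /= oppr_eq0 lt0r_neq0.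
have sub : (fun d : R => - d) @ 0^'+ `=>` nbhs 0.
  by apply: (cvg_trans opp); exact: cvg_within.
have dM : rcvg ((0 : R)^'+) (fun d : R => (- d)^-1 *: (M *m rotJ (- d) - M)) (J *m (invmx M^T *m invmx M) *m M).
  move=> i j; apply: (cvg_comp (fun d : R => - d) (fun d : R => (d^-1 *: (M *m rotJ d - M)) i j) opp).
  exact: rotJ_derive.
have MM : rcvg ((0 : R)^'+) (fun d : R => M *m rotJ (- d)) M.
  by move=> i j; exact: (@rcvg_rotJ ((fun d : R => - d) @ 0^'+) _ sub i j).
have DD : D + n%:R * - d @[d --> (0 : R)^'+] --> D.
  exact: (@arg_rotJ_cvg D ((fun d : R => - d) @ 0^'+) _ sub).
have neg : \forall d \near (0 : R)^'+, - d < 0.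
  by near=> d; rewrite oppr_lt0.
have := @theta_path_left R n R (0^'+) _ (fun d => M *m rotJ (- d)) M
  (fun d => symplecticM sM (symplectic_rotJ (- d))) sM MM z _ (fun d => - d)
  (fun d => D + n%:R * - d) D z1 (gram_posdef uM) dM (fun d => is_arg_rotJ (- d) sM aM) aM
  DD neg.
have FF : Filter ((0 : R)^'+) by typeclasses eauto.
move=> /(_ FF); apply: filterS => d [h E]; split=> //; move: E.
by move: (theta z _) (theta z M) => a b; lra.
Unshelve. all: by end_near. Qed.

End Jump.
End Rotation.

Opaque adet theta nuz.

(** * The index formula *)

Section NearSymplectic.
Variables (R : realType) (n : nat).
Local Notation C := R[i].

Definition mclose (e : R) (M M' : 'M[R]_(n + n)) := forall i j, `|M' i j - M i j| < e.

Lemma nbhs_mclose (M : 'M[R]_(n + n)) (P : 'M[R]_(n + n) -> Prop) :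
  (\forall X \near M, P X) -> exists2 e, 0 < e & forall X, mclose e M X -> P X.
Proof.
move=> /nbhs_ballP[e /= e0 eP]; exists e => // X MX; apply: eP; split=> // i j.
by rewrite -ball_normE /= distrC; exact: MX.
Qed.

Lemma expi_close (D D' : R) : expi D = expi D' -> `|D - D'| < 2 * pi -> D = D'.
Proof.
move=> /expi_eq[k ->] h; suff -> : k = 0 by rewrite mul0r addr0.
apply: (@int_small R); move: h; rewrite addrC addKr normrM (gtr0_norm (x := 2 * pi)); last first.
  by rewrite mulr_gt0// pi_gt0.
by rewrite -ltr_pdivlMr ?mulr_gt0 ?pi_gt0// divff ?mulf_neq0// ?lt0r_neq0 ?pi_gt0.
Qed.

Lemma arg_dist (x y p : R) : `|x - y| < pi / 2 -> - (pi / 2) < p < pi / 2 -> `|x - (y + p)| < 2 * pi.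
Proof.
rewrite !ltr_norml => /andP[a b] /andP[c d]; have := pi_gt0 R => p0.
by apply/andP; split; lra.
Qed.

Lemma arg_shift (th0 thX p q r s k : R) : thX - 2 * (p - q + s) = th0 - 2 * r - 2 * pi * k ->
  0 <= k -> 2 * (r - s) - th0 <= 2 * (p - q) - thX.
Proof. by move=> E k0; have : 0 <= 2 * pi * k; [rewrite !mulr_ge0// pi_ge0|lra]. Qed.

Lemma re_polar (a b : C) (r s D D' : R) : a = r%:C%C * expi D -> b = s%:C%C * expi D' ->
  reC (b * a^*%C) = s * r * cos (D' - D).
Proof. by move=> -> ->; rewrite /expi /= cosB; ring. Qed.

Lemma polar_quotient (a b : C) (r s D p : R) : 0 < r -> 0 < s -> a = r%:C%C * expi D ->
  b * a^*%C = s%:C%C * expi p -> exists2 t, 0 < t & b = t%:C%C * expi (D + p).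
Proof.
move=> r0 s0 -> E; exists (s / r); first exact: divr_gt0.
have rn : r%:C%C != 0 :> C by rewrite (inj_eq (@complexI R) _ 0) lt0r_neq0.
have J : (r%:C%C * expi D)^*%C = r%:C%C * expi (- D) by rewrite rmorphM -expiJ; congr (_ * _); exact: conjc_real.
apply: (mulIf rn); apply: (mulIf (expi_neq0 (- D))); rewrite -mulrA -J E.
have -> : (s / r)%:C%C * expi (D + p) * r%:C%C * expi (- D) = (s / r * r)%:C%C * (expi (D + p) * expi (- D)).
  by rewrite [(s / r * r)%:C%C]rmorphM /=; ring.
by rewrite divfK ?lt0r_neq0// -expiD addrAC subrr add0r.
Qed.

Lemma re_arg (M M' : 'M[R]_(n + n)) D D' : symplectic M -> symplectic M' -> is_arg M D -> is_arg M' D' ->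
  exists2 r, 0 < r & reC (adet M' * (adet M)^*%C) = r * cos (D' - D).
Proof.
move=> sM sM'; rewrite /is_arg.
have := sqrt_nsq_gt0 (adet_neq0 sM); have := sqrt_nsq_gt0 (adet_neq0 sM').
move: (adet M) (adet M') => a b.
move: (Num.sqrt (nsq a)) (Num.sqrt (nsq b)) => r s s0 r0 aE bE.
exists (s * r).
exact: mulr_gt0.
by rewrite (re_polar aE bE).
Qed.

Section ThetaNear.
Variables (M0 : 'M[R]_(n + n)) (D0 : R) (z : C).
Hypotheses (sM0 : symplectic M0) (aM0 : is_arg M0 D0) (z1 : nsq z = 1).

(** [theta_path_local] requires a family that is symplectic throughout and carries a continuous
    argument. Matrices without these properties are replaced by [M0], which does not affect those of
    interest. *)
Let good (X : 'M[R]_(n + n)) := symplectic X /\ 0 < reC (adet X * (adet M0)^*%C).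
Let Mt (X : 'M[R]_(n + n)) : 'M[R]_(n + n) := if pselect (good X) then X else M0.
Let w (X : 'M[R]_(n + n)) := adet (Mt X) * (adet M0)^*%C.
Let Dt (X : 'M[R]_(n + n)) := D0 + argp (w X).

Lemma Mt_good X : good (Mt X).
Proof.
rewrite /Mt; case: (pselect (good X)) => [gX|nX] /=; first by [].
split=> //; rewrite -nsqE /= lt_neqAle eq_sym nsq_eq0.
by rewrite adet_neq0//= nsq_ge0.
Qed.

Lemma Mt_arg X : is_arg (Mt X) (Dt X).
Proof.
have [sX wX] := Mt_good X; have a0 := sqrt_nsq_gt0 (adet_neq0 sM0).
have w0 : 0 < Num.sqrt (nsq (w X)).
  by apply: sqrt_nsq_gt0; apply/eqP => E; move: wX; rewrite -/(w X) E ltxx.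
have [r r0 rE] := polar_quotient a0 w0 aM0 (argpP wX).
exact: is_arg_polar r0 rE.
Qed.

(** The argument [DX] is prescribed only up to the window of width [pi / 2]; there it must coincide
    with the one built from [argp]. The jump has a sign: [theta - 2 D] can only decrease near
    [M0]. *)
Lemma theta_near : exists2 e, 0 < e & forall X DX, symplectic X -> mclose e M0 X -> is_arg X DX ->
  `|DX - D0| < pi / 2 ->
  exists2 k : nat, (k <= nuz z M0)%N & theta z X - 2 * DX = theta z M0 - 2 * D0 - 2 * pi * k%:R.
Proof.
have Mc : rcvg (nbhs M0) Mt M0.
  move=> i j; apply/cvgrPdist_lt => e e0.
  have : \forall X \near M0, ball M0 e X by exact: nbhsx_ballx.
  apply: filterS => X [_ /(_ i j)]; rewrite -ball_normE /= /Mt; case: pselect => //= _ _.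
  by rewrite subrr normr0.
have wc : ccvg (nbhs M0) w (adet M0 * (adet M0)^*%C).
  by apply: ccvgM; [exact: ccvg_adet|exact: ccvg_cst].
have rew0 : 0 < reC (adet M0 * (adet M0)^*%C).
  by rewrite -nsqE /= lt_neqAle eq_sym nsq_eq0 adet_neq0//= nsq_ge0.
have Dc : Dt X @[X --> M0] --> D0.
  have : Dt X @[X --> M0] --> D0 + argp (adet M0 * (adet M0)^*%C).
    have h := @argp_cvg R _ (nbhs M0) (nbhs_filter M0) w _ rew0 wc.
    exact: (cvgD (cvg_cst D0) h).
  by rewrite -nsqE /argp /= mul0r atan0 addr0.
have cz : ccvg (nbhs M0) (fun=> z) z by exact: ccvg_cst.
have := @theta_path_local R n _ (nbhs M0) (nbhs_filter M0) Mt M0 (fun X => (Mt_good X).1) sM0 Mc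
  (fun=> z) z (fun=> z1) z1 cz Dt D0 Mt_arg aM0 Dc.
move=> /nbhs_mclose[e e0 eP]; exists e => // X DX sX MX aX DD.
have [r r0 rE] := re_arg sM0 sX aM0 aX.
have cpos : 0 < cos (DX - D0) by apply: cos_gt0_pihalf; move: DD; rewrite ltr_norml.
have gX : good X by split; [exact: sX|rewrite rE; exact: mulr_gt0].
have MtX : Mt X = X by rewrite /Mt; case: pselect.
have [k kn kE] := eP X MX; exists k => //.
suff DE : DX = Dt X by move: kE; rewrite MtX -DE.
apply: expi_close; first by apply: (polar_unique r0 r0); have s0 := sqrt_nsq_gt0 (adet_neq0 sX);
  congr (_ * _); apply: (polar_unique s0 s0); rewrite -aX; have := Mt_arg X; rewrite MtX => <-.
exact: arg_dist DD (argp_itv (w X)).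
Qed.

End ThetaNear.

Lemma cvg_sub_norm (T : Type) (F : set_system T) (FF : Filter F) (f : T -> R) e :
  f t @[t --> F] --> (0 : R) -> e - `|f t| @[t --> F] --> e.
Proof.
move=> f0; have h : e - `|f t| @[t --> F] --> e - `|0 : R|.
  by apply: cvgB; [exact: cvg_cst|exact: cvg_norm].
by rewrite normr0 subr0 in h.
Qed.

Section PathNear.
Variables (tau : R) (g : R -> 'M[R]_(n + n)) (D : R -> R) (z : C).
Hypotheses (tau0 : 0 < tau) (z1 : nsq z = 1) (gP : Ppath tau g).
Hypothesis gD : argpath (g \o clamp 0 tau) D.

Let tt : tau \in `[0, tau]. Proof. by rewrite in_itv /= lexx andbT ltW. Qed.
Let t0 : 0 \in `[0, tau]. Proof. by rewrite in_itv /= lexx ltW. Qed.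

Definition ind := n%:R + (2 * (D tau - D 0) - theta z (g tau)) / (2 * pi).

Lemma adet_near : exists2 e, 0 < e & forall t X, t \in `[0, tau] -> mclose e (g t) X ->
  0 < reC (adet X * (adet (g t))^*%C).
Proof.
have [gc _ gsD] := gD; pose gg := g \o clamp 0 tau.
pose f (E : 'M[R]_(n + n)) t := reC (adet (gg t + E) * (adet (gg t))^*%C).
have h t : t \in `[0, tau] -> 0 < nsq (adet (gg t)) /\
    f p.2 p.1 @[p --> (nbhs t, nbhs (0 : 'M[R]_(n + n)))] --> nsq (adet (gg t)).
  move=> tI; split; first by rewrite lt_neqAle eq_sym nsq_eq0 adet_neq0 ?nsq_ge0//; have [] := gsD t.
  have g1 : rcvg (filter_prod (nbhs t) (nbhs (0 : 'M[R]_(n + n)))) (fun p : R * 'M[R]_(n + n) => gg p.1) (gg t).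
    by move=> i j; apply: (cvg_comp fst (fun t => gg t i j)); [exact: cvg_fst|exact: gc].
  have g2 : rcvg (filter_prod (nbhs t) (nbhs (0 : 'M[R]_(n + n)))) (fun p : R * 'M[R]_(n + n) => gg p.1 + p.2) (gg t + 0).
    apply: rcvgD; first exact: g1.
    have id0 : rcvg (nbhs (0 : 'M[R]_(n + n))) id (0 : 'M[R]_(n + n)) by apply/rcvgP; exact: cvg_id.
    by move=> i j; apply: (cvg_comp snd (fun E : 'M[R]_(n + n) => E i j)); [exact: cvg_snd|exact: id0].
  rewrite addr0 in g2.
  have [c _] : ccvg (filter_prod (nbhs t) (nbhs (0 : 'M[R]_(n + n))))
      (fun p : R * 'M[R]_(n + n) => adet (gg p.1 + p.2) * (adet (gg p.1))^*%C) (adet (gg t) * (adet (gg t))^*%C).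
    by apply: ccvgM; [exact: ccvg_adet|apply: ccvgJ; exact: ccvg_adet].
  have E : reC (adet (gg t) * (adet (gg t))^*%C) = nsq (adet (gg t)) by rewrite -nsqE.
  rewrite -E.
  exact: c.
have := near_segment_pos (nbhs_filter (0 : 'M[R]_(n + n))) h.
move=> /nbhs_mclose[e e0 eP]; exists e => // t X tI gX.
have /(eP (X - g t))/(_ t tI) : mclose e 0 (X - g t) by move=> i j; rewrite !mxE subr0; exact: gX.
by rewrite /f /gg /comp (clamp_id tI) addrC subrK.
Qed.

(** A path uniformly close to [g] has a close polar angle at every time, so the two angles
    correspond without ambiguity at the end, where [theta_near] allows only a jump that raises the
    index. *)
Lemma index_lower : exists2 e, 0 < e & forall b, Ppath tau b ->
  (forall t, t \in `[0, tau] -> mclose e (g t) (b t)) -> nondeg z (b tau) -> ind <= index_nd tau z b.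
Proof.
have [gc Dc gsD] := gD; have gtau : (g \o clamp 0 tau) tau = g tau by rewrite /comp (clamp_id tt).
have [st at_] : symplectic (g tau) /\ is_arg (g tau) (D tau) by have := gsD tau; rewrite gtau.
have [e1 e10 h1] := adet_near; have [e2 e20 h2] := theta_near st at_ z1.
exists (Num.min e1 e2); first by rewrite lt_min e10.
move=> b bP bg nb; have [bp b0] := bP; have [gp g0] := gP.
have [Db bD _] := argpath_exists (ltW tau0) bp; have [bc Dbc bsD] := bD.
have clo i t : t \in `[0, tau] -> (i = e1 \/ i = e2) -> mclose i (g t) (b t).
  move=> tI ie k l; apply: (lt_le_trans (bg t tI k l)).
  by case: ie => ->; rewrite ge_min lexx ?orbT.
pose f t := Db t - Db 0 - (D t - D 0).
have e00 : expi (Db 0) = expi (D 0).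
  have [s1 a1] := bsD 0; have [_ a2] := gsD 0; have s0 := sqrt_nsq_gt0 (adet_neq0 s1).
  by move: a1 a2 s0; rewrite /comp !clamp_id// b0 g0 => a1 a2 s0; apply: (polar_unique s0 s0); rewrite -a1 -a2.
have [k kE] := expi_eq e00.
have fc : continuous f.
  move=> t; apply: cvgB; first by apply: cvgB; [exact: Dbc|exact: cvg_cst].
  by apply: cvgB; [exact: Dc|exact: cvg_cst].
have fpos t : t \in `[0, tau] -> 0 < cos (f t).
  move=> tI; have [s1 a1] := bsD t; have [s2 a2] := gsD t.
  have [r r0 rE] := re_arg s2 s1 a2 a1.
  have : 0 < r * cos (Db t - D t).
    by rewrite -rE /comp (clamp_id tI); apply: h1 => //; apply: clo => //; left.
  rewrite pmulr_rgt0// => h.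
  suff -> : cos (f t) = cos (Db t - D t) by [].
  have -> : f t = (Db t - D t) + (- k)%:~R * (2 * pi) by rewrite /f kE mulrNz; ring.
  by have := expiDint (Db t - D t) (- k); rewrite /expi => -[].
have f0 : `|f 0| < pi / 2 by rewrite /f !subrr normr0 divr_gt0// pi_gt0.
have := close_lifts fc fpos f0 tt; rewrite /f => ftau.
have [sb ab] : symplectic (b tau) /\ is_arg (b tau) (Db tau) by have := bsD tau; rewrite /comp (clamp_id tt).
have ab' : is_arg (b tau) (Db tau - Db 0 + D 0).
  rewrite /is_arg {1}ab; congr (_ * _); have -> : Db tau = (Db tau - Db 0 + D 0) + k%:~R * (2 * pi) by rewrite kE; ring.
  by rewrite expiDint; congr expi; rewrite kE; ring.
have c2 : mclose e2 (g tau) (b tau) by apply: clo => //; right.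
have dd : `|Db tau - Db 0 + D 0 - D tau| < pi / 2.
  by move: ftau; congr (`|_| < _); ring.
have [j jn jE] := h2 _ _ sb c2 ab' dd.
rewrite (index_ndE tau0 z1 bP nb bD) /ind lerD2l; apply: ler_wpM2r.
  by rewrite invr_ge0 mulr_ge0// pi_ge0.
exact: arg_shift jE (ler0n _ j).
Qed.

Lemma uniform_close (U : set {uniform` `[0, tau] -> 'M[R]_(n + n)}) : open U -> U g ->
  exists2 e, 0 < e & forall b : R -> 'M[R]_(n + n),
    (forall t, t \in `[0, tau] -> mclose e (g t) (b t)) -> U b.
Proof.
move=> oU Ug; have : nbhs (g : {uniform` `[0, tau] -> 'M[R]_(n + n)}) U by exact: open_nbhs_nbhs.
move=> /uniform_nbhs[E [entE EU]].
move: entE; rewrite -entourage_ballE => -[e /= e0 eE]; exists e => // b bg; apply: EU => t tI; apply: eE.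
split=> // i j; rewrite -ball_normE /= distrC; apply: bg.
exact: tI.
Qed.

Lemma close_uniform e : 0 < e -> exists U : set {uniform` `[0, tau] -> 'M[R]_(n + n)},
  [/\ open U, U g & forall b : R -> 'M[R]_(n + n), U b -> forall t, t \in `[0, tau] -> mclose e (g t) (b t)].
Proof.
move=> e0; pose V : set {uniform` `[0, tau] -> 'M[R]_(n + n)} :=
  [set b | forall t, t \in `[0, tau] -> mclose e (g t) (b t)].
exists (interior V); split; first exact: open_interior.
  apply/uniform_nbhs; exists [set xy | ball xy.1 e xy.2]; split.
    by rewrite -entourage_ballE; exists e.
  move=> b bE t tI i j; have [_ /(_ i j)] := bE t tI.
  by rewrite -ball_normE /= distrC.
by move=> b /interior_subset.
Qed.

(** [g] is multiplied by a backward rotation growing linearly in time: the start stays at the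
    identity, the end becomes nondegenerate, and by [rotJ_left] the value [ind] is unchanged. *)
Lemma index_achieved e : 0 < e -> exists b, [/\ Ppath tau b,
  forall t, t \in `[0, tau] -> mclose e (g t) (b t), nondeg z (b tau) & index_nd tau z b = ind].
Proof.
move=> e0; have [gc Dc gsD] := gD; have [gp g0] := gP.
have gtau : (g \o clamp 0 tau) tau = g tau by rewrite /comp (clamp_id tt).
have [st at_] : symplectic (g tau) /\ is_arg (g tau) (D tau) by have := gsD tau; rewrite gtau.
pose gg := g \o clamp 0 tau; pose B d t := gg t *m rotJ n (- (d * (clamp 0 tau t / tau))).
have cc : continuous (fun t : R => clamp 0 tau t / tau).
  by move=> t; apply: cvgM; [exact: clamp_continuous|exact: cvg_cst].
have Bc d : rcontinuous (B d).
  move=> t; apply: rcvgM; first exact: gc.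
  apply: (@rcontinuous_comp R _ _ (@rotJ R n) (fun t => - (d * (clamp 0 tau t / tau)))).
    exact: rotJ_cont.
  by move=> t'; apply: cvgN; apply: cvgM; [exact: cvg_cst|exact: cc].
have near_e : \forall d \near (0 : R), forall t, t \in `[0, tau] -> mclose e (gg t) (B d t).
  have : \forall d \near (0 : R), forall i j, forall t, t \in `[0, tau] -> 0 < e - `|B d t i j - gg t i j|.
    have FF : Filter (nbhs (0 : R)) by typeclasses eauto.
    apply: (@filter_forall _ _ _ _ FF) => i; apply: (@filter_forall _ _ _ _ FF) => j.
    apply: (@near_segment_pos R R (nbhs (0 : R)) _ 0 tau (fun d t => e - `|B d t i j - gg t i j|) (fun=> e)).
    move=> t tI; split=> //.
    have h : rcvg (filter_prod (nbhs t) (nbhs (0 : R))) (fun p : R * R => B p.2 p.1 - gg p.1)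
        (gg t *m rotJ n (- (0 * (clamp 0 tau t / tau))) - gg t).
      have g1 : rcvg (filter_prod (nbhs t) (nbhs (0 : R))) (fun p : R * R => gg p.1) (gg t).
        by move=> i' j'; apply: (cvg_comp fst (fun t => gg t i' j')); [exact: cvg_fst|exact: gc].
      apply: rcvgD; last exact: rcvgN.
      apply: rcvgM; first exact: g1.
      move=> i' j'; apply: (cvg_comp (fun p : R * R => - (p.2 * (clamp 0 tau p.1 / tau))) (fun s => rotJ n s i' j') _ (@rotJ_cont R n _ i' j')).
      apply: cvgN; apply: cvgM; first exact: cvg_snd.
      by apply: (cvg_comp fst (fun t => clamp 0 tau t / tau)); [exact: cvg_fst|exact: cc].
    have := h i j; rewrite mul0r oppr0 rotJ0 mulmx1 subrr [X in _ --> X]mxE => h'.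
    move: h'; under eq_fun do rewrite mxE [X in _ + X]mxE.
    exact: cvg_sub_norm.
  by apply: filterS => d h t tI i j; have := h i j t tI; rewrite subr_gt0.
have nr : \forall d \near (0 : R)^'+, forall t, t \in `[0, tau] -> mclose e (gg t) (B d t).
  have sub : (0 : R)^'+ `=>` nbhs 0 by exact: cvg_within.
  exact: (sub _ near_e).
have [d [h1 [h2 h3]]] : exists d, (forall t, t \in `[0, tau] -> mclose e (gg t) (B d t)) /\
    (nuz z (g tau *m rotJ n (- d)) = 0%N /\ theta z (g tau *m rotJ n (- d)) = theta z (g tau) - 2 * (n%:R * d)).
  have F2 : Filter ((0 : R)^'+) by typeclasses eauto.
  by have := filterI nr (rotJ_left z1 st) => /(_ F2)/filter_ex[d [h1 h2]]; exists d.
have Btau : B d tau = g tau *m rotJ n (- d).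
  by rewrite /B /gg /comp (clamp_id tt) divff ?mulr1// lt0r_neq0.
have BP : Ppath tau (B d).
  split; last by rewrite /B /gg /comp (clamp_id t0) mul0r mulr0 oppr0 rotJ0 mulmx1.
  split; first by apply: continuous_within => t; apply/rcvgP; exact: Bc.
  by move=> t tI; apply: symplecticM; [have [] := gsD t|exact: symplectic_rotJ].
have nB : nondeg z (B d tau) by rewrite Btau nuz_nondeg h2.
exists (B d); split=> //; first by move=> t tI; have := h1 t tI; rewrite /gg /comp (clamp_id tI).
pose DB t := D t + n%:R * (- (d * (clamp 0 tau t / tau))).
have BD : argpath (B d \o clamp 0 tau) DB.
  split.
  - by apply: rcontinuous_comp; [exact: Bc|exact: clamp_continuous].
  - move=> t; apply: cvgD; first exact: Dc.
    by apply: cvgM; [exact: cvg_cst|apply: cvgN; apply: cvgM; [exact: cvg_cst|exact: cc]].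
  - move=> t; have cl : clamp 0 tau (clamp 0 tau t) = clamp 0 tau t by rewrite clamp_id// clamp_itv// ltW.
    have [s1 a1] := gsD t; have -> : (B d \o clamp 0 tau) t = gg t *m rotJ n (- (d * (clamp 0 tau t / tau))).
      by rewrite /B /gg /comp cl.
    by split; [apply: symplecticM => //; exact: symplectic_rotJ|exact: is_arg_rotJ].
rewrite (index_ndE tau0 z1 BP nB BD) /ind Btau h3 /DB (clamp_id tt) (clamp_id t0).
rewrite mul0r mulr0 oppr0 mulr0 addr0 divff ?mulr1 ?lt0r_neq0//.
by congr (_ + _ / _); ring.
Qed.

(** Every neighbourhood contains a path of index [ind], and on a small one nothing is lower; so the
    sup-inf is attained and equals [ind]. *)
Lemma maslov_indexE : maslov_index tau z g = ind.
Proof.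
rewrite /maslov_index; case: ifP => ng; first exact: index_ndE.
set S := [set ereal_inf _ | U in _]; suff -> : ereal_sup S = ind%:E by [].
apply/eqP; rewrite eq_le; apply/andP; split.
  apply: ge_ereal_sup => _ [U [oU Ug] <-]; have [e e0 eU] := uniform_close oU Ug.
  have [b [bP bg nb bE]] := index_achieved e0; rewrite -bE.
  by apply: ereal_inf_lbound; exists b => //; split=> //; exact: eU.
have [e e0 eL] := index_lower; have [U [oU Ug Ub]] := close_uniform e0.
apply: (@le_trans _ _ (ereal_inf [set (index_nd tau z b)%:E | b in
          [set b | [/\ Ppath tau b, U b & nondeg z (b tau)]]])).
  apply/ereal_infP => _ [b [bP bU nb] <-]; rewrite lee_fin.
  by apply: eL => // t tI; exact: (Ub b bU t tI).
by apply: ereal_sup_ubound; exists U.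
Qed.

End PathNear.
End NearSymplectic.

(** * Splitting numbers *)

Section LocalMonotone.
Variable R : realType.

(** The supremum [c] of the points up to which [f a <= f t] is itself such a point by the left half
    of the local condition, and the right half carries on beyond it unless [c = b]. *)
Lemma locally_mono (f : R -> R) a b : a <= b ->
  (forall t, a <= t <= b -> \forall u \near t, a <= u <= b ->
     (t <= u -> f t <= f u) /\ (u <= t -> f u <= f t)) -> f a <= f b.
Proof.
move=> ab H; pose S := [set t | a <= t <= b /\ f a <= f t].
have Sa : S a by split; rewrite ?lexx.
have Sb : has_sup S.
  by split; [exists a|exists b => t [/andP[]]].
pose c := sup S.
have ac : a <= c by apply: ub_le_sup => //; case: Sb.
have cb : c <= b by apply: ge_sup => [|t [/andP[]]//]; exists a.
have cI : a <= c <= b by rewrite ac cb.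
have /nbhs_ballP[e /= e0 eH] := H c cI.
have Sc : f a <= f c.
  have [u Su cu] := sup_adherent e0 Sb; have [uI fu] := Su.
  have uc : u <= c by apply: ub_le_sup => //; case: Sb.
  apply: le_trans fu _.
  have bu : ball c e u by rewrite -ball_normE /= ger0_norm ?subr_ge0// ltrBlDr addrC -ltrBlDr.
  by have [_ ->] := eH u bu uI.
suff -> : b = c by [].
apply/eqP; rewrite eq_le cb andbT leNgt; apply/negP => cb'.
pose u := Num.min b (c + e / 2).
have cu : c < u by rewrite lt_min cb'/= ltrDl divr_gt0.
have uI : a <= u <= b by rewrite (le_trans ac (ltW cu)) ge_min lexx.
have bu : ball c e u.
  rewrite -ball_normE /= distrC ger0_norm ?subr_ge0 ?ltW// ltrBlDl.
  by rewrite gt_min ltrD2l ltr_pdivrMr// ltr_pMr// ltrDl ltr01 orbT.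
have [h _] := eH u bu uI.
have : S u by split=> //; exact: le_trans Sc (h (ltW cu)).
move=> /(ub_le_sup (proj2 Sb)); rewrite -/c leNgt cu; by [].
Qed.

End LocalMonotone.

Lemma shift_eq (R : realType) (a b D c : R) : a - 2 * D = b - 2 * D - c -> a = b - c.
Proof. by lra. Qed.

Lemma splitting_arith (R : realType) (k N d th : R) :
  k - (N + (2 * d - (th - 2 * pi * k)) / (2 * pi) - (N + (2 * d - th) / (2 * pi))) = 0.
Proof. by have := lt0r_neq0 (pi_gt0 R); move: pi => p p0; field. Qed.

Lemma near_comp (R : realType) (f : R -> R) (t l : R) (P : R -> Prop) :
  f u @[u --> t] --> l -> (\forall y \near l, P y) -> \forall u \near t, P (f u).
Proof. by move=> fl Pl; exact: (fl _ Pl). Qed.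

Section Counting.
Variables (R : realType) (nu : R[i] -> nat) (s : seq R[i]).
Local Notation C := R[i].
Hypotheses (us : uniq s) (sP : forall z : C, nu z != 0%N -> z \in s).

(** Eigenvalues are counted with geometric multiplicity. The strict inequality [ang z < phi] charges
    the eigenvalue at [phi] to the right of [phi]. *)
Definition cnt (phi : R) : R :=
  \sum_(z <- s) (nu z)%:R * ((nsq z == 1) && (0 < ang z < phi))%:R.

Lemma cnt_le x y : x <= y -> cnt x <= cnt y.
Proof.
move=> xy; apply: ler_sum => z _; apply: ler_wpM2l; first exact: ler0n.
rewrite ler_nat; case: (nsq z == 1) => //=; case: (0 < ang z) => //=.
by case E : (ang z < x) => //; rewrite (lt_le_trans E xy).
Qed.

Lemma cnt_jump x y : 0 < x <= pi -> x < y -> cnt x + (nu (expi x))%:R <= cnt y.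
Proof.
move=> /andP[x0 xpi] xy; have [->|nz] := eqVneq (nu (expi x)) 0%N.
  by rewrite addr0 cnt_le// ltW.
have xs := sP nz; have x2 : 0 < x <= 2 * pi.
  by rewrite x0 (le_trans xpi)// ler_peMl ?pi_ge0// ler1n.
rewrite /cnt !(bigD1_seq (expi x))//= ang_expi// ltxx !andbF mulr0 add0r nsq_expi eqxx x0 xy mulr1.
rewrite [X in X <= _]addrC lerD2l; apply: ler_sum => z _; apply: ler_wpM2l; first exact: ler0n.
rewrite ler_nat; case: (nsq z == 1) => //=; case: (0 < ang z) => //=.
by case E : (ang z < x) => //; rewrite (lt_trans E xy).
Qed.

Lemma cnt0 : cnt 0 = 0.
Proof.
rewrite /cnt big1// => z _; case E : (_ && _); last by rewrite mulr0.
by move: E => /andP[_ /andP[a b]]; have := lt_trans a b; rewrite ltxx.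
Qed.

Lemma imC_ang (z : C) : nsq z = 1 -> 0 < ang z < pi -> 0 < imC z.
Proof. by move=> z1 az; have [_ ->] := angP z1; rewrite /= sin_gt0_pi. Qed.

(** The eigenvalues counted lie strictly above the real axis; together with their conjugates they
    are distinct and have total multiplicity at most [2k]. *)
Lemma cnt_pi k : (forall z, nu z^*%C = nu z) ->
  (forall u : seq C, uniq u -> (\sum_(z <- u) nu z <= k + k)%N) -> cnt pi <= k%:R.
Proof.
move=> nuJ nule; pose t := [seq z <- s | (nsq z == 1) && (0 < ang z < pi)].
have E : cnt pi = (\sum_(z <- t) nu z)%:R.
  rewrite natr_sum /t big_filter [RHS]big_mkcond /=; apply: eq_bigr => z _.
  by case: ifP; rewrite ?mulr1 ?mulr0.
have tim z : z \in t -> 0 < imC z.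
  by rewrite mem_filter => /andP[/andP[/eqP z1 az] _]; exact: imC_ang.
have ut : uniq (t ++ [seq z^*%C | z <- t]).
  rewrite cat_uniq filter_uniq// map_inj_uniq ?filter_uniq//=; last exact: (can_inj (@conjcK R)).
  rewrite andbT; apply/hasPn => z /mapP[w /tim w0 ->]; apply/negP => /tim /=.
  case: w w0 => a b /=; rewrite oppr_gt0 => h1 h2.
  by have := lt_trans h1 h2; rewrite ltxx.
have := nule _ ut; rewrite big_cat /= big_map.
under [X in (_ + X <= _)%N]eq_bigr do rewrite nuJ.
by rewrite E !addnn leq_double ler_nat.
Qed.

(** [th] can only jump down, by at most [p] times the multiplicity. Hence [th + p * cnt] and
    [p * (cnt + nu) - th] are both locally nondecreasing, and the multiplicities vanish at the two
    ends. *)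
Lemma count_variation (th : R -> R) (p : R) : 0 <= p ->
  (forall x, \forall y \near x, exists2 k : nat, (k <= nu (expi x))%N & th y = th x - p * k%:R) ->
  forall x y, 0 <= x -> x <= y -> y <= pi -> nu (expi x) = 0%N -> nu (expi y) = 0%N ->
  `|th y - th x| <= p * (cnt y - cnt x).
Proof.
move=> p0 loc x y x0 xy ypi nx ny.
have jump t : x <= t <= y -> nu (expi t) = 0%N \/ 0 < t <= pi.
  move=> /andP[xt ty]; have [t0|t0] := ltrP 0 t; first by right; rewrite (le_trans ty ypi).
  by left; have -> : t = x by apply/eqP; rewrite eq_le xt (le_trans t0 x0).
have jumpR t u : x <= t <= y -> t < u -> p * cnt t + p * (nu (expi t))%:R <= p * cnt u.
  move=> tI tu; rewrite -mulrDr; apply: ler_wpM2l => //.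
  have [->|tp] := jump t tI; last exact: cnt_jump.
  by rewrite addr0 cnt_le// ltW.
have lep (i j : nat) : (i <= j)%N -> 0 <= p * i%:R /\ p * i%:R <= p * j%:R.
  by move=> ij; rewrite mulr_ge0// ler_wpM2l// ler_nat.
have lo : th x + p * cnt x <= th y + p * cnt y.
  apply: (@locally_mono R (fun t => th t + p * cnt t)) => // t tI.
  have := loc t; apply: filterS => u [k /lep[k0 kn] E] uI; case: (ltgtP t u) => [tu|ut|<-] //; split=> // _.
    by have := jumpR t u tI tu; rewrite E; lra.
  by have : p * cnt u <= p * cnt t; [rewrite ler_wpM2l// cnt_le// ltW|rewrite E; lra].
have hi : p * (cnt x + (nu (expi x))%:R) - th x <= p * (cnt y + (nu (expi y))%:R) - th y.
  apply: (@locally_mono R (fun t => p * (cnt t + (nu (expi t))%:R) - th t)) => // t tI.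
  have := loc t; apply: filterS => u [k /lep[k0 kn] E] uI; case: (ltgtP t u) => [tu|ut|<-] //; split=> // _.
    have [u0 _] := lep 0%N (nu (expi u)) (leq0n _); have [u1 _] := lep _ _ (leqnn (nu (expi u))).
    by have := jumpR t u tI tu; rewrite E !mulrDr; lra.
  by have := jumpR u t uI ut; rewrite E !mulrDr; lra.
rewrite nx ny !addr0 in hi; rewrite ler_norml mulrBr; apply/andP; split; lra.
Qed.

End Counting.

Section Variation.
Variables (R : realType) (n : nat) (M : 'M[R]_(n + n)).
Hypothesis sM : symplectic M.
Local Notation C := R[i].

Lemma spectrum_seq : exists2 s : seq C, uniq s & forall z, nuz z M != 0%N -> z \in s.
Proof.
have [r rE] := closed_field_poly_normal (char_poly (cmx M)).
exists (undup r); first exact: undup_uniq.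
move=> z nz; rewrite mem_undup.
have : eigenvalue (cmx M) z.
  rewrite /eigenvalue /eigenspace; apply: contra nz => /eqP E.
  by rewrite [nuz z M](_ : _ = \rank (kermx (cmx M - z%:M))) // E mxrank0.
rewrite eigenvalue_root_char rE rootZ; last by rewrite lead_coef_eq0 monic_neq0// char_poly_monic.
by rewrite root_prod_XsubC.
Qed.

Lemma sum_nuz_le (u : seq C) : uniq u -> (\sum_(z <- u) nuz z M <= n + n)%N.
Proof.
move=> uu; have inj : {in xpredT &, injective (fun i : 'I_(size u) => nth 0 u i)}.
  by move=> i j _ _ /eqP; rewrite nth_uniq// => /eqP/val_inj.
have /mxdirectP := mxdirect_sum_eigenspace (cmx M) (a_ := fun i : 'I_(size u) => nth 0 u i) inj.
move=> /= E; rewrite (big_nth 0) big_mkord.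
by have := rank_leq_col (\sum_i eigenspace (cmx M) (nth 0 u (i : 'I_(size u))))%MS; rewrite E.
Qed.

Lemma rank_ker_map (F : fieldType) (f : {rmorphism F -> F}) N (A : 'M[F]_N) :
  \rank (kermx (map_mx f A)) = \rank (kermx A).
Proof. by rewrite !mxrank_ker mxrank_map. Qed.

Lemma nuz_conj (z : C) : nuz z^*%C M = nuz z M.
Proof.
have := rank_ker_map (@Num.conj C) (cmx M - z%:M); rewrite map_mxB map_conj_cmx map_scalar_mx.
exact.
Qed.

Local Notation th x := (theta (expi x) M).

Lemma theta_expi_local x : \forall y \near x, exists2 k : nat, (k <= nuz (expi x) M)%N &
  th y = th x - 2 * pi * k%:R.
Proof.
have [D aM] := arg_exists sM.
have ec : ccvg (nbhs x) (fun y => expi y) (expi x).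
  by split; [exact: continuous_cos|exact: continuous_sin].
have Mc : rcvg (nbhs x) (fun=> M) M by exact: rcvg_cst.
have Dc : (fun=> D) y @[y --> x] --> D by exact: cvg_cst.
have := @theta_path_local R n R (nbhs x) (nbhs_filter x) (fun=> M) M (fun=> sM) sM Mc
  (fun y => expi y) (expi x) (@nsq_expi R) (nsq_expi x) ec (fun=> D) D (fun=> aM) aM Dc.
apply: filterS => y [k kn E]; exists k => //.
exact: (shift_eq E).
Qed.

(** [c] counts the eigenvalues of [M] along the upper half circle; its total is at most [n], half
    the dimension, by conjugation symmetry. *)
Lemma variation : exists c : R -> R,
  [/\ forall x y, x <= y -> c x <= c y, c 0 = 0, c pi <= n%:R &
    forall x y, 0 <= x -> x <= y -> y <= pi -> nuz (expi x) M = 0%N -> nuz (expi y) M = 0%N ->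
      `|th y - th x| <= 2 * pi * (c y - c x)].
Proof.
have [s us sP] := spectrum_seq; exists (cnt (fun z => nuz z M) s); split.
- exact: cnt_le.
- exact: cnt0.
- exact: (@cnt_pi R (fun z => nuz z M) s us n nuz_conj sum_nuz_le).
- have p0 : 0 <= 2 * pi :> R by rewrite mulr_ge0// pi_ge0.
  exact: (@count_variation R (fun z => nuz z M) s us sP (fun x => th x) (2 * pi) p0 theta_expi_local).
Qed.

End Variation.

(** * Connectedness of the symplectic group and computation of splitting numbers *)

Section Splitting.
Variables (R : realType) (n : nat).
Local Notation C := R[i].

Definition reach (X : 'M[R]_(n + n)) := exists b : R -> 'M[R]_(n + n),
  [/\ rcontinuous b, forall t, symplectic (b t), b 0 = 1%:M & b 1 = X].

Lemma reachM X Y : reach X -> reach Y -> reach (X *m Y).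
Proof.
move=> [b [bc sb b0 b1]] [c [cc sc c0 c1]]; exists (fun t => b t *m c t); split.
- by move=> t; apply: rcvgM; [exact: bc|exact: cc].
- by move=> t; exact: symplecticM.
- by rewrite b0 c0 mulmx1.
- by rewrite b1 c1.
Qed.

Lemma reach_rotJ d : reach (rotJ n d).
Proof.
exists (fun t => rotJ n (t * d)); split.
- apply: (@rcontinuous_comp R _ _ (@rotJ R n) (fun t => t * d)); first exact: rotJ_cont.
  by move=> t; apply: cvgM; [exact: cvg_id|exact: cvg_cst].
- by move=> t; exact: symplectic_rotJ.
- by rewrite mul0r rotJ0.
- by rewrite mul1r.
Qed.

Lemma rcvg_scalar k (f : R -> R) t : f u @[u --> t] --> f t ->
  rcvg (nbhs t) (fun t => (f t)%:M : 'M[R]_k) (f t)%:M.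
Proof.
move=> fc i j; rewrite mxE; under eq_fun do rewrite mxE.
by case: (i == j); [exact: fc|rewrite mulr0n; under eq_fun do rewrite mulr0n; exact: cvg_cst].
Qed.

Lemma symplectic_diag (a : R) : a != 0 -> symplectic (block_mx a%:M 0 0 a^-1%:M : 'M[R]_(n + n)).
Proof.
move=> a0; apply: symplectic_of; rewrite tr_block_mx !trmx0 !tr_scalar_mx !mulmx_block.
rewrite !mulmx0 !mul0mx !addr0 !add0r !mul0mx mulmx1 mulmxN mulmx1 mulNmx -!scalar_mxM.
by rewrite mulfV// mulVf.
Qed.

Lemma reach_stretch1 : reach (stretch (1%:M : 'M[R]_n)).
Proof.
pose f (t : R) := expR (t * ln 2); have f0 t : f t != 0 by rewrite lt0r_neq0// expR_gt0.
have fc : continuous f.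
  move=> t; apply: (cvg_comp (fun t : R => t * ln 2) expR); last exact: continuous_expR.
  by apply: cvgM; [exact: cvg_id|exact: cvg_cst].
exists (fun t => block_mx (f t)%:M 0 0 (f t)^-1%:M); split.
- move=> t; apply: rcvg_block; try exact: rcvg_cst; first by apply: rcvg_scalar; exact: fc.
  by apply: (@rcvg_scalar n (fun t => (f t)^-1)); apply: cvgV => //; exact: fc.
- by move=> t; exact: symplectic_diag.
- by rewrite /f mul0r expR0 invr1 -scalar_mx_block.
- by rewrite /f mul1r lnK ?posrE// /stretch !scale_scalar_mx !mulr1.
Qed.

End Splitting.

Lemma symplectic_rotmx (R : realType) n (u1 u2 : 'M[R]_n) : u1^T *m u1 + u2^T *m u2 = 1%:M ->
  u1^T *m u2 = u2^T *m u1 -> symplectic (rotmx u1 u2).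
Proof.
move=> h1 h2; apply: symplectic_of; rewrite /rotmx /Jmx tr_block_mx !mulmx_block.
have NT : (- u2)^T = - u2^T by apply/matrixP => i j; rewrite !mxE.
rewrite NT !mulmx0 !mulmx1 !addr0 !add0r !mulmxN !mulmx1 !mulNmx !opprK.
by rewrite h2 subrr addNr h1 -opprD [u2^T *m u2 + _]addrC h1.
Qed.

(** The unitary path [exp (i pi t)] in the first complex coordinate ends at the reflection. *)
Lemma reach_reflection (R : realType) n :
  @reach R (1 + n) (rotmx (block_mx (-1)%:M 0 0 1%:M) 0).
Proof.
pose u1 (t : R) : 'M[R]_(1 + n) := block_mx (cos (t * pi))%:M 0 0 1%:M.
pose u2 (t : R) : 'M[R]_(1 + n) := block_mx (sin (t * pi))%:M 0 0 0.
have pc : continuous (fun t : R => t * pi) by move=> t; apply: cvgM; [exact: cvg_id|exact: cvg_cst].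
have c1 t : rcvg (nbhs t) u1 (u1 t).
  apply: rcvg_block; try exact: rcvg_cst; apply: (@rcvg_scalar R 1 (fun t => cos (t * pi))).
  by apply: (cvg_comp (fun t : R => t * pi) cos); [exact: pc|exact: continuous_cos].
have c2 t : rcvg (nbhs t) u2 (u2 t).
  apply: rcvg_block; try exact: rcvg_cst; apply: (@rcvg_scalar R 1 (fun t => sin (t * pi))).
  by apply: (cvg_comp (fun t : R => t * pi) sin); [exact: pc|exact: continuous_sin].
exists (fun t => rotmx (u1 t) (u2 t)); split.
- by move=> t; apply: rcvg_block => //; exact: rcvgN.
- move=> t; apply: symplectic_rotmx; rewrite /u1 /u2 !tr_block_mx !trmx0 !tr_scalar_mx ?trmx1 !mulmx_dblock.
    rewrite add_block_mx !addr0 mulmx0 mulmx1 addr0 -!scalar_mxM -raddfD /= -!expr2 cos2Dsin2.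
    by rewrite -scalar_mx_block.
  by rewrite mulmx0 mul0mx scalar_mxC.
- rewrite /rotmx /u1 /u2 mul0r cos0 sin0 raddf0 block_mx0 oppr0 -(scalar_mx_block 1 n 1).
  by rewrite -scalar_mx_block.
- by rewrite /u1 /u2 mul1r cospi sinpi raddf0 block_mx0.
Qed.

Lemma stretch_rotmx (R : realType) n (O : 'M[R]_n) : stretch O = stretch 1%:M *m rotmx O 0.
Proof.
rewrite /stretch /rotmx oppr0 mulmx_dblock; congr block_mx;
by rewrite -scalemxAl mul1mx.
Qed.

(** A rotation makes [M] nondegenerate, a path leads from there to a normal form, and the normal
    forms are reached from the identity explicitly. This provides the path ending at [M] from which
    [splitting] selects its value. *)
Lemma reach_all (R : realType) n (M : 'M[R]_(n + n)) : symplectic M -> reach M.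
Proof.
move=> sM; have z1 : nsq (1 : R[i]) = 1 by rewrite /nsq /= expr1n expr0n addr0.
have [d nd] : exists d, nuz 1 (M *m rotJ n d) = 0%N.
  have PF : ProperFilter ((0 : R)^'+) by typeclasses eauto.
  by have [d [h _]] := @filter_ex _ _ PF _ (rotJ_right z1 sM); exists d.
have sN : symplectic (M *m rotJ n d) by apply: symplecticM => //; exact: symplectic_rotJ.
have rN N' : reach N' -> conn 1 (M *m rotJ n d) N' -> reach M.
  move=> rN' [b [bc sb b0 b1]].
  have sN' : symplectic N' by rewrite -b1; have [] := sb 1.
  have [uN' _] := sN'; have iN' := symplecticV sN'.
  (* The connecting path divided by its end point joins the first factor to the identity, and the
     second factor is a product of reachable matrices. *)
  have -> : M = (M *m rotJ n d *m invmx N') *m (N' *m rotJ n (- d)).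
    rewrite mulmxA mulmxKV// -mulmxA; have -> : rotJ n d *m rotJ n (- d) = 1%:M :> 'M[R]_(n + n).
      rewrite !rotJE cosN sinN mulmxDl !mul_scalar_mx -scalemxAl mulmxDr mul_mx_scalar -scalemxAr Jmx2.
      have := cos2Dsin2 d; move: (cos d) (sin d) (Jmx R n) => c s J h.
      have E (I : 'M[R]_(n + n)) : c *: (c *: I + - s *: J) + s *: (c *: J + - s *: - I) =
          (c ^+ 2 + s ^+ 2) *: I by apply/matrixP => i j; rewrite !mxE; ring.
      by rewrite -[c%:M]scalemx1 E h scale1r.
    by rewrite mulmx1.
  apply: reachM; last by apply: reachM => //; exact: reach_rotJ.
  exists (fun t => b (1 - t) *m invmx N'); split.
  - move=> t; apply: rcvgM; last exact: rcvg_cst.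
    apply: (@rcontinuous_comp R _ _ b (fun t => 1 - t)) => // u.
    by apply: cvgB; [exact: cvg_cst|exact: cvg_id].
  - by move=> t; apply: symplecticM => //; have [] := sb (1 - t).
  - by rewrite subr0 b1 mulmxV.
  - by rewrite subrr b0.
have n1 : nondeg 1 (M *m rotJ n d) by rewrite nuz_nondeg nd.
case: (conn_Mpm z1 sN n1) => c.
  by apply: rN c; rewrite Mplus_stretch; exact: reach_stretch1.
case: n M sM d nd sN rN n1 c => [|n] M sM d nd sN rN n1 c.
  by exists (fun=> M); split=> //; [move=> t; exact: rcvg_cst|rewrite [LHS]flatmx0 [RHS]flatmx0].
apply: rN c; rewrite Mminus_stretch stretch_rotmx; apply: reachM; first exact: reach_stretch1.
exact: reach_reflection.
Qed.

Section SplittingNumbers.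
Variables (R : realType) (n : nat) (M : 'M[R]_(n + n)) (e : R) (w : R[i]).
Hypotheses (sM : symplectic M) (e1 : e = 1 \/ e = -1) (w1 : nsq w = 1).
Local Notation C := R[i].

Lemma small_eps_neq (z : C) : exists2 d : R, 0 < d & forall t, 0 < t < d -> expi (e * t) * w != z.
Proof.
have [[t0 [/andP[t00 t01] tz]]|H] := pselect (exists t0 : R, 0 < t0 < 1 /\ expi (e * t0) * w = z).
  exists t0 => // t /andP[t1 tt0]; apply/eqP => E.
  have w0 : w != 0 by apply/eqP => h; move: w1; rewrite h /nsq /= expr0n /= addr0 => /eqP; rewrite eq_sym oner_eq0.
  have /(mulIf w0) E2 : expi (e * t) * w = expi (e * t0) * w by rewrite E tz.
  have E3 : e * t = e * t0.
    apply: expi_close => //; rewrite -mulrBr normrM.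
    have -> : `|e| = 1 by case: e1 => ->; rewrite ?normrN normr1.
    rewrite mul1r distrC ger0_norm ?subr_ge0 1?ltW//.
    have p2 : 2 <= pi :> R by exact: pi_ge2.
    lra.
  have e0 : e != 0 by case: e1 => ->; rewrite ?oppr_eq0 oner_eq0.
  by move: tt0; rewrite (mulfI e0 E3) ltxx.
by exists 1 => // t tI; apply/eqP => E; apply: H; exists t.
Qed.

Lemma small_eps_nondeg : exists2 d : R, 0 < d & forall t, 0 < t < d -> nuz (expi (e * t) * w) M = 0%N.
Proof.
have [s _ sP] := spectrum_seq M.
suff [d d0 H] : exists2 d : R, 0 < d & forall t, 0 < t < d -> expi (e * t) * w \notin s.
  exists d => // t tI; apply/eqP; apply: contraTT (H t tI) => h; rewrite negbK; exact: sP.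
elim: s {sP} => [|z s [d d0 IH]]; first by exists 1.
have [d' d0' H] := small_eps_neq z; exists (Num.min d d'); first by rewrite lt_min d0.
move=> t /andP[t0]; rewrite lt_min => /andP[td td']; rewrite inE negb_or H ?t0//= IH// t0.
by [].
Qed.

(** Only finitely many eigenvalues exist, so on one side of [w] a short arc is free of them and
    [theta] is constant there; its jump at [w] is a multiple of [2 pi] controlled by the nullity. *)
Lemma splitting_theta : exists2 k : nat, (k <= nuz w M)%N & \forall eps \near (0 : R)^'+,
  nuz (expi (e * eps) * w) M = 0%N /\ theta (expi (e * eps) * w) M = theta w M - 2 * pi * k%:R.
Proof.
have [_ wE] := angP w1; pose x := ang w.
have fE t : expi (e * t) * w = expi (x + e * t) by rewrite {1}wE mulrC -expiD.
have [d d0 nd] := small_eps_nondeg.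
pose f t := theta (expi (x + e * t)) M.
have fc (g : R -> R) t : continuous g -> x + e * g u @[u --> t] --> x + e * g t.
  by move=> gc; apply: cvgD; [exact: cvg_cst|apply: cvgM; [exact: cvg_cst|exact: gc]].
have const a b : 0 < a -> a <= b -> b < d -> f a = f b.
  move=> a0 ab bd; have := @locally_constant R (fun t => f (clamp a b t)).
  have aI : a \in `[a, b] by rewrite in_itv /= lexx.
  have bI : b \in `[a, b] by rewrite in_itv /= lexx andbT.
  move=> /(_ _ a b); rewrite (clamp_id aI) (clamp_id bI); apply=> t.
  have loc := theta_expi_local sM (x + e * clamp a b t).
  have loc' : \forall u \near t, exists2 k : nat, (k <= nuz (expi (x + e * clamp a b t)) M)%N &
      theta (expi (x + e * clamp a b u)) M = theta (expi (x + e * clamp a b t)) M - 2 * pi * k%:R.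
    exact: near_comp (fc (clamp a b) t (@clamp_continuous R a b)) loc.
  move: loc'; apply: filterS => u [k kn E]; move: kn; rewrite -fE nd; last first.
    have := clamp_itv t ab; rewrite in_itv /= => /andP[h1 h2].
    by rewrite (lt_le_trans a0 h1) (le_lt_trans h2 bd).
  rewrite leqn0 => /eqP k0; apply: (etrans E); by rewrite k0 mulr0 subr0.
have h0 := fc id 0 (fun t => cvg_id).
rewrite mulr0 addr0 in h0.
have loc : \forall t \near (0 : R), exists2 k : nat, (k <= nuz (expi x) M)%N &
    theta (expi (x + e * t)) M = theta (expi x) M - 2 * pi * k%:R.
  exact: near_comp h0 (theta_expi_local sM x).
have pos : \forall t \near (0 : R)^'+, 0 < t < d.
  have F2 : Filter ((0 : R)^'+) by typeclasses eauto.
  have h1 : \forall t \near (0 : R)^'+, 0 < t by exact: nbhs_right_gt.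
  have h2 : \forall t \near (0 : R)^'+, t < d by exact: nbhs_right_lt.
  by move: h1 h2; apply: filterS2 => t -> ->.
have sub : (0 : R)^'+ `=>` nbhs 0 by exact: cvg_within.
have PF : ProperFilter ((0 : R)^'+) by typeclasses eauto.
have [t0 [tI [k kn kE]]] : exists t, 0 < t < d /\ exists2 k : nat, (k <= nuz (expi x) M)%N &
    theta (expi (x + e * t)) M = theta (expi x) M - 2 * pi * k%:R.
  have F2 : Filter ((0 : R)^'+) by typeclasses eauto.
  have := @filterI _ _ F2 _ _ pos (sub _ loc).
  by move=> /(@filter_ex _ _ PF)[t [h1 h2]]; exists t.
exists k; first by rewrite wE.
move: pos; apply: filterS => t tI'; split; first exact: nd.
rewrite fE {1}wE -/x -kE -[LHS]/(f t) -[RHS]/(f t0).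
move: tI tI' => /andP[a1 a2] /andP[b1 b2].
by have [tt|tt] := leP t t0; [exact: const|rewrite (const t0 t)// ltW].
Qed.

(** In a difference of two indices of one path the constant and the polar angle cancel and only
    [theta] at the end point is left. The limit is therefore the same for all paths ending at
    [M]. *)
Lemma splittingE : exists k : nat, [/\ (k <= nuz w M)%N, splitting e M w = k%:R &
  \forall eps \near (0 : R)^'+,
  nuz (expi (e * eps) * w) M = 0%N /\ theta (expi (e * eps) * w) M = theta w M - 2 * pi * k%:R].
Proof.
have [k kn kE] := splitting_theta; exists k; split=> //.
have u1 t : nsq (expi (e * t) * w) = 1 by rewrite nsqM nsq_expi w1 mulr1.
have key tau g : 0 < tau -> Ppath tau g -> g tau = M ->
  (maslov_index tau (expi (e * eps) * w) g - maslov_index tau w g) @[eps --> (0 : R)^'+] --> (k%:R : R).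
  move=> tau0 gP gM; have [gp _] := gP; have [D gD _] := argpath_exists (ltW tau0) gp.
  apply/cvgrPdist_lt => r r0; move: kE; apply: filterS => t [_ tE].
  rewrite (maslov_indexE tau0 (u1 t) gP gD) (maslov_indexE tau0 w1 gP gD) /ind gM tE.
  have -> : k%:R - (n%:R + (2 * (D tau - D 0) - (theta w M - 2 * pi * k%:R)) / (2 * pi) -
    (n%:R + (2 * (D tau - D 0) - theta w M) / (2 * pi))) = 0; last by rewrite normr0.
  exact: splitting_arith.
rewrite /splitting; set A := [set r | _].
have [tau [g [tau0 gP gM h]]] : A (xget 0 A).
  apply: xgetPex; have [b [bc sb b0 b1]] := reach_all sM; exists k%:R, 1, b; split=> //.
    split=> //; split; last by move=> t _; exact: sb.
    by apply: continuous_within => t; apply/rcvgP; exact: bc.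
  by apply: key => //; split=> //; split; [apply: continuous_within => t; apply/rcvgP; exact: bc|move=> t _; exact: sb].
exact: (cvg_unique _ h (key tau g tau0 gP gM)).
Qed.

End SplittingNumbers.

(** * Positive paths and iteration *)

Section Powers.
Variable R : realType.
Local Notation C := R[i].

Lemma kermx_prod_rank (F : fieldType) N (g : 'M[F]_N) (rs : seq F) : uniq rs ->
  \rank (kermxpoly g (\prod_(a <- rs) ('X - a%:P))) =
  (\sum_(a <- rs) \rank (kermx (g - a%:M)))%N.
Proof.
move=> urs; have cop : {in predT &, forall i j : 'I_(size rs), j != i ->
    coprimep ('X - (nth 0 rs i)%:P) ('X - (nth 0 rs j)%:P)}.
  by move=> i j _ _ ji; rewrite coprimep_XsubC root_XsubC nth_uniq// eq_sym.
rewrite (big_nth 0) big_mkord (kermxpoly_prod g cop).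
have /mxdirectP /= -> := mxdirect_sum_kermx g cop.
rewrite [RHS](big_nth 0) big_mkord; apply: eq_bigr => i _.
by rewrite -eigenspace_poly.
Qed.

Lemma cmxX N (M : 'M[R]_N) k : cmx (M ^+ k) = cmx M ^+ k.
Proof.
elim: k => [|k IH]; first by rewrite !expr0; apply/matrixP => i j; rewrite !mxE; case: (i == j).
by rewrite !exprS -IH; exact: cmxM.
Qed.

Lemma kermxpoly_XnsubC (F : fieldType) N (g : 'M[F]_N) k (c : F) :
  kermxpoly g ('X^k - c%:P) = kermx (g ^+ k - c%:M).
Proof.
case: N g => [|N] g; first by rewrite [LHS]flatmx0 [RHS]flatmx0.
by rewrite /kermxpoly rmorphB rmorphXn /= horner_mx_X horner_mx_C.
Qed.

(** [X^k - z] splits into distinct linear factors, so the kernel of [M^k - z] is the direct sum of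
    the kernels of [M - a] over the roots [a]. *)
Lemma nuz_pow n (M : 'M[R]_(n + n)) k (z : C) (rs : seq C) : uniq rs -> size rs = k -> (0 < k)%N ->
  (forall a, a \in rs -> a ^+ k = z) -> nuz z (M ^+ k) = (\sum_(a <- rs) nuz a M)%N.
Proof.
move=> urs srs k0 rk; transitivity (\rank (kermx (cmx (M ^+ k) - z%:M))); first by [].
have pE : 'X^k - z%:P = \prod_(a <- rs) ('X - a%:P) :> {poly C}.
  rewrite (@all_roots_prod_XsubC C ('X^k - z%:P) rs).
  - by rewrite lead_coefDl ?lead_coefXn ?scale1r// size_polyN size_polyXn (leq_ltn_trans (size_polyC_leq1 _)).
  - by rewrite size_XnsubC// srs.
  - by apply/allP => a /rk E; rewrite rootE !hornerE E subrr.
  - by rewrite uniq_rootsE.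
by rewrite cmxX -kermxpoly_XnsubC pE (kermx_prod_rank _ urs).
Qed.

End Powers.

Section PositiveQuotient.
Variables (R : realType) (n : nat).
Local Notation J := (Jmx R n).

(** [X] is driven at time [t] by a positive definite quadratic Hamiltonian [B]. The filter allows
    one-sided derivatives, all that is available at the ends of a segment. *)
Definition posquot (F : set_system R) (t : R) (X : R -> 'M[R]_(n + n)) := exists B : 'M[R]_(n + n),
  posdef B /\ rcvg F (fun u => (u - t)^-1 *: (X u - X t)) (J *m B *m X t).

Lemma posdefD (B B' : 'M[R]_(n + n)) : posdef B -> posdef B' -> posdef (B + B').
Proof.
move=> [h1 h2] [h3 h4]; split; first by rewrite linearD /= h1 h3.
by move=> v v0; rewrite mulmxDr mulmxDl mxE addr_gt0// ?h2 ?h4.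
Qed.

Lemma posdef_congr (B X : 'M[R]_(n + n)) : X \in unitmx -> posdef B -> posdef (X^T *m B *m X).
Proof.
move=> uX [h1 h2]; split; first by rewrite !trmx_mul trmxK h1 mulmxA.
move=> v v0; have -> : v^T *m (X^T *m B *m X) *m v = (X *m v)^T *m B *m (X *m v).
  by rewrite trmx_mul !mulmxA.
by apply: h2; apply: contra v0 => /eqP E; rewrite -(mulKmx uX v) E mulmx0.
Qed.

(** By Leibniz' rule the product is driven by [B + X^-T D X^-1], using [X J = J X^-T] for symplectic
    [X]; this is again positive. *)
Lemma posquotM (F : set_system R) (FF : Filter F) t X Z : symplectic (X t) ->
  rcvg F Z (Z t) -> posquot F t X -> posquot F t Z -> posquot F t (fun u => X u *m Z u).
Proof.
move=> sX Zc [B [pB XB]] [D [pD ZD]]; have [uX _] := sX; have sXi := symplecticV sX.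
have [uXi _] := sXi.
exists (B + (invmx (X t))^T *m D *m invmx (X t)); split.
  by apply: posdefD => //; exact: posdef_congr.
have -> : J *m (B + (invmx (X t))^T *m D *m invmx (X t)) *m (X t *m Z t) =
   J *m B *m X t *m Z t + X t *m (J *m D *m Z t).
  rewrite mulmxDr mulmxDl; congr (_ + _); first by rewrite !mulmxA.
  rewrite -!mulmxA mulKmx// !mulmxA; congr (_ *m _ *m _).
  have uXT : (X t)^T \in unitmx by rewrite unitmx_tr.
  rewrite trmx_inv; apply: (can_inj (mulmxK uXT)).
  by rewrite mulmxKV// symplectic_tr_mul.
have E u : (u - t)^-1 *: (X u *m Z u - X t *m Z t) =
    ((u - t)^-1 *: (X u - X t)) *m Z u + X t *m ((u - t)^-1 *: (Z u - Z t)).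
  rewrite -scalemxAl -scalemxAr -scalerDr; congr (_ *: _).
  by rewrite mulmxBl mulmxBr addrA subrK.
rewrite (funext E); apply: rcvgD; first by apply: rcvgM.
by apply: rcvgM; [exact: rcvg_cst|].
Qed.

Lemma posquotX (F : set_system R) (FF : Filter F) t X k : symplectic (X t) ->
  rcvg F X (X t) -> posquot F t X -> posquot F t (fun u => X u ^+ k.+1).
Proof.
move=> sX Xc pX; elim: k => [|k IH]; first by rewrite (_ : (fun u => _) = X)//; apply/funext => u; rewrite expr1.
rewrite (_ : (fun u => _) = (fun u => X u *m X u ^+ k.+1)); last first.
  by apply/funext => u; rewrite exprS.
by apply: posquotM => //; exact: rcvgX.
Qed.

End PositiveQuotient.

Lemma near_sides (R : realType) (t : R) (P : R -> Prop) : P t ->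
  (\forall u \near t^'+, P u) -> (\forall u \near t^'-, P u) -> \forall u \near t, P u.
Proof.
move=> Pt; rewrite /at_right /at_left !near_withinE => h1 h2; move: h1 h2; apply: filterS2 => u h1 h2.
by case: (ltgtP t u) => [/h1|/h2|<-].
Qed.

Lemma phase_shift (R : realType) (a b D D0 c : R) :
  a - 2 * D = b - 2 * D0 - c -> 2 * D - a = 2 * D0 - b + c.
Proof. by lra. Qed.

Lemma phase_shift0 (R : realType) (a b D D0 : R) : a - 2 * D = b - 2 * D0 -> 2 * D - a = 2 * D0 - b.
Proof. by lra. Qed.

Lemma gain_arith (R : realType) (t0e t0 te tx0 d0 dt q nu ps : R) : t0e = t0 - q -> te = tx0 ->
  2 * dt - tx0 = 2 * d0 - t0 + nu -> 2 * dt - te <= ps -> nu - q <= ps - (2 * d0 - t0e).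
Proof. by lra. Qed.

Lemma sum_jump (R : realType) (T : eqType) (rs : seq T) (f g : T -> R) (h : T -> nat) N (p a b : R) :
  a = b + p * N%:R -> (forall x, x \in rs -> f x = g x + p * (h x)%:R) ->
  N = (\sum_(x <- rs) h x)%N -> a - \sum_(x <- rs) f x = b - \sum_(x <- rs) g x.
Proof.
move=> -> E ->; rewrite natr_sum mulr_sumr (eq_big_seq _ E) big_split /=.
by rewrite opprD addrACA subrr addr0.
Qed.

Lemma sum_jump0 (R : realType) (T : eqType) (rs : seq T) (f g : T -> R) (a b : R) :
  a = b -> (forall x, x \in rs -> f x = g x) -> a - \sum_(x <- rs) f x = b - \sum_(x <- rs) g x.
Proof. by move=> -> E; rewrite (eq_big_seq _ E). Qed.

Lemma bott_arith (R : realType) (p0 q0 p1 q1 : R) : p0 - q0 = p1 - q1 -> p1 - p0 = q1 - q0.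
Proof. by lra. Qed.

Section SidedJumps.
Variables (R : realType) (s : R) (f : R -> R).
Hypothesis s0 : 0 < s.

Lemma sided_near t (P : R -> Prop) : P t ->
  (t < s -> \forall u \near t^'+, P u) -> (0 < t -> \forall u \near t^'-, P u) ->
  0 <= t <= s -> \forall u \near t, 0 <= u <= s -> P u.
Proof.
move=> Pt hr hl /andP[t0 ts]; apply: near_sides => //.
  have [ts'|ts'] := ltrP t s; first by apply: filterS (hr ts') => u ? _.
  have h : \forall u \near t^'+, t < u by exact: nbhs_right_gt.
  move: h; apply: filterS => u tu /andP[_ ub].
  by have := lt_le_trans tu (le_trans ub ts'); rewrite ltxx.
have [t0'|t0'] := ltrP 0 t; first by apply: filterS (hl t0') => u ? _.
have h : \forall u \near t^'-, u < t by exact: nbhs_left_lt.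
move: h; apply: filterS => u ut /andP[au _].
by have := le_lt_trans au (lt_le_trans ut t0'); rewrite ltxx.
Qed.

Lemma jump_mono : (forall t, 0 <= t < s -> \forall u \near t^'+, f t <= f u) ->
  (forall t, 0 < t <= s -> \forall u \near t^'-, f u <= f t) ->
  forall a b, 0 <= a -> a <= b -> b <= s -> f a <= f b.
Proof.
move=> hr hl a b a0 ab bs; apply: locally_mono => // t /andP[at_ tb].
have tI : 0 <= t <= s by rewrite (le_trans a0 at_) (le_trans tb bs).
have := @sided_near t (fun u => (t <= u -> f t <= f u) /\ (u <= t -> f u <= f t)) _ _ _ tI.
have [t0 ts] := andP tI.
move=> /(_ (conj (fun _ => lexx _) (fun _ => lexx _))) H.
apply: filterS (H _ _) => [u hu /andP[au ub]|ts'|t0'].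
- by apply: hu; rewrite (le_trans a0 au) (le_trans ub bs).
- have h : \forall u \near t^'+, t < u by exact: nbhs_right_gt.
  have h2 : \forall u \near t^'+, f t <= f u by apply: hr; rewrite t0.
  move: h h2; apply: filterS2 => u tu fu; split=> // ut.
  by have := lt_le_trans tu ut; rewrite ltxx.
- have h : \forall u \near t^'-, u < t by exact: nbhs_left_lt.
  have h2 : \forall u \near t^'-, f u <= f t by apply: hl; rewrite t0'.
  move: h h2; apply: filterS2 => u tu fu; split=> // ut.
  by have := lt_le_trans tu ut; rewrite ltxx.
Qed.

Lemma jump_const : (forall t, 0 <= t < s -> \forall u \near t^'+, f u = f t) ->
  (forall t, 0 < t <= s -> \forall u \near t^'-, f u = f t) -> f 0 = f s.
Proof.
move=> hr hl.
have i0 : (0 : R) \in `[0, s] by rewrite in_itv /= lexx ltW.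
have is_ : s \in `[0, s] by rewrite in_itv /= lexx ltW.
have := @locally_constant R (fun t => f (clamp 0 s t)) _ 0 s; rewrite (clamp_id i0) (clamp_id is_); apply=> t.
have tI : 0 <= clamp 0 s t <= s by have := clamp_itv t (ltW s0); rewrite in_itv.
have [t0 ts] := andP tI.
have loc : \forall u \near clamp 0 s t, 0 <= u <= s -> f u = f (clamp 0 s t).
  by apply: sided_near => // h; [apply: hr; rewrite t0|apply: hl; rewrite h].
have := near_comp (@clamp_continuous R 0 s t) loc; apply: filterS => u; apply.
by have := clamp_itv u (ltW s0); rewrite in_itv.
Qed.

End SidedJumps.

Section PositivePath.
Variables (R : realType) (n : nat) (s : R).
Local Notation C := R[i].
Hypothesis s0 : 0 < s.

Definition pospath (X : R -> 'M[R]_(n + n)) (D : R -> R) :=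
  [/\ argpath X D, forall t, 0 <= t < s -> posquot t^'+ t X & forall t, 0 < t <= s -> posquot t^'- t X].

Lemma rcvg_sides (X : R -> 'M[R]_(n + n)) t : rcontinuous X ->
  rcvg t^'+ X (X t) /\ rcvg t^'- X (X t).
Proof.
by move=> Xc; split=> i j; apply: cvg_trans (Xc t i j); apply: cvg_app; exact: cvg_within.
Qed.

Section OnePath.
Variables (X : R -> 'M[R]_(n + n)) (D : R -> R) (z : C).
Hypotheses (XD : pospath X D) (z1 : nsq z = 1).

(** [2 pi] times the index, up to a constant. Along a positive path it is locally constant on the
    left of each time and jumps up by [2 pi] times the nullity on the right. *)
Definition phase t := 2 * D t - theta z (X t).

Lemma phase_right t : 0 <= t < s -> \forall u \near t^'+,
  nuz z (X u) = 0%N /\ phase u = phase t + 2 * pi * (nuz z (X t))%:R.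
Proof.
move=> tI; have [[Xc Dc XsD] pr _] := XD; have [B [pB qB]] := pr t tI.
have FF : Filter t^'+ by typeclasses eauto.
have [Xr _] := rcvg_sides t Xc.
have Dr : D u @[u --> t^'+] --> D t by apply: cvg_trans (Dc t); apply: cvg_app; exact: cvg_within.
have pos : \forall u \near t^'+, 0 < u - t.
  have h : \forall u \near t^'+, t < u by exact: nbhs_right_gt.
  by move: h; apply: filterS => u; rewrite subr_gt0.
have := @theta_path_right R n R t^'+ FF X (X t) (fun u => (XsD u).1) (XsD t).1 Xr z B
  (fun u => u - t) D (D t) z1 pB qB (fun u => (XsD u).2) (XsD t).2 Dr pos.
apply: filterS => u [h E]; rewrite /phase; split; [exact: h|exact: (phase_shift E)].
Qed.

Lemma phase_left t : 0 < t <= s -> \forall u \near t^'-,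
  nuz z (X u) = 0%N /\ phase u = phase t.
Proof.
move=> tI; have [[Xc Dc XsD] _ pl] := XD; have [B [pB qB]] := pl t tI.
have FF : Filter t^'- by typeclasses eauto.
have [_ Xl] := rcvg_sides t Xc.
have Dl : D u @[u --> t^'-] --> D t by apply: cvg_trans (Dc t); apply: cvg_app; exact: cvg_within.
have neg : \forall u \near t^'-, u - t < 0.
  have h : \forall u \near t^'-, u < t by exact: nbhs_left_lt.
  by move: h; apply: filterS => u; rewrite subr_lt0.
have := @theta_path_left R n R t^'- FF X (X t) (fun u => (XsD u).1) (XsD t).1 Xl z B
  (fun u => u - t) D (D t) z1 pB qB (fun u => (XsD u).2) (XsD t).2 Dl neg.
apply: filterS => u [h E]; rewrite /phase; split; [exact: h|exact: (phase_shift0 E)].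
Qed.

Lemma phase_mono a b : 0 <= a -> a <= b -> b <= s -> phase a <= phase b.
Proof.
apply: jump_mono => t tI.
  move: (phase_right tI); apply: filterS => u [_ ->].
  by rewrite lerDl !mulr_ge0// pi_ge0.
by move: (phase_left tI); apply: filterS => u [_ ->].
Qed.

Definition gain := phase s - phase 0.

Lemma start_jump : exists2 t0, 0 < t0 < s & nuz z (X t0) = 0%N /\
  phase t0 = phase 0 + 2 * pi * (nuz z (X 0))%:R.
Proof.
have I0 : 0 <= (0 : R) < s by rewrite lexx.
have PF : ProperFilter ((0 : R)^'+) by typeclasses eauto.
have FF : Filter ((0 : R)^'+) by typeclasses eauto.
have h1 : \forall t \near (0 : R)^'+, 0 < t by exact: nbhs_right_gt.
have h2 : \forall t \near (0 : R)^'+, t < s by exact: nbhs_right_lt.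
have := @filterI _ _ FF _ _ (@filterI _ _ FF _ _ h1 h2) (phase_right I0).
by move=> /(@filter_ex _ _ PF)[t [[a b] c]]; exists t => //; rewrite a b.
Qed.

Lemma gain_ge : 2 * pi * (nuz z (X 0))%:R <= gain.
Proof.
have [t0 /andP[t00 t0s] [_ E]] := start_jump.
have h := phase_mono (ltW t00) (ltW t0s) (lexx s); rewrite E in h.
by rewrite lerBrDl.
Qed.

End OnePath.

(** At a time [t0] just after the start the jump at [expi x] has already been gained, and [X t0]
    being nondegenerate there, this persists for nearby parameters. Only the starting phase changes,
    by the jump [q] of [theta] at [X 0]. *)
Lemma gain_near X D (x e : R) (q : nat) : pospath X D -> 
  (\forall eps \near (0 : R)^'+, theta (expi (x + e * eps)) (X 0) = theta (expi x) (X 0) - 2 * pi * q%:R) ->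
  \forall eps \near (0 : R)^'+, 2 * pi * (nuz (expi x) (X 0))%:R - 2 * pi * q%:R <=
    gain X D (expi (x + e * eps)).
Proof.
move=> XD hq; have [t0 /andP[t00 t0s] [nt E]] := start_jump XD (nsq_expi x).
have sX : symplectic (X t0) by have [[_ _ /(_ t0)[]]] := XD.
have FF : Filter ((0 : R)^'+) by typeclasses eauto.
have sub : (0 : R)^'+ `=>` nbhs 0 by exact: cvg_within.
have lc : x + e * eps @[eps --> (0 : R)] --> x.
  have : x + e * eps @[eps --> (0 : R)] --> x + e * 0.
    by apply: cvgD; [exact: cvg_cst|apply: cvgM; [exact: cvg_cst|exact: cvg_id]].
  by rewrite mulr0 addr0.
have h2 := sub _ (near_comp lc (theta_expi_local sX x)).
move: hq h2; apply: filterS2 => eps E1 [k]; rewrite nt leqn0 => /eqP -> E2.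
have m := phase_mono XD (nsq_expi (x + e * eps)) (ltW t00) (ltW t0s) (lexx s).
by rewrite mulr0 subr0 in E2; exact: gain_arith E1 E2 E m.
Qed.

Section Bott.
Variables (X : R -> 'M[R]_(n + n)) (D Dm : R -> R) (m : nat) (z : C) (rs : seq C).
Hypotheses (XD : pospath X D) (m0 : (0 < m)%N) (z1 : nsq z = 1).
Hypothesis XDm : argpath (fun t => X t ^+ m) Dm.
Hypotheses (urs : uniq rs) (srs : size rs = m) (rsP : forall a, a \in rs -> nsq a = 1 /\ a ^+ m = z).

Lemma pospath_pow : pospath (fun t => X t ^+ m) Dm.
Proof.
have [[Xc _ XsD] pr pl] := XD; split=> // t tI; have [c1 c2] := rcvg_sides t Xc;
case: m m0 => // k _; apply: posquotX => //; try exact: (XsD t).1.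
- exact: pr.
- exact: pl.
Qed.

Lemma near_all (F : set_system R) (FF : Filter F) (P : C -> R -> Prop) (l : seq C) :
  (forall a, a \in l -> \forall u \near F, P a u) -> \forall u \near F, forall a, a \in l -> P a u.
Proof.
elim: l => [|b l IH] H; first by apply: nearW.
have h1 := H b (mem_head _ _); have h2 : \forall u \near F, forall a, a \in l -> P a u.
  by apply: IH => a al; apply: H; rewrite inE al orbT.
move: h1 h2; apply: filterS2 => u p1 p2 a; rewrite inE => /orP[/eqP ->//|]; exact: p2.
Qed.

(** Both sides are constant on the left of each time and jump on the right; by [nuz_pow] the jumps
    agree, so the difference of the phases is constant. *)
Lemma bott_gain : gain (fun t => X t ^+ m) Dm z = \sum_(a <- rs) gain X D a.
Proof.
have XmD := pospath_pow.
pose G t := phase (fun t => X t ^+ m) Dm z t - \sum_(a <- rs) phase X D a t.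
suff E : G 0 = G s.
  by rewrite /gain sumrB; exact: (bott_arith E).
apply: (jump_const s0) => t tI.
  have FF : Filter t^'+ by typeclasses eauto.
  have h1 := phase_right XmD z1 tI.
  have h2 a : a \in rs -> \forall u \near t^'+, phase X D a u = phase X D a t + 2 * pi * (nuz a (X t))%:R.
    by move=> al; move: (phase_right XD (rsP al).1 tI); apply: filterS => u [].
  have {}h2 := near_all FF h2.
  have nE := nuz_pow (X t) urs srs m0 (fun a al => (rsP al).2).
  move: h1 h2; apply: filterS2 => u [_ E1] E2.
  exact: (sum_jump E1 E2 nE).
have FF : Filter t^'- by typeclasses eauto.
have h1 := phase_left XmD z1 tI.
have h2 a : a \in rs -> \forall u \near t^'-, phase X D a u = phase X D a t.
  by move=> al; move: (phase_left XD (rsP al).1 tI); apply: filterS => u [].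
have {}h2 := near_all FF h2.
move: h1 h2; apply: filterS2 => u [_ E1] E2.
exact: (sum_jump0 E1 E2).
Qed.

End Bott.
End PositivePath.

(** * Regularity and symmetry of the gauge *)

Section Gauge.
Variables (R : realType) (k : nat) (C : set 'cV[R]_k).
Local Notation V := 'cV[R]_k.
Hypotheses (cC : compact C) (vC : convex_set C) (iC : (interior C) 0).
Implicit Types x y : V.

Lemma convexP x y (t : R) : 0 <= t <= 1 -> C x -> C y -> C (t *: x + (1 - t) *: y).
Proof.
move=> /andP[t0 t1] Cx Cy.
have h : t = (Itv01 t0 t1)%:num by [].
have := @vC x y (Itv01 t0 t1); rewrite !inE => /(_ Cx Cy).
by [].
Qed.

Lemma interior_ball : exists2 r : R, 0 < r & forall y, `|y| < r -> C y.
Proof.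
move: iC => /nbhs_ballP[r /= r0 rC]; exists r => // y yr; apply: rC.
by rewrite -ball_normE /= sub0r normrN.
Qed.

Lemma C_closed : closed C.
Proof. by apply: compact_closed => //; exact: norm_hausdorff. Qed.

Lemma C_bound : exists2 K : R, 0 < K & forall y, C y -> `|y| <= K.
Proof.
have [M [_ MC]] := compact_bounded cC; exists (Num.max 0 M + 1).
  by rewrite ltr_wpDl// le_max lexx.
by move=> y Cy; apply: MC => //; rewrite ltr_pwDr// le_max lexx orbT.
Qed.

Let A x := [set l : R | 0 < l /\ C (l^-1 *: x)].

Lemma gaugeE x : x != 0 -> gauge C x = inf (A x).
Proof. by rewrite /gauge => /negPf ->. Qed.

Lemma gauge_inf x : x != 0 -> has_inf (A x).
Proof.
move=> x0; have [r r0 rC] := interior_ball; have nx : 0 < `|x| by rewrite normr_gt0.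
split; last by exists 0 => l [/ltW].
exists (2 * `|x| / r); split; first by rewrite divr_gt0// mulr_gt0.
apply: rC; rewrite normrZ gtr0_norm ?invr_gt0 ?divr_gt0 ?mulr_gt0//.
rewrite invfM invrK invfM -!mulrA (mulrC r) (mulrA (`|x|^-1)) mulVf ?lt0r_neq0// mul1r.
by rewrite mulrC ltr_pdivrMr// ltr_pMr// ltr1n.
Qed.

Lemma gauge_gt0 x : x != 0 -> 0 < gauge C x.
Proof.
move=> x0; rewrite gaugeE//; have [K K0 KC] := C_bound; have nx : 0 < `|x| by rewrite normr_gt0.
have h : `|x| / K <= inf (A x).
  apply: lb_le_inf; first by have [] := gauge_inf x0.
  move=> l [l0 /KC]; rewrite normrZ gtr0_norm ?invr_gt0// ler_pdivrMl// => h.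
  by rewrite ler_pdivrMr.
by apply: lt_le_trans h; rewrite divr_gt0.
Qed.

Lemma C_star x (l m : R) : 0 < l -> l <= m -> C (l^-1 *: x) -> C (m^-1 *: x).
Proof.
move=> l0 lm Cl; have m0 := lt_le_trans l0 lm.
have C0 : C 0 by exact: interior_subset iC.
have -> : m^-1 *: x = (l / m) *: (l^-1 *: x) + (1 - l / m) *: 0.
  by rewrite scaler0 addr0 scalerA mulrAC divff ?mul1r// lt0r_neq0.
apply: convexP => //; apply/andP; split; first by rewrite divr_ge0 ?ltW.
by rewrite ler_pdivrMr// mul1r.
Qed.

Lemma gauge_lt_in x (l : R) : x != 0 -> gauge C x < l -> C (l^-1 *: x).
Proof.
move=> x0; rewrite gaugeE// => h.
have [m [m0 Cm] ml] : exists2 m, A x m & m < l.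
  have e0 : 0 < l - inf (A x) by rewrite subr_gt0.
  have [m Am] := inf_adherent e0 (gauge_inf x0).
  by rewrite addrC subrK => ml; exists m.
exact: C_star m0 (ltW ml) Cm.
Qed.

Lemma gauge_in x : x != 0 -> C ((gauge C x)^-1 *: x).
Proof.
move=> x0; have j0 := gauge_gt0 x0; set j := gauge C x in j0 *.
have FF : ProperFilter (j^'+) by typeclasses eauto.
apply: (@closed_cvg _ _ (j^'+) FF (fun l : R => l^-1 *: x) C C_closed).
  have h : \forall l \near j^'+, j < l by exact: nbhs_right_gt.
  by apply: filterS h => l; exact: gauge_lt_in.
apply: cvgZr_tmp; have c : l^-1 @[l --> j] --> j^-1 by apply: cvgV; [rewrite lt0r_neq0|exact: cvg_id].
by apply: cvg_trans c; apply: cvg_app; exact: cvg_within.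
Qed.

Lemma gauge_le x (l : R) : x != 0 -> 0 < l -> C (l^-1 *: x) -> gauge C x <= l.
Proof.
move=> x0 l0 Cl; rewrite gaugeE//; apply: ge_inf; last by split.
by have [] := gauge_inf x0.
Qed.

(** The points lie in the open cone with apex [p] over the ball of radius [r], a subset of the
    convex set [C]. *)
Lemma cone_interior p (b : V) (s : R) : C p -> 0 < s <= 1 ->
  (forall r : R, 0 < r -> (forall y, `|y| < r -> C y) -> `|b| < r -> interior C ((1 - s) *: p + s *: b)).
Proof.
move=> Cp /andP[s0 s1] r r0 rC br; apply/nbhs_ballP; exists (s * (r - `|b|)) => /=.
  by rewrite mulr_gt0// subr_gt0.
move=> y; rewrite -ball_normE /= => h.
have -> : y = (1 - s) *: p + (1 - (1 - s)) *: (s^-1 *: (y - (1 - s) *: p)).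
  have -> : 1 - (1 - s) = s by ring.
  by rewrite scalerA divff ?lt0r_neq0// scale1r [RHS]addrC subrK.
apply: convexP => //; first by rewrite subr_ge0 s1 gerBl ltW.
apply: rC; have -> : s^-1 *: (y - (1 - s) *: p) = b - s^-1 *: ((1 - s) *: p + s *: b - y).
  rewrite scalerBr scalerBr scalerDr (scalerA s^-1 s) mulVf ?lt0r_neq0// scale1r opprB.
  by move: (s^-1 *: y) (s^-1 *: _) => a q; apply/matrixP => i j; rewrite !mxE; ring.
apply: le_lt_trans (ler_normB _ _) _.
rewrite normrZ gtr0_norm ?invr_gt0// -ltrBrDl mulrC ltr_pdivrMr// mulrC.
by rewrite distrC in h; rewrite distrC.
Qed.

Lemma gauge_lt_interior x (l : R) : x != 0 -> gauge C x < l -> interior C (l^-1 *: x).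
Proof.
move=> x0 jl; have j0 := gauge_gt0 x0; have l0 := lt_trans j0 jl; have [r r0 rC] := interior_ball.
have := @cone_interior ((gauge C x)^-1 *: x) 0 (1 - gauge C x / l) (gauge_in x0) _ r r0 rC.
have -> : 1 - (1 - gauge C x / l) = gauge C x / l by ring.
rewrite normr0 scaler0 addr0 scalerA mulrAC (divff (lt0r_neq0 j0)) mul1r; apply; last exact: r0.
apply/andP; split; first by rewrite subr_gt0 ltr_pdivrMr// mul1r.
by rewrite gerBl divr_ge0// ltW.
Qed.

(** From an interior point one could move further out along the ray of [x], which would give a
    smaller value of the gauge. *)
Lemma gauge_boundary x : x != 0 -> ~ interior C ((gauge C x)^-1 *: x).
Proof.
move=> x0 /nbhs_ballP[e /= e0 eC]; have j0 := gauge_gt0 x0; set j := gauge C x in j0 eC *.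
have nx : 0 < `|x| by rewrite normr_gt0.
have c : (l : R)^-1 *: x @[l --> j] --> j^-1 *: x.
  by apply: cvgZr_tmp; apply: cvgV; [rewrite lt0r_neq0|exact: cvg_id].
have h1 : \forall l \near j, ball (j^-1 *: x) e (l^-1 *: x).
  by have := c _ (nbhsx_ballx (j^-1 *: x) e e0).
have sub : j^'- `=>` nbhs j by exact: cvg_within.
have h2 : \forall l \near j^'-, l < j by exact: nbhs_left_lt.
have h3 : \forall l \near j^'-, 0 < l by exact: nbhs_left_gt.
have PF : ProperFilter (j^'-) by typeclasses eauto.
have FF : Filter (j^'-) by typeclasses eauto.
have := @filterI _ _ FF _ _ (sub _ h1) (@filterI _ _ FF _ _ h2 h3).
move=> /(@filter_ex _ _ PF)[l [/eC Cl [lj l0]]].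
by have := gauge_le x0 l0 Cl; rewrite leNgt lj.
Qed.

(** Subadditivity of the gauge, with [|y - x| / r] bounding the gauge of the increment: [y] suitably
    scaled is a convex combination of the radial point of [x] and a point of the ball. *)
Lemma gauge_lip x y : forall r : R, 0 < r -> (forall y, `|y| <= r -> C y) -> x != 0 -> y != 0 ->
  gauge C y <= gauge C x + `|y - x| / r.
Proof.
move=> r r0 rC x0 y0; have [->|xy] := eqVneq y x; first by rewrite subrr normr0 mul0r addr0.
have jx := gauge_gt0 x0; have nxy : 0 < `|y - x| by rewrite normr_gt0 subr_eq0.
set d := `|y - x| / r; have d0 : 0 < d by rewrite divr_gt0.
have jd : 0 < gauge C x + d by rewrite addr_gt0.
apply: gauge_le => //.
have -> : (gauge C x + d)^-1 *: y = (gauge C x / (gauge C x + d)) *: ((gauge C x)^-1 *: x) +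
    (1 - gauge C x / (gauge C x + d)) *: (d^-1 *: (y - x)).
  have -> : 1 - gauge C x / (gauge C x + d) = d / (gauge C x + d) by field; rewrite lt0r_neq0.
  rewrite !scalerA mulrAC divff ?lt0r_neq0// mul1r mulrAC divff ?lt0r_neq0// mul1r -scalerDr.
  by rewrite [x + _]addrC subrK.
apply: convexP.
- by rewrite divr_ge0 ?ltW//= ltr_pdivrMr// mul1r ltrDl.
- exact: gauge_in.
- apply: rC; rewrite normrZ gtr0_norm ?invr_gt0// /d invf_div -mulrA mulVf ?mulr1//.
  exact: lt0r_neq0.
Qed.

Lemma gauge_lipschitz : exists2 L : R, 0 < L & forall x y, x != 0 -> y != 0 ->
  `|gauge C y - gauge C x| <= L * `|y - x|.
Proof.
have [r r0 rC] := interior_ball; exists (2 / r); first exact: divr_gt0.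
have r2 : 0 < r / 2 by rewrite divr_gt0.
have rC' y : `|y| <= r / 2 -> C y.
  by move=> h; apply: rC; apply: le_lt_trans h _; rewrite ltr_pdivrMr// ltr_pMr// ltr1n.
move=> x y x0 y0; have h1 := gauge_lip r2 rC' x0 y0; have h2 := gauge_lip r2 rC' y0 x0.
rewrite distrC invf_div mulrC in h2; rewrite invf_div mulrC in h1.
by rewrite ler_norml; apply/andP; split; lra.
Qed.

End Gauge.

Section Differentials.
Variables (R : realType) (k : nat).
Local Notation V := 'cV[R]_k.

Lemma diff_eps (f : V -> R) x : differentiable f x -> forall e : R, 0 < e ->
  \forall h \near (0 : V), `|f (h + x) - f x - 'd f x h| <= e * `|h|.
Proof.
move=> /diff_locally /eqaddoP H e e0; have := H e e0; apply: filterS => h.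
by rewrite /= opprD addrA.
Qed.

Lemma eps_diff (f : V -> R) (l : {linear V -> R^o}) x : continuous l ->
  (forall e : R, 0 < e -> \forall h \near (0 : V), `|f (h + x) - f x - l h| <= e * `|h|) ->
  differentiable f x /\ 'd f x = l :> (V -> R).
Proof.
move=> lc H; have E : f \o shift x = cst (f x) + l +o_ (0 : V) id.
  apply/eqaddoP => e e0; have := H e e0; apply: filterS => h.
  by rewrite /= opprD addrA.
have E1 := diff_unique lc E; split=> //.
by apply/diff_locallyP; rewrite E1.
Qed.

Lemma shift_cvg (x : V) : h + x @[h --> (0 : V)] --> x.
Proof.
have := @cvgD _ _ _ (nbhs (0 : V)) _ id (fun=> x) 0 x (@cvg_id _ _) (@cvg_cst _ _ _ _ _).
rewrite add0r; apply.
Qed.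

(** Differentiability with an explicit candidate differential, stated by its algebraic properties so
    that it can be proposed as a plain function before ['d f x] is known. *)
Definition fdiff (f : V -> R) (x : V) (l : V -> R) := [/\ forall a v, l (a *: v) = a * l v,
  forall v w, l (v - w) = l v - l w, continuous l &
  forall e : R, 0 < e -> \forall h \near (0 : V), `|f (h + x) - f x - l h| <= e * `|h|].

Lemma differentiable_fdiff f x : differentiable f x -> fdiff f x (fun v => 'd f x v).
Proof.
move=> df; split; first by move=> a v; rewrite linearZ.
- by move=> v w; rewrite linearB.
- exact: diff_continuous.
- exact: diff_eps.
Qed.

Lemma fdiff_differentiable f x l : fdiff f x l -> differentiable f x /\ forall v, 'd f x v = l v.
Proof.
case=> lZ lB lc le.
have ll : linear (l : V -> R^o).
  move=> a u v; have l0 : l 0 = 0 by rewrite -(subrr 0) lB subrr.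
  have lN : l (- v) = - l v by rewrite -sub0r lB l0 sub0r.
  by rewrite -{1}[v]opprK lB lZ lN opprK.
pose l' : {linear V -> R^o} := HB.pack l (GRing.isLinear.Build _ _ _ _ l ll).
have [h1 h2] := @eps_diff f l' x lc le.
by split=> // v; rewrite h2.
Qed.

Lemma near_eq_diff (f g : V -> R) x : differentiable g x -> (\forall y \near x, f y = g y) ->
  differentiable f x.
Proof.
move=> dg fg; suff [] : differentiable f x /\ 'd f x = 'd g x :> (V -> R) by [].
apply: eps_diff; first exact: diff_continuous.
move=> e e0; have fx := nbhs_singleton fg.
have fg' : \forall h \near (0 : V), f (h + x) = g (h + x).
  exact: (shift_cvg fg).
have := diff_eps dg e0; move: fg'; apply: filterS2 => h -> E.
by rewrite fx.
Qed.

Lemma col_sum (v : V) : v = \sum_i v i 0 *: delta_mx i 0.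
Proof. by rewrite {1}[v]matrix_sum_delta; apply: eq_bigr => i _; rewrite big_ord1. Qed.

Lemma diff_partial (f : V -> R) x v : differentiable f x -> 'd f x v = \sum_i v i 0 * partial i f x.
Proof.
move=> df; rewrite {1}[v]col_sum linear_sum; apply: eq_bigr => i _.
by rewrite linearZ /= /partial deriveE.
Qed.

Lemma diff_coord (i : 'I_k) x : differentiable (fun y : V => y i 0 : R) x.
Proof. exact: differentiable_coord. Qed.

Lemma diff_scale_id (g : V -> R) x : differentiable g x -> differentiable (fun y : V => g y *: y : V) x.
Proof.
move=> dg; have -> : (fun y : V => g y *: y) =
    \sum_(i < k) (fun y : V => (g y * y i 0) *: (delta_mx i 0 : V)).
  apply/funext => y; rewrite fct_sumE; have := congr1 (fun w : V => g y *: w) (col_sum y); rewrite /= scaler_sumr => {1}->; apply: eq_bigr => i _.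
  by rewrite scalerA.
apply: differentiable_sum => i; apply: differentiableZl.
by apply: differentiableM => //; exact: diff_coord.
Qed.

Lemma diff_nonzero (f : V -> R) x : differentiable f x -> grad f x != 0 -> exists v, 'd f x v != 0.
Proof.
move=> df g0; apply: contrapT => H; move/negP: g0; apply; apply/eqP/colP => i; rewrite !mxE.
rewrite /partial deriveE//; apply/eqP; apply: contrapT => h; apply: H; exists (delta_mx i 0).
exact/negP.
Qed.

End Differentials.

Section GaugeDifferentiable.
Variables (R : realType) (k : nat) (C : set 'cV[R]_k).
Local Notation V := 'cV[R]_k.
Hypotheses (cC : compact C) (vC : convex_set C) (iC : (interior C) 0).
Let S : set V := closure C `\` interior C.
Let j := gauge C.
Let p (x : V) : V := (j x)^-1 *: x.

Lemma radial_S x : x != 0 -> S (p x).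
Proof.
move=> x0; split; last exact: gauge_boundary.
by apply: subset_closure; exact: gauge_in.
Qed.

Lemma near_nonzero (x : V) : x != 0 -> \forall y \near x, y != 0.
Proof.
move=> x0; have : nbhs x (ball x `|x|) by apply: nbhsx_ballx; rewrite normr_gt0.
by apply: filterS => y; rewrite -ball_normE /=; apply: contraTneq => ->; rewrite subr0 ltxx.
Qed.

Lemma gauge_cvg (x : V) : x != 0 -> {for x, continuous j}.
Proof.
move=> x0; have [L L0 jL] := gauge_lipschitz cC vC iC; apply/(@cvgrPdist_lt _ _ _ (nbhs x) (@nbhs_filter V x)) => e e0.
have nz : \forall y \near (x : V), y != 0 by exact: near_nonzero.
have nb : \forall y \near (x : V), ball x (e / L) y by apply: nbhsx_ballx; exact: divr_gt0.
move: nz nb; apply: filterS2 => y y0; rewrite -ball_normE /= => h.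
rewrite distrC; apply: le_lt_trans (jL x y x0 y0) _.
by rewrite distrC -ltr_pdivlMl// mulrC.
Qed.

Lemma radial_cvg (x : V) : x != 0 -> {for x, continuous p}.
Proof.
move=> x0; apply: (@continuousZ R V V (fun y => (j y)^-1) id x); last exact: cvg_id.
by apply: continuousV; [rewrite lt0r_neq0// gauge_gt0|exact: gauge_cvg].
Qed.

Section LocalEquation.
Variables (W : set V) (f : V -> R).
Hypotheses (oW : open W) (fd : forall y, W y -> differentiable f y).
Hypotheses (fg : forall y, W y -> grad f y != 0) (SW : S `&` W = [set y | W y /\ f y = 0]).

Lemma SW_zero y : S y -> W y -> f y = 0.
Proof. by move=> Sy Wy; have : (S `&` W) y by []; rewrite SW => -[]. Qed.

Lemma zero_SW y : W y -> f y = 0 -> S y.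
Proof. by move=> Wy fy; have : [set y | W y /\ f y = 0] y ; [by split|]; rewrite -SW => -[]. Qed.

(** Suppose [l q = 0]. Points [(1 - s) q + s u v] with [v] in an inner ball are interior to [C],
    hence off [S], for all [|u| <= 1]. But [f] is about [s u (l v)] there, so it changes sign
    between [u = -1] and [u = 1] and vanishes in between: a point of [S]. *)
Lemma transversal q l : S q -> W q -> fdiff f q l -> (exists v, l v != 0) -> l q != 0.
Proof.
move=> Sq Wq [lZ lB lc le] [v0 v00]; apply/eqP => d0.
have [r r0 rC] := interior_ball iC.
have Cq : C q by case: (Sq) => + _; rewrite -(closure_id C).1//; exact: C_closed.
have [v vr dv] : exists2 v : V, `|v| < r & 0 < l v.
  pose c : R := r / 2 / (`|v0| + 1) * Num.sg (l v0).
  have n1 : 0 < `|v0| + 1 by rewrite ltr_wpDl.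
  exists (c *: v0).
    rewrite normrZ /c normrM normr_sg v00 mulr1 gtr0_norm ?divr_gt0//.
    rewrite mulrAC ltr_pdivrMr// -mulrA (mulrC 2^-1) mulrA ltr_pdivrMr// -mulrA ltr_pM2l//.
    by have := normr_ge0 v0; lra.
  have -> : l (c *: v0) = r / 2 / (`|v0| + 1) * `|l v0|.
    by rewrite lZ [in RHS]normrEsg mulrA.
  by rewrite mulr_gt0 ?divr_gt0// normr_gt0.
pose D := l v; pose K : R := `|q| + `|v| + 1.
have K0 : 0 < K by rewrite /K ltr_wpDl// addr_ge0.
have e0 : 0 < D / (2 * K) by rewrite divr_gt0// mulr_gt0.
have small := le _ e0.
have nW : \forall h \near (0 : V), W (h + q).
  by apply: (@shift_cvg _ _ q W); exact: open_nbhs_nbhs.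
have [e /= e10 eH] := (nbhs_ballP _ _).1 (filterI small nW).
pose s := Num.min 1 (e / (2 * K)).
have s0 : 0 < s by rewrite lt_min ltr01 divr_gt0// mulr_gt0.
have s1 : s <= 1 by rewrite ge_min lexx.
have sK : s * K < e.
  have : s <= e / (2 * K) by rewrite ge_min lexx orbT.
  rewrite ler_pdivlMr ?mulr_gt0// => h; apply: lt_le_trans h.
  by rewrite mulrCA ltr_pMl ?mulr_gt0// ltr1n.
pose h (u : R) : V := s *: (u *: v - q).
have hb (u : R) : `|u| <= 1 -> ball (0 : V) e (h u) /\ `|h u| <= s * K.
  move=> u1; have hK : `|h u| <= s * K.
    rewrite /h normrZ gtr0_norm// ler_pM2l//; apply: le_trans (ler_normB _ _) _.
    by have := ler_wpM2r (normr_ge0 v) u1; rewrite normrZ /K; lra.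
  by split=> //; rewrite -ball_normE /= sub0r normrN; apply: le_lt_trans hK sK.
have hq (u : R) : h u + q = (1 - s) *: q + s *: (u *: v).
  by rewrite /h; apply/matrixP => a b; rewrite !mxE; ring.
have hi (u : R) : `|u| <= 1 -> ~ S (h u + q).
  move=> u1 [_ ]; apply; rewrite hq; apply: (cone_interior vC Cq _ r0 rC); first by rewrite s0.
  by rewrite normrZ; apply: le_lt_trans vr; rewrite ler_piMl.
have fq0 : f q = 0 := SW_zero Sq Wq.
have est (u : R) : `|u| <= 1 -> `|f (h u + q) - s * u * D| <= s * (D / 2).
  move=> u1; have [hb1 hb2] := hb u u1; have [E _] := eH _ hb1.
  have Eh : l (h u) = s * u * D.
    by rewrite /h lZ lB d0 subr0 lZ mulrA.
  move: E; rewrite fq0 subr0 Eh => E; apply: le_trans E _.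
  rewrite mulrC; apply: (@le_trans _ _ (s * K * (D / (2 * K)))).
    by rewrite ler_pM2r.
  rewrite le_eqVlt; apply/orP; left; apply/eqP.
  by field; rewrite lt0r_neq0.
have n1 : `|1 : R| <= 1 by rewrite normr1.
have nN1 : `|-1 : R| <= 1 by rewrite normrN normr1.
have sD : 0 < s * D by rewrite mulr_gt0.
have f1 : 0 < f (h 1 + q) by have := est 1 n1; rewrite mulr1 ler_norml => /andP[]; lra.
have fN1 : f (h (-1) + q) < 0 by have := est (-1) nN1; rewrite mulrN1 ler_norml => /andP[]; lra.
have hc : continuous (fun u => h u + q).
  move=> u; apply: (@continuousD R V R h (fun=> q)); last exact: cvg_cst.
  apply: (@continuous_comp R V V (fun u => u *: v - q) ( *:%R s)); last exact: scaler_continuous.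
  apply: (@continuousD R V R (fun u => u *: v) (fun=> - q)); last exact: cvg_cst.
  exact: (@scalel_continuous R V v).
have fc : {within `[-1, 1], continuous (fun u => f (h u + q))}.
  apply: (@continuous_in_subspaceT R R `[-1, 1]%classic (fun u => f (h u + q))) => u.
  rewrite inE /= in_itv /= => uI; have u1 : `|u| <= 1 by rewrite ler_norml.
  have [hb1 _] := hb u u1; have [_ Wu] := eH _ hb1.
  apply: (@continuous_comp _ _ _ (fun u => h u + q) f); last exact: (differentiable_continuous (fd Wu)).
  exact: hc.
have [u uI fu0] : exists2 u : R, u \in `[-1, 1] & f (h u + q) = 0.
  apply: (@IVT R (fun u => f (h u + q)) (-1) 1 0 _ fc); first by rewrite -subr_ge0 opprK addr_ge0.
  by rewrite ge_min le_max (ltW f1) (ltW fN1) orbT.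
have u1 : `|u| <= 1 by move: uI; rewrite in_itv /= ler_norml.
have [hb1 _] := hb u u1; have [_ Wu] := eH _ hb1.
exact: (hi u u1 (zero_SW Wu fu0)).
Qed.

(** An implicit differentiation of [f (x / j x) = 0]: [j (h + x) (p (h + x) - p x)] equals
    [h - (j (h + x) - j x) p x], and applying [l] isolates the increment of the gauge. The Lipschitz
    bound on the gauge makes the error small compared with [|h|]. *)
Lemma gauge_fdiff (x : V) l : x != 0 -> W (p x) -> fdiff f (p x) l -> l (p x) != 0 ->
  fdiff j x (fun v => (l (p x))^-1 * l v).
Proof.
move=> x0 Wp [lZ lB lc le]; set c := l (p x) => c0.
have Sp := radial_S x0.
have j0 : 0 < j x by exact: gauge_gt0.
have [L L0 jL] := gauge_lipschitz cC vC iC.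
split; first by move=> a v; rewrite lZ mulrCA.
- by move=> v w; rewrite lB mulrBr.
- move=> v; apply: (@continuous_comp V R R l ( *:%R c^-1)); last exact: scaler_continuous.
  exact: lc.
move=> e e0; pose K : R := 1 + L * `|p x|.
have K0 : 0 < K by rewrite ltr_pwDl// mulr_ge0// ltW.
have e'0 : 0 < e * `|c| / K by rewrite divr_gt0// mulr_gt0// normr_gt0.
have pc := radial_cvg x0.
have n1 : \forall h \near (0 : V), W (p (h + x)).
  apply: (@shift_cvg _ _ x [set y | W (p y)]); apply: (pc W); exact: open_nbhs_nbhs.
have n2 : \forall h \near (0 : V), h + x != 0.
  by apply: (@shift_cvg _ _ x [set y | y != 0]); exact: near_nonzero.
have n3 : \forall h \near (0 : V), `|f (p (h + x) - p x + p x) - f (p x) - l (p (h + x) - p x)|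
    <= e * `|c| / K * `|p (h + x) - p x|.
  have q0 : {for x, continuous (fun y => p y - p x)}.
    by apply: (@continuousD R V V p (fun=> - p x)); [exact: pc|exact: (@cst_continuous V V (- p x) x)].
  have q1 : (fun y => p y - p x) @ x --> (0 : V) by rewrite -[0 : V](subrr (p x)); exact: q0.
  exact: (shift_cvg (q1 _ (le _ e'0))).
move: n1 n2 n3; apply: filterS3 => h Wh h0 E.
have jh0 : 0 < j (h + x) by exact: gauge_gt0.
move: E; rewrite subrK (SW_zero (radial_S h0) Wh) (SW_zero Sp Wp) subrr sub0r normrN => E.
have xE : x = j x *: p x by rewrite /p scalerA mulfV ?lt0r_neq0// scale1r.
have w : j (h + x) *: (p (h + x) - p x) = h - (j (h + x) - j x) *: p x.
  rewrite scalerBr {1}/p scalerA mulfV ?lt0r_neq0// scale1r scalerBl -xE.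
  by rewrite opprB addrA.
have lw : j (h + x) * l (p (h + x) - p x) = l h - (j (h + x) - j x) * c.
  by rewrite -lZ w lB lZ.
have nw : j (h + x) * `|p (h + x) - p x| <= K * `|h|.
  have -> : j (h + x) * `|p (h + x) - p x| = `|h - (j (h + x) - j x) *: p x|.
    by rewrite -w normrZ gtr0_norm.
  apply: le_trans (ler_normB _ _) _; rewrite normrZ /K mulrDl mul1r lerD2l mulrAC ler_wpM2r//.
  by have := jL _ _ x0 h0; rewrite addrK.
have -> : j (h + x) - j x - c^-1 * l h = - (c^-1 * (j (h + x) * l (p (h + x) - p x))).
  by rewrite lw; field.
rewrite normrN normrM normfV mulrC ler_pdivrMr ?normr_gt0// normrM gtr0_norm//.
apply: le_trans (ler_wpM2l (ltW jh0) E) _.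
rewrite mulrCA; apply: le_trans (ler_wpM2l (ltW e'0) nw) _.
by rewrite mulrA divfK ?lt0r_neq0// mulrAC.
Qed.

Lemma gauge_differentiable (x : V) : x != 0 -> W (p x) ->
  differentiable j x /\ forall v, 'd j x v = ('d f (p x) (p x))^-1 * 'd f (p x) v.
Proof.
move=> x0 Wp; have d := differentiable_fdiff (fd Wp).
apply: fdiff_differentiable; apply: gauge_fdiff => //.
exact: (transversal (radial_S x0) Wp d (diff_nonzero (fd Wp) (fg Wp))).
Qed.

End LocalEquation.
End GaugeDifferentiable.

Section GaugeC2.
Variables (R : realType) (k : nat) (C : set 'cV[R]_k).
Local Notation V := 'cV[R]_k.
Hypotheses (cC : compact C) (vC : convex_set C) (iC : (interior C) 0).
Let S : set V := closure C `\` interior C.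
Hypothesis S2 : C2_hypersurface S.
Let j := gauge C.
Let p (x : V) : V := (j x)^-1 *: x.

Lemma C2_chart (x : V) : x != 0 -> exists (W : set V) (f : V -> R),
  [/\ open W, W (p x), C2_on W f, forall y, W y -> grad f y != 0 & S `&` W = [set y | W y /\ f y = 0]].
Proof. by move=> x0; apply: S2; exact: radial_S. Qed.

Lemma gauge_differentiable_off0 (x : V) : x != 0 -> differentiable j x.
Proof.
move=> x0; have [W [f [oW Wx fC fg SW]]] := C2_chart x0.
have fd y : W y -> differentiable f y by move=> /fC[].
by have [] := gauge_differentiable cC vC iC oW fd fg SW x0 Wx.
Qed.

Lemma radial_differentiable (x : V) : x != 0 -> differentiable p x.
Proof.
move=> x0; apply: diff_scale_id; apply: differentiableV; first exact: gauge_differentiable_off0.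
by rewrite lt0r_neq0// gauge_gt0.
Qed.

(** The partial derivatives of the gauge are those of the local equation [f] at the radial point,
    divided by ['d f (p y) (p y)]; since [f] is of class [C2], this quotient is differentiable
    again. *)
Lemma gauge_partial_differentiable i (x : V) : x != 0 -> differentiable (partial i j) x.
Proof.
move=> x0; have [W [f [oW Wx fC fg SW]]] := C2_chart x0.
have fd y : W y -> differentiable f y by move=> /fC[].
have gd := gauge_differentiable cC vC iC oW fd fg SW.
pose c : V -> R := \sum_(l < k) (fun y : V => p y l 0 * partial l f (p y)).
have cE (y : V) : W (p y) -> c y = 'd f (p y) (p y).
  by move=> Wy; rewrite (diff_partial _ (fd _ Wy)) /c fct_sumE.
have pd := radial_differentiable x0.
have comp (g : V -> R) : differentiable g (p x) -> differentiable (g \o p) x.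
  by move=> dg; exact: differentiable_comp.
have dc : differentiable c x.
  apply: differentiable_sum => l; apply: differentiableM.
    by apply: (comp (fun y : V => y l 0)); exact: diff_coord.
  by apply: (comp (partial l f)); have [_ + _] := fC _ Wx; exact.
have c0 : c x != 0.
  rewrite cE//; apply: (transversal cC vC iC oW fd SW (radial_S cC vC iC x0) Wx (differentiable_fdiff (fd _ Wx))).
  exact: (diff_nonzero (fd _ Wx) (fg _ Wx)).
apply: (@near_eq_diff _ _ _ (fun y => (c y)^-1 * partial i f (p y))).
  apply: differentiableM; first exact: differentiableV.
  by apply: (comp (partial i f)); have [_ + _] := fC _ Wx; exact.
have n1 : \forall y \near x, W (p y).
  by apply: (radial_cvg cC vC iC x0); exact: open_nbhs_nbhs.
have n2 : \forall y \near x, y != 0 by exact: near_nonzero.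
move: n1 n2; apply: filterS2 => y Wy y0; have [d1 d2] := gd y y0 Wy.
by rewrite /partial deriveE// d2 cE// deriveE//; exact: fd.
Qed.

Variable alpha : R.
Hypothesis alpha0 : alpha != 0.
Let H := Halpha C alpha.

Lemma pow_differentiable (a r : R) : 0 < r -> differentiable (fun u : R => u `^ a) r.
Proof. by move=> r0; apply/derivable1_diffP; have [] := is_derive1_powR a r0. Qed.

Lemma Halpha_differentiable (x : V) : x != 0 -> differentiable H x /\
  forall v, 'd H x v = alpha * j x `^ (alpha - 1) * 'd j x v.
Proof.
move=> x0; have j0 : 0 < j x by exact: gauge_gt0.
have d1 := gauge_differentiable_off0 x0; have d2 := pow_differentiable alpha j0.
split; first exact: (differentiable_comp d1 d2).
move=> v; have -> : 'd H x v = 'd (fun u : R => u `^ alpha) (j x) ('d j x v).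
  by rewrite -[LHS]/('d ((fun u : R => u `^ alpha) \o j) x v) (diff_comp d1 d2).
rewrite (diff1E d2) derive1E; have [_ ->] := is_derive1_powR alpha j0.
exact: mulrC.
Qed.

Lemma Halpha_partial_differentiable i (x : V) : x != 0 -> differentiable (partial i H) x.
Proof.
move=> x0; have j0 : 0 < j x by exact: gauge_gt0.
apply: (@near_eq_diff _ _ _ (fun y => alpha * j y `^ (alpha - 1) * partial i j y)).
  apply: differentiableM; last exact: gauge_partial_differentiable.
  apply: differentiableM; first exact: differentiable_cst.
  exact: (differentiable_comp (gauge_differentiable_off0 x0) (pow_differentiable (alpha - 1) j0)).
have := near_nonzero x0; apply: filterS => y y0; have [d1 d2] := Halpha_differentiable y0.
by rewrite /partial !deriveE//; exact: gauge_differentiable_off0.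
Qed.

Section Equivariance.
Variable P : 'M[R]_k.
Hypotheses (uP : P \in unitmx) (PS : forall x, S x -> S (P *m x)).

Lemma mul_nonzero (x : V) : x != 0 -> P *m x != 0.
Proof.
move=> x0; apply: contraNneq x0 => h.
by rewrite -[x]mul1mx -(mulVmx uP) -mulmxA h mulmx0.
Qed.

(** The image under [P] of the boundary point [x / j x] is on the boundary: being in [C] it bounds
    the gauge of [P x] from above, not being interior it bounds it from below. *)
Lemma gauge_equivariant (x : V) : j (P *m x) = j x.
Proof.
case: (eqVneq x 0) => [->|x0]; first by rewrite mulmx0.
have Px0 := mul_nonzero x0; have j0 : 0 < j x by exact: gauge_gt0.
have [Sc Si] := PS (radial_S cC vC iC x0).
have pE : P *m ((j x)^-1 *: x) = (j x)^-1 *: (P *m x) by rewrite -scalemxAr.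
apply/eqP; rewrite eq_le; apply/andP; split.
  apply: (gauge_le iC Px0 j0); rewrite -pE.
  by move: Sc; rewrite -((closure_id C).1 (C_closed cC)).
rewrite leNgt; apply/negP => h; apply: Si; rewrite pE.
exact: (gauge_lt_interior cC vC iC Px0 h).
Qed.

Lemma Halpha_equivariant (x : V) : H (P *m x) = H x.
Proof. by congr (_ `^ _); exact: gauge_equivariant. Qed.

Lemma derive_equivariant (f g : V -> R) (x v : V) : (forall y, g y = f (P *m y)) ->
  'D_v g x = 'D_(P *m v) f (P *m x).
Proof.
move=> gE; rewrite /derive; set d := (fun _ : R => _); set d' := (fun _ : R => _).
suff -> : d = d' by []; rewrite funeqE /d /d' => h /=.
by rewrite !gE mulmxDr scalemxAr.
Qed.

Lemma Pdelta (l a : 'I_k) : (P *m delta_mx l 0 : V) a 0 = P a l.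
Proof.
rewrite !mxE (bigD1 l)//= big1 => [|c cl]; rewrite !mxE ?eqxx ?mulr1 ?addr0//.
by rewrite (negbTE cl) mulr0.
Qed.

(** The chain rule applied twice to [H (P y) = H y]. The order of the two derivatives is kept
    throughout, so symmetry of the Hessian does not enter. *)
Lemma hess_equivariant (x : V) : x != 0 -> hess H x = P^T *m hess H (P *m x) *m P.
Proof.
move=> x0; have Px0 := mul_nonzero x0.
have part l (y : V) : y != 0 -> partial l H y = \sum_a P a l * partial a H (P *m y).
  move=> y0; rewrite /partial (derive_equivariant _ _ (fun z => esym (Halpha_equivariant z))).
  have Py0 := mul_nonzero y0; have [d _] := Halpha_differentiable Py0.
  rewrite deriveE// (diff_partial _ d); apply: eq_bigr => a _.
  by rewrite Pdelta.
apply/matrixP => a b; rewrite !mxE.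
pose g c (y : V) := P c b *: partial c H y; pose G : V -> R := \sum_c g c.
have gd c (z : V) : z != 0 -> differentiable (partial c H) z.
  exact: Halpha_partial_differentiable.
have Gd (z : V) : z != 0 -> differentiable G z.
  by move=> z0; apply: differentiable_sum => c; apply: differentiableZ; exact: gd.
have -> : partial a (partial b H) x = 'D_(P *m delta_mx a 0) G (P *m x).
  rewrite -(derive_equivariant (g := fun y => G (P *m y)))//; apply: near_eq_derive.
  have := near_nonzero x0; apply: filterS => y y0.
  by rewrite part// /G fct_sumE.
rewrite deriveE ?(diff_partial _ (Gd _ Px0)); last exact: Gd.
under [RHS]eq_bigr => c _ do rewrite !mxE mulr_suml.
rewrite exchange_big /=; apply: eq_bigr => l _.
rewrite Pdelta /partial derive_sum => [|c]; last first.
  by apply: derivableZ; apply: diff_derivable; exact: gd.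
rewrite mulr_sumr; apply: eq_bigr => c _; rewrite !mxE deriveZ; last by apply: diff_derivable; exact: gd.
by rewrite [_ *: _]mulrC mulrA.
Qed.

End Equivariance.
End GaugeC2.

(** * The linearized flow *)

Section MatrixDerivative.
Variable R : realType.

Definition rderiv k l (t : R) (X : R -> 'M[R]_(k, l)) (d : 'M[R]_(k, l)) :=
  forall i j, is_derive t (1 : R) (fun u => X u i j : R) (d i j).

Lemma is_derive_cvg (f : R -> R) (t d : R) :
  h^-1 * (f (h + t) - f t) @[h --> (0 : R)^'] --> d -> is_derive t (1 : R) f d.
Proof.
move=> h; have E : (fun h0 : R => h0^-1 *: ((f \o shift t) (h0 *: (1 : R)) - f t)) =
   (fun h0 => h0^-1 * (f (h0 + t) - f t)).
  by apply/funext => u; rewrite /= [_ *: 1]mulr1.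
split; first by rewrite /derivable E; apply/cvg_ex; exists d.
by rewrite /derive E; apply/cvg_lim.
Qed.

Lemma cvg_is_derive (f : R -> R) (t d : R) : is_derive t (1 : R) f d ->
  h^-1 * (f (h + t) - f t) @[h --> (0 : R)^'] --> d.
Proof.
move=> [h1 h2]; have E : (fun h0 : R => h0^-1 *: ((f \o shift t) (h0 *: (1 : R)) - f t)) =
   (fun h0 => h0^-1 * (f (h0 + t) - f t)).
  by apply/funext => u; rewrite /= [_ *: 1]mulr1.
by move: h1 h2; rewrite /derivable /derive E => h1 <-.
Qed.

Lemma rderiv_matrix k l (t : R) (X : R -> 'M[R]_(k, l)) d : is_derive t (1 : R) X d -> rderiv t X d.
Proof.
move=> [h1 h2] i j; apply: is_derive_cvg.
have E : (fun h0 : R => h0^-1 *: ((X \o shift t) (h0 *: (1 : R)) - X t)) =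
   (fun h0 => h0^-1 *: (X (h0 + t) - X t)).
  by apply/funext => u; rewrite /= [_ *: 1]mulr1.
move: h1 h2; rewrite /derivable /derive E => h1 <-.
have /rcvgP/(_ i j) := h1; apply: cvg_trans; apply: near_eq_cvg; near=> h.
by rewrite !mxE.
Unshelve. all: by end_near.
Qed.

Lemma rderiv_cst k l (t : R) (B : 'M[R]_(k, l)) : rderiv t (fun=> B) 0.
Proof. by move=> i j; rewrite mxE; exact: is_derive_cst. Qed.

Lemma rderivM k l p (t : R) (X : R -> 'M[R]_(k, l)) (Y : R -> 'M[R]_(l, p)) dX dY :
  rderiv t X dX -> rderiv t Y dY -> rderiv t (fun u => X u *m Y u) (dX *m Y t + X t *m dY).
Proof.
move=> hX hY i j.
have -> : (fun u => (X u *m Y u) i j : R) = \sum_(a < l) (fun u => X u i a * Y u a j).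
  by apply/funext => u; rewrite fct_sumE !mxE.
have -> : (dX *m Y t + X t *m dY) i j = \sum_(a < l) (X t i a *: dY a j + Y t a j *: dX i a).
  rewrite !mxE -big_split /=; apply: eq_bigr => a _.
  by rewrite addrC [dX _ _ * _]mulrC.
by apply: is_derive_sum => a; exact: is_deriveM.
Qed.

Lemma rderivT k l (t : R) (X : R -> 'M[R]_(k, l)) d : rderiv t X d -> rderiv t (fun u => (X u)^T) d^T.
Proof.
move=> h i j; rewrite mxE; have := h j i.
by congr is_derive; apply/funext => u; rewrite mxE.
Qed.

Lemma rderiv_shift k l (t c : R) (X : R -> 'M[R]_(k, l)) d :
  rderiv (t + c) X d -> rderiv t (fun u => X (u + c)) d.
Proof.
move=> h i j; apply: is_derive_cvg; have := cvg_is_derive (h i j).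
by under eq_fun do rewrite addrA.
Qed.

Lemma rderiv_cvg k l (t : R) (X : R -> 'M[R]_(k, l)) d : rderiv t X d ->
  rcvg t^' (fun u => (u - t)^-1 *: (X u - X t)) d.
Proof.
move=> h i j; have c := cvg_is_derive (h i j).
have e : u - t @[u --> t^'] --> (0 : R)^'.
  move=> A [e /= e0 eA]; exists e => //= y yt yn; apply: eA; last by rewrite subr_eq0.
  by rewrite /= sub0r normrN distrC.
have := cvg_comp _ _ e c; apply: cvg_trans; apply: near_eq_cvg; near=> u.
by rewrite /= !mxE subrK.
Unshelve. all: by end_near.
Qed.

Lemma rderiv_near k l (t : R) (X Y : R -> 'M[R]_(k, l)) d : (\forall u \near t, X u = Y u) ->
  rderiv t X d -> rderiv t Y d.
Proof.
move=> h hX i j; apply: near_eq_is_derive (hX i j).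
by apply: filterS h => u ->.
Qed.

Lemma rderiv_const k l (a b : R) (X : R -> 'M[R]_(k, l)) : a <= b -> rcontinuous X ->
  (forall t, a < t < b -> rderiv t X 0) -> X b = X a.
Proof.
rewrite le_eqVlt => /predU1P[->//|ab] Xc Xd; apply/matrixP => i j.
have fc : {within `[a, b], continuous (fun u => X u i j : R)}.
  by apply: continuous_within => t; exact: Xc.
have fd t : t \in `]a, b[ -> is_derive t (1 : R) (fun u => X u i j : R) ((fun=> 0) t).
  by rewrite in_itv /= => /Xd /(_ i j); rewrite mxE.
have [c _] := MVT ab fd fc.
by rewrite mul0r => /eqP; rewrite subr_eq0 => /eqP.
Qed.

Lemma rcvgT (T : Type) (F : set_system T) (FF : Filter F) k l (X : T -> 'M[R]_(k, l)) B :
  rcvg F X B -> rcvg F (fun t => (X t)^T) B^T.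
Proof.
move=> h i j; rewrite mxE; have := h j i; apply: cvg_trans; apply: near_eq_cvg.
by near=> t; rewrite mxE.
Unshelve. all: by end_near.
Qed.

Lemma rcontinuousM k l p (X : R -> 'M[R]_(k, l)) (Y : R -> 'M[R]_(l, p)) :
  rcontinuous X -> rcontinuous Y -> rcontinuous (fun t => X t *m Y t).
Proof. by move=> Xc Yc t; exact: rcvgM. Qed.

Lemma rcontinuous_cst k l (B : 'M[R]_(k, l)) : rcontinuous (fun=> B).
Proof. by move=> t; exact: rcvg_cst. Qed.

Lemma rcontinuousX k (X : R -> 'M[R]_k) m : rcontinuous X -> rcontinuous (fun t => X t ^+ m).
Proof. by move=> Xc t; exact: rcvgX. Qed.

Lemma rcontinuous_shift k l (X : R -> 'M[R]_(k, l)) c : rcontinuous X -> rcontinuous (fun t => X (t + c)).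
Proof.
move=> Xc; apply: (rcontinuous_comp Xc) => t.
by apply: (@continuousD R R R id (fun=> c)); [exact: cvg_id|exact: cvg_cst].
Qed.

End MatrixDerivative.

Section LinearFlow.
Variables (R : realType) (n : nat).
Local Notation J := (Jmx R n).
Local Notation Mx := 'M[R]_(n + n).

(** Two solutions of the same linear Hamiltonian system have a constant symplectic pairing. With
    [Z = Y] this is symplecticity of the flow, with different solutions it yields their
    uniqueness. *)
Lemma flow_wronskian (a b : R) (A Y Z : R -> Mx) : a <= b ->
  (forall t, (A t)^T = A t) -> rcontinuous Y -> rcontinuous Z ->
  (forall t, a < t < b -> rderiv t Y (J *m A t *m Y t)) ->
  (forall t, a < t < b -> rderiv t Z (J *m A t *m Z t)) ->
  (Z b)^T *m J *m Y b = (Z a)^T *m J *m Y a.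
Proof.
move=> ab As Yc Zc Yd Zd.
apply: (@rderiv_const _ _ _ a b (fun t => (Z t)^T *m J *m Y t) ab).
  apply: rcontinuousM => //; apply: rcontinuousM; last exact: rcontinuous_cst.
  by move=> t; apply: rcvgT; exact: Zc.
move=> t tab; have dY := Yd t tab; have dZ := Zd t tab.
have := rderivM (rderivM (rderivT dZ) (rderiv_cst t J)) dY.
congr rderiv; rewrite !trmx_mul As Jmx_tr mulmx0 addr0.
have E : (Z t)^T *m (A t *m - J) *m J = (Z t)^T *m A t.
  by rewrite mulmxN mulmxN mulNmx -!mulmxA Jmx2 !mulmxN mulmx1 opprK.
have E2 : (Z t)^T *m J *m (J *m A t *m Y t) = - ((Z t)^T *m A t *m Y t).
  by rewrite -!mulmxA (mulmxA J J) Jmx2 mulNmx mul1mx !mulmxN.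
by rewrite E E2 subrr.
Qed.

Section Periodic.
Variables (tau s : R) (m : nat) (P : Mx) (A G : R -> Mx).
Hypotheses (s0 : 0 < s) (m2 : (2 <= m)%N) (tauE : tau = m%:R * s).
Hypotheses (Gc : rcontinuous G) (G0 : G 0 = 1%:M).
Hypothesis Gd : forall t : R, 0 < t < tau -> rderiv t G (J *m A t *m G t).
Hypothesis Apos : forall t, posdef (A t).
Hypotheses (sP : symplectic P) (Pm : P ^+ m = 1).
Hypothesis AP : forall t : R, 0 <= t <= tau -> A t = invmx P^T *m A (t + s) *m invmx P.

Lemma flow_symplectic (t : R) : 0 <= t <= tau -> symplectic (G t).
Proof.
case/andP=> t0 tt; apply: symplectic_of.
have As u : (A u)^T = A u by case: (Apos u).
have h (u : R) : 0 < u < t -> rderiv u G (J *m A u *m G u).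
  by case/andP=> u0 ut; apply: Gd; rewrite u0 (lt_le_trans ut tt).
by rewrite (flow_wronskian t0 As Gc Gc h h) G0 trmx1 mul1mx mulmx1.
Qed.

Lemma symplectic_mulJ (Q : Mx) : symplectic Q -> Q *m J = J *m invmx Q^T.
Proof.
move=> sQ; have [uQ _] := symplectic_tr sQ.
by rewrite -[LHS]mulmx1 -(mulmxV uQ) mulmxA (symplectic_tr_mul sQ).
Qed.

Lemma conj_flow (Q B Y : Mx) : symplectic Q ->
  Q *m (J *m B *m Y) = J *m (invmx Q^T *m B *m invmx Q) *m (Q *m Y).
Proof.
move=> sQ; have [uQ _] := sQ.
rewrite !mulmxA (symplectic_mulJ sQ) -!mulmxA; congr (_ *m _).
by rewrite (mulmxA (invmx Q)) mulVmx// mul1mx.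
Qed.

Lemma s_lt_tau : s < tau.
Proof. by rewrite tauE ltr_pMl// ltr1n. Qed.

(** By the invariance of [A] under [P] both sides solve the same linear system in [t], and both
    equal [P G (s)] at [t = 0]. *)
Lemma flow_shift (t : R) : 0 <= t <= tau - s -> P *m G (t + s) = G t *m P *m G s.
Proof.
case/andP=> t0 tt; have As u : (A u)^T = A u by case: (Apos u).
have st := s_lt_tau; have sG : symplectic (G s) by apply: flow_symplectic; rewrite !ltW.
pose K := P *m G s; have sK : symplectic K by exact: symplecticM.
have Zc : rcontinuous (fun u => G u *m K) by apply: rcontinuousM => //; exact: rcontinuous_cst.
have Yc : rcontinuous (fun u => P *m G (u + s)).
  by apply: rcontinuousM; [exact: rcontinuous_cst|exact: rcontinuous_shift].
have Zd (u : R) : 0 < u < t -> rderiv u (fun u => G u *m K) (J *m A u *m (G u *m K)).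
  case/andP=> u0 ut; have ut' : 0 < u < tau.
    by rewrite u0 (lt_le_trans ut)// (le_trans tt)// gerBl ltW.
  by have := rderivM (Gd ut') (rderiv_cst u K); rewrite mulmx0 addr0 mulmxA.
have Yd (u : R) : 0 < u < t -> rderiv u (fun u => P *m G (u + s)) (J *m A u *m (P *m G (u + s))).
  case/andP=> u0 ut; have ut' : 0 < u + s < tau.
    by rewrite addr_gt0//= -ltrBrDr (lt_le_trans ut tt).
  have := rderivM (rderiv_cst u P) (rderiv_shift (Gd ut')).
  by rewrite mul0mx add0r (conj_flow _ _ sP) -AP// (ltW u0) (le_trans (ltW ut))// (le_trans tt)// gerBl ltW.
have := flow_wronskian t0 As Yc Zc Yd Zd.
rewrite G0 mul1mx add0r (sK.2) -!mulmxA -/K => E.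
have sZ : symplectic (G t *m K) by apply: symplecticM => //; apply: flow_symplectic; rewrite t0 (le_trans tt)// gerBl ltW.
have [uZ eZ] := sZ; have uZT : (G t *m K)^T *m J \in unitmx.
  by rewrite unitmx_mul unitmx_tr uZ Jmx_unit.
have EE : ((G t *m K)^T *m J) *m (P *m G (t + s)) = ((G t *m K)^T *m J) *m (G t *m K).
  by rewrite eZ -[RHS]E !mulmxA.
by rewrite -[LHS](mulKmx uZT) EE mulKmx.
Qed.

Lemma flow_iter (t : R) j : 0 <= t <= s -> (j < m)%N ->
  G (t + j%:R * s) = invmx P ^+ j *m G t *m (P *m G s) ^+ j.
Proof.
move=> ts; elim: j => [|j IH] jm; first by rewrite mul0r addr0 !expr0 mul1mx mulmx1.
have h : 0 <= t + j%:R * s <= tau - s.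
  case/andP: ts => t0 ts; rewrite addr_ge0 ?mulr_ge0 ?(ltW s0)//=.
  rewrite tauE lerBrDr -addrA; apply: (@le_trans _ _ (s + (j%:R * s + s))); first by rewrite lerD2r.
  have -> : s + (j%:R * s + s) = (j.+2)%:R * s by rewrite -addn2 natrD; ring.
  by rewrite ler_pM2r// ler_nat.
have := flow_shift h; rewrite IH; last exact: ltnW.
have -> : t + j%:R * s + s = t + j.+1%:R * s by rewrite mulrSr; ring.
move=> E; have [uP _] := sP; rewrite -[LHS](mulKmx uP) E.
by rewrite exprS exprSr -!mulmxE !mulmxA.
Qed.

Lemma flow_end : G tau = (P *m G s) ^+ m.
Proof.
have [k mk] : exists k, m = k.+1 by exists m.-1; rewrite prednK// (leq_trans _ m2).
have [uP _] := sP.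
have := @flow_iter s k; rewrite mk lexx (ltW s0) ltnSn => /(_ isT isT).
have -> : s + k%:R * s = tau by rewrite tauE mk mulrSr; ring.
(* [k = m - 1], so [P^m = 1] turns [P^(-k)] into [P]; this factor completes the power. *)
move=> ->; have -> : invmx P ^+ k = P.
  have VP : GRing.comm (invmx P) P by rewrite /GRing.comm -!mulmxE mulVmx// mulmxV.
  have : invmx P ^+ k *m P ^+ m = invmx P ^+ k by rewrite Pm mulmx1.
  rewrite mk exprSr -mulmxE mulmxA mulmxE -exprMn_comm// -mulmxE mulVmx// expr1n => <-.
  by rewrite mul1mx.
by rewrite exprS -mulmxE.
Qed.

Section Arguments.
Variable D : R -> R.
Hypotheses (Dc : continuous D) (GD : forall t : R, 0 <= t <= tau -> is_arg (G t) (D t)).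
Let X r := P *m G (clamp 0 s r).

Lemma clamp0 (r : R) : 0 <= r <= s -> clamp 0 s r = r.
Proof. by move=> rs; rewrite clamp_id// in_itv. Qed.

Lemma clamp_range (r : R) : 0 <= clamp 0 s r <= s.
Proof. by have := clamp_itv r (ltW s0); rewrite in_itv. Qed.

Lemma X_symplectic r : symplectic (X r).
Proof.
apply: symplecticM => //; apply: flow_symplectic; have /andP[-> h] := clamp_range r.
by apply: le_trans h _; apply: ltW; exact: s_lt_tau.
Qed.

Lemma X_continuous : rcontinuous X.
Proof.
apply: rcontinuousM; first exact: rcontinuous_cst.
by apply: (rcontinuous_comp Gc); exact: clamp_continuous.
Qed.

Lemma X0 : X 0 = P.
Proof. by rewrite /X clamp0 ?lexx ?ltW// G0 mulmx1. Qed.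

Lemma Xs : X s = P *m G s.
Proof. by rewrite /X clamp0// lexx ltW. Qed.

Lemma right_dnbhs (t : R) : t^'+ `=>` t^'.
Proof. by move=> B [e e0 eB]; exists e => // y yt ty; apply: eB => //; rewrite gt_eqF. Qed.

Lemma left_dnbhs (t : R) : t^'- `=>` t^'.
Proof. by move=> B [e e0 eB]; exists e => // y yt ty; apply: eB => //; rewrite lt_eqF. Qed.

Lemma posquot_of_rderiv (t : R) (F : set_system R) (FF : Filter F) (B : Mx) (Y Z : R -> Mx) :
  F `=>` t^' -> posdef B -> Z t = Y t -> (\forall u \near F, Z u = Y u) ->
  rderiv t Y (J *m B *m Y t) -> posquot F t Z.
Proof.
move=> Ft pB E0 E dY; exists B; split=> //; rewrite E0 => i j.
have h : rcvg t^' (fun u => (u - t)^-1 *: (Y u - Y t)) (J *m B *m Y t) := rderiv_cvg dY.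
have hij := h i j; apply: cvg_trans (cvg_trans (cvg_app _ Ft) hij).
by apply: near_eq_cvg; apply: filterS E => u ->.
Qed.

Lemma Ginterior (t : R) : 0 < t < tau ->
  posdef (invmx P^T *m A t *m invmx P) /\
  rderiv t (fun u => P *m G u) (J *m (invmx P^T *m A t *m invmx P) *m (P *m G t)).
Proof.
move=> tt; have [uP _] := sP; split.
  by have := @posdef_congr _ n (A t) (invmx P); rewrite unitmx_inv trmx_inv => /(_ uP (Apos t)).
by have := rderivM (rderiv_cst t P) (Gd tt); rewrite mul0mx add0r (conj_flow _ _ sP).
Qed.

(** The differential equation is available only inside the open interval. Near [0], [flow_shift]
    expresses [P G (u)] through [G (u + s)], and [s] is an interior time. *)
Lemma right_start : exists B Y, [/\ posdef B, rderiv 0 Y (J *m B *m Y 0) &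
  forall u : R, 0 <= u <= tau - s -> P *m G u = Y u].
Proof.
have st := s_lt_tau; have [uP _] := sP.
have ss : 0 < s < tau by rewrite s0.
have sG : symplectic (G s) by apply: flow_symplectic; rewrite !ltW.
have [uG _] := sG; have sPP := symplecticM sP sP; have [uPP _] := sPP.
pose L := invmx (G s) *m invmx P.
pose B := invmx (P *m P)^T *m A s *m invmx (P *m P).
exists B, (fun u => (P *m P *m G (u + s)) *m L); split.
- have := @posdef_congr _ n (A s) (invmx (P *m P)).
  by rewrite unitmx_inv trmx_inv => /(_ uPP (Apos s)).
- have ds : rderiv (0 + s) G (J *m A s *m G s) by rewrite add0r; exact: Gd.
  have := rderivM (rderivM (rderiv_cst 0 (P *m P)) (rderiv_shift ds)) (rderiv_cst 0 L).
  by rewrite mul0mx add0r mulmx0 addr0 add0r (conj_flow _ _ sPP) !mulmxA.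
move=> u uI; rewrite -(mulmxA P P) (flow_shift uI) /L.
by rewrite !mulmxA mulmxK// mulmxK.
Qed.

Lemma X_right (t : R) : 0 <= t < s -> posquot t^'+ t X.
Proof.
case/andP=> t0 ts; have st := s_lt_tau.
have near_in : \forall u \near t^'+, 0 <= u <= s.
  apply: filterS2 (nbhs_right_gt t) (nbhs_right_lt ts) => u tu us.
  by rewrite (le_trans t0 (ltW tu)) (ltW us).
have Xt : X t = P *m G t by rewrite /X clamp0// t0 ltW.
move: t0; rewrite le_eqVlt => /predU1P[t0|t0]; last first.
  have ti : 0 < t < tau by rewrite t0 (lt_trans ts).
  have [pB dY] := Ginterior ti.
  apply: (posquot_of_rderiv _ _ pB Xt _ dY); first exact: right_dnbhs.
  by apply: filterS near_in => u uI; rewrite /X clamp0.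
subst t; have [B [Y [pB dY YE]]] := right_start.
have ts' : 0 < tau - s by rewrite subr_gt0.
apply: (posquot_of_rderiv _ _ pB _ _ dY); first exact: right_dnbhs.
  by rewrite Xt YE// lexx ltW.
apply: filterS2 near_in (nbhs_right_lt ts') => u uI us; rewrite /X clamp0// YE//.
by have /andP[-> _] := uI; exact: ltW.
Qed.

Lemma X_left (t : R) : 0 < t <= s -> posquot t^'- t X.
Proof.
case/andP=> t0 ts; have st := s_lt_tau.
have near_in : \forall u \near t^'-, 0 <= u <= s.
  apply: filterS2 (nbhs_left_lt t) (nbhs_left_gt t0) => u tu us.
  by rewrite (ltW us) (le_trans (ltW tu)).
have Xt : X t = P *m G t by rewrite /X clamp0// ts ltW.
have ti : 0 < t < tau by rewrite t0 (le_lt_trans ts).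
have [pB dY] := Ginterior ti.
apply: (posquot_of_rderiv _ _ pB Xt _ dY); first exact: left_dnbhs.
by apply: filterS near_in => u uI; rewrite /X clamp0.
Qed.

Let c (z : R[i]) := ((Num.sqrt (nsq z))^-1)%:C%C * z.

Lemma unitize_arg (M : Mx) d : symplectic M -> is_arg M d -> c (adet M) = expi d.
Proof.
move=> sM dM; have a0 := adet_neq0 sM.
have h : Num.sqrt (nsq (adet M)) != 0 by rewrite gt_eqF// sqrt_nsq_gt0.
by rewrite /c {2}dM mulrA -rmorphM /= mulVf// mul1r.
Qed.

(** [square_lift] for [K u v = P^-(j+1) X(u) X(v)^j]: the edge [u = 0] is the previous power, as
    [X 0 = P]; the edge [v = s] is [e2]; the diagonal is the next power. *)
Lemma arg_step j e0 e1 e2 : 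
  argpath (fun t => invmx P ^+ j *m X t ^+ j) e0 ->
  argpath (fun t => invmx P ^+ j.+1 *m X t ^+ j.+1) e1 ->
  argpath (fun t => invmx P ^+ j.+1 *m X t *m X s ^+ j) e2 ->
  e1 s - e1 0 = (e0 s - e0 0) + (e2 s - e2 0).
Proof.
move=> [Xc0 c0 a0] [Xc1 c1 a1] [Xc2 c2 a2].
pose K u v := invmx P ^+ j.+1 *m X u *m X v ^+ j.
have [uP _] := sP.
have sK u v : symplectic (K u v).
  apply: symplecticM; last exact/symplecticX/X_symplectic.
  apply: symplecticM; last exact: X_symplectic.
  exact/symplecticX/symplecticV.
have n0 u v : Num.sqrt (nsq (adet (K u v))) != 0 by rewrite gt_eqF// sqrt_nsq_gt0// adet_neq0.
apply: (@square_lift R s (fun u v => c (adet (K u v))) (ltW s0)) => //.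
- move=> p; have Kc : rcvg (nbhs p) (fun q => K q.1 q.2) (K p.1 p.2).
    have c1' : rcvg (nbhs p) (fun q => X q.1) (X p.1).
      by move=> a b; apply: (@continuous_comp _ _ _ fst (fun u => X u a b) p); [exact: cvg_fst|exact: X_continuous].
    have c2' : rcvg (nbhs p) (fun q => X q.2) (X p.2).
      by move=> a b; apply: (@continuous_comp _ _ _ snd (fun u => X u a b) p); [exact: cvg_snd|exact: X_continuous].
    by apply: rcvgM; [apply: rcvgM => //; exact: rcvg_cst|exact: rcvgX].
  have ac : ccvg (nbhs p) (fun q => adet (K q.1 q.2)) (adet (K p.1 p.2)).
    exact: ccvg_adet.
  apply: ccvgM => //; apply: ccvg_real; apply: cvgV; first exact: n0.
  by apply: (cvg_realfun (g := @Num.sqrt R)); [exact: sqrt_continuous|exact: ccvg_nsq].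
- move=> u v; rewrite /c nsqM /nsq /= expr0n /= addr0 -[X in _ * X]/(nsq (adet (K u v))).
  by rewrite exprVn sqr_sqrtr ?nsq_ge0// mulVf// nsq_eq0 adet_neq0.
- move=> u _; have [s1 d1] := a1 u; rewrite -(unitize_arg s1 d1); congr (c (adet _)).
  by rewrite /K [X u ^+ j.+1]exprS -mulmxE -[LHS]mulmxA.
- move=> v _; have [s1 d1] := a0 v; rewrite -(unitize_arg s1 d1); congr (c (adet _)).
  by rewrite /K X0 exprSr -mulmxE -(mulmxA _ _ P) mulVmx// mulmx1.
- by move=> u _; have [s1 d1] := a2 u; rewrite -(unitize_arg s1 d1).
Qed.

Lemma argpath_periodic (Q : R -> Mx) : rcontinuous Q -> (forall r, symplectic (Q r)) ->
  (forall r, Q (clamp 0 s r) = Q r) -> exists e, argpath Q e.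
Proof.
move=> Qc sQ QE; have iQ : is_path 0 s Q.
  split=> [|t _]; last exact: sQ.
  by apply: continuous_within => t; apply/rcvgP; exact: Qc.
have [e he _] := argpath_exists (ltW s0) iQ; exists e.
by have <- : Q \o clamp 0 s = Q by apply/funext => r; exact: QE.
Qed.

Lemma X_clamp r : X (clamp 0 s r) = X r.
Proof. by rewrite /X clamp0 ?clamp_range. Qed.

Lemma power_symplectic j t : symplectic (invmx P ^+ j *m X t ^+ j).
Proof.
apply: symplecticM; last exact/symplecticX/X_symplectic.
exact/symplecticX/symplecticV.
Qed.

Lemma power_path j : exists e, argpath (fun t => invmx P ^+ j *m X t ^+ j) e.
Proof.
apply: argpath_periodic.
- apply: rcontinuousM; first exact: rcontinuous_cst.
  by apply: rcontinuousX; exact: X_continuous.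
- by move=> r; exact: power_symplectic.
- by move=> r; rewrite X_clamp.
Qed.

(** In [arg_step] the second edge runs through [gamma] between the times [j s] and [(j + 1) s], so
    the angle of the power accumulates that of [gamma] piece by piece. *)
Lemma power_angle j : (j <= m)%N ->
  exists2 e, argpath (fun t => invmx P ^+ j *m X t ^+ j) e & e s - e 0 = D (j%:R * s) - D 0.
Proof.
elim: j => [_|j IH jm].
  have [d hd] := arg_exists (symplectic1 R n); exists (fun=> d); last by rewrite mul0r !subrr.
  have E : (fun t : R => invmx P ^+ 0 *m X t ^+ 0) = fun=> 1%:M.
    by apply/funext => t; rewrite !expr0 mulmx1.
  rewrite E; split=> [||t]; [exact: rcontinuous_cst|by move=> t; exact: cvg_cst|].
  by split=> //; exact: symplectic1.
have [e0 he0 e0E] := IH (ltnW jm); have [e1 he1] := power_path j.+1; exists e1 => //.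
pose e2 t := D (clamp 0 s t + j%:R * s).
have GE t : invmx P ^+ j.+1 *m X t *m X s ^+ j = G (clamp 0 s t + j%:R * s).
  rewrite (flow_iter (clamp_range t) jm) Xs /X exprSr -mulmxE.
  by have [uP _] := sP; rewrite (mulmxA _ P) mulmxKV.
have he2 : argpath (fun t => invmx P ^+ j.+1 *m X t *m X s ^+ j) e2.
  split.
  - apply: rcontinuousM; last exact: rcontinuous_cst.
    by apply: rcontinuousM; [exact: rcontinuous_cst|exact: X_continuous].
  - move=> t; apply: (@continuous_comp _ _ _ (fun t => clamp 0 s t + j%:R * s) D); last exact: Dc.
    by apply: (@continuousD R R R (clamp 0 s) (fun=> j%:R * s)); [exact: clamp_continuous|exact: cvg_cst].
  - move=> t; rewrite GE; have h : 0 <= clamp 0 s t + j%:R * s <= tau.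
      have /andP[h1 h2] := clamp_range t; rewrite addr_ge0 ?mulr_ge0 ?(ltW s0)//=.
      apply: (@le_trans _ _ (s + j%:R * s)); first by rewrite lerD2r.
      by rewrite tauE -[X in X + _]mul1r -mulrDl ler_pM2r// nat1r ler_nat.
    by split; [exact: flow_symplectic|exact: GD].
rewrite (arg_step he0 he1 he2) e0E /e2 !clamp0 ?lexx ?(ltW s0)//.
have -> : s + j%:R * s = j.+1%:R * s by rewrite mulrSr; ring.
by rewrite add0r; ring.
Qed.

(** At [j = m] the factor [P^-m] is [1]. The power of [X] and the original flow thus have the same
    total angle, which makes the Bott formula for [X] a statement about the index of the flow. *)
Lemma flow_power : exists E Dm, [/\ pospath s X E, argpath (fun t => X t ^+ m) Dm &
  Dm s - Dm 0 = D tau - D 0].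
Proof.
have [E hE] := argpath_periodic X_continuous X_symplectic X_clamp.
have [e he eE] := power_angle (leqnn m); exists E, e; split.
- by split=> //; [exact: X_right|exact: X_left].
- move: he; congr argpath; apply/funext => t.
  have [uP _] := sP; have VP : GRing.comm P (invmx P).
    by rewrite /GRing.comm -!mulmxE mulVmx// mulmxV.
  have : P ^+ m *m invmx P ^+ m = 1%:M.
    by rewrite mulmxE -exprMn_comm// -mulmxE mulmxV// expr1n.
  by rewrite Pm mul1mx => ->; rewrite mul1mx.
- by rewrite eE tauE.
Qed.

End Arguments.

End Periodic.
End LinearFlow.

(** * The inequality at the roots of unity *)

Section Combinatorics.
Variable R : realType.

(** [Em], [Ep] stand for the gain just before and after the [j]-th root, [E0] for gain plus
    multiplicity at it, and [cm], [c0], [cp] for the eigenvalue count at these places. Away from [k]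
    increments are bounded by the count; at [k] the jumps [q] and [p] come in, offset by the two
    lower bounds on the gain there. *)
Lemma upper_half_sum (r k : nat) (n p q : R) (Em E0 Ep cm c0 cp : nat -> R) :
  (0 < k <= r)%N -> p + q = n -> c0 0%N = 0 -> cp r <= n ->
  (forall j, (j <= r)%N -> E0 j <= Ep j + (cp j - c0 j) + (if j == k then p else 0)) ->
  (forall j, (0 < j <= r)%N -> E0 j <= Em j + (c0 j - cm j) + (if j == k then q else 0)) ->
  (forall j, (j < r)%N -> Em j.+1 <= Ep j + (cm j.+1 - cp j)) ->
  (forall j, (j < r)%N -> cp j <= cm j.+1) ->
  (forall j, (0 < j <= r)%N -> 0 <= Em j /\ 0 <= Ep j) ->
  n - q <= Em k -> n - p <= Ep k ->
  - q <= 2 * Ep 0%N - E0 0%N + \sum_(1 <= j < r.+1) (2 * Ep j + 2 * Em j - 2 * E0 j).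
Proof.
move=> /andP[k0 kr] pq c00 cpr H1 H2 H3 H6 H4 Hq Hp.
pose T j := 2 * Ep 0%N - E0 0%N + \sum_(1 <= i < j.+1) (2 * Ep i + 2 * Em i - 2 * E0 i).
have T0 : T 0%N = 2 * Ep 0%N - E0 0%N by rewrite /T big_geq// addr0.
have TS j : T j.+1 = T j + (2 * Ep j.+1 + 2 * Em j.+1 - 2 * E0 j.+1).
  by rewrite /T big_nat_recr//= addrA.
(* The invariant of the partial sums: before [k] the current gain is retained up to the count so
   far; the two bounds at [k] replace it by the constant [n - q]. *)
suff H j : (j <= r)%N -> (if (j < k)%N then Ep j - cp j else n - q - cp j) <= T j.
  by have := H r (leqnn r); rewrite ltnNge kr /= -/(T r); lra.
elim: j => [_|j IH jr].
  have := H1 0%N (leq0n _); rewrite eq_sym (gtn_eqF k0) k0 T0 c00; lra.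
have {}IH := IH (ltnW jr).
have h1 := H1 _ jr; have h2 := H2 j.+1 jr; have h3 := H3 j jr; have h6 := H6 j jr; have [h4 h5] := H4 j.+1 jr.
rewrite TS; case: (ltngtP j.+1 k) => jk.
- move: IH; rewrite (ltn_trans (ltnSn j) jk) => IH.
  by move: h1 h2; rewrite (ltn_eqF jk); lra.
- move: IH; rewrite ltnNge -ltnS jk /= => IH.
  by move: h1 h2; rewrite (gtn_eqF jk); lra.
- move: IH; rewrite -jk ltnSn => IH.
  by move: h1 h2; rewrite jk eqxx -jk => h1 h2; move: Hq Hp; rewrite -jk; lra.
Qed.

(** The roots of an odd order: [1] alone, and the others in pairs [j], [m - j] of conjugates with
    [j] in the upper half. *)
Lemma fold_sum r (h : nat -> R) :
  \sum_(0 <= j < r.*2.+1) h j = h 0%N + \sum_(1 <= j < r.+1) (h j + h (r.*2.+1 - j)%N).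
Proof.
rewrite big_ltn// (@big_cat_nat _ _ _ r.+1)//=; last by lia.
congr (_ + _); rewrite big_split /=; congr (_ + _).
rewrite [RHS]big_nat_rev /= -{1}[r.+1]add1n big_addn.
have -> : (r.*2.+1 - r = r.+1)%N by lia.
by apply: eq_big_nat => i /andP[i1 ir]; congr h; lia.
Qed.

End Combinatorics.

Section Perturbation.
Variables (R : realType) (n : nat).
Local Notation Mx := 'M[R]_(n + n).
Local Notation th x M := (theta (expi x) M).
Local Notation nu x M := ((nuz (expi x) M)%:R : R).

(** The abstract properties of an eigenvalue count along the upper half circle; this is all that the
    summation uses. *)
Definition spread (c : R -> R) := [/\ forall x y, x <= y -> c x <= c y, c 0 = 0 & c pi <= n%:R].

Lemma ratio_arith (a b c d k u v : R) : `|a - b| <= 2 * pi * (c - d) ->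
  a = u + k -> b = v + k -> `|u - v| <= 2 * pi * (c - d).
Proof. by move=> h ha hb; move: h; rewrite ha hb opprD addrACA subrr addr0. Qed.

(** A small positive rotation makes [M] nondegenerate at all points of the finite list, where
    [variation] applies. The angle [2 n d] added by the rotation is the same at every point and
    drops out. *)
Lemma perturb_right (xs : seq R) (M : Mx) : symplectic M ->
  exists2 c, spread c & forall x y, x \in xs -> y \in xs -> 0 <= x -> x <= y -> y <= pi ->
    `|(th y M - 2 * pi * nu y M) - (th x M - 2 * pi * nu x M)| <= 2 * pi * (c y - c x).
Proof.
move=> sM; have FF : Filter ((0 : R)^'+) by typeclasses eauto.
have PF : ProperFilter ((0 : R)^'+) by typeclasses eauto.
have [d dP] : exists d, forall z, z \in map (@expi R) xs -> nuz z (M *m rotJ n d) = 0%N /\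
    theta z (M *m rotJ n d) = theta z M + 2 * (n%:R * d) - 2 * pi * (nuz z M)%:R.
  have h := @near_all R _ FF (fun z d => nuz z (M *m rotJ n d) = 0%N /\
    theta z (M *m rotJ n d) = theta z M + 2 * (n%:R * d) - 2 * pi * (nuz z M)%:R) (map (@expi R) xs).
  have [|d hd] := @filter_ex _ _ PF _ (h _); last by exists d.
  by move=> z /mapP[x _ ->]; apply: rotJ_right => //; exact: nsq_expi.
have sM' : symplectic (M *m rotJ n d) by apply: symplecticM => //; exact: symplectic_rotJ.
have [c [c1 c2 c3 c4]] := variation sM'; exists c => // x y xx yx x0 xy ypi.
have [nx tx] := dP _ (map_f _ xx); have [ny ty] := dP _ (map_f _ yx).
have := c4 x y x0 xy ypi nx ny.
by move=> H; apply: (ratio_arith (k := 2 * (n%:R * d)) H); rewrite ?tx ?ty addrAC.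
Qed.

(** The same with a backward rotation, which involves no multiplicities. Comparing both versions
    bounds the jumps of [theta] from both sides. *)
Lemma perturb_left (xs : seq R) (M : Mx) : symplectic M ->
  exists2 c, spread c & forall x y, x \in xs -> y \in xs -> 0 <= x -> x <= y -> y <= pi ->
    `|th y M - th x M| <= 2 * pi * (c y - c x).
Proof.
move=> sM; have FF : Filter ((0 : R)^'+) by typeclasses eauto.
have PF : ProperFilter ((0 : R)^'+) by typeclasses eauto.
have [d dP] : exists d, forall z, z \in map (@expi R) xs -> nuz z (M *m rotJ n (- d)) = 0%N /\
    theta z (M *m rotJ n (- d)) = theta z M - 2 * (n%:R * d).
  have h := @near_all R _ FF (fun z d => nuz z (M *m rotJ n (- d)) = 0%N /\
    theta z (M *m rotJ n (- d)) = theta z M - 2 * (n%:R * d)) (map (@expi R) xs).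
  have [|d hd] := @filter_ex _ _ PF _ (h _); last by exists d.
  by move=> z /mapP[x _ ->]; apply: rotJ_left => //; exact: nsq_expi.
have sM' : symplectic (M *m rotJ n (- d)) by apply: symplecticM => //; exact: symplectic_rotJ.
have [c [c1 c2 c3 c4]] := variation sM'; exists c => // x y xx yx x0 xy ypi.
have [nx tx] := dP _ (map_f _ xx); have [ny ty] := dP _ (map_f _ yx).
have := c4 x y x0 xy ypi nx ny.
by move=> H; apply: (ratio_arith (k := - (2 * (n%:R * d))) H).
Qed.

Lemma jump_bound (a b p c d : R) : `|a - b| <= 2 * pi * (c - d) -> a - b = 2 * pi * p -> `|p| <= c - d.
Proof.
move=> h E; have p0 : 0 < 2 * pi :> R by rewrite mulr_gt0// pi_gt0.
by move: h; rewrite E normrM (gtr0_norm p0) ler_pM2l.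
Qed.

Section Split.
Variables (P : Mx) (x e : R) (p q : nat).
Hypotheses (sP : symplectic P) (e0 : 0 < e) (xe0 : 0 <= x - e).
Hypotheses (nq : nuz (expi (x - e)) P = 0%N) (tq : th (x - e) P = th x P - 2 * pi * q%:R).

Lemma split_left_bound : x <= pi -> ((q <= n) /\ (nuz (expi x) P <= q + n))%N.
Proof.
move=> xpi; have xx : x - e <= x by rewrite gerBl ltW.
pose xs := [:: x - e; x]; have i1 : x - e \in xs by rewrite !inE eqxx.
have i2 : x \in xs by rewrite !inE eqxx orbT.
have bound (c : R -> R) : spread c -> c x - c (x - e) <= n%:R.
  by case=> c1 c2 c3; have := c1 _ _ xpi; have := c1 _ _ xe0; lra.
split.
  have [c sc h] := perturb_left xs sP.
  have := @jump_bound _ _ q%:R _ _ (h _ _ i1 i2 xe0 xx xpi); rewrite tq => /(_ ltac:(ring)).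
  by move=> H; have := le_trans H (bound c sc); rewrite normr_nat ler_nat.
have [c sc h] := perturb_right xs sP.
have := @jump_bound _ _ (q%:R - nu x P) _ _ (h _ _ i1 i2 xe0 xx xpi); rewrite tq nq mulr0 subr0.
move=> /(_ ltac:(ring)) H; have := le_trans H (bound c sc).
by rewrite ler_norml -(ler_nat R) natrD => /andP[]; lra.
Qed.

Hypotheses (xepi : x + e <= pi).
Hypotheses (np : nuz (expi (x + e)) P = 0%N) (tp : th (x + e) P = th x P - 2 * pi * p%:R).

(** The total variation of [theta] across [x] is at most [n] in units of [2 pi]. The backward
    perturbation sees the jumps [q] and [p], the forward one sees [nu - q] and [nu - p]. *)
Lemma split_bounds : ((p + q <= n) /\ (nuz (expi x) P * 2 <= n + (p + q)))%N.
Proof.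
have xx : x - e <= x by rewrite gerBl ltW.
have xx' : x <= x + e by rewrite lerDl ltW.
have x0 := le_trans xe0 xx; have xpi := le_trans xx' xepi.
pose xs := [:: x - e; x; x + e]; have i1 : x - e \in xs by rewrite !inE eqxx.
have i2 : x \in xs by rewrite !inE eqxx orbT.
have i3 : x + e \in xs by rewrite !inE eqxx !orbT.
have bound (c : R -> R) : spread c -> (c x - c (x - e)) + (c (x + e) - c x) <= n%:R.
  by case=> c1 c2 c3; have := c1 _ _ xepi; have := c1 _ _ xe0; lra.
split.
  have [c sc h] := perturb_left xs sP.
  have := @jump_bound _ _ q%:R _ _ (h _ _ i1 i2 xe0 xx xpi); rewrite tq => /(_ ltac:(ring)) H1.
  have := @jump_bound _ _ (- p%:R) _ _ (h _ _ i2 i3 x0 xx' xepi); rewrite tp => /(_ ltac:(ring)) H2.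
  have := bound c sc; rewrite -(ler_nat R) natrD; move: H1 H2; rewrite normrN !normr_nat; lra.
have [c sc h] := perturb_right xs sP.
have := @jump_bound _ _ (q%:R - nu x P) _ _ (h _ _ i1 i2 xe0 xx xpi); rewrite tq nq mulr0 subr0.
move=> /(_ ltac:(ring)) H1.
have := @jump_bound _ _ (nu x P - p%:R) _ _ (h _ _ i2 i3 x0 xx' xepi); rewrite tp np mulr0 subr0.
move=> /(_ ltac:(ring)) H2.
have := bound c sc; move: H1 H2; rewrite !ler_norml => /andP[H1 _] /andP[_ H2].
by rewrite -(ler_nat R) natrM !natrD; lra.
Qed.

End Split.

Lemma theta_const_interval (P : Mx) a b : symplectic P -> a <= b ->
  (forall x : R, a <= x <= b -> nuz (expi x) P = 0%N) -> th a P = th b P.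
Proof.
move=> sP ab H; have loc (t : R) : a <= t <= b -> \forall y \near t, th y P = th t P.
  move=> /H h; have := theta_expi_local sP t; apply: filterS => y [k]; rewrite h leqn0 => /eqP ->.
  by rewrite mulr0 subr0.
apply/eqP; rewrite eq_le; apply/andP; split.
  apply: (locally_mono (f := fun y => th y P) ab) => t /loc; apply: filterS => u -> _.
  by rewrite lexx.
rewrite -lerN2; apply: (locally_mono (f := fun y => - th y P) ab) => t /loc; apply: filterS => u -> _.
by rewrite lexx.
Qed.

End Perturbation.

Section RootAngles.
Variables (R : realType) (m : nat).
Hypothesis m0 : (0 < m)%N.

Definition root_angle (j : nat) : R := (2 * j)%:R * pi / m%:R.
Local Notation ph := root_angle.

Lemma mR0 : 0 < m%:R :> R. Proof. by rewrite ltr0n. Qed.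

Lemma root_angleD i j : ph (i + j) = ph i + ph j.
Proof. by rewrite /ph mulnDr natrD mulrDl mulrDl. Qed.

Lemma root_angle_ge0 j : 0 <= ph j.
Proof. by rewrite /ph divr_ge0 ?mulr_ge0 ?pi_ge0. Qed.

Lemma root_angleM j : m%:R * ph j = j%:R * (2 * pi).
Proof. by rewrite /ph mulrC divfK ?gt_eqF ?mR0// natrM; ring. Qed.

Lemma root_angle_m : ph m = 2 * pi.
Proof. by apply: (mulfI (x := m%:R)); [rewrite gt_eqF ?mR0|rewrite root_angleM]. Qed.

Lemma root_angle0 : ph 0%N = 0.
Proof. by rewrite /ph muln0 !mul0r. Qed.

Lemma root_angle_lt i j : (i < j)%N -> ph i < ph j.
Proof. by move=> ij; rewrite /ph ltr_pM2r ?invr_gt0 ?mR0// ltr_pM2r ?pi_gt0// ltr_nat; lia. Qed.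

Lemma root_angle_half j : (j <= m./2)%N -> ph j <= pi.
Proof.
move=> jm; rewrite /ph ler_pdivrMr ?mR0// mulrC ler_pM2l ?pi_gt0// ler_nat.
by have := odd_double_half m; lia.
Qed.

Lemma root_angle1 : ph 1%N = 2 * (pi / m%:R).
Proof. by rewrite /ph muln1 mulrA. Qed.

Lemma root_angle_sep i j : (i < j)%N -> ph i + 2 * (pi / m%:R) <= ph j.
Proof.
rewrite -root_angle1 -root_angleD addn1 leq_eqVlt => /predU1P[->//|h].
by apply: ltW; exact: root_angle_lt.
Qed.

Lemma root_angle_odd : odd m -> ph m./2 + pi / m%:R = pi.
Proof.
move=> om; apply: (mulfI (x := m%:R)); first by rewrite gt_eqF ?mR0.
have -> : m%:R * (ph m./2 + pi / m%:R) = (m./2)%:R * (2 * pi) + pi.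
  by rewrite mulrDr root_angleM; congr (_ + _); rewrite mulrC divfK// gt_eqF ?mR0.
have mE : m%:R = 1 + 2 * (m./2)%:R :> R by rewrite -{1}(odd_double_half m) om natrD -muln2 natrM mulrC.
by rewrite mE; ring.
Qed.

Lemma expi_root j (e : R) : expi (ph j + e) ^+ m = expi (m%:R * e).
Proof.
rewrite -expi_natM mulrDr root_angleM addrC.
exact: (expiDint (m%:R * e) j%:Z).
Qed.

Lemma expi_inj (x y : R) : 0 <= x < 2 * pi -> 0 <= y < 2 * pi -> expi x = expi y -> x = y.
Proof.
wlog xy : x y / x <= y => [H|].
  case: (leP x y) => [|/ltW] xy hx hy E; first exact: H.
  by apply/esym; apply: H.
move=> /andP[x0 _] /andP[_ y2] E; have : y - x = 0.
  apply: expi_eq1_small; last by rewrite expiD expiN -E mulfV// expi_neq0.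
  by rewrite subr_ge0 xy/=; lra.
by lra.
Qed.

Definition roots (e : R) := [seq expi (ph j + e) | j <- iota 0 m].

Lemma roots_uniq e : uniq (roots e).
Proof.
rewrite map_inj_in_uniq ?iota_uniq// => i j; rewrite !mem_iota /= add0n => im jm.
rewrite !expiD => /(mulIf (expi_neq0 e)) E.
have b l : (l < m)%N -> 0 <= ph l < 2 * pi.
  by move=> lm; rewrite root_angle_ge0 -root_angle_m root_angle_lt.
have Ep := expi_inj (b i im) (b j jm) E.
case: (ltngtP i j) => // h; have := root_angle_lt h; by rewrite Ep ltxx.
Qed.

Lemma roots_size e : size (roots e) = m.
Proof. by rewrite size_map size_iota. Qed.

Lemma rootsP e a : a \in roots e -> nsq a = 1 /\ a ^+ m = expi (m%:R * e).
Proof. by case/mapP => j _ ->; rewrite nsq_expi expi_root. Qed.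

Lemma expi_rootN j (e : R) : (j <= m)%N -> expi (ph (m - j) + e) = (expi (ph j - e))^*%C.
Proof.
move=> jm; rewrite expiJ; have : ph (m - j) = 2 * pi - ph j.
  by have := root_angleD j (m - j); rewrite subnKC// root_angle_m; lra.
move=> ->; have -> : 2 * pi - ph j + e = - (ph j - e) + 1%:~R * (2 * pi) by rewrite mulr1z; ring.
exact: expiDint.
Qed.

End RootAngles.

Lemma gain_difference (R : realType) (a b x y : R) : (2 * a - x) - (2 * b - y) = 2 * (a - b) - x + y.
Proof. by ring. Qed.

Lemma right_limit_arith (R : realType) (a b t u v : R) :
  2 * a - (t - u) - (2 * b - v * (1 + false%:R)) = 2 * a - t - (2 * b - v * (1 + true%:R)) + u - v.
Proof. by rewrite /=; ring. Qed.

Lemma normalize_arith (R : realType) (a S n : R) :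
  (a + 2 * pi * S - 2 * pi * n) / (2 * pi) = a / (2 * pi) + S - n.
Proof. have p0 : pi != 0 :> R by rewrite gt_eqF// pi_gt0. by move: (pi : R) p0 => x x0; field. Qed.

Lemma total_arith (R : realType) m (x y z : nat -> R) (a S c : R) n :
  a = \sum_(0 <= j < m) y j -> a + S - n%:R = \sum_(0 <= j < m) x j -> c = \sum_(0 <= j < m) z j ->
  a + 2 * S - c = (2 * n)%:R + \sum_(0 <= j < m) (2 * x j - (y j + z j)).
Proof. by rewrite sumrB big_split /= -mulr_sumr => <- <- <-; rewrite natrM; ring. Qed.

Lemma deviation_arith (R : realType) (d t u v t' u' v' : R) :
  ((d - t' + u') / (2 * pi) + v' - u' / (2 * pi)) - ((d - t + u) / (2 * pi) + v - u / (2 * pi)) =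
  (2 * pi)^-1 * - ((t' - 2 * pi * v') - (t - 2 * pi * v)).
Proof. have p0 : pi != 0 :> R by rewrite gt_eqF// pi_gt0. by move: (pi : R) p0 => x x0; field. Qed.

Lemma rise_arith (R : realType) (gx gy v Fx Fy d p : R) :
  `|(gy + 0 - Fy) - (gx + v - Fx)| <= d -> Fy = Fx - p -> gx + v <= gy + d + p.
Proof. by move=> h E; move: h; rewrite E ler_norml => /andP[]; lra. Qed.

Lemma fall_arith (R : realType) (gx gy v Fx Fy d q : R) :
  `|(gy + v - Fy) - (gx + 0 - Fx)| <= d -> Fx = Fy - q -> gy + v <= gx + d + q.
Proof. by move=> h E; move: h; rewrite E ler_norml => /andP[]; lra. Qed.

Lemma flat_arith (R : realType) (gx gy Fx Fy d : R) :
  `|(gy + 0 - Fy) - (gx + 0 - Fx)| <= d -> Fx = Fy -> gy <= gx + d.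
Proof. by move=> h E; move: h; rewrite E ler_norml => /andP[]; lra. Qed.

Lemma deviation_bound (R : realType) (g g' d t u v t' u' v' c : R) :
  g = (d - t + u) / (2 * pi) -> g' = (d - t' + u') / (2 * pi) ->
  `|(t' - 2 * pi * v') - (t - 2 * pi * v)| <= 2 * pi * c ->
  `|(g' + v' - u' / (2 * pi)) - (g + v - u / (2 * pi))| <= c.
Proof.
have p0 : 0 < 2 * pi :> R by rewrite mulr_gt0// pi_gt0.
move=> -> ->; rewrite deviation_arith normrM normrN gtr0_norm ?invr_gt0// ler_pdivrMl//.
Qed.

Lemma double_arith (R : realType) (a b d : R) : 2 * a + 2 * b - 2 * d = 2 * a - d + (2 * b - d).
Proof. by ring. Qed.

Lemma lower_shift (R : realType) (a b d q : R) : a = b + d -> - q <= d -> b - q <= a.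
Proof. by move=> ->; rewrite lerD2l. Qed.

Lemma lower_shift0 (R : realType) (a b d : R) : a = b + d -> 0 <= d -> b <= a.
Proof. by move=> ->; rewrite lerDl. Qed.

Lemma jump_ratio (R : realType) (a b q : R) : a = b - 2 * pi * q -> a / (2 * pi) = b / (2 * pi) - q.
Proof. move=> ->; have p0 : pi != 0 :> R by rewrite gt_eqF// pi_gt0. by move: (pi : R) p0 => x x0; field. Qed.

Lemma symmetric_sum (r k : nat) (h : nat -> nat) : (0 < k <= r)%N -> h 0%N = 0%N ->
  (forall j, (j <= r.*2.+1)%N -> h (r.*2.+1 - j)%N = h j) ->
  (forall j, (0 < j <= r)%N -> j != k -> h j = 0%N) ->
  (\sum_(0 <= j < r.*2.+1) h j = h k + h k)%N.
Proof.
move=> kr h0 hm hz; rewrite big_ltn// (@big_cat_nat _ _ _ r.+1)//=; last by lia.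
have half (F : nat -> nat) : (forall j, (0 < j <= r)%N -> F j = h j) ->
    (\sum_(1 <= j < r.+1) F j = h k)%N.
  move=> Fh; rewrite (bigD1_seq k) ?iota_uniq ?mem_index_iota//= Fh//.
  rewrite big_seq_cond big1 ?addn0// => j; rewrite mem_index_iota => /andP[jr jk].
  by rewrite Fh ?hz//; lia.
rewrite h0 (half h)// add0n; congr (_ + _)%N.
rewrite -{1}[r.+1]add1n big_addn; have -> : (r.*2.+1 - r = r.+1)%N by lia.
rewrite big_nat_rev /= half// => j jr; rewrite -hm; last by lia.
by congr h; lia.
Qed.

Lemma nsq1 (R : realType) : nsq (1 : R[i]) = 1.
Proof. by rewrite -(expi0 R) nsq_expi. Qed.

Lemma nuz_one (R : realType) n : nuz 1 (1%:M : 'M[R]_(n + n)) = (n + n)%N.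
Proof.
rewrite -[nuz _ _]/(\rank (kermx (cmx 1%:M - 1%:M))) cmx_scalar subrr.
by rewrite mxrank_ker mxrank0 subn0.
Qed.

Section UpperHalf.
Variables (R : realType) (n m k p q : nat) (eps : R) (g nu F : R -> R).
Local Notation ph := (root_angle R m).
Hypotheses (m0 : (0 < m)%N) (k0 : (0 < k <= m./2)%N) (e0 : 0 < eps) (epi : eps < pi / m%:R).
Hypothesis Hvar : forall xs : seq R, exists2 c, spread n c & forall x y, x \in xs -> y \in xs ->
  0 <= x -> x <= y -> y <= pi -> `|(g y + nu y - F y) - (g x + nu x - F x)| <= c y - c x.
Hypothesis F_const : forall a b : R, 0 <= a -> a <= b -> b <= pi -> b < ph k \/ ph k < a -> F a = F b.
Hypotheses (Fp : F (ph k + eps) = F (ph k) - p%:R) (Fq : F (ph k - eps) = F (ph k) - q%:R).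
Hypothesis nu_right : forall j, (j < m)%N -> nu (ph j + eps) = 0.
Hypothesis nu_left : forall j, (0 < j <= m)%N -> nu (ph j - eps) = 0.
Hypothesis g_ge0 : forall x, 0 <= g x.
Hypothesis mirror : forall j, (j <= m)%N -> g (ph (m - j) + eps) = g (ph j - eps) /\
  g (ph (m - j)) + nu (ph (m - j)) = g (ph j) + nu (ph j).

Lemma F_near j : (j <= m./2)%N -> j != k -> ph j + eps < ph k \/ ph k < ph j - eps.
Proof.
move=> jr jk; have d0 := divr_gt0 (pi_gt0 R) (mR0 R m0).
case: (ltngtP j k) jk => // l _; have h := root_angle_sep R m0 l; [left|right]; move: epi h d0; lra.
Qed.

(** [g], [nu] and [F] stand for the normalized gain, the multiplicity for [X s] and [theta] of [P]
    over [2 pi]. [F] is constant except at the angle of [k], where its jumps supply [p] and [q]. *)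
Lemma sum_odd : odd m -> (p + q)%N = n -> n%:R - p%:R <= g (ph k + eps) -> n%:R - q%:R <= g (ph k - eps) ->
  - q%:R <= \sum_(0 <= j < m) (2 * g (ph j + eps) - (g (ph j) + nu (ph j))).
Proof.
move=> om pq gp gq; pose r := m./2; have mE : m = r.*2.+1 by rewrite -{1}(odd_double_half m) om.
(* All points of evaluation are listed at once, so that a single count [c], of total at most [n],
   serves the whole half circle. *)
pose xs := [seq ph j | j <- iota 0 r.+1] ++ [seq ph j + eps | j <- iota 0 r.+1]
  ++ [seq ph j - eps | j <- iota 0 r.+1].
have i1 j : (j <= r)%N -> ph j \in xs.
  by move=> jr; rewrite !mem_cat map_f// mem_iota.
have i2 j : (j <= r)%N -> ph j + eps \in xs.
  by move=> jr; rewrite !mem_cat (map_f (fun j => ph j + eps)) ?orbT// mem_iota.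
have i3 j : (j <= r)%N -> ph j - eps \in xs.
  by move=> jr; rewrite !mem_cat (map_f (fun j => ph j - eps)) ?orbT// mem_iota.
have [c [c1 c2 c3] var] := Hvar xs.
have d0 := divr_gt0 (pi_gt0 R) (mR0 R m0).
have bp j : (j <= r)%N -> ph j + eps <= pi.
  move=> jr; have := root_angle_odd R m0 om; rewrite -/r.
  have : ph j <= ph r by move: jr; rewrite leq_eqVlt => /predU1P[->//|/(root_angle_lt R m0)/ltW].
  by move: epi; lra.
have bm j : (0 < j)%N -> 0 <= ph j - eps.
  by move=> /(root_angle_sep R m0); rewrite root_angle0; move: epi; lra.
have b0 j := root_angle_ge0 R m j.
have bj j : (j <= r)%N -> ph j <= pi by move=> /bp; move: e0; lra.
have gap j : ph j + eps <= ph j.+1 - eps.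
  by have := root_angle_sep R m0 (ltnSn j); move: epi; lra.
have bpe j : 0 <= ph j + eps by rewrite addr_ge0// ltW.
have inc j : ph j <= ph j + eps by rewrite lerDl ltW.
have dec j : ph j - eps <= ph j by rewrite gerBl ltW.
have lt_m j : (j <= r)%N -> (j < m)%N by rewrite mE; lia.
have kr := k0; have k0r : (k <= r)%N by case/andP: kr.
have nuP j : (j <= r)%N -> nu (ph j + eps) = 0 by move=> /lt_m /nu_right.
have nuM j : (0 < j <= r)%N -> nu (ph j - eps) = 0.
  by case/andP=> j0 /lt_m jm; apply: nu_left; rewrite j0 ltnW.
have H1 j : (j <= r)%N -> g (ph j) + nu (ph j) <=
    g (ph j + eps) + (c (ph j + eps) - c (ph j)) + (if j == k then p%:R else 0).
  move=> jr; have := var _ _ (i1 j jr) (i2 j jr) (b0 j) (inc j) (bp j jr).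
  rewrite (nuP j jr) => /rise_arith; apply.
  case: eqVneq => [->//|jk]; rewrite subr0; apply/esym; apply: (F_const (b0 j) (inc j) (bp j jr)).
  by case: (F_near jr jk) => h; [left|right; apply: lt_le_trans h (dec j)].
have H2 j : (0 < j <= r)%N -> g (ph j) + nu (ph j) <=
    g (ph j - eps) + (c (ph j) - c (ph j - eps)) + (if j == k then q%:R else 0).
  move=> /[dup] jj /andP[j0 jr]; have := var _ _ (i3 j jr) (i1 j jr) (bm j j0) (dec j) (bj j jr).
  rewrite (nuM j jj) => /fall_arith; apply.
  case: eqVneq => [->//|jk]; rewrite subr0; apply: (F_const (bm j j0) (dec j) (bj j jr)).
  by case: (F_near jr jk) => h; [left; apply: le_lt_trans (inc j) h|right].
have H3 j : (j < r)%N -> g (ph j.+1 - eps) <= g (ph j + eps) + (c (ph j.+1 - eps) - c (ph j + eps)).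
  move=> jr; have bl : ph j.+1 - eps <= pi by apply: le_trans (dec _) (bj _ jr).
  have := var _ _ (i2 j (ltnW jr)) (i3 j.+1 jr) (bpe j) (gap j) bl.
  rewrite (nuP j (ltnW jr)) (nuM j.+1 jr) => /flat_arith; apply; apply: (F_const (bpe j) (gap j) bl).
  have [kj|jk] := leqP k j; [right|left].
    apply: le_lt_trans (_ : ph k <= ph j) _; last by rewrite ltrDl.
    by move: kj; rewrite leq_eqVlt => /predU1P[->//|/(root_angle_lt R m0)/ltW].
  apply: lt_le_trans (_ : _ < ph j.+1) _; first by rewrite gtrBl.
  by move: jk; rewrite leq_eqVlt => /predU1P[->//|/(root_angle_lt R m0)/ltW].
have c0' : c (ph 0) = 0 by rewrite root_angle0.
have cr : c (ph r + eps) <= n%:R by apply: le_trans (c1 _ _ (bp r (leqnn r))) c3.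
have pq' : p%:R + q%:R = n%:R :> R by rewrite -natrD pq.
have := upper_half_sum kr pq' c0' cr H1 H2 H3 (fun j _ => c1 _ _ (gap j))
  (fun j _ => conj (g_ge0 (ph j - eps)) (g_ge0 (ph j + eps))).
move=> /(_ gq gp) H.
have fold := @fold_sum R r (fun j => 2 * g (ph j + eps) - (g (ph j) + nu (ph j))).
rewrite -mE in fold; rewrite fold.
apply: le_trans H _; rewrite lerD2l le_eqVlt; apply/orP; left; apply/eqP.
apply: eq_big_nat => j /andP[j0 jr]; have [E1 E2] := @mirror j (ltnW (lt_m j jr)).
by rewrite E1 E2; exact: double_arith.
Qed.

(** The eigenvalue of [P] is [-1], at the end of the half circle. The points just before and just
    after it are conjugate and have the same gain, at least [n] here, which pays for the count and
    the jump. *)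
Lemma sum_two : m = 2%N -> q = n -> 2 * n%:R - q%:R <= g (ph k - eps) ->
  0 <= \sum_(0 <= j < m) (2 * g (ph j + eps) - (g (ph j) + nu (ph j))).
Proof.
move=> m2 qn gq; have k1 : k = 1%N by move: k0; rewrite m2 /=; lia.
have d0 := divr_gt0 (pi_gt0 R) (mR0 R m0).
have p1 : ph 1%N = pi by rewrite root_angle1 m2 mulrC divfK ?pnatr_eq0.
have p0 := root_angle0 R m.
have e2 : eps < pi - eps by have := root_angle1 R m; rewrite p1; move: epi; lra.
pose xs := [:: 0; eps; pi - eps; pi].
have [c [c1 c2 c3] var] := Hvar xs.
have nuP : nu eps = 0 by have := nu_right m0; rewrite p0 add0r.
have nuM : nu (pi - eps) = 0 by have := @nu_left 1%N; rewrite p1; apply; rewrite m2.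
have pi0 := pi_ge0 R.
have pe : pi - eps <= pi by rewrite gerBl ltW.
have ep : eps <= pi by apply: le_trans (ltW e2) pe.
have pe0 : 0 <= pi - eps by rewrite subr_ge0.
have h1 : g 0 + nu 0 <= g eps + (c eps - c 0) + 0.
  have := var 0 eps; rewrite !inE !eqxx ?orbT => /(_ isT isT (lexx _) (ltW e0) ep).
  rewrite nuP => /rise_arith; apply; rewrite subr0; apply/esym; apply: F_const => //; first exact: ltW.
  by left; rewrite k1 p1; apply: lt_le_trans e2 pe.
have h2 : g pi + nu pi <= g (pi - eps) + (c pi - c (pi - eps)) + q%:R.
  have := var (pi - eps) pi; rewrite !inE !eqxx ?orbT => /(_ isT isT pe0 pe (lexx _)).
  by rewrite nuM => /fall_arith; apply; move: Fq; rewrite k1 p1.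
have h3 : g (pi - eps) <= g eps + (c (pi - eps) - c eps).
  have := var eps (pi - eps); rewrite !inE !eqxx ?orbT => /(_ isT isT (ltW e0) (ltW e2) pe).
  rewrite nuP nuM => /flat_arith; apply; apply: F_const => //; [exact: ltW|exact: ltW|].
  by left; rewrite k1 p1 gtrBl.
have m11 : (m - 1 = 1)%N by rewrite m2.
have [E1 _] := @mirror 1%N m0; rewrite m11 p1 in E1.
rewrite {1}m2 !big_nat_recl// big_geq// p0 p1 E1 add0r addr0.
have qn' : q%:R = n%:R :> R by rewrite qn.
move: gq; rewrite k1 p1 => gq; have := g_ge0 (pi - eps); move: c2 c3 h1 h2 h3 gq qn'; lra.
Qed.

End UpperHalf.

Section FiniteOrder.
Variables (R : realType) (n m k : nat) (P : 'M[R]_(n + n)).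
Hypotheses (m0 : (0 < m)%N) (k0 : (0 < k <= m./2)%N) (Pm : P ^+ m = 1).
Hypothesis spec : spectrum P = [set omega R m k; ((omega R m k)^*)%C].
Local Notation ph := (root_angle R m).

Lemma nuz_eq0 z : (nuz z P == 0%N) = ~~ eigenvalue (cmx P) z.
Proof. by rewrite /eigenvalue negbK /eigenspace mxrank_eq0. Qed.

Lemma spectrum_nuz z : spectrum P z <-> nuz z P <> 0%N.
Proof.
rewrite /spectrum /=; split=> [h /eqP|/eqP]; first by rewrite nuz_eq0 h.
by rewrite nuz_eq0 negbK.
Qed.

Lemma k_angle : 0 < ph k <= pi.
Proof.
have /andP[k1 k2] := k0; rewrite (root_angle_half R m0 k2) andbT.
by rewrite -(root_angle0 R m); exact: root_angle_lt.
Qed.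

Lemma nuz_off (x : R) : 0 <= x <= pi -> x != ph k -> nuz (expi x) P = 0%N.
Proof.
move=> /andP[x0 xpi] xk; apply: contrapT => /spectrum_nuz; rewrite spec => h.
have /andP[k1 k2] := k_angle; have pi0 := pi_gt0 R.
have bx : 0 <= x < 2 * pi by apply/andP; split; lra.
have bk : 0 <= ph k < 2 * pi by apply/andP; split; lra.
case: h => E; first by move/eqP: xk; apply; exact: (expi_inj bx bk E).
have {}E : expi x = (expi (ph k))^*%C := E.
have E2 : expi x = expi (2 * pi - ph k).
  rewrite E expiJ.
  have -> : 2 * pi - ph k = - ph k + 1%:~R * (2 * pi) by rewrite mulr1z; ring.
  by rewrite expiDint.
have bk' : 0 <= 2 * pi - ph k < 2 * pi by apply/andP; split; lra.
have := expi_inj bx bk' E2 => E3; move/eqP: xk; apply; lra.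
Qed.

(** [P^m = 1] has the eigenvalue [1] with multiplicity [2n], which [nuz_pow] distributes over the
    [m]-th roots of unity. *)
Lemma nuz_sum : (\sum_(0 <= j < m) nuz (expi (ph j)) P)%N = (n + n)%N.
Proof.
have h := nuz_pow P (z := 1) (roots_uniq m0 (0 : R)) (roots_size m 0) m0.
have {}h : nuz 1 (P ^+ m) = (\sum_(a <- roots m (0 : R)) nuz a P)%N.
  by apply: h => a /(rootsP m0)[_]; rewrite mulr0 expi0.
move: h; rewrite Pm big_map /index_iota subn0 => h.
under eq_bigr => j _ do rewrite -[root_angle R m j]addr0.
rewrite -h; exact: nuz_one.
Qed.

Lemma nuz_0 : nuz (expi (ph 0)) P = 0%N.
Proof.
have /andP[h _] := k_angle; rewrite root_angle0; apply: nuz_off; last by rewrite lt_eqF.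
by rewrite lexx pi_ge0.
Qed.

Lemma nuz_k_two : m = 2%N -> nuz (expi (ph k)) P = (n + n)%N.
Proof.
move=> m2; have k1 : k = 1%N by move: k0; rewrite m2 /=; lia.
have := nuz_sum; rewrite [X in (\sum_(0 <= j < X) _)%N]m2 !big_nat_recl// big_geq// nuz_0.
by rewrite k1 addn0.
Qed.

(** The [2n] dimensions are shared equally by two distinct conjugate eigenvalues. *)
Lemma nuz_k_odd : odd m -> nuz (expi (ph k)) P = n.
Proof.
move=> om; have mE : m = m./2.*2.+1 by rewrite -{1}(odd_double_half m) om.
have hm j : (j <= m./2.*2.+1)%N -> nuz (expi (ph (m./2.*2.+1 - j))) P = nuz (expi (ph j)) P.
  rewrite -mE => jm; have := expi_rootN m0 (0 : R) jm.
  by rewrite addr0 subr0 => ->; rewrite nuz_conj.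
have hz j : (0 < j <= m./2)%N -> j != k -> nuz (expi (ph j)) P = 0%N.
  move=> /andP[j0 jr] jk; rewrite nuz_off//; first by rewrite root_angle_ge0 root_angle_half.
  by apply/eqP => E; case: (ltngtP j k) jk => // l _; have := root_angle_lt R m0 l; rewrite E ltxx.
have := symmetric_sum k0 nuz_0 hm hz; rewrite -mE nuz_sum.
by move: (nuz _ _) => x; lia.
Qed.

End FiniteOrder.

Section MainInequality.
Variables (R : realType) (n m k : nat) (P : 'M[R]_(n + n)) (s : R) (X : R -> 'M[R]_(n + n)) (E Dm : R -> R).
Hypotheses (s0 : 0 < s) (XD : pospath s X E) (XDm : argpath (fun t => X t ^+ m) Dm) (XP : X 0 = P).
Hypotheses (m0 : (0 < m)%N) (k0 : (0 < k <= m./2)%N) (Pm : P ^+ m = 1) (sP : symplectic P).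
Hypothesis spec : spectrum P = [set omega R m k; ((omega R m k)^*)%C].
Local Notation ph := (root_angle R m).
Local Notation M1 := (X s).
Local Notation M := (X s ^+ m).
Local Notation A := (gain s (fun t => X t ^+ m) Dm).
Local Notation g x := (gain s X E (expi x) / (2 * pi)).
Local Notation nu x := ((nuz (expi x) M1)%:R : R).

Lemma tpi_gt0 : 0 < 2 * pi :> R. Proof. by rewrite mulr_gt0// pi_gt0. Qed.

Lemma sX t : symplectic (X t). Proof. by case: XD => -[_ _ /(_ t)[]]. Qed.

Lemma gE x : g x = (2 * (E s - E 0) - theta (expi x) M1 + theta (expi x) P) / (2 * pi).
Proof. by rewrite /gain /phase XP gain_difference. Qed.

Lemma gainJ (z : R[i]) : nsq z = 1 -> gain s X E z^*%C = gain s X E z.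
Proof. by move=> z1; rewrite /gain /phase !theta_conj//; exact: sX. Qed.

Lemma g_ge0 x : 0 <= g x.
Proof.
rewrite divr_ge0// ?(ltW tpi_gt0)//; apply: le_trans (gain_ge s0 XD (nsq_expi x)).
by rewrite mulr_ge0// ltW// tpi_gt0.
Qed.

Lemma A_sum (e : R) : A (expi (m%:R * e)) / (2 * pi) = \sum_(0 <= j < m) g (ph j + e).
Proof.
rewrite (bott_gain s0 XD m0 (nsq_expi _) XDm (roots_uniq m0 e) (roots_size m e)); last first.
  by move=> a /(rootsP m0).
by rewrite big_map mulr_suml /index_iota subn0.
Qed.

Lemma nuz_power (e : R) : nuz (expi (m%:R * e)) M = (\sum_(0 <= j < m) nuz (expi (ph j + e)) M1)%N.
Proof.
rewrite (nuz_pow M1 (roots_uniq m0 e) (roots_size m e) m0).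
  by rewrite big_map /index_iota subn0.
by move=> a /(rootsP m0)[].
Qed.

Lemma angle0 : expi (m%:R * 0) = 1 :> R[i].
Proof. by rewrite mulr0 expi0. Qed.

Lemma A_sum0 : A 1 / (2 * pi) = \sum_(0 <= j < m) g (ph j).
Proof.
have h := A_sum 0; rewrite -angle0; apply: etrans h _.
by apply: eq_bigr => j _; rewrite -[in RHS](addr0 (ph j)).
Qed.

Lemma nuz_power0 : nuz 1 M = (\sum_(0 <= j < m) nuz (expi (ph j)) M1)%N.
Proof.
rewrite -angle0 nuz_power.
by apply: eq_bigr => j _; rewrite -[in RHS](addr0 (ph j)).
Qed.

Section Chosen.
Variables (eps : R) (S p q : nat).
Hypotheses (e0 : 0 < eps) (epi : eps < pi / m%:R).
Hypotheses (nM : nuz (expi (m%:R * eps)) M = 0%N)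
  (tM : theta (expi (m%:R * eps)) M = theta 1 M - 2 * pi * S%:R).
Hypotheses (tp : theta (expi (ph k + eps)) P = theta (expi (ph k)) P - 2 * pi * p%:R).
Hypotheses (tq : theta (expi (ph k - eps)) P = theta (expi (ph k)) P - 2 * pi * q%:R).
Local Notation nuk := ((nuz (expi (ph k)) P)%:R : R).
Hypotheses (gp : nuk - p%:R <= g (ph k + eps)) (gq : nuk - q%:R <= g (ph k - eps)).

Lemma meps : 0 < m%:R * eps < pi.
Proof. by rewrite mulr_gt0 ?mR0//= mulrC -ltr_pdivlMr ?mR0. Qed.

(** Two jumps between [1] and its right neighbour: that of the end matrix, which is [S], and that of
    the identity at the start, where [theta_1] loses [2 pi n]. *)
Lemma A_right : A (expi (m%:R * eps)) = A 1 + 2 * pi * S%:R - 2 * pi * n%:R.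
Proof.
have /andP[h1 h2] := meps; have n1 : expi (m%:R * eps) != 1.
  apply/eqP => /(expi_eq1_small _) h; have : m%:R * eps = 0 by apply: h; rewrite (ltW h1) /=; lra.
  by move: h1 => /[swap] ->; rewrite ltxx.
rewrite /gain /phase tM XP Pm !theta_1 ?nsq_expi ?nsq1// eqxx (negbTE n1).
exact: right_limit_arith.
Qed.

Opaque gain.

(** The Bott formula is used at [1] and just after it. Twice the second value minus the first,
    corrected by [A_right], is the left-hand side; the two losses of [n] become the summand [2n]. *)
Lemma total_sum : A 1 / (2 * pi) + 2 * S%:R - (nuz 1 M)%:R =
  (2 * n)%:R + \sum_(0 <= j < m) (2 * g (ph j + eps) - (g (ph j) + nu (ph j))).
Proof.
have a1 : A 1 / (2 * pi) = \sum_(0 <= j < m) g (ph j).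
  exact: A_sum0.
have a2 : A 1 / (2 * pi) + S%:R - n%:R = \sum_(0 <= j < m) g (ph j + eps).
  by rewrite -(A_sum eps) A_right normalize_arith.
have a3 : (nuz 1 M)%:R = \sum_(0 <= j < m) nu (ph j).
  by rewrite nuz_power0 natr_sum.
exact: (total_arith a1 a2 a3).
Qed.

Lemma nu_right j : (j < m)%N -> nuz (expi (ph j + eps)) M1 = 0%N.
Proof.
move=> jm; have := nM; rewrite nuz_power => /eqP; rewrite sum_nat_seq_eq0 => /allP/(_ j).
by rewrite mem_index_iota /= => /(_ jm)/eqP.
Qed.

Lemma nu_left j : (0 < j <= m)%N -> nuz (expi (ph j - eps)) M1 = 0%N.
Proof.
case/andP=> j0 jm; have := @nu_right (m - j) ltac:(lia).
by rewrite (expi_rootN m0 _ jm) nuz_conj.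
Qed.

Lemma mirror j : (j <= m)%N -> g (ph (m - j) + eps) = g (ph j - eps) /\
  g (ph (m - j)) + nu (ph (m - j)) = g (ph j) + nu (ph j).
Proof.
move=> jm; have E1 := expi_rootN m0 eps jm; have E2 : expi (ph (m - j)) = (expi (ph j))^*%C.
  by have := expi_rootN m0 (0 : R) jm; rewrite (addr0 (ph (m - j))) (subr0 (ph j)).
by rewrite E1 E2 !(gainJ (nsq_expi _)) nuz_conj.
Qed.

Lemma phase_variation (xs : seq R) : exists2 c, spread n c & forall x y, x \in xs -> y \in xs ->
  0 <= x -> x <= y -> y <= pi ->
  `|(g y + nu y - theta (expi y) P / (2 * pi)) - (g x + nu x - theta (expi x) P / (2 * pi))| <= c y - c x.
Proof.
have [c sc h] := perturb_right xs (sX s); exists c => // x y xx yx x0 xy ypi.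
exact: (deviation_bound (gE x) (gE y) (h x y xx yx x0 xy ypi)).
Qed.

Local Notation F x := (theta (expi x) P / (2 * pi)).

Lemma F_const (a b : R) : 0 <= a -> a <= b -> b <= pi -> b < ph k \/ ph k < a -> F a = F b.
Proof.
move=> a0 ab bpi h; suff Eab : theta (expi a) P = theta (expi b) P by exact: (congr1 (fun t : R => t / (2 * pi)) Eab).
apply: (theta_const_interval sP ab) => x /andP[ax xb].
apply: (nuz_off m0 k0 spec); first by rewrite (le_trans a0 ax) (le_trans xb bpi).
by case: h => h; [rewrite lt_eqF// (le_lt_trans xb h)|rewrite gt_eqF// (lt_le_trans h ax)].
Qed.

Lemma main_odd : odd m -> (p + q)%N = n -> nuz (expi (ph k)) P = n ->
  (2 * n)%:R - q%:R <= A 1 / (2 * pi) + 2 * S%:R - (nuz 1 M)%:R.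
Proof.
move=> om pq nuzk; apply: (lower_shift total_sum).
have gp' := gp; have gq' := gq; rewrite nuzk in gp' gq'.
have Hr j : (j < m)%N -> nu (ph j + eps) = 0 by move=> /nu_right ->.
have Hl j : (0 < j <= m)%N -> nu (ph j - eps) = 0 by move=> /nu_left ->.
exact (@sum_odd R n m k p q eps (fun x => g x) (fun x => nu x) (fun x => F x) m0 k0 e0 epi
  phase_variation F_const (jump_ratio tp) (jump_ratio tq) Hr Hl g_ge0 mirror om pq gp' gq').
Qed.

Lemma main_two : m = 2%N -> q = n -> nuz (expi (ph k)) P = (n + n)%N ->
  (2 * n)%:R <= A 1 / (2 * pi) + 2 * S%:R - (nuz 1 M)%:R.
Proof.
move=> m2 qn nuzk; apply: (lower_shift0 total_sum).
have gq' := gq; rewrite nuzk in gq'.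
have Hr j : (j < m)%N -> nu (ph j + eps) = 0 by move=> /nu_right ->.
have Hl j : (0 < j <= m)%N -> nu (ph j - eps) = 0 by move=> /nu_left ->.
have nn : (n + n)%:R = 2 * n%:R :> R by rewrite natrD mulr_natl mulr2n.
rewrite nn in gq'.
exact (@sum_two R n m k q eps (fun x => g x) (fun x => nu x) (fun x => F x) m0 k0 e0 epi
  phase_variation F_const (jump_ratio tq) Hr Hl g_ge0 mirror m2 qn gq').
Qed.

End Chosen.
End MainInequality.
Transparent gain.

Lemma ratio_lower (R : realType) (a b g : R) : 2 * pi * a - 2 * pi * b <= g -> a - b <= g / (2 * pi).
Proof.
have p0 : 0 < 2 * pi :> R by rewrite mulr_gt0// pi_gt0.
by rewrite ler_pdivlMr// mulrBl ![_ * (2 * pi)]mulrC.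
Qed.

Lemma lower_arith (R : realType) (e d x : R) : e < d -> 0 < d -> 2 * d <= x -> 0 <= x - e.
Proof. by lra. Qed.

Lemma upper_arith (R : realType) (e d x y c : R) : e < d -> y + d = c -> x <= y -> x + e <= c.
Proof. by lra. Qed.

Lemma sum_squeeze (a n : nat) : (a <= n -> n * 2 <= n + a -> a = n)%N.
Proof. by lia. Qed.

Lemma jump_squeeze (q n : nat) : (q <= n -> n + n <= q + n -> q = n)%N.
Proof. by lia. Qed.

Lemma one_squeeze (k : nat) : (0 < k -> k <= 1 -> k = 1)%N.
Proof. by lia. Qed.

Lemma near_ex6 (T : Type) (F : set_system T) (PF : ProperFilter F) (P1 P2 P3 P4 P5 P6 : T -> Prop) :
  F P1 -> F P2 -> F P3 -> F P4 -> F P5 -> F P6 ->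
  exists x, [/\ P1 x, P2 x & P3 x] /\ [/\ P4 x, P5 x & P6 x].
Proof.
move=> h1 h2 h3 h4 h5 h6.
have [x [[? [? ?]] [? [? ?]]]] := @filter_ex _ _ PF _
  (filterI (filterI h1 (filterI h2 h3)) (filterI h4 (filterI h5 h6))).
by exists x.
Qed.

Lemma near_right_mul (R : realType) (a : R) (Q : R -> Prop) : 0 < a ->
  (\forall x \near (0 : R)^'+, Q x) -> \forall x \near (0 : R)^'+, Q (a * x).
Proof.
move=> a0 [e /= e1 eQ]; exists (e / a); first exact: divr_gt0.
move=> y yt y0; apply: eQ; last by rewrite mulr_gt0.
by move: yt; rewrite /= !sub0r !normrN normrM gtr0_norm// ltr_pdivlMr// mulrC.
Qed.

Lemma jump_unique (R : realType) (a : R) (p q : nat) : a - 2 * pi * p%:R = a - 2 * pi * q%:R -> p = q.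
Proof.
have p0 : 2 * pi != 0 :> R by rewrite gt_eqF// mulr_gt0// pi_gt0.
by move=> /addrI /oppr_inj /(mulfI p0) /eqP; rewrite eqr_nat => /eqP.
Qed.

Section Inequality.
Variables (R : realType) (n m k : nat) (P : 'M[R]_(n + n)) (s : R) (X : R -> 'M[R]_(n + n)) (E Dm : R -> R).
Hypotheses (s0 : 0 < s) (XD : pospath s X E) (XDm : argpath (fun t => X t ^+ m) Dm) (XP : X 0 = P).
Hypotheses (m0 : (0 < m)%N) (k0 : (0 < k <= m./2)%N) (Pm : P ^+ m = 1) (sP : symplectic P).
Hypothesis spec : spectrum P = [set omega R m k; ((omega R m k)^*)%C].
Local Notation ph := (root_angle R m).
Local Notation M := (X s ^+ m).
Local Notation w := (expi (ph k)).
Variables (S p q : nat).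
Hypothesis hS : \forall eps \near (0 : R)^'+, nuz (expi (1 * eps) * 1) M = 0%N /\
  theta (expi (1 * eps) * 1) M = theta 1 M - 2 * pi * S%:R.
Hypothesis hp : \forall eps \near (0 : R)^'+, nuz (expi (1 * eps) * w) P = 0%N /\
  theta (expi (1 * eps) * w) P = theta w P - 2 * pi * p%:R.
Hypothesis hq : \forall eps \near (0 : R)^'+, nuz (expi (-1 * eps) * w) P = 0%N /\
  theta (expi (-1 * eps) * w) P = theta w P - 2 * pi * q%:R.

(** All six conditions hold for small positive [eps]. The bound [pi / m], half the distance of
    neighbouring roots, keeps the shifted points in order and in the upper half circle. *)
Lemma chosen_eps : exists eps : R, [/\ 0 < eps < pi / m%:R,
  nuz (expi (m%:R * eps)) M = 0%N /\ theta (expi (m%:R * eps)) M = theta 1 M - 2 * pi * S%:R,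
  nuz (expi (ph k + eps)) P = 0%N /\ theta (expi (ph k + eps)) P = theta w P - 2 * pi * p%:R,
  nuz (expi (ph k - eps)) P = 0%N /\ theta (expi (ph k - eps)) P = theta w P - 2 * pi * q%:R &
  (nuz w P)%:R - p%:R <= gain s X E (expi (ph k + eps)) / (2 * pi) /\
  (nuz w P)%:R - q%:R <= gain s X E (expi (ph k - eps)) / (2 * pi)].
Proof.
have FF : Filter ((0 : R)^'+) by typeclasses eauto.
have PF : ProperFilter ((0 : R)^'+) by typeclasses eauto.
have ee (e x : R) : expi (e * x) * w = expi (ph k + e * x) by rewrite addrC expiD.
have hp' : \forall eps \near (0 : R)^'+, theta (expi (ph k + 1 * eps)) (X 0) = theta w (X 0) - 2 * pi * p%:R.
  by rewrite XP; apply: filterS hp => x [_]; rewrite ee.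
have hq' : \forall eps \near (0 : R)^'+, theta (expi (ph k + -1 * eps)) (X 0) = theta w (X 0) - 2 * pi * q%:R.
  by rewrite XP; apply: filterS hq => x [_]; rewrite ee.
have gp := gain_near s0 XD hp'; have gq := gain_near s0 XD hq'.
have mR := mR0 R m0.
have hM : \forall eps \near (0 : R)^'+, nuz (expi (1 * (m%:R * eps)) * 1) M = 0%N /\
    theta (expi (1 * (m%:R * eps)) * 1) M = theta 1 M - 2 * pi * S%:R.
  exact (near_right_mul mR hS).
have pm : 0 < pi / m%:R :> R by rewrite divr_gt0// pi_gt0.
have hb : \forall eps \near (0 : R)^'+, 0 < eps < pi / m%:R.
  by apply: filterS2 (nbhs_right_gt 0) (nbhs_right_lt pm) => x -> ->.
have [eps [[e1 e2 e3] [e4 e5 e6]]] := near_ex6 PF hb hM hp hq gp gq.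
exists eps; move: e2 e3 e4 e5 e6; rewrite !ee !mul1r !mulr1 mulN1r XP => e2 e3 e4 e5 e6.
split; [exact e1|exact e2|exact e3|exact e4|split; [exact (ratio_lower e5)|exact (ratio_lower e6)]].
Qed.

(** The multiplicity of the eigenvalue of [P] is [n], so [split_bounds] gives both [p + q <= n] and
    [2n <= n + p + q]: the two jumps add up to exactly [n]. *)
Lemma inequality_odd : odd m -> (p + q)%N = n /\
  (2 * n)%:R - q%:R <= gain s (fun t => X t ^+ m) Dm 1 / (2 * pi) + 2 * S%:R - (nuz 1 M)%:R.
Proof.
move=> om; have [eps [/andP[e0 epi] [nM tM] [np tp] [nq tq] [gp gq]]] := chosen_eps.
have nk := nuz_k_odd m0 k0 Pm spec om.
have pq : (p + q)%N = n.
  have xe : 0 <= ph k - eps.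
    have /andP[k1 _] := k0; have := root_angle_sep R m0 k1; rewrite root_angle0 add0r.
    exact: lower_arith epi (divr_gt0 (pi_gt0 R) (mR0 R m0)).
  have xpi : ph k + eps <= pi.
    have /andP[_ k2] := k0; have om' := root_angle_odd R m0 om.
    have kh : ph k <= ph m./2.
      by move: k2; rewrite leq_eqVlt => /predU1P[->//|/(root_angle_lt R m0)/ltW].
    exact: (upper_arith epi om' kh).
  have [h1 h2] := split_bounds sP e0 xe nq tq xpi np tp; rewrite nk in h2.
  exact: (sum_squeeze h1 h2).
split=> //.
exact: (main_odd s0 XD XDm XP m0 k0 Pm sP spec e0 epi nM tM tp tq gp gq om pq nk).
Qed.

(** At [-1] the two sides are exchanged by conjugation, so [p = q]. The multiplicity [2n] and
    [split_left_bound] force [q = n]. *)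
Lemma inequality_two : m = 2%N -> [/\ p = q, q = n &
  (2 * n)%:R <= gain s (fun t => X t ^+ m) Dm 1 / (2 * pi) + 2 * S%:R - (nuz 1 M)%:R].
Proof.
move=> m2; have [eps [/andP[e0 epi] [nM tM] [np tp] [nq tq] [gp gq]]] := chosen_eps.
have k1 : k = 1%N by move: k0; rewrite m2 => /andP[]; exact: one_squeeze.
have nk := nuz_k_two m0 k0 Pm spec m2.
have m1 : (m - k = k)%N by rewrite m2 k1.
have km : (k <= m)%N by rewrite m2 k1.
have pq : p = q.
  have E1 := expi_rootN m0 eps km; rewrite m1 in E1.
  apply: (jump_unique (a := theta w P)); rewrite -tp -tq E1.
  by rewrite theta_conj// nsq_expi.
have xe : 0 <= ph k - eps.
  have /andP[k1' _] := k0; have := root_angle_sep R m0 k1'; rewrite root_angle0 add0r.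
  exact: lower_arith epi (divr_gt0 (pi_gt0 R) (mR0 R m0)).
have kpi : ph k <= pi by have /andP[_ h] := k_angle R m0 k0.
have [h1 h2] := split_left_bound sP e0 xe nq tq kpi; rewrite nk in h2.
have qn : q = n by exact: (jump_squeeze h1 h2).
split=> //.
exact: (main_two s0 XD XDm XP m0 k0 Pm sP spec e0 epi nM tM tq gp gq m2 qn nk).
Qed.

End Inequality.

(** With [p + q = n] each condition on [p - q] determines [q] from [n], and [2n - q] becomes the
    stated bound; [p] and [q] differ by one only for odd [n]. *)
Lemma odd_bounds (R : realType) (n p q : nat) (L : R) : (p + q)%N = n -> (2 * n)%:R - q%:R <= L ->
  [/\ p = q -> (3 * n)%:R / 2 <= L, p = q.+1 -> ((3 * n) %/ 2)%:R + 1 <= L &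
      q = p.+1 -> ((3 * n) %/ 2)%:R <= L].
Proof.
move=> pq h; split=> E.
- have -> : (3 * n)%:R / 2 = (2 * n)%:R - q%:R :> R by rewrite -pq E !natrM !natrD; lra.
  exact: h.
- have -> : ((3 * n) %/ 2 = 3 * q + 1)%N by rewrite -pq E; lia.
  apply: le_trans h; rewrite -[1 in X in X <= _]/(1%:R) -natrD lerBrDr -natrD ler_nat; lia.
- have -> : ((3 * n) %/ 2 = 3 * p + 1)%N by rewrite -pq E; lia.
  by apply: le_trans h; rewrite lerBrDr -natrD ler_nat; lia.
Qed.

Lemma two_bound (R : realType) (n : nat) (L : R) : (2 * n)%:R <= L -> (3 * n)%:R / 2 <= L.
Proof. by apply: le_trans; rewrite ler_pdivrMr// -natrM ler_nat; lia. Qed.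

Lemma nullity_nuz (R : realType) n (tau : R) (w : R[i]) (g : R -> 'M[R]_(n + n)) :
  nullity tau w g = nuz w (g tau).
Proof. by rewrite /nullity [RHS]mxrank_ker mxrank_ker mxrank_tr. Qed.

Lemma clamp_near (R : realType) (a b t : R) : a < t < b -> \forall u \near t, clamp a b u = u.
Proof.
move=> tI; have : nbhs t `]a, b[%classic.
  by apply: open_nbhs_nbhs; split; [exact: interval_open|rewrite /= in_itv].
apply: filterS => u; rewrite /= in_itv /= => /andP[au ub].
by rewrite clamp_id// in_itv /= !ltW.
Qed.

(** * The closed characteristic and the final inequality *)

Section Characteristic.
Variables (R : realType) (n m : nat) (P : 'M[R]_(n + n))
    (alpha : R) (C Sigma : set 'cV[R]_(n + n))
    (tau : R) (x : R -> 'cV[R]_(n + n)) (gamma : R -> 'M[R]_(n + n)).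
Hypotheses (pm : prime m) (OP : Omega m P) (a12 : 1 < alpha < 2).
Hypotheses (hC : sym_convex_hypersurface alpha P C Sigma) (hx : closed_characteristic alpha C tau x).
Hypothesis hg : associated_path alpha C tau x gamma.
Hypothesis hP : forall t, t \in `[0, tau] -> x t = P *m x (t + tau / m%:R).
Local Notation H := (Halpha C alpha).
Local Notation A := (fun t => hess H (x t)).
Local Notation G := (gamma \o clamp 0 tau).
Local Notation s := (tau / m%:R).

Lemma tau_gt0 : 0 < tau. Proof. by case: hx. Qed.

Lemma x_neq0 t : x t != 0.
Proof.
have [_ Hx _ _] := hx; apply/eqP => x0; have := Hx t.
rewrite x0 /Halpha /gauge eqxx powR0; last by case/andP: a12 => h _; rewrite gt_eqF// (lt_trans _ h).
by move/eqP; rewrite eq_sym oner_eq0.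
Qed.

Lemma hess_posdef t : posdef (A t).
Proof. by have [[_ _ _ _ h] _] := hC; apply: h; exact: x_neq0. Qed.

(** The second derivative of [H (P y) = H y] at [y = x (t + s)], where [P y = x t]. *)
Lemma hess_period t : 0 <= t <= tau -> A t = invmx P^T *m A (t + s) *m invmx P.
Proof.
move=> tI; have [[[cC vC] iC SE C2 _] PS] := hC; have [[uP _] _ _] := OP.
have a0 : alpha != 0 by case/andP: a12 => h _; rewrite gt_eqF// (lt_trans _ h).
rewrite SE in C2 PS; have := hess_equivariant cC vC iC C2 alpha uP PS (x_neq0 (t + s)).
rewrite -hP; last by rewrite in_itv.
move=> ->; have uT : P^T \in unitmx by rewrite unitmx_tr.
by rewrite -!mulmxA mulmxV// mulmx1 mulKmx.
Qed.

Lemma G_rcontinuous : rcontinuous G.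
Proof.
have [_ gc _] := hg; have := within_clamp (ltW tau_gt0) gc.
by move=> h t; apply/rcvgP; exact: h.
Qed.

Lemma G_start : G 0 = 1%:M.
Proof. by have [g0 _ _] := hg; rewrite /= clamp_id ?g0// in_itv /= lexx ltW// tau_gt0. Qed.

Lemma G_derive t : 0 < t < tau -> rderiv t G (Jmx R n *m A t *m G t).
Proof.
move=> tI; have [_ _ gd] := hg; have tI' : t \in `]0, tau[ by rewrite in_itv.
have Gt : G t = gamma t.
  by rewrite /= clamp_id// in_itv /=; case/andP: tI => /ltW -> /ltW ->.
rewrite Gt; apply: rderiv_near (rderiv_matrix (gd t tI')).
by apply: filterS (clamp_near tI) => u /= ->.
Qed.

Lemma characteristic_power : exists X E Dm D, [/\ pospath s X E, argpath (fun t => X t ^+ m) Dm,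
  X 0 = P, X s ^+ m = gamma tau & Ppath tau gamma /\ argpath G D /\ Dm s - Dm 0 = D tau - D 0].
Proof.
have [sP Pm _] := OP; have m2 := prime_gt1 pm; have m0 : (0 < m)%N by exact: ltnW.
have t0 := tau_gt0; have mR : 0 < m%:R :> R by rewrite ltr0n.
have s0 : 0 < s by rewrite divr_gt0.
have tE : tau = m%:R * s by rewrite mulrC divfK// gt_eqF.
have Gs t : 0 <= t <= tau -> symplectic (G t).
  exact: (flow_symplectic G_rcontinuous G_start G_derive hess_posdef).
have Gg t : 0 <= t <= tau -> G t = gamma t by move=> tI; rewrite /= clamp_id// in_itv.
have gP : Ppath tau gamma.
  have [g0 gc _] := hg; split=> //; split=> // t; rewrite in_itv /= => tI.
  by rewrite -Gg//; exact: Gs.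
have [D hD _] := argpath_exists (ltW t0) gP.1.
have [_ Dc Da] := hD.
have [E [Dm [h1 h2 h3]]] := flow_power s0 m2 tE G_rcontinuous G_start G_derive hess_posdef
  sP Pm hess_period Dc (fun t _ => (Da t).2).
exists (fun r => P *m G (clamp 0 s r)), E, Dm, D; split=> //.
- by rewrite (X0 _ s0) ?G_start.
- rewrite (Xs _ _ s0) -(flow_end s0 m2 tE G_rcontinuous G_start G_derive hess_posdef sP Pm hess_period).
  by rewrite Gg// (ltW t0) lexx.
Qed.

End Characteristic.

(** The summand [n] of the index formula and the [n] normalizing the Maslov index together are
    [theta 1] of the identity divided by [2 pi]. So the Maslov index is exactly the normalized gain
    at [1]. *)
Lemma gain_index (R : realType) (n : nat) (X : R -> 'M[R]_(n + n)) (D : R -> R) (s d t : R) :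
  X 0 = 1%:M -> theta 1 (X s) = t -> D s - D 0 = d ->
  n%:R + (2 * d - t) / (2 * pi) + n%:R = gain s X D 1 / (2 * pi).
Proof.
move=> X0 <- <-; rewrite /gain /phase X0 theta_1 ?nsq1// eqxx.
move: (theta 1 (X s)) (D s) (D 0) => a b c.
have p0 : pi != 0 :> R by rewrite gt_eqF// pi_gt0.
by move: (pi : R) p0 => q q0 /=; field.
Qed.

Lemma upper_spectrum (R : realType) (n m k : nat) (P : 'M[R]_(n + n)) w :
  (0 < m)%N -> (0 < k <= m./2)%N -> spectrum P = [set omega R m k; ((omega R m k)^*)%C] ->
  (spectrum P `&` @Uplus R) w -> w = expi (root_angle R m k).
Proof.
move=> m0 k0 spec [h [t /= /andP[t0 tpi] wE]]; move: h; rewrite spec => -[->//|E].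
rewrite -{}wE in E *.
have {}E : expi t = (expi (root_angle R m k))^*%C := E.
have /andP[k1 k2] := k_angle R m0 k0; have pi0 := pi_gt0 R.
have E2 : expi t = expi (2 * pi - root_angle R m k).
  rewrite E expiJ; have -> : 2 * pi - root_angle R m k = - root_angle R m k + 1%:~R * (2 * pi).
    by rewrite mulr1z; ring.
  by rewrite expiDint.
have bt : 0 <= t < 2 * pi by apply/andP; split; lra.
have bk : 0 <= 2 * pi - root_angle R m k < 2 * pi by apply/andP; split; lra.
by congr expi; have := expi_inj bt bk E2; lra.
Qed.

Lemma shift_nat (R : realType) (p q : nat) (a : int) : p%:R = q%:R + a%:~R :> R -> p%:Z = q%:Z + a.
Proof. by move=> h; apply: (@intr_inj R); rewrite rmorphD /=. Qed.

Lemma int_shift0 (p q : nat) : p%:Z = q%:Z + 0 -> p = q.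
Proof. by lia. Qed.

Lemma int_shift1 (p q : nat) : p%:Z = q%:Z + 1 -> p = q.+1.
Proof. by lia. Qed.

Lemma int_shiftN1 (p q : nat) : p%:Z = q%:Z + -1 -> q = p.+1.
Proof. by lia. Qed.

Unset Implicit Arguments.
Set Strict Implicit.
Set Printing Implicit Defensive.

Theorem theorem4p6 (R : realType) (n m : nat) (P : 'M[R]_(n + n))
    (alpha : R) (C Sigma : set 'cV[R]_(n + n))
    (tau : R) (x : R -> 'cV[R]_(n + n)) (gamma : R -> 'M[R]_(n + n)) :
  (1 <= n)%N -> prime m -> Omega m P ->
  1 < alpha < 2 ->
  sym_convex_hypersurface alpha P C Sigma ->
  closed_characteristic alpha C tau x ->
  prime_period tau x ->
  associated_path alpha C tau x gamma ->
  (forall t, t \in `[0, tau] -> x t = P *m x (t + tau / m%:R)) ->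
  let L := mu_graph tau gamma + 2 * Splus (gamma tau) 1
           - (nullity tau 1 gamma)%:R in
  [/\ forall w, (spectrum P `&` @Uplus R) w ->
        L >= (2 * n)%:R - Sminus P w,
      Omega_tilde m 0 P -> L >= (3 * n)%:R / 2,
      Omega_tilde m 1 P -> L >= ((3 * n) %/ 2)%:R + 1 &
      Omega_tilde m (-1) P -> L >= ((3 * n) %/ 2)%:R].
Proof.
move=> n1 pm OP a12 hC hx hper hg hP L.
have m2 := prime_gt1 pm; have m0 : (0 < m)%N by exact: ltnW.
have [sP Pm [k k0 spec]] := OP.
have [X [E [Dm [D [XD XDm X0P XM [gP [hD DD]]]]]]] := characteristic_power pm OP a12 hC hx hg hP.
have t0 : 0 < tau by case: hx.
have s0 : 0 < tau / m%:R by rewrite divr_gt0// ltr0n.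
have sM : symplectic (gamma tau) by case: gP => -[_ h] _; apply: h; rewrite in_itv /= lexx ltW.
pose w := expi (root_angle R m k).
have [S [_ SE hS]] := @splittingE R n (gamma tau) 1 1 sM (or_introl erefl) (nsq1 R).
have [p [_ pE hp]] := @splittingE R n P 1 w sP (or_introl erefl) (nsq_expi _).
have [q [_ qE hq]] := @splittingE R n P (-1) w sP (or_intror erefl) (nsq_expi _).
have LE : L = gain (tau / m%:R) (fun t => X t ^+ m) Dm 1 / (2 * pi) + 2 * S%:R - (nuz 1 (X (tau / m%:R) ^+ m))%:R.
  rewrite /L /mu_graph (maslov_indexE t0 (nsq1 R) gP hD) /ind nullity_nuz /Splus SE XM.
  congr (_ + _ - _); apply: gain_index; last exact: DD; last by rewrite XM.
  by rewrite X0P Pm.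
rewrite -XM in hS.
(* [w] is itself an admissible eigenvalue, so the condition defining [Omega_tilde] can be read off
   there as a relation between [p] and [q]. *)
have wU : (spectrum P `&` @Uplus R) w.
  rewrite spec; split; first exact: or_introl.
  by exists (root_angle R m k); first exact: (k_angle R m0 k0).
have tilde (a : int) : Omega_tilde m a P -> p%:Z = q%:Z + a.
  by case=> _ /(_ w wU); rewrite /Splus /Sminus pE qE; exact: shift_nat.
have part1 w' (b : R) : (2 * n)%:R - q%:R <= b -> (spectrum P `&` @Uplus R) w' -> (2 * n)%:R - Sminus P w' <= b.
  by move=> h /(upper_spectrum m0 k0 spec) ->; rewrite /Sminus qE.
have [m_two|om] := even_prime pm.
  (* For [m = 2] the splitting numbers of [P] are equal, so the cases [a = 1] and [a = -1] are
     contradictory, and the bound [2n] covers the others. *)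
  have [pq qn h] := inequality_two s0 XD XDm X0P m0 k0 Pm sP spec hS hp hq m_two.
  rewrite -LE in h; split.
  - by move=> w'; apply: part1; apply: le_trans h; rewrite gerBl.
  - by move=> _; exact: two_bound.
  - move/tilde/int_shift1 => e; exact (False_ind _ (n_Sn q (etrans (esym pq) e))).
  - move/tilde/int_shiftN1 => e; exact (False_ind _ (n_Sn p (etrans pq e))).
have [pq h] := inequality_odd s0 XD XDm X0P m0 k0 Pm sP spec hS hp hq om.
rewrite -LE in h; have [b0 b1 b2] := odd_bounds pq h; split.
- by move=> w'; apply: part1.
- by move/tilde/int_shift0/b0.
- by move/tilde/int_shift1/b1.
- by move/tilde/int_shiftN1/b2.
Qed.
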